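(* Each of the following varieties $X=(Y,\mathcal{E})$ (the zero locus in $Y$ of a general global section of $\mathcal{E}$) is quasi-homogeneous: $(OG(3,8),\mathcal{S}_+)$, $(OG(3,8),\mathcal{S}_+\oplus\mathcal{S}_-)$, $(OG(3,9),\mathcal{S})$, $(OG(2,10),\mathcal{S}_+)$, $(OG(3,10),\mathcal{S}_+)$, $(OG(3,10),\mathcal{S}_+\oplus\mathcal{S}_+)$, $(OG(3,10),\mathcal{S}_+\oplus\mathcal{S}_-)$, $(OG(5,10)_+,\mathcal{S}_+)$, $(OG(5,10)_+,\mathcal{S}_+\oplus\mathcal{S}_+)$, $(OG(3,11),\mathcal{S})$, $(OG(3,12),\mathcal{S}_+)$, $(OG(4,12),\mathcal{S}_+)$, $(OG(6,12)_+,\mathcal{S}_+)$, $(OG(3,14),\mathcal{S}_+)$, $(OG(7,14)_+,\mathcal{S}_+)$, $(OG(7,14)_-,\mathcal{S}_+)$. Moreover, $(OG(4,14),\mathcal{S}_+)$ and $(OG(5,14),\mathcal{S}_+)$ have cohomogeneity at most one.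
   Context: Everything is over $\mathbb{C}$. $V=\mathbb{C}^m$ carries a non-degenerate quadratic form, and $OG(k,m)$ is the orthogonal Grassmannian of isotropic $k$-dimensional subspaces $U\subset V$, with tautological bundle $\mathcal{U}$. Spin representations. If $m=2n$, write $V=E\oplus F$ with $E,F$ maximal isotropic, $F\simeq E^\vee$; the half-spin representations of $Spin_{2n}$ are $\Delta_+=\wedge^{even}E$, $\Delta_-=\wedge^{odd}E$, and the Clifford action $V\otimes\Delta_\pm\to\Delta_\mp$ is given by wedge product for $E$ and contraction for $F$. If $m=2n+1$, $Spin_m$ has one spin representation $\Delta$, of dimension $2^n$, with Clifford action $V\otimes\Delta\to\Delta$. Spinor bundles. These are the irreducible homogeneous bundles on $OG(k,m)$ with spaces of global sections $\Delta_\pm$ (resp. $\Delta$). For $m=2n$ and $k<n-1$, the fiber of $\mathcal{S}_\pm$ at $[U]$ is the cokernel of the Clifford map $U\otimes\Delta_\mp\to\Delta_\pm$ (rank $2^{n-k-1}$). For $m=2n+1$ and $k<n$, the fiber of $\mathcal{S}$ at $[U]$ is the cokernel of $U\otimes\Delta\to\Delta$ (rank $2^{n-k}$). For $m=2n$, $k=n$: $OG(n,2n)$ has two components $OG(n,2n)_\pm$, embedded in $\mathbb{P}(\Delta_\pm)$; on $OG(n,2n)_\pm$ the bundle $\mathcal{S}_\pm$ is the hyperplane line bundle $\mathcal{O}(1)$ of this embedding, while $\mathcal{S}_\mp$ is the rank $n$ bundle $\mathcal{U}\otimes\mathcal{O}(1)$. For $m=2n$, $k=n-1$: an isotropic $(n-1)$-space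 is contained in exactly one maximal isotropic space of each family, so $OG(n-1,2n)\subset OG(n,2n)_+\times OG(n,2n)_-$, and $\mathcal{S}_\pm$ are the line bundles obtained by pulling back the hyperplane bundles from the two factors. $(Y,\mathcal{E})$ denotes the zero locus in $Y$ of a general global section of $\mathcal{E}$. $X$ is quasi-homogeneous if its automorphism group acts on it with an open orbit; the cohomogeneity of $X$ is the codimension in $X$ of a generic orbit of its automorphism group. *)

(* Defs.v *)
From HB Require Import structures.
From mathcomp Require Import all_boot all_order all_algebra.
From mathcomp Require Import classical_sets reals complex mpoly.

Set Implicit Arguments.
Unset Strict Implicit.
Unset Printing Implicit Defensive.

Import Order.TTheory GRing.Theory Num.Theory.
From mathcomp Require Import ring zify.

Local Open Scope ring_scope.
Local Open Scope complex_scope.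
Local Open Scope classical_set_scope.

(** * The quadratic space V = C^m and its spin modules

    With n = m./2, the first n coordinates of V = C^m span E, the last n span
    F, and the i-th coordinate of E is paired with the opposite coordinate
    (in the sense of [rev_ord]) of F.  When m is odd the remaining coordinate
    is the fixed point of [rev_ord]; it spans the orthogonal of E + F.
    Every non-degenerate complex quadratic form is of this shape in a suitable
    basis. *)

Lemma half_leqm (m : nat) : (m./2 <= m)%N.
Proof. by rewrite -{2}(odd_double_half m) -addnn addnA leq_addl. Qed.

Definition idxE (m : nat) (i : 'I_m./2) : 'I_m := widen_ord (half_leqm m) i.
Definition idxF (m : nat) (i : 'I_m./2) : 'I_m := rev_ord (idxE i).

(* [Splus] and [Sminus] label the half-spin modules (m even), [Sfull] labels
   the spin module of odd m. *)
Variant spin_label := Splus | Sminus | Sfull.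

Definition opp_label (l : spin_label) : spin_label :=
  match l with Splus => Sminus | Sminus => Splus | Sfull => Sfull end.

Section Spin.
Variables (R : realType) (m : nat).
Local Notation C := (R[i]).
Local Notation V := 'rV[C]_m.

Definition qform (v : V) : C :=
  \sum_(i < m./2) v 0 (idxE i) * v 0 (idxF i)
  + \sum_(j < m | rev_ord j == j) v 0 j ^+ 2.

(* The exterior algebra of E: x I is the coefficient in x of the wedge product
   of the basis vectors e_i, i in I, taken in increasing order. *)
Definition spinor := {ffun {set 'I_m./2} -> C^o}.

Definition ext_sign (i : 'I_m./2) (I : {set 'I_m./2}) : C :=
  (-1) ^+ #|[set j in I | (j < i)%N]|.

Definition wedge (i : 'I_m./2) (x : spinor) : spinor :=
  [ffun I : {set 'I_m./2} =>
    if i \in I then ext_sign i I * x (I :\ i) else 0].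

Definition contract (i : 'I_m./2) (x : spinor) : spinor :=
  [ffun I : {set 'I_m./2} =>
    if i \in I then 0 else ext_sign i I * x (i |: I)].

Definition grade (x : spinor) : spinor :=
  [ffun I : {set 'I_m./2} => (-1) ^+ #|I| * x I].

Definition clifford (v : V) (x : spinor) : spinor :=
  \sum_(i < m./2) (v 0 (idxE i) *: wedge i x + v 0 (idxF i) *: contract i x)
  + \sum_(j < m | rev_ord j == j) v 0 j *: grade x.

Lemma cliffordE (v : V) (x : spinor) (I : {set 'I_m./2}) :
  clifford v x I =
    \sum_(i < m./2) (if i \in I then v 0 (idxE i) * (ext_sign i I * x (I :\ i))
                     else v 0 (idxF i) * (ext_sign i I * x (i |: I)))
    + \sum_(j < m | rev_ord j == j) v 0 j * ((-1) ^+ #|I| * x I).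
Proof.
rewrite /clifford ffunE !sum_ffunE; congr (_ + _); apply: eq_bigr => i _.
  rewrite !ffunE; case: (i \in I); first by rewrite scaler0 addr0.
  by rewrite scaler0 add0r.
by rewrite !ffunE.
Qed.

Lemma clifford_is_linear (v : V) : linear (clifford v).
Proof.
have lin (a p s x y : C) : p * (s * (a * x + y)) = a * (p * (s * x)) + p * (s * y).
  by rewrite !mulrDr; congr (_ + _); rewrite (mulrCA s) (mulrCA p).
move=> a x y; apply/ffunP => I.
rewrite [RHS]ffunE [in RHS]ffunE !cliffordE scalerDr addrACA.
congr (_ + _); rewrite scaler_sumr -big_split; apply: eq_bigr => i _ /=.
  by case: (i \in I); rewrite !ffunE; apply: lin.
by rewrite !ffunE; apply: lin.
Qed.

HB.instance Definition _ (v : V) :=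
  GRing.isLinear.Build C spinor spinor *:%R (clifford v) (clifford_is_linear v).

Definition toggle (i : 'I_m./2) (I : {set 'I_m./2}) : {set 'I_m./2} :=
  if i \in I then I :\ i else i |: I.

Lemma in_toggle i j I : (j \in toggle i I) = (j == i) (+) (j \in I).
Proof.
rewrite /toggle; case: ifP => iI; rewrite !inE; case: eqVneq => // ->;
  by rewrite iI.
Qed.

Lemma toggleK i I : toggle i (toggle i I) = I.
Proof. by apply/setP => j; rewrite !in_toggle addbA addbb. Qed.

Lemma toggleC i j I : toggle i (toggle j I) = toggle j (toggle i I).
Proof. by apply/setP => k; rewrite !in_toggle addbCA. Qed.

Lemma sign_toggle i I : (-1) ^+ #|toggle i I| = - (-1) ^+ #|I| :> C.
Proof.
rewrite /toggle; case: ifP => iI.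
  by rewrite (cardsD1 i I) iI exprS mulN1r opprK.
by rewrite cardsU1 iI exprS mulN1r.
Qed.

Lemma ext_sign_toggle i k I :
  ext_sign k (toggle i I) = (if (i < k)%N then - ext_sign k I else ext_sign k I).
Proof.
rewrite /ext_sign; case: ifP => ik.
  rewrite -(sign_toggle i); congr (_ ^+ #|pred_of_set _|); apply/setP => j.
  rewrite inE !in_toggle inE; case: (eqVneq j i) => [->|] //=.
  by rewrite ik !andbT.
congr (_ ^+ #|pred_of_set _|); apply/setP => j.
by rewrite !inE in_toggle; case: (eqVneq j i) => [->|] //; rewrite ik !andbF.
Qed.

Lemma cliffordK (v : V) (x : spinor) : clifford v (clifford v x) = qform v *: x.
Proof.
pose a i (I : {set 'I_m./2}) := if i \in I then v 0 (idxE i) else v 0 (idxF i).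
pose t := \sum_(j < m | rev_ord j == j) v 0 j.
have cE y I : clifford v y I =
    \sum_i a i I * (ext_sign i I * y (toggle i I)) + t * ((-1) ^+ #|I| * y I).
  rewrite cliffordE mulr_suml; congr (_ + _); apply: eq_bigr => i _.
  by rewrite /a /toggle; case: ifP.
have sgn2 (n : nat) : (-1) ^+ n * (-1) ^+ n = 1 :> C.
  by rewrite -exprMn mulrNN mulr1 expr1n.
have r1 (p c u e y : C) : p * (c * (u * (- e * y))) + u * (e * (p * (c * y))) = 0.
  by ring.
have r2 (p q c y : C) : p * (c * (q * (c * y))) = c * c * (p * q * y) by ring.
have r3 (p c q d y : C) : p * (c * (q * (- d * y))) = - (q * (d * (p * (c * y)))).
  by ring.
have r4 (p c q d y : C) : p * (c * (q * (d * y))) = - (q * (d * (p * (- c * y)))).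
  by ring.
apply/ffunP => I; rewrite [RHS]ffunE cE.
under eq_bigr => i _ do rewrite cE sign_toggle !mulrDr.
rewrite big_split /= [clifford v x I]cE !mulrDr -!addrA.
have cross : \sum_i a i I * (ext_sign i I * (t * (- (-1) ^+ #|I| * x (toggle i I))))
    + t * ((-1) ^+ #|I| * \sum_i a i I * (ext_sign i I * x (toggle i I))) = 0.
  rewrite !mulr_sumr -big_split big1 // => i _; exact: r1.
rewrite (addrA (\sum_i a i I * (ext_sign i I * (t * _)))) cross add0r.
have -> : t * ((-1) ^+ #|I| * (t * ((-1) ^+ #|I| * x I))) = t * t * x I.
  by rewrite -[RHS]mul1r -[in RHS](sgn2 #|I|); apply: r2.
rewrite [RHS]mulrDl; congr (_ + _ * _); last first.
  rewrite /t; case: (pickP [pred j : 'I_m | rev_ord j == j]) => [j0 /= j0P|no].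
    have uj j : (rev_ord j == j) = (j == j0).
      apply/idP/eqP => [|->] // /eqP/(congr1 val)/= jE; apply/val_inj => /=.
      by move/eqP/(congr1 val): j0P => /=; have := ltn_ord j; have := ltn_ord j0; lia.
    by rewrite !(eq_bigl _ _ uj) !big_pred1_eq expr2.
  by rewrite !big_pred0 // mulr0.
pose G i k := a i I * (ext_sign i I * (a k (toggle i I) *
                (ext_sign k (toggle i I) * x (toggle k (toggle i I))))).
have diag i : G i i = v 0 (idxE i) * v 0 (idxF i) * x I.
  rewrite /G toggleK ext_sign_toggle ltnn /a in_toggle eqxx addTb.
  rewrite -[RHS]mul1r -[in RHS](sgn2 #|[set j in I | (j < i)%N]|) -/(ext_sign i I).
  case: (i \in I) => /=; last by rewrite (mulrC (v 0 (idxE i)) (v 0 (idxF i))); apply: r2.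
  exact: r2.
have anti i k : i != k -> G i k = - G k i.
  move=> ik; rewrite /G !ext_sign_toggle (toggleC i k) /a !in_toggle.
  rewrite (eq_sym k i) (negPf ik) /=.
  case: ltngtP => [_|_|/val_inj ikE]; [exact: r3|exact: r4|].
  by rewrite ikE eqxx in ik.
under eq_bigr => i _ do rewrite 2!mulr_sumr.
rewrite -[LHS]/(\sum_i \sum_k G i k) mulr_suml.
under eq_bigr => i _ do rewrite (bigD1 i) //= diag.
rewrite big_split /= -[RHS]addr0; congr (_ + _).
set S := LHS; have SN : S = - S.
  rewrite {1}/S (exchange_big_dep xpredT) //= -sumrN; apply: eq_bigr => i _.
  rewrite -sumrN; apply: eq_big => [k|k ki]; first by rewrite eq_sym.
  by apply: anti; rewrite eq_sym.
have : S *+ 2 == 0 by rewrite mulr2n {1}SN addNr.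
by rewrite mulrn_eq0 => /eqP.
Qed.

Definition basis_spinor (I : {set 'I_m./2}) : spinor :=
  [ffun J : {set 'I_m./2} => (J == I)%:R].

Definition label_parity (l : spin_label) (k : nat) : bool :=
  match l with Splus => ~~ odd k | Sminus => odd k | Sfull => true end.

Definition Delta (l : spin_label) : {vspace spinor} :=
  (\sum_(I : {set 'I_m./2} | label_parity l #|I|) <[basis_spinor I]>)%VS.

(* The image of the Clifford map from U (x) D to the spinors. *)
Definition clifford_im (U : {vspace V}) (D : {vspace spinor}) : {vspace spinor} :=
  (\sum_(u <- vbasis U) (linfun (clifford u) @: D))%VS.

End Spin.

(** * Grassmannians as projective varieties *)

Section Grassmannian.
Variables (R : realType) (k m : nat).
Local Notation C := (R[i]).

Definition Gr := {U : {vspace 'rV[C]_m} | \dim U == k}.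

(* All maximal minors of a basis of U, including those with repeated or
   permuted columns; these redundant coordinates embed Gr(k, m) in the
   projective space of the k-th tensor power of V instead of the k-th exterior
   power, with the same homogeneous coordinate ring.  They depend on the basis
   only up to a common non-zero factor. *)
Definition plucker_dim : nat := #|{ffun 'I_k -> 'I_m}|.

Definition plucker (U : Gr) (a : 'I_plucker_dim) : C :=
  \det (\matrix_(i < k, j < k) (vbasis (val U))`_i 0 (enum_val a j)).

Definition zclosed_in (X Z : set Gr) : Prop :=
  exists2 S : set {mpoly C[plucker_dim]},
    forall p, S p -> exists d : nat, p \is d.-homog &
    Z = [set U | X U /\ forall p, S p -> p.@[plucker U] = 0].

Definition zopen_in (X O : set Gr) : Prop :=
  O `<=` X /\ zclosed_in X (X `\` O).

Definition zdense_in (X A : set Gr) : Prop :=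
  forall O, zopen_in X O -> O !=set0 -> (O `&` A) !=set0.

(* Morphisms of X to the Grassmannian; the values of f off X are irrelevant. *)
Definition regular_on (X : set Gr) (f : Gr -> Gr) : Prop :=
  forall U, X U ->
  exists (O : set Gr) (d : nat) (F : 'I_plucker_dim -> {mpoly C[plucker_dim]}),
    [/\ zopen_in X O, O U, forall a, F a \is d.-homog &
        forall W, O W ->
        exists c : C, forall a, plucker (f W) a = c * (F a).@[plucker W]].

Definition endomorphism (X : set Gr) (f : Gr -> Gr) : Prop :=
  (forall U, X U -> X (f U)) /\ regular_on X f.

Definition automorphism (X : set Gr) (f : Gr -> Gr) : Prop :=
  endomorphism X f /\
  exists2 g, endomorphism X g &
    forall U, X U -> g (f U) = U /\ f (g U) = U.

Definition aut_orbit (X : set Gr) (U : Gr) : set Gr :=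
  [set W | exists2 f, automorphism X f & W = f U].

Definition quasi_homogeneous (X : set Gr) : Prop :=
  exists2 U, X U & zopen_in X (aut_orbit X U).

Definition zirreducible (Z : set Gr) : Prop :=
  Z !=set0 /\
  forall Z1 Z2, zclosed_in Z Z1 -> zclosed_in Z Z2 ->
    Z = Z1 `|` Z2 -> Z = Z1 \/ Z = Z2.

Definition irreducible_chain (X : set Gr) (d : nat) (Z : nat -> set Gr) : Prop :=
  (forall i, (i <= d)%N -> zclosed_in X (Z i) /\ zirreducible (Z i)) /\
  (forall i, (i < d)%N -> Z i `<` Z i.+1).

(* Krull dimension of X with its Zariski topology. *)
Definition has_dim (X : set Gr) (d : nat) : Prop :=
  (exists Z, irreducible_chain X d Z) /\
  (forall e Z, irreducible_chain X e Z -> (e <= d)%N).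

(* The generic orbits of Aut X have codimension c in X. *)
Definition has_cohomogeneity (X : set Gr) (c : nat) : Prop :=
  exists (d e : nat) (O : set Gr),
    [/\ has_dim X d, zopen_in X O, zdense_in X O,
        forall U, O U -> has_dim (aut_orbit X U) e & d = (e + c)%N].

Definition cohomogeneity_at_most (c : nat) (X : set Gr) : Prop :=
  exists2 c', has_cohomogeneity X c' & (c' <= c)%N.

End Grassmannian.

(** * Orthogonal Grassmannians and spinor bundles *)

Section SpinorBundles.
Variables (R : realType).
Local Notation C := (R[i]).

Definition OG (k m : nat) : set (Gr R k m) :=
  [set U : Gr R k m | forall u : 'rV[C]_m, u \in val U -> qform u = 0].

(* The two families of maximal isotropic subspaces, for m even.  A space W of
   the family l is sent to the one-dimensional quotient Delta_l / W.Delta_-l,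
   a point of P(Delta_l); here P(-) is the space of one-dimensional quotients,
   so that O(1) has fibre Delta_l / W.Delta_-l at W and Delta_l as space of
   global sections.  (The annihilator of W.Delta_-l in the dual of Delta_l is
   the pure spinor line of W.) *)
Definition OGmax (m : nat) (l : spin_label) : set (Gr R m./2 m) :=
  [set W | OG W /\
     \dim (Delta R m l)
     = (\dim (clifford_im (val W) (Delta R m (opp_label l)))).+1].

(* The vanishing at [U] of the section of the spinor bundle S_l defined by
   delta in Delta_l, that is, delta is in the kernel of the evaluation
   map from Delta_l to the fibre. *)
Definition vanish_coker (m : nat) (l : spin_label) (delta : spinor R m)
    (U : {vspace 'rV[C]_m}) : Prop :=
  delta \in clifford_im U (Delta R m (opp_label l)).

Definition vanish_O1 (m : nat) (l : spin_label) (delta : spinor R m)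
    (W : Gr R m./2 m) : Prop :=
  delta \in clifford_im (val W) (Delta R m (opp_label l)).

(* On the family opposite to l: the fibre of U(1) at W is identified with
   Hom(V/W, O(1)_W) through W = (V/W)^*, and delta in Delta_l is sent to
   v |-> class of v.delta in O(1)_W = Delta_-l / W.Delta_l. *)
Definition vanish_U1 (m : nat) (l : spin_label) (delta : spinor R m)
    (W : Gr R m./2 m) : Prop :=
  forall v : 'rV[C]_m, clifford v delta \in clifford_im (val W) (Delta R m l).

Definition vanish (k m : nat) (l : spin_label) (delta : spinor R m)
    (U : Gr R k m) : Prop :=
  if odd m || (k.+1 < m./2)%N then vanish_coker l delta (val U)
  else if k.+1 == m./2 then
    exists W, [/\ @OGmax m l W, (val U <= val W)%VS & vanish_O1 l delta W]
  else
    exists2 W : Gr R m./2 m, val W = val U &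
      (@OGmax m l W /\ vanish_O1 l delta W) \/
      (@OGmax m (opp_label l) W /\ vanish_U1 l delta W).

(* A list E of labels stands for the direct sum of the corresponding bundles;
   a global section of it is a family of spinors, one in Delta_l for each
   label l of the list. *)
Definition label_at (E : seq spin_label) (i : 'I_(size E)) : spin_label :=
  tnth (in_tuple E) i.

Definition global_sections (m : nat) (E : seq spin_label) :
    set {ffun 'I_(size E) -> spinor R m} :=
  [set s : {ffun 'I_(size E) -> spinor R m} |
    forall i, s i \in Delta R m (label_at i)].

Definition zero_locus (k m : nat) (Y : set (Gr R k m)) (E : seq spin_label)
    (s : {ffun 'I_(size E) -> spinor R m}) : set (Gr R k m) :=
  [set U : Gr R k m | Y U /\ forall i, vanish (label_at i) (s i) U].

(* Q holds on a non-empty Zariski open subset of the linear subspace D of W;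
   S is a set of equations of the complement of this subset. *)
Definition generally (W : vectType C) (D : set W) (Q : W -> Prop) : Prop :=
  exists S : set {mpoly C[\dim {:W}]},
    let nonzero w :=
      exists2 p, S p & p.@[fun i => coord (vbasis {:W}) i w] != 0 in
    (exists2 w, D w & nonzero w) /\ (forall w, D w -> nonzero w -> Q w).

(* The variety (Y, E) satisfies Q. *)
Definition general_zero_locus (k m : nat) (Y : set (Gr R k m))
    (E : seq spin_label) (Q : set (Gr R k m) -> Prop) : Prop :=
  generally (@global_sections m E) (fun s => Q (zero_locus Y s)).

End SpinorBundles.

Arguments OG R k m : clear implicits.
Arguments OGmax R m l : clear implicits.
Arguments quasi_homogeneous {R k m} X.
Arguments cohomogeneity_at_most {R k m} c X.

(* Main.v *)
(** The elements 1 + t u w of the Clifford algebra (u, w orthogonal, u isotropic)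
 act on V and on the spinors.  Let s0 be a section vanishing at a coordinate
 space U0.  If words in these elements move s0 in all directions, and words
 fixing U0 move s0 in all directions of sections vanishing at U0, then general
 sections are equivalent to s0, and the orbit of U0 in the zero locus X of s0
 contains an open set, hence is open.  Both conditions are ranks of integer
 matrices.  For S_+ + S_- on OG(3,10) sections have one modulus, a ratio of
 invariants built from the pairing of the half-spin modules.

 For k = 4, 5 and m = 14 the stabilizer of s0 is G2 x G2, with invariants T1, T2
 on the spaces U; X is swept out by a family Psi (x, tau) in orbits of this
 group, with T1 = tau T2, so orbits have codimension at most one.  Let A be
 the set of the tau in a fixed Aut X-orbit.  If every A is finite, the orbits
 have codimension one.  If infinitely many tau lie in finite sets A,
 automorphisms act on tau as homographies; finitely many translates of the
 open part of X cover X, so the values at three tau with finite A leave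
 finitely many homographies, and no A is infinite.  Otherwise all but finitely
 many tau lie in infinite sets A, and their orbits have the dimension of X,
 which is bounded above by counting the forms independent on a chain. *)
From HB Require Import structures.
Require Import Defs.
From Stdlib Require Import ZArith.
From mathcomp Require Import all_boot all_order all_algebra all_field perm.
From mathcomp Require Import classical_sets boolp reals complex mpoly ring lra zify ssrZ.
Set Implicit Arguments. Unset Strict Implicit. Unset Printing Implicit Defensive.
Import Order.TTheory GRing.Theory Num.Theory.
Local Open Scope ring_scope.
Local Open Scope complex_scope.
Local Open Scope classical_set_scope.

(** Open orbits only require enough explicit automorphisms. Cohomogeneity is harder because Aut X is
    just a set of biregular maps, with no algebraic group structure and no orbit dimension formula
    at hand, and it might be larger than the stabilizer of s0. The dimension of its generic orbits
    is therefore bounded on both sides by chains of irreducible subsets, which is why the finiteness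
    of the sets A decides between the two possible values. Two notions of genericity occur. A
    polynomial map with surjective differential reaches a Zariski open set, by the Jacobian
    criterion and quantifier elimination; this is enough for general sections. That translates of
    the family Psi meet every open subset of X, in whatever component, has to start from an
    arbitrary point of X; here the classical topology is used, and a Newton iteration gives the
    group element. Ranks are certified over the integers: an elimination proposes coefficients, and
    only the combinations that they define are verified. Invariance of forms is an identity with
    coefficients in Z[x]. *)

Ltac by_vm := vm_cast_no_check (erefl true).

(** * Polynomial identities and the Jacobian criterion *)

Lemma mpoly_ring_ind (n : nat) (K : nzRingType) (P : {mpoly K[n]} -> Prop) :
 (forall c, P c%:MP) -> (forall i, P 'X_i) ->
 (forall p q, P p -> P q -> P (p + q)) -> (forall p q, P p -> P q -> P (p * q)) ->
 forall p, P p.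
move=> hC hX hD hM p; elim/mpolyind: p => [|c m p _ _ hp]; first by rewrite -mpolyC0.
have hXn i k : P ('X_i ^+ k).
 by elim: k => [|k IH]; rewrite ?expr0 -?mpolyC1 // exprS; apply: (hM).
apply: (hD) => //; rewrite -mul_mpolyC; apply: (hM) => //; rewrite mpolyXE_id.
by elim/big_rec: _ => [|i q _ hq]; [rewrite -mpolyC1 | apply: (hM)].
Qed.

Lemma neqM (K : idomainType) (x y : K) : (x * y != 0) = (x != 0) && (y != 0).
by rewrite mulf_eq0 negb_or. Qed.

Section MPolyFacts.
Variable F : numFieldType.

Lemma mderivXU (n : nat) (i l : 'I_n) :
 ('X_i : {mpoly F[n]})^`M(l) = ((i == l)%:R)%:MP.
rewrite mderivX mnm1E; have [->|] := eqVneq i l; last by rewrite scale0r mpolyC0.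
by rewrite scale1r mpolyC1 -mpolyX0; congr mpolyX; apply/mnmP => j; rewrite mnmBE subnn mnm0E.
Qed.

Lemma meval_eq (n : nat) (x y : 'I_n -> F) (p : {mpoly F[n]}) :
 x =1 y -> p.@[x] = p.@[y].
by move=> /funext ->. Qed.

Lemma polyP_eval (p : {poly F}) : (forall x, p.[x] = 0) -> p = 0.
move=> p0; apply/eqP; apply/negPn/negP => pn0.
have := max_poly_roots pn0 (rs := [seq i%:R | i <- iota 0 (size p)]).
rewrite size_map size_iota ltnn => H; suff : false by [].
apply: H; first by apply/allP => x _; apply/rootP.
by rewrite map_inj_uniq ?iota_uniq // => i j /eqP; rewrite eqr_nat => /eqP.
Qed.

(** Later derivatives are computed through this restriction to a line: values along a line are
    usually explicit, whereas the coefficients of the polynomial are not. *)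
Lemma meval_line (n : nat) (p : {mpoly F[n]}) (x v : 'I_n -> F) :
 exists g : {poly F}, (forall e, g.[e] = p.@[fun i => x i + e * v i]) /\
  g^`().[0] = \sum_l v l * (p^`M(l)).@[x].
elim/mpoly_ring_ind: p => [c|i|p q [g [gE gD]] [h [hE hD]]|p q [g [gE gD]] [h [hE hD]]].
- exists c%:P; split=> [e|]; first by rewrite hornerC mevalC.
 by rewrite derivC horner0 big1 // => l _; rewrite mderivC meval0 mulr0.
- exists ((x i)%:P + 'X * (v i)%:P); split=> [e|].
  by rewrite !hornerE mevalXU.
 rewrite derivD derivC add0r derivM derivX mul1r derivC mulr0 addr0 hornerC.
 rewrite (bigD1 i) //= mderivXU eqxx mevalC mulr1 big1 ?addr0 // => l li.
 by rewrite mderivXU eq_sym (negPf li) mevalC mulr0.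
- exists (g + h); split=> [e|]; first by rewrite hornerD gE hE mevalD.
 rewrite derivD hornerD gD hD -big_split; apply: eq_bigr => l _ /=.
 by rewrite mderivD mevalD mulrDr.
- exists (g * h); split=> [e|]; first by rewrite hornerM gE hE mevalM.
 have x0 (r : {mpoly F[n]}) : r.@[fun i => x i + 0 * v i] = r.@[x].
  by apply: meval_eq => i; rewrite mul0r addr0.
 rewrite derivM hornerD !hornerM gD hD gE hE !x0 mulr_suml mulr_sumr -big_split.
 by apply: eq_bigr => l _ /=; rewrite mderivM mevalD !mevalM; ring.
Qed.

Lemma mderiv_eq0 (n : nat) (p : {mpoly F[n]}) :
 (forall l, p^`M(l) = 0) -> p = (p@_0%MM)%:MP.
move=> p0; apply/mpolyP => m; rewrite mcoeffC.
have [->|m0] := eqVneq m 0%MM; first by rewrite mulr1.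
rewrite mulr0.
have [i mi] : exists i, (0 < m i)%N.
 apply/existsP; apply: contra_neqT m0 => /existsPn m0.
 by apply/mnmP => i; rewrite mnm0E; apply/eqP; rewrite eqn0Ngt m0.
have := congr1 (mcoeff (m - U_(i))%MM) (p0 i).
rewrite mcoeff_deriv mcoeff0 submK ?lep1mP -?lt0n // => /eqP.
by rewrite mulrn_eq0 => /eqP.
Qed.

Lemma msize_mderiv_lt (n : nat) (p : {mpoly F[n]}) l :
 p != 0 -> (msize (p^`M(l)) < msize p)%N.
move=> p0; rewrite -[X in (_ < X)%N]prednK; last by rewrite lt0n msize_poly_eq0.
rewrite ltnS msizeE; apply/bigmax_leqP_seq => m + _.
rewrite mcoeff_msupp mcoeff_deriv mulrn_eq0 /= -mcoeff_msupp => /msize_mdeg_lt.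
by rewrite mdegD mdeg1 addn1; case: (msize p).
Qed.

(** By induction on the degree the derivatives are zero, since they vanish as functions; in
    characteristic zero the polynomial is then constant. *)
Lemma meval_eq0 (n : nat) (p : {mpoly F[n]}) : (forall x, p.@[x] = 0) -> p = 0.
elim: (msize p) {-2}p (leqnn (msize p)) => {p} [|k IH] p sp p0.
 by apply/eqP; rewrite -msize_poly_eq0 -leqn0.
have [->//|pn0] := eqVneq p 0.
have dp l : p^`M(l) = 0.
 apply: IH => [|x]; first by rewrite -ltnS (leq_trans (msize_mderiv_lt l pn0)).
 have [g [gE gD]] := meval_line p x (fun i => (i == l)%:R).
 move: gD; rewrite (polyP_eval (fun e => etrans (gE e) (p0 _))) deriv0 horner0.
 rewrite (bigD1 l) //= eqxx mul1r big1 ?addr0 // => i /negPf ->.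
 by rewrite mul0r.
by move: (p0 (fun=> 0)); rewrite (mderiv_eq0 dp) mevalC => ->.
Qed.

Lemma meval_neq0 (n : nat) (p : {mpoly F[n]}) : p != 0 -> exists x, p.@[x] != 0.
move=> p0; apply: contrapT => H; case/eqP: p0; apply: meval_eq0 => x.
by apply/eqP/negPn/negP => px; apply: H; exists x.
Qed.

Lemma mderiv_comp (n r : nat) (P : {mpoly F[n]}) (G : n.-tuple {mpoly F[r]}) l :
 (P \mPo G)^`M(l) = \sum_(j < n) (P^`M(j) \mPo G) * (tnth G j)^`M(l).
elim/mpoly_ring_ind: P => [c|i|p q hp hq|p q hp hq].
- rewrite comp_mpolyC mderivC big1 // => j _.
 by rewrite mderivC comp_mpoly0 mul0r.
- rewrite comp_mpolyXU -tnth_nth (bigD1 i) //= mderivXU eqxx comp_mpolyC mpolyC1 mul1r.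
 rewrite big1 ?addr0 // => j ji.
 by rewrite mderivXU eq_sym (negPf ji) comp_mpolyC mpolyC0 mul0r.
- rewrite comp_mpolyD mderivD hp hq -big_split; apply: eq_bigr => j _ /=.
 by rewrite mderivD comp_mpolyD mulrDl.
- rewrite rmorphM /= mderivM hp hq mulr_suml mulr_sumr -big_split.
 apply: eq_bigr => j _ /=; rewrite mderivM comp_mpolyD !rmorphM /= mulrDl.
 by rewrite mulrAC mulrA.
Qed.

(** Induction on the degree of a relation P. By the chain rule the gradient of P, evaluated on G, is
    killed by the matrix [K] of derivatives of G along the vectors v. This matrix is the identity at
    t0, so its determinant is non-zero; the derivatives of P are thus relations of smaller degree,
    hence zero, and P is constant. *)
Lemma comp_mpoly_inj_jac (n r : nat) (G : n.-tuple {mpoly F[r]}) (t0 : 'I_r -> F) :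
 (forall i, exists v : 'I_r -> F, forall j,
   \sum_l v l * ((tnth G j)^`M(l)).@[t0] = (i == j)%:R) ->
 forall P : {mpoly F[n]}, P \mPo G = 0 -> P = 0.
move=> /fin_all_exists [v vP] P.
pose K : 'M[{mpoly F[r]}]_n := \matrix_(j, i) \sum_l v i l *: (tnth G j)^`M(l).
have K0 : \det K != 0.
 apply/eqP => /(congr1 (meval t0)); rewrite -det_map_mx meval0.
 suff -> : map_mx (meval t0) K = 1%:M by rewrite det1 => /eqP; rewrite oner_eq0.
 apply/matrixP => j i; rewrite !mxE raddf_sum /= eq_sym -vP.
 by apply: eq_bigr => l _; rewrite mevalZ.
elim: (msize P) {-2}P (leqnn (msize P)) => {P} [|k IH] P sP P0.
 by apply/eqP; rewrite -msize_poly_eq0 -leqn0.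
have [->//|Pn0] := eqVneq P 0.
have dP j : P^`M(j) = 0.
 apply: IH; first by rewrite -ltnS (leq_trans (msize_mderiv_lt j Pn0)).
 pose g : 'rV_n := \row_j (P^`M(j) \mPo G).
 have gK : g *m K = 0.
  apply/rowP => i; rewrite !mxE.
  under eq_bigr do rewrite !mxE mulr_sumr.
  rewrite exchange_big big1 //= => l _.
  under eq_bigr do rewrite -scalerAr.
  by rewrite -scaler_sumr -mderiv_comp P0 mderiv0 scaler0.
 have /rowP/(_ j) : \det K *: g = 0.
  by rewrite -[_ *: g]mul_mx_scalar -mul_mx_adj mulmxA gK mul0mx.
 by rewrite !mxE => /eqP; rewrite mulf_eq0 (negPf K0) => /eqP.
move: P0; rewrite (mderiv_eq0 dP) comp_mpolyC => /eqP; rewrite mpolyC_eq0 => /eqP ->.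
by rewrite mpolyC0.
Qed.

End MPolyFacts.

(** * Images of polynomial maps *)

Section Dominant.
Variable F : numClosedFieldType.
Import ClosedFieldQE.

Lemma mpoly_term (r : nat) (h : 'I_r -> nat) (p : {mpoly F[r]}) :
 exists2 t : GRing.term F, GRing.rterm t &
  forall e : seq F, GRing.eval e t = p.@[fun i => e`_(h i)].
elim/mpoly_ring_ind: p => [c|i|p q [t tr tE] [u ur uE]|p q [t tr tE] [u ur uE]].
- by exists (GRing.Const c) => // e; rewrite mevalC.
- by exists (GRing.Var _ (h i)) => // e; rewrite mevalXU.
- by exists (t + u)%T => [|e] /=; rewrite ?tr ?tE ?uE ?mevalD.
- by exists (t * u)%T => [|e] /=; rewrite ?tr ?tE ?uE ?mevalM.
Qed.

Lemma term_mpoly (n : nat) (e : ('I_n -> F) -> seq F) (t : GRing.term F) :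
 GRing.rterm t ->
 (forall k, exists p : {mpoly F[n]}, forall y, (e y)`_k = p.@[y]) ->
 exists p : {mpoly F[n]}, forall y, GRing.eval (e y) t = p.@[y].
move=> + eP; elim: t => //=.
- by move=> c _; exists c%:MP => y; rewrite mevalC.
- by move=> k _; exists (k%:R)%:MP => y; rewrite mevalC.
- move=> t IHt u IHu /andP[/IHt[p pE] /IHu[q qE]].
 by exists (p + q) => y; rewrite mevalD pE qE.
- by move=> t IHt /IHt[p pE]; exists (- p) => y; rewrite mevalN pE.
- by move=> t IHt k /IHt[p pE]; exists (p *+ k) => y; rewrite mevalMn pE.
- move=> t IHt u IHu /andP[/IHt[p pE] /IHu[q qE]].
 by exists (p * q) => y; rewrite mevalM pE qE.
- by move=> t IHt k /IHt[p pE]; exists (p ^+ k) => y; rewrite rmorphXn pE.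
Qed.

(* On the closure of the image of G, a constructible set or its complement
  contains a non-empty principal open subset. *)
Lemma qf_generic (n r : nat) (G : n.-tuple {mpoly F[r]}) (e : ('I_n -> F) -> seq F)
  (f : GRing.formula F) :
 (forall k, exists p : {mpoly F[n]}, forall y, (e y)`_k = p.@[y]) ->
 GRing.qf_form f -> GRing.rformula f ->
 exists (q : {mpoly F[n]}) (b : bool), q \mPo G != 0 /\
  forall y, (forall P : {mpoly F[n]}, P \mPo G = 0 -> P.@[y] = 0) ->
   q.@[y] != 0 -> GRing.qf_eval (e y) f = b.
have nz1 : (1 : {mpoly F[n]}) \mPo G != 0 by rewrite rmorph1 oner_neq0.
have nzM (p q : {mpoly F[n]}) : p \mPo G != 0 -> q \mPo G != 0 -> (p * q) \mPo G != 0.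
 by move=> p0 q0; rewrite rmorphM mulf_neq0.
move=> eP; elim: f => //=.
- by move=> b _ _; exists 1, b.
- move=> t u _ /andP[/(term_mpoly)/(_ eP)[p pE] /(term_mpoly)/(_ eP)[q qE]].
 have [pq|pq] := eqVneq ((p - q) \mPo G) 0.
  exists 1, true; split=> // y yG _.
  by rewrite pE qE; apply/eqP/subr0_eq; rewrite -mevalB yG.
 exists (p - q), false; split=> // y _.
 by rewrite mevalB subr_eq0 pE qE => /negPf.
- move=> f IHf g IHg /andP[qf qg] /andP[rf rg].
 have [p [b [p0 pb]]] := IHf qf rf; have [q [c [q0 qc]]] := IHg qg rg.
 exists (p * q), (b && c); split=> [|y yG]; first exact: nzM.
 by rewrite mevalM mulf_eq0 negb_or => /andP[/(pb _ yG) -> /(qc _ yG) ->].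
- move=> f IHf g IHg /andP[qf qg] /andP[rf rg].
 have [p [b [p0 pb]]] := IHf qf rf; have [q [c [q0 qc]]] := IHg qg rg.
 exists (p * q), (b || c); split=> [|y yG]; first exact: nzM.
 by rewrite mevalM mulf_eq0 negb_or => /andP[/(pb _ yG) -> /(qc _ yG) ->].
- move=> f IHf g IHg /andP[qf qg] /andP[rf rg].
 have [p [b [p0 pb]]] := IHf qf rf; have [q [c [q0 qc]]] := IHg qg rg.
 exists (p * q), (b ==> c); split=> [|y yG]; first exact: nzM.
 by rewrite mevalM mulf_eq0 negb_or => /andP[/(pb _ yG) -> /(qc _ yG) ->].
- move=> f IHf qf rf; have [p [b [p0 pb]]] := IHf qf rf.
 by exists p, (~~ b); split=> // y yG /(pb _ yG) ->.
Qed.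

(** The image of the set where psi does not vanish is definable, so after quantifier elimination
    membership has a constant truth value on a principal open part of the closure of the image. The
    value is true because this part contains points of the image. The relations P between the
    components of G describe the closure. *)
Theorem image_generic (n r : nat) (G : n.-tuple {mpoly F[r]}) (psi : {mpoly F[r]}) :
 psi != 0 ->
 exists2 q : {mpoly F[n]}, q \mPo G != 0 &
  forall y, (forall P : {mpoly F[n]}, P \mPo G = 0 -> P.@[y] = 0) -> q.@[y] != 0 ->
  exists t, psi.@[t] != 0 /\ forall j, (tnth G j).@[t] = y j.
move=> psi0.
have [tpsi rpsi psiE] := mpoly_term (fun l : 'I_r => l : nat) psi.
have /fin_all_exists2[tG rG GE] : forall j : 'I_n, exists2 t : GRing.term F, GRing.rterm t &
  forall e : seq F, GRing.eval e t = (tnth G j).@[fun i : 'I_r => e`_i].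
 by move=> j; apply: mpoly_term.
pose eqs := \big[GRing.And/GRing.True]_(j < n)
 GRing.Equal (tG j) (GRing.Var F (r + j)).
have eqsr : GRing.rformula eqs.
 by apply: (big_ind (fun f => GRing.rformula f)) => //= [f g -> ->//|j _]; rewrite rG.
have eqsP e : GRing.holds e eqs <-> forall j, (tnth G j).@[fun i : 'I_r => e`_i] = e`_(r + j).
 rewrite /eqs; split=> [H j|H]; last first.
  elim/big_rec: _ => //= j f _ hf; split=> //; by rewrite GE.
 have : j \in index_enum _ by rewrite mem_index_enum.
 move: H; elim: (index_enum _) => // i s IHs; rewrite big_cons /= => -[h1 h2].
 by rewrite inE => /predU1P[->|/(IHs h2)//]; rewrite -GE.
pose f0 := GRing.And (GRing.Not (GRing.Equal tpsi (GRing.Const 0))) eqs.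
pose f := foldr GRing.Exists f0 (iota 0 r).
have rf : GRing.rformula f.
 by rewrite /f; elim: (iota 0 r) => //=; rewrite rpsi eqsr.
(* Variables below r are the quantified parameters t; those from r to r + n carry the point y. *)
pose e (y : 'I_n -> F) := mkseq (fun k => if (insub (k - r)%N : option 'I_n) is Some j then y j else 0) (r + n)%N.
have er y (j : 'I_n) : (e y)`_(r + j)%N = y j.
 rewrite nth_mkseq ?ltn_add2l // addKn; case: insubP => [i _ /val_inj ->//|].
 by rewrite ltn_ord.
have wf := @wf_ex_elim F; have val := holds_ex_elim (@solve_monicpoly F).
have /andP[qfg rg] := GRing.quantifier_elim_wf wf rf.
have gP y := GRing.quantifier_elim_rformP wf val (e y) rf.
have fP y : GRing.holds (e y) f <-> exists t, psi.@[t] != 0 /\ forall j, (tnth G j).@[t] = y j.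
 rewrite -GRing.foldExistsP; split=> [[e' ee' /= [p0 /eqsP E]]|[t [p0 E]]].
  exists (fun i => e'`_i); split; first by rewrite -psiE; apply/eqP.
  move=> j; rewrite E -er; apply/esym/ee'.
  by rewrite inE /= mem_iota add0n ltnNge leq_addr.
 exists (mkseq (fun k => if (insub k : option 'I_r) is Some l then t l else (e y)`_k) (r + n)).
  move=> k; rewrite inE /= mem_iota add0n => kr.
  have [krn|krn] := ltnP k (r + n)%N.
   by rewrite [RHS]nth_mkseq //; case: insubP => // i ir; rewrite ir in kr.
  by rewrite !nth_default // size_mkseq.
 have tE (p : {mpoly F[r]}) : p.@[fun i => (mkseq (fun k => if (insub k : option 'I_r) is Some l then t l else (e y)`_k) (r + n)%N)`_i] = p.@[t].
  apply: meval_eq => i; rewrite nth_mkseq ?ltn_addr //.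
  by case: insubP => [j _ /val_inj ->//|]; rewrite ltn_ord.
 split=> /=; first by apply/eqP; rewrite psiE tE.
 apply/eqsP => j; rewrite tE E nth_mkseq ?ltn_add2l //.
 by case: insubP => [i|_]; rewrite ?er // ltnNge leq_addr.
have eP k : exists p : {mpoly F[n]}, forall y, (e y)`_k = p.@[y].
 have [krn|krn] := ltnP k (r + n)%N; last first.
  by exists 0 => y; rewrite meval0 nth_default // size_mkseq.
 case kr: (insub (k - r)%N : option 'I_n) => [j|].
  by exists 'X_j => y; rewrite mevalXU nth_mkseq // kr.
 by exists 0 => y; rewrite meval0 nth_mkseq // kr.
have [q [b [q0 qb]]] := qf_generic G eP qfg rg.
exists q => // y yG /(qb _ yG); case: b qb => [_ /gP/fP//|qb _]; exfalso.
have /meval_neq0[t] : psi * (q \mPo G) != 0 by rewrite mulf_neq0.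
rewrite mevalM neqM comp_mpoly_meval => /andP[p0 qt].
have /(_ _ qt)/negP[] := qb (fun j => (tnth G j).@[t]).
 by move=> P PG; rewrite -comp_mpoly_meval PG meval0.
by apply/gP/fP; exists t.
Qed.

(** Without relations between the components, the closure of the image is the whole affine space. *)
Theorem dominant_image (n r : nat) (G : n.-tuple {mpoly F[r]}) (psi : {mpoly F[r]})
  (t0 : 'I_r -> F) :
 psi != 0 ->
 (forall i, exists v : 'I_r -> F, forall j,
   \sum_l v l * ((tnth G j)^`M(l)).@[t0] = (i == j)%:R) ->
 exists2 q : {mpoly F[n]}, q != 0 & forall y, q.@[y] != 0 ->
  exists t, psi.@[t] != 0 /\ forall j, (tnth G j).@[t] = y j.
move=> psi0 jac; have [q q0 qP] := image_generic G psi0.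
exists q => [|y qy]; first by apply: contraNneq q0 => ->; rewrite comp_mpoly0.
by apply: qP qy => P /(comp_mpoly_inj_jac jac) ->; rewrite meval0.
Qed.
End Dominant.

(** * Homogeneous polynomials and minors *)

Section Homog.
Variable K : comNzRingType.

Lemma dhomog_bigprod (n : nat) (I : Type) (s : seq I) (P : I -> {mpoly K[n]}) (e : I -> nat) :
 (forall i, P i \is (e i).-homog) -> \prod_(i <- s) P i \is (\sum_(i <- s) e i)%N.-homog.
by move=> hP; elim/big_rec2: _ => [|i d p _ hp]; [exact: dhomog1 | exact: dhomogM].
Qed.

Lemma dhomog_sum (n d : nat) (I : Type) (s : seq I) (P : I -> {mpoly K[n]}) :
 (forall i, P i \is d.-homog) -> \sum_(i <- s) P i \is d.-homog.
by move=> hP; elim/big_rec: _ => [|i p _]; [exact: dhomog0 | exact: dhomogD]. Qed.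

Lemma dhomog_comp (n r d e : nat) (P : {mpoly K[n]}) (G : n.-tuple {mpoly K[r]}) :
 P \is e.-homog -> (forall i, tnth G i \is d.-homog) -> P \mPo G \is (e * d).-homog.
move=> hP hG; rewrite comp_mpolyE big_seq; elim/big_rec: _ => [|m p mP]; first exact: dhomog0.
apply: dhomogD; apply: dhomogZ; rewrite -((dhomogP _ _ _ hP) _ mP) /= mdegE mulnC big_distrr /=.
by apply: dhomog_bigprod => i; rewrite mulnC mulnC; apply: dhomogMn.
Qed.

Lemma meval_dhomogZ (n d : nat) (P : {mpoly K[n]}) (c : K) (x : 'I_n -> K) :
 P \is d.-homog -> P.@[fun i => c * x i] = c ^+ d * P.@[x].
move=> hP; rewrite !mevalE mulr_sumr big_seq [RHS]big_seq; apply: eq_bigr => m mP.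
rewrite -((dhomogP _ _ _ hP) _ mP) /= mdegE mulrCA; congr (_ * _).
by rewrite -prodrXr -big_split; apply: eq_bigr => i _; rewrite exprMn.
Qed.
End Homog.

Section Minors.
Variable K : fieldType.
Variables k m : nat.

Definition minor (p : nat) (B : 'M[K]_(k, p)) (f : 'I_k -> 'I_p) : K :=
 \det (\matrix_(i, j) B i (f j)).

Lemma minor_mulmx (p : nat) (A : 'M_k) (B : 'M_(k, p)) f :
 minor (A *m B) f = \det A * minor B f.
rewrite -det_mulmx; congr (\det _); apply/matrixP => i j; rewrite !mxE.
by apply: eq_bigr => l _; rewrite !mxE.
Qed.

(** The Cauchy-Binet formula, summed over all maps h instead of increasing ones: this matches the
    redundant Plucker coordinates, and columns never have to be sorted. *)
Lemma minor_mulmxr (p : nat) (B : 'M_(k, m)) (G : 'M_(m, p)) (f : 'I_k -> 'I_p) :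
 minor (B *m G) f = \sum_(h : {ffun 'I_k -> 'I_m}) (\prod_j G (h j) (f j)) * minor B h.
rewrite /minor /determinant.
under eq_bigr => s _.
 rewrite (reindex_inj (@perm_inj _ s^-1%g)) /=.
 under eq_bigr => j _ do rewrite permKV !mxE.
 rewrite bigA_distr_bigA /= mulr_sumr.
 over.
rewrite exchange_big /=; apply: eq_bigr => h _; rewrite mulr_sumr.
apply: eq_bigr => s _; rewrite big_split /= mulrCA mulrC mulrA; congr (_ * _).
rewrite mulrC; congr (_ * _).
rewrite (reindex_inj (@perm_inj _ s)) /=; apply: eq_bigr => j _.
by rewrite permK !mxE.
Qed.

Definition upd (b : 'I_k -> 'I_m) (i : 'I_k) (j : 'I_m) (l : 'I_k) : 'I_m :=
 if l == i then j else b l.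

(** Replacing one column of an identity block reads off a single entry, which makes chart
    coordinates quotients of Plucker coordinates. *)
Lemma minor_upd (B : 'M[K]_(k, m)) (b : 'I_k -> 'I_m) i j :
 (forall r c, B r (b c) = (r == c)%:R) -> minor B (upd b i j) = B i j.
move=> hB; rewrite /minor (expand_det_col _ i) (bigD1 i) //=.
have cof r : cofactor (\matrix_(i0, j0) B i0 (upd b i j j0)) r i = (r == i)%:R.
 transitivity (cofactor (1%:M : 'M[K]_k) r i); last first.
  have /matrixP/(_ i r) := adj1 K k.
  by rewrite !mxE eq_sym.
 congr (_ * \det _); apply/matrixP => x y; rewrite !mxE /upd.
 by rewrite eq_sym (negPf (neq_lift _ _)) hB.
rewrite cof eqxx mulr1 mxE /upd eqxx big1 ?addr0 // => r /negPf ri.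
by rewrite cof ri mulr0.
Qed.

Lemma row_free_minor (B : 'M[K]_(k, m)) : row_free B -> exists h : {ffun 'I_k -> 'I_m}, minor B h != 0.
move=> /row_freeP[P BP]; apply/existsP; apply: contraT => /existsPn H.
have : minor (B *m P) id = 1.
 rewrite BP /minor -[RHS](det1 K k); congr (\det _).
 by apply/matrixP => i j; rewrite !mxE.
rewrite minor_mulmxr big1 => [/esym/eqP|h _]; first by rewrite oner_eq0.
by have /eqP -> := negbNE (H h); rewrite mulr0.
Qed.
End Minors.

(** * Grassmannians: linear action, morphisms, automorphisms, charts *)

Section GrGeometry.
Variables (R : realType) (k m : nat).
Notation C := (R[i]).
Notation Gr := (Gr R k m).
Implicit Types (U W : Gr) (X O : set Gr).

Definition bmx U : 'M[C]_(k, m) := \matrix_(i, j) (vbasis (val U))`_i 0 j.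

Lemma dimGr U : \dim (val U) = k. by apply/eqP; case: U. Qed.

Lemma row_bmx U i : row i (bmx U) = (vbasis (val U))`_i.
by apply/rowP => j; rewrite !mxE. Qed.

Lemma memGr U (v : 'rV[C]_m) : (v \in val U) <-> exists x, v = x *m bmx U.
split=> [vU|[x ->]].
 exists (\row_i coord (vbasis (val U)) (cast_ord (esym (dimGr U)) i) v).
 rewrite {1}(coord_vbasis vU) mulmx_sum_row (reindex (cast_ord (esym (dimGr U)))) /=.
  by apply: eq_bigr => i _; rewrite mxE row_bmx.
 by exists (cast_ord (dimGr U)) => i _; rewrite ?cast_ordK ?cast_ordKV.
rewrite mulmx_sum_row; apply: memv_suml => i _; rewrite row_bmx memvZ //.
by rewrite vbasis_mem // mem_nth // size_tuple dimGr.
Qed.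

Lemma bmx_free U : row_free (bmx U).
apply/row_freeP; rewrite -/(row_free _).
apply/row_freeP; apply: inj_row_free => x x0.
have := basis_free (vbasisP (val U)) => /freeP H.
have e := dimGr U.
pose c i := x 0 (cast_ord e i).
apply/rowP => i; have -> : i = cast_ord e (cast_ord (esym e) i) by rewrite cast_ordKV.
rewrite mxE; apply: (H c).
rewrite -[RHS]x0 mulmx_sum_row (reindex (cast_ord (esym e))) /=.
 by apply: eq_bigr => j _; rewrite /c cast_ordKV row_bmx.
by exists (cast_ord e) => j _; rewrite ?cast_ordK ?cast_ordKV.
Qed.

Lemma pluckerE U a : plucker U a = minor (bmx U) (enum_val a).
by congr (\det _); apply/matrixP => i j; rewrite !mxE. Qed.

Lemma basis_change U (B : 'M[C]_(k, m)) :
 (forall i, row i B \in val U) -> exists A : 'M[C]_k, B = A *m bmx U.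
move=> hB; have /fin_all_exists[x xE] : forall i, exists x, row i B = x *m bmx U.
 by move=> i; apply/memGr.
exists (\matrix_i x i); apply/row_matrixP => i.
by rewrite row_mul rowK xE.
Qed.

Lemma pluckerB U (B : 'M[C]_(k, m)) :
 (forall i, row i B \in val U) -> row_free B ->
 exists2 c : C, c != 0 & forall f, minor B f = c * minor (bmx U) f.
move=> /basis_change[A BE] rB; exists (\det A); last by move=> f; rewrite BE minor_mulmx.
have [h] := row_free_minor rB; rewrite BE minor_mulmx neqM.
by case/andP.
Qed.

Lemma plucker_neq0 U : exists a, plucker U a != 0.
have [h hP] := row_free_minor (bmx_free U).
by exists (enum_rank h); rewrite pluckerE enum_rankK.
Qed.

(** Right action on row vectors. If the image has the wrong dimension the value defaults to U, so
    the lemmas below assume g invertible. *)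
Definition gla (g : 'M[C]_m) U : Gr := insubd U (linfun (mulmxr g) @: val U)%VS.

Lemma val_gl_act g U : g \in unitmx -> val (gla g U) = (linfun (mulmxr g) @: val U)%VS.
move=> gu; apply: insubdK; rewrite -topredE /= limg_dim_eq ?dimGr //; apply/eqP.
rewrite -subv0; apply/subvP => v; rewrite memv_cap memv_ker memv0 lfunE /=.
by case/andP=> _ /eqP vg; rewrite -[v](mulmxK gu) vg mul0mx.
Qed.

Lemma mem_gl_act g U v : g \in unitmx -> (v \in val (gla g U)) = (v *m invmx g \in val U).
move=> gu; rewrite val_gl_act //; apply/memv_imgP/idP => [[u uU ->]|vU].
 by rewrite lfunE /= mulmxK.
by exists (v *m invmx g) => //; rewrite lfunE /= mulmxKV.
Qed.

Lemma mem_glM g U v : g \in unitmx -> (v *m g \in val (gla g U)) = (v \in val U).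
by move=> gu; rewrite mem_gl_act // mulmxK. Qed.

Lemma Gr_eqP U W : (forall v, (v \in val U) = (v \in val W)) -> U = W.
by move=> h; apply/val_inj/vspaceP => v; apply: h. Qed.


Lemma gl_actM g h U : g \in unitmx -> h \in unitmx -> gla h (gla g U) = gla (g *m h) U.
move=> gu hu; have ghu : g *m h \in unitmx by rewrite unitmx_mul gu.
apply: Gr_eqP => v; have [w ->] : exists w, v = w *m (g *m h).
 by exists (v *m invmx (g *m h)); rewrite mulmxKV.
by rewrite [RHS]mem_glM // mulmxA [LHS]mem_glM // mem_glM.
Qed.

Lemma gl_act1 U : gla 1%:M U = U.
by apply: Gr_eqP => v; rewrite mem_gl_act ?unitmx1 // invmx1 mulmx1. Qed.

Lemma gl_actK g : g \in unitmx -> cancel (gla g) (gla (invmx g)).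
by move=> gu U; rewrite gl_actM ?unitmx_inv // mulmxV // gl_act1. Qed.

Lemma glKV g : g \in unitmx -> cancel (gla (invmx g)) (gla g).
by move=> gu U; rewrite gl_actM ?unitmx_inv // mulVmx // gl_act1. Qed.

Lemma row_freeM (B : 'M[C]_(k, m)) g : row_free B -> g \in unitmx -> row_free (B *m g).
by move=> rB gu; rewrite /row_free mxrankMfree ?row_free_unit. Qed.

Lemma minor_gl g U : g \in unitmx ->
 exists2 c : C, c != 0 & forall f, minor (bmx U *m g) f = c * minor (bmx (gla g U)) f.
move=> gu; apply: pluckerB; last exact: row_freeM (bmx_free U) gu.
by move=> i; rewrite row_mul mem_glM // memGr; exists (delta_mx 0 i); rewrite -rowE.
Qed.

Definition gl_form (g : 'M[C]_m) (a : 'I_(plucker_dim k m)) : {mpoly C[plucker_dim k m]} :=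
 \sum_(h : {ffun 'I_k -> 'I_m}) (\prod_j g (h j) (enum_val a j)) *: 'X_(enum_rank h).

Lemma gl_formE g U a : (gl_form g a).@[plucker U] = minor (bmx U *m g) (enum_val a).
rewrite minor_mulmxr raddf_sum; apply: eq_bigr => h _ /=.
by rewrite mevalZ mevalXU pluckerE enum_rankK.
Qed.

Lemma gl_form_homog g a : gl_form g a \is 1.-homog.
by apply: dhomog_sum => h; apply: dhomogZ; rewrite dhomogX /= mdeg1. Qed.

Lemma plucker_gl g U : g \in unitmx ->
 exists2 c : C, c != 0 & forall a, plucker (gla g U) a = c * (gl_form g a).@[plucker U].
move=> gu; have [c c0 H] := minor_gl U gu; exists c^-1; first by rewrite invr_eq0.
by move=> a; rewrite gl_formE H pluckerE mulKf.
Qed.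

(** Openness through principal neighbourhoods of points, the form in which it is both produced and
    used below. *)
Lemma zopenP X O : zopen_in X O <-> O `<=` X /\
 forall U, O U -> exists (d : nat) (p : {mpoly C[plucker_dim k m]}),
  [/\ p \is d.-homog, p.@[plucker U] != 0 &
   forall W, X W -> p.@[plucker W] != 0 -> O W].
split=> [[OX [S hS E]]|[OX H]]; split=> //.
 move=> U OU; have XU := OX _ OU.
 have /not_andP[//|] : ~ (X U /\ forall p, S p -> p.@[plucker U] = 0).
  move=> h; have : (X `\` O) U by rewrite E.
  by case=> _; apply.
 move=> /existsNP[p /not_implyP[Sp /eqP p0]]; have [d hd] := hS _ Sp.
 exists d, p; split=> // W XW pW; apply: contrapT => nOW.
 have : (X `\` O) W by split.
 by rewrite E => -[_ /(_ _ Sp)]; apply/eqP.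
exists [set p | (exists d : nat, p \is d.-homog) /\
  forall W, X W -> p.@[plucker W] != 0 -> O W]; first by move=> p [].
apply/seteqP; split=> [W [XW nOW]|W [XW hW]]; split=> //.
 by move=> p [_ hp]; apply/eqP/negPn/negP => /(hp _ XW).
move=> OW; have [d [p [hd p0 pO]]] := H _ OW.
by move: p0; rewrite hW ?eqxx //; split=> //; exists d.
Qed.

(** [regular_on] does not ask the scalar to be non-zero; this is automatic because some Plucker
    coordinate of the image is non-zero. *)
Lemma plucker_scale_neq0 (f : Gr -> Gr) U c (F : 'I_(plucker_dim k m) -> C) :
 (forall a, plucker (f U) a = c * F a) -> c != 0.
move=> h; have [a] := plucker_neq0 (f U); rewrite h neqM.
by case/andP.
Qed.

(** [endomorphism X] is convertible with [mor X X]; a different target is needed to transport X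
    along a linear map. *)
Definition mor X Y (f : Gr -> Gr) : Prop := (forall U, X U -> Y (f U)) /\ regular_on X f.

Lemma mor_zopen X Y f O : mor X Y f -> zopen_in Y O ->
 zopen_in X [set U | X U /\ O (f U)].
move=> [fX reg] /zopenP[OX OP]; apply/zopenP; split=> [U []//|U [XU OfU]].
have [d [p [hp p0 pO]]] := OP _ OfU.
have [O1 [e [F [/zopenP[_ O1P] O1U hF FE]]]] := reg _ XU.
have [d1 [q [hq q0 qO]]] := O1P _ O1U.
pose G := [tuple F i | i < plucker_dim k m].
have GE W : (p \mPo G).@[plucker W] = p.@[fun a => (F a).@[plucker W]].
 by rewrite comp_mpoly_meval; congr meval; apply/funext => a; rewrite tnth_mktuple.
have key W : O1 W -> exists2 c : C, c != 0 & p.@[plucker (f W)] = c ^+ d * (p \mPo G).@[plucker W].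
 move=> /FE[c cE]; exists c; first exact: plucker_scale_neq0 cE.
 by rewrite GE -(meval_dhomogZ _ _ hp); congr meval; apply/funext => a.
exists (d * e + d1)%N, ((p \mPo G) * q); split.
- by apply: dhomogM => //; apply: dhomog_comp => // i; rewrite tnth_mktuple.
- rewrite mevalM neqM q0 andbT.
 by have [c c0 E] := key _ O1U; move: p0; rewrite E neqM => /andP[].
move=> W XW; rewrite mevalM neqM => /andP[pW qW]; split=> //.
apply: pO; first exact: fX.
have [c c0 ->] := key _ (qO _ XW qW).
by rewrite mulf_neq0 // expf_neq0.
Qed.

Lemma mor_comp X Y Z f g : mor X Y f -> mor Y Z g -> mor X Z (g \o f).
move=> fe ge; have [fX freg] := fe; have [gX greg] := ge; split=> [U XU|U XU] /=.
 exact/gX/fX.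
have [O1 [e [F [O1o O1U hF FE]]]] := freg _ XU.
have [O2 [d [G [O2o O2U hG GE]]]] := greg _ (fX _ XU).
have [_ O1P] := (zopenP _ _).1 O1o.
have [_ O2P] := (zopenP _ _).1 (mor_zopen fe O2o).
exists (O1 `&` [set U | X U /\ O2 (f U)]), (d * e)%N.
exists (fun a => G a \mPo [tuple F i | i < plucker_dim k m]); split.
- apply/zopenP; split=> [W [_ []]//|W [O1W O2W]].
 have [d1 [p [hp p0 pO]]] := O1P _ O1W; have [d2 [q [hq q0 qO]]] := O2P _ O2W.
 exists (d1 + d2)%N, (p * q); split; [exact: dhomogM|by rewrite mevalM mulf_neq0|].
 move=> W' XW'; rewrite mevalM neqM => /andP[/(pO _ XW') ? /(qO _ XW') ?].
 by split.
- by split.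
- by move=> a; apply: dhomog_comp => // i; rewrite tnth_mktuple.
move=> W [/FE[c cE] [XW /GE[c' cE']]]; exists (c' * c ^+ d) => a.
rewrite cE' -mulrA; congr (_ * _); rewrite comp_mpoly_meval -(meval_dhomogZ _ _ (hG a)).
by congr meval; apply/funext => i; rewrite tnth_mktuple.
Qed.

Lemma aut_comp X f g : automorphism X f -> automorphism X g -> automorphism X (g \o f).
move=> [fe [f' fe' fK]] [ge [g' ge' gK]]; split; first exact: (mor_comp fe ge).
exists (f' \o g'); first exact: (mor_comp ge' fe').
move=> U XU /=; have [fX _] := fe; have [gX' _] := ge'; split.
 by rewrite (gK _ (fX _ XU)).1 (fK _ XU).1.
by rewrite (fK _ (gX' _ XU)).2 (gK _ XU).2.
Qed.

Lemma aut_inv X f : automorphism X f -> exists2 g, automorphism X g &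
 forall U, X U -> g (f U) = U /\ f (g U) = U.
move=> [fe [g ge gK]]; exists g => //; split=> //; exists f => // U XU.
by have [] := gK _ XU.
Qed.

Lemma zopen_in_setT X : zopen_in X X.
apply/zopenP; split=> // U XU; exists 0%N, 1; split=> //; first exact: dhomog1.
by rewrite meval1 oner_neq0.
Qed.

Lemma gl_mor X Y g : g \in unitmx -> (forall U, X U -> Y (gla g U)) -> mor X Y (gla g).
move=> gu gX; split=> // U XU; exists X, 1%N, (gl_form g); split=> //.
- exact: zopen_in_setT.
- by move=> a; apply: gl_form_homog.
- by move=> W _; have [c _ E] := plucker_gl W gu; exists c.
Qed.

Lemma gl_aut X g : g \in unitmx -> (forall U, X U <-> X (gla g U)) -> automorphism X (gla g).
move=> gu gX.
split; first by apply: gl_mor => // U /gX.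
exists (gla (invmx g)); last by move=> U _; rewrite gl_actK ?glKV.
by apply: gl_mor; rewrite ?unitmx_inv // => U XU; apply/gX; rewrite glKV.
Qed.

Lemma aut_gl_conj X X' g f : g \in unitmx -> (forall U, X U <-> X' (gla g U)) ->
 automorphism X f -> automorphism X' (fun U => gla g (f (gla (invmx g) U))).
move=> gu XX' [fe [f' fe' fK]].
have m1 : mor X X' (gla g) by apply: gl_mor => // U /XX'.
have m2 : mor X' X (gla (invmx g)).
 by apply: gl_mor => [|U XU]; rewrite ?unitmx_inv // XX' glKV.
split; first exact: (mor_comp (mor_comp m2 fe) m1).
exists (fun U => gla g (f' (gla (invmx g) U))); first exact: (mor_comp (mor_comp m2 fe') m1).
move=> U XU; have XU' : X (gla (invmx g) U) by apply: m2.1.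
by rewrite !gl_actK // (fK _ XU').1 (fK _ XU').2 !glKV.
Qed.

Lemma aut_orbit_gl X X' g U : g \in unitmx -> (forall U, X U <-> X' (gla g U)) -> X U ->
 forall W, aut_orbit X' (gla g U) W <-> aut_orbit X U (gla (invmx g) W).
move=> gu XX' XU W; have X'X V : X' V <-> X (gla (invmx g) V) by rewrite XX' glKV.
split=> [[f fa ->]|[f fa E]].
 have fa' : automorphism X (fun U => gla (invmx g) (f (gla (invmx (invmx g)) U))).
  by apply: (aut_gl_conj _ X'X) => //; rewrite unitmx_inv.
 by exists (fun U => gla (invmx g) (f (gla (invmx (invmx g)) U))) => //; rewrite invmxK.
exists (fun U => gla g (f (gla (invmx g) U))); first exact: aut_gl_conj.
by rewrite gl_actK // -E glKV.
Qed.

Lemma qh_gl X X' g : g \in unitmx -> (forall U, X U <-> X' (gla g U)) ->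
 quasi_homogeneous X -> quasi_homogeneous X'.
move=> gu XX' [U XU Uo]; exists (gla g U); first exact/XX'.
have m2 : mor X' X (gla (invmx g)).
 by apply: gl_mor => [|V XV]; rewrite ?unitmx_inv // XX' glKV.
have /zopenP[_ H] := mor_zopen m2 Uo; apply/zopenP; split=> [W [f [[fX _] _] ->]|W WA].
 by apply: fX; apply/XX'.
have WA' := (aut_orbit_gl gu XX' XU W).1 WA.
have [|d [p [hp p0 pO]]] := H W.
 by split=> //; have [f [[fX _] _] ->] := WA; apply: fX; apply/XX'.
by exists d, p; split=> // V X'V /(pO _ X'V)[_ /(aut_orbit_gl gu XX' XU)].
Qed.

(** Automorphisms carry a neighbourhood of one point of the orbit to neighbourhoods of all the
    others. *)
Lemma aut_orbit_open X U O : X U -> zopen_in X O -> O U -> O `<=` aut_orbit X U ->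
 zopen_in X (aut_orbit X U).
move=> XU Oo OU OA; apply/zopenP; split=> [W [f [[fX _] _] ->]|W [f fa ->]].
 exact: fX.
have [g ga gK] := aut_inv fa; have [ge _] := ga.
have /zopenP[_ H] := mor_zopen ge Oo.
have [|d [p [hp p0 pO]]] := H (f U).
 have [[fX _] _] := fa; split; first exact: fX.
 by rewrite /= (gK _ XU).1.
exists d, p; split=> // W' XW' /(pO _ XW')[_ /OA[f' fa' E]].
exists (f \o f'); first exact: aut_comp.
by rewrite /= -E (gK _ XW').2.
Qed.

(** Regular functions on the chart where the minor b does not vanish: forms divided by the power of
    this minor of the same degree. *)
Definition rgl (b : {ffun 'I_k -> 'I_m}) (f : Gr -> C) : Prop :=
 exists (d : nat) (F : {mpoly C[plucker_dim k m]}), F \is d.-homog /\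
  forall U, minor (bmx U) b != 0 -> f U = F.@[plucker U] / minor (bmx U) b ^+ d.

Section Rgl.
Variable b : {ffun 'I_k -> 'I_m}.
Notation pb U := (minor (bmx U) b).
Notation Xb := ('X_(enum_rank b) : {mpoly C[plucker_dim k m]}).

Lemma mevalXb U : Xb.@[plucker U] = pb U.
by rewrite mevalXU pluckerE enum_rankK. Qed.

Lemma Xb_homog : Xb \is 1.-homog. by rewrite dhomogX /= mdeg1. Qed.

Lemma rgl_ext f g : (forall U, pb U != 0 -> f U = g U) -> rgl b g -> rgl b f.
by move=> fg [d [F [hF E]]]; exists d, F; split=> // U pU; rewrite fg ?E. Qed.

Lemma rgl_const c : rgl b (fun=> c).
exists 0%N, c%:MP; split=> [|U _]; last by rewrite mevalC expr0 divr1.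
by rewrite -[c%:MP]mulr1 mul_mpolyC dhomogZ // dhomog1.
Qed.

Lemma rgl_add f g : rgl b f -> rgl b g -> rgl b (fun U => f U + g U).
move=> [d [F [hF E]]] [e [G [hG E']]]; exists (d + e)%N, (F * Xb ^+ e + G * Xb ^+ d); split.
 apply: dhomogD; first by apply: dhomogM => //; rewrite -[X in X.-homog]mul1n dhomogMn ?Xb_homog.
 by rewrite addnC; apply: dhomogM => //; rewrite -[X in X.-homog]mul1n dhomogMn ?Xb_homog.
move=> U pU; rewrite E // E' // mevalD !mevalM !rmorphXn /= mevalXb exprD.
have : pb U ^+ d != 0 by rewrite expf_neq0.
have : pb U ^+ e != 0 by rewrite expf_neq0.
by move: (pb U ^+ d) (pb U ^+ e) => x y y0 x0; field; rewrite x0 y0.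
Qed.

Lemma rgl_mul f g : rgl b f -> rgl b g -> rgl b (fun U => f U * g U).
move=> [d [F [hF E]]] [e [G [hG E']]]; exists (d + e)%N, (F * G); split.
 exact: dhomogM.
move=> U pU; rewrite E // E' // mevalM exprD.
have : pb U ^+ d != 0 by rewrite expf_neq0.
have : pb U ^+ e != 0 by rewrite expf_neq0.
by move: (pb U ^+ d) (pb U ^+ e) => x y y0 x0; field; rewrite x0 y0.
Qed.

Lemma rgl_sum (I : Type) (s : seq I) (P : pred I) (f : I -> Gr -> C) :
 (forall i, rgl b (f i)) -> rgl b (fun U => \sum_(i <- s | P i) f i U).
move=> h; elim: s => [|i s IH].
 by apply: rgl_ext (rgl_const 0) => U _; rewrite big_nil.
case Pi: (P i); last by apply: rgl_ext IH => U _; rewrite big_cons Pi.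
by apply: rgl_ext (rgl_add (h i) IH) => U _; rewrite big_cons Pi.
Qed.

Lemma rgl_meval (n : nat) (x : Gr -> 'I_n -> C) (p : {mpoly C[n]}) :
 (forall i, rgl b (fun U => x U i)) -> rgl b (fun U => p.@[x U]).
move=> hx.
have hX i e : rgl b (fun U => x U i ^+ e).
 elim: e => [|e IH]; first exact: rgl_const 1.
 by apply: rgl_ext (rgl_mul (hx i) IH) => U _; rewrite exprS.
have hP (s : seq 'I_n) (e : 'I_n -> nat) : rgl b (fun U => \prod_(i <- s) x U i ^+ e i).
 elim: s => [|i s IH].
  by apply: rgl_ext (rgl_const 1) => U _; rewrite big_nil.
 by apply: rgl_ext (rgl_mul (hX i (e i)) IH) => U _; rewrite big_cons.
apply: rgl_ext (fun U _ => mevalE _ _) _; apply: rgl_sum => e.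
apply: rgl_mul; [exact: rgl_const | exact: hP].
Qed.

Lemma rgl_open X (f : Gr -> C) : rgl b f -> zopen_in X [set U | [/\ X U, pb U != 0 & f U != 0]].
move=> [d [F [hF E]]]; apply/zopenP; split=> [U []//|U [XU pU fU]].
exists (1 + d)%N, (Xb * F); split; first by apply: dhomogM => //; exact: Xb_homog.
 rewrite mevalM mevalXb mulf_neq0 //; apply: contra_neq fU => F0.
 by rewrite E // F0 mul0r.
move=> W XW; rewrite mevalM mevalXb neqM => /andP[pW FW]; split=> //.
by rewrite E // mulf_neq0 // invr_eq0 expf_neq0.
Qed.

Definition bsq U : 'M[C]_k := \matrix_(i, j) bmx U i (b j).
(** The basis of U whose columns b form the identity matrix; locked to keep unification away from
    the inverse. *)
Definition cmx U : 'M[C]_(k, m) := locked (invmx (bsq U) *m bmx U).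

Lemma cmxE U : cmx U = invmx (bsq U) *m bmx U.
by rewrite /cmx -lock. Qed.

Lemma chart_mx_b U : pb U != 0 -> forall i j, cmx U i (b j) = (i == j)%:R.
move=> pU i j; have bu : bsq U \in unitmx by rewrite unitmxE unitfE.
have /matrixP/(_ i j) := mulVmx bu; rewrite cmxE !mxE => <-.
by apply: eq_bigr => l _; rewrite [X in _ = _ * X]mxE.
Qed.

Lemma cmx_mem U i : row i (cmx U) \in val U.
by rewrite cmxE row_mul; apply/memGr; exists (row i (invmx (bsq U))). Qed.

Lemma chart_mxE U i j : pb U != 0 -> cmx U i j = minor (bmx U) (upd b i j) / pb U.
move=> pU; rewrite -(minor_upd _ _ (chart_mx_b pU)) cmxE minor_mulmx mulrC.
by rewrite det_inv.
Qed.

Lemma rgl_chart_mx i j : rgl b (fun U => cmx U i j).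
exists 1%N, 'X_(enum_rank [ffun l => upd b i j l]); split; first by rewrite dhomogX /= mdeg1.
move=> U pU; rewrite chart_mxE // mevalXU pluckerE enum_rankK expr1.
by congr (\det _ / _); apply/matrixP => r c; rewrite !mxE ffunE.
Qed.
End Rgl.

Lemma dim_mx_Gr (B : 'M[C]_(k, m)) : row_free B -> \dim (limg (linfun (mulmxr B : 'rV[C]_k -> 'rV[C]_m))) == k.
move=> rB; rewrite limg_dim_eq; first by rewrite dimvf /dim /= mul1n.
apply/eqP.
rewrite -subv0; apply/subvP => v; rewrite memv_cap memv_ker memv0 lfunE /= => /andP[_ /eqP vB].
by apply/eqP/(row_free_inj rB); rewrite mul0mx.
Qed.

Definition mx_Gr (B : 'M[C]_(k, m)) (rB : row_free B) : Gr :=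
 exist (fun U : {vspace 'rV[C]_m} => \dim U == k) _ (dim_mx_Gr rB).

Lemma mem_mx_Gr (B : 'M[C]_(k, m)) (rB : row_free B) v :
 (v \in val (mx_Gr rB)) <-> exists x, v = x *m B.
split=> [/memv_imgP[x _ ->]|[x ->]]; first by exists x; rewrite lfunE.
by apply/memv_imgP; exists x; rewrite ?memvf // lfunE.
Qed.

End GrGeometry.

(** For odd m the middle basis vector preserves the parity of degrees, so the half-spin labels are
    compatible with the Clifford action only for even m. *)
Definition label_ok (m : nat) (l : spin_label) : bool :=
 if l is Sfull then true else ~~ odd m.

Lemma label_ok_opp m l : label_ok m (opp_label l) = label_ok m l.
by case: l. Qed.

Lemma opp_labelK : involutive opp_label. by case. Qed.

(** * The Clifford action, the polar form and the Clifford group *)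

Section Indices.
Variable m : nat.
Implicit Types (i : 'I_m./2) (j : 'I_m).

Definition idx i (b : bool) : 'I_m := if b then idxE i else idxF i.

Lemma rev_idx i b : rev_ord (idx i b) = idx i (~~ b).
by case: b => //=; rewrite /idxF rev_ordK. Qed.

Lemma idxEF i i' : (idxE i == idxF i') = false.
apply/negP => /eqP/(congr1 val) /=; have := ltn_ord i; have := ltn_ord i'.
by lia.
Qed.

Lemma idx_eq i i' b b' : (idx i b == idx i' b') = (i == i') && (b == b').
case: b; case: b' => /=; rewrite ?eqxx ?andbT ?andbF /idx.
- by apply/eqP/eqP => [/(congr1 val)/= /val_inj//|->].
- exact: idxEF.
- by rewrite eq_sym idxEF.
- by rewrite (inj_eq rev_ord_inj); apply/eqP/eqP => [/(congr1 val)/= /val_inj//|->].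
Qed.

Lemma idx_rev_neq i b : (rev_ord (idx i b) == idx i b) = false.
by rewrite rev_idx idx_eq eqxx /=; case: b. Qed.

Lemma idx_cases j : (exists i b, j = idx i b) \/ rev_ord j == j.
have [jE|jE] := ltnP j m./2.
 by left; exists (Ordinal jE), true; apply/val_inj.
have [jF|jF] := ltnP (m - j.+1) m./2.
 by left; exists (Ordinal jF), false; apply/val_inj => /=; have := ltn_ord j; lia.
by right; apply/eqP/val_inj => /=; have := ltn_ord j; lia.
Qed.
End Indices.

Section Clifford.
Variables (R : realType) (m : nat).
Notation C := (R[i]).
Notation V := 'rV[C]_m.
Notation Spn := (spinor R m).
Implicit Types (u v w : V) (x y : Spn) (l : spin_label).

Definition cf : Spn -> {set 'I_m./2} -> C := locked (fun (x : Spn) I => x I).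
Lemma cfunE x I : x I = cf x I. by rewrite /cf -lock. Qed.
Lemma spinorP x y : (forall I, cf x I = cf y I) -> x = y.
by move=> H; apply/ffunP => I; rewrite !cfunE. Qed.
Lemma cfD x y I : cf (x + y) I = cf x I + cf y I. by rewrite -!cfunE ffunE. Qed.
Lemma cfZ (a : C) x I : cf (a *: x) I = a * cf x I. by rewrite -!cfunE ffunE. Qed.
Lemma cfN x I : cf (- x) I = - cf x I. by rewrite -!cfunE ffunE. Qed.
Lemma cf0 I : cf 0 I = 0. by rewrite -!cfunE ffunE. Qed.
Lemma cf_sum (I : Type) (s : seq I) (P : pred I) (F : I -> Spn) J :
 cf (\sum_(i <- s | P i) F i) J = \sum_(i <- s | P i) cf (F i) J.
elim: s => [|i s IH]; first by rewrite !big_nil cf0.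
by rewrite !big_cons; case: ifP; rewrite ?cfD IH.
Qed.
(* Locked, so that unification never unfolds the sums of its definition. *)
Definition cl : V -> Spn -> Spn := locked (@clifford R m).
Lemma clE v x : clifford v x = cl v x. by rewrite /cl -lock. Qed.
Lemma cf_cl v x I : cf (cl v x) I =
  \sum_(i < m./2) (if i \in I then v 0 (idxE i) * (ext_sign R i I * cf x (I :\ i))
           else v 0 (idxF i) * (ext_sign R i I * cf x (i |: I)))
  + \sum_(j < m | rev_ord j == j) v 0 j * ((-1) ^+ #|I| * cf x I).
rewrite -clE -cfunE cliffordE; congr (_ + _); last by apply: eq_bigr => j _; rewrite cfunE.
by apply: eq_bigr => j _; rewrite !cfunE.
Qed.
Lemma cf_basis I J : cf (basis_spinor R I) J = (J == I)%:R.
by rewrite -cfunE ffunE. Qed.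
Lemma clK v x : cl v (cl v x) = qform v *: x. by rewrite -!clE cliffordK. Qed.
Definition cfE := (cfD, cfN, cfZ).

Lemma cliffDr v x y : cl v (x + y) = cl v x + cl v y.
by rewrite -!clE raddfD. Qed.
Lemma cliffNr v x : cl v (- x) = - cl v x.
by rewrite -!clE raddfN. Qed.
Lemma cliff0r v : cl v 0 = 0.
by rewrite -!clE raddf0. Qed.
Lemma cliffZr v (a : C) x : cl v (a *: x) = a *: cl v x.
by rewrite -!clE linearZ. Qed.
Definition cliffr := (cliffDr, cliffNr, cliffZr).

Lemma cliffordDl (a : C) u w x : cl (a *: u + w) x = a *: cl u x + cl w x.
apply: spinorP => I; rewrite cfD cfZ !cf_cl.
rewrite mulrDr addrACA !mulr_sumr -!big_split; congr (_ + _).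
 by apply: eq_bigr => i _ /=; rewrite !mxE; case: ifP => _; ring.
by apply: eq_bigr => i _ /=; rewrite !mxE; ring.
Qed.

Lemma clifford0l x : cl 0 x = 0.
by have := cliffordDl 1 0 0 x; rewrite scaler0 addr0 scale1r => /eqP; rewrite -subr_eq subrr eq_sym => /eqP. Qed.

Lemma cliffordZl (a : C) u x : cl (a *: u) x = a *: cl u x.
by rewrite -[a *: u]addr0 cliffordDl clifford0l addr0. Qed.

Lemma cliffordD u w x : cl (u + w) x = cl u x + cl w x.
by rewrite -{1}[u]scale1r cliffordDl scale1r. Qed.

Lemma cliffordBl u w x : cl (u - w) x = cl u x - cl w x.
by rewrite cliffordD -scaleN1r cliffordZl scaleN1r. Qed.

Lemma cl_suml (I : Type) (s : seq I) (P : pred I) (F : I -> V) x :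
 cl (\sum_(i <- s | P i) F i) x = \sum_(i <- s | P i) cl (F i) x.
elim: s => [|i s IH]; first by rewrite !big_nil clifford0l.
by rewrite !big_cons; case: ifP; rewrite ?cliffordD IH.
Qed.

Definition bform u w : C := qform (u + w) - qform u - qform w.

Lemma bformE u w : bform u w =
 \sum_(i < m./2) (u 0 (idxE i) * w 0 (idxF i) + w 0 (idxE i) * u 0 (idxF i))
 + \sum_(j < m | rev_ord j == j) (u 0 j * w 0 j) *+ 2.
rewrite /bform /qform !opprD !addrA -!sumrN.
rewrite -!addrA [X in _ + X](_ : _ = (\sum_(i < m./2) (- (u 0 (idxE i) * u 0 (idxF i)) - w 0 (idxE i) * w 0 (idxF i))) + \sum_(j < m | rev_ord j == j) ((u + w) 0 j ^+ 2 - u 0 j ^+ 2 - w 0 j ^+ 2)).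
 rewrite addrA -big_split; congr (_ + _); apply: eq_bigr => i _ /=; rewrite !mxE; ring.
by rewrite !big_split /= !sumrN; ring.
Qed.

Lemma bformC u w : bform u w = bform w u.
by rewrite /bform (addrC u); ring. Qed.

Lemma bformDr u v w : bform u (v + w) = bform u v + bform u w.
rewrite !bformE addrACA -!big_split; congr (_ + _); apply: eq_bigr => i _ /=; rewrite !mxE; ring.
Qed.

Lemma bformZr (a : C) u v : bform u (a *: v) = a * bform u v.
rewrite !bformE mulrDr !mulr_sumr; congr (_ + _); apply: eq_bigr => i _ /=; rewrite !mxE; ring.
Qed.

Lemma bform0r u : bform u 0 = 0.
by rewrite -(scale0r u) bformZr mul0r. Qed.

Lemma bformDl u v w : bform (u + v) w = bform u w + bform v w.
by rewrite bformC bformDr !(bformC w). Qed.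

Lemma bformZl (a : C) u v : bform (a *: u) v = a * bform u v.
by rewrite bformC bformZr bformC. Qed.

Lemma bform_suml (I : Type) (s : seq I) (P : pred I) (F : I -> V) w :
 bform (\sum_(i <- s | P i) F i) w = \sum_(i <- s | P i) bform (F i) w.
elim: s => [|i s IH]; first by rewrite !big_nil bformC bform0r.
by rewrite !big_cons; case: ifP; rewrite ?bformDl IH.
Qed.

Lemma qformD u w : qform (u + w) = qform u + qform w + bform u w.
by rewrite /bform; ring. Qed.

Lemma qformZ (a : C) u : qform (a *: u) = a ^+ 2 * qform u.
rewrite /qform mulrDr !mulr_sumr; congr (_ + _); apply: eq_bigr => i _ /=; rewrite !mxE; ring.
Qed.

Lemma bformvv u : bform u u = qform u *+ 2.
by rewrite /bform -mulr2n -scaler_nat qformZ; ring. Qed.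

Lemma cliff_anti u w x : cl u (cl w x) = bform u w *: x - cl w (cl u x).
have := clK (u + w) x; rewrite !cliffordD !cliffr !clK qformD.
move: (cl u (cl w x)) (cl w (cl u x)) => y z E; apply: spinorP => I.
move: (congr1 (cf^~ I) E); rewrite /= !cfE => /eqP; rewrite -subr_eq0 => /eqP E0; apply/eqP; rewrite -subr_eq0 -E0.
by apply/eqP; ring.
Qed.

Definition ev (j : 'I_m) : V := delta_mx 0 j.

Lemma vec_ev v : v = \sum_j v 0 j *: ev j.
exact: row_sum_delta. Qed.

(** The middle coordinate enters [qform] by its square, hence the polar form with a factor two;
    every other basis vector pairs with its opposite. *)
Lemma bform_ev j v : bform (ev j) v = v 0 (rev_ord j) *+ (1 + (rev_ord j == j)).
rewrite bformE; have [[i [b ->]]|jj] := idx_cases j.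
 rewrite idx_rev_neq addn0 rev_idx [X in _ + X]big1 ?addr0; last first.
  move=> j0 j0j0; rewrite mxE eqxx /=; case: eqP => [E|]; last by rewrite mul0r mul0rn.
  by move: j0j0; rewrite E idx_rev_neq.
 rewrite (bigD1 i) //= big1 ?addr0 => [|i' i'i].
  rewrite !mxE !eqxx /= -[idxE i]/(idx i true) -[idxF i]/(idx i false) !idx_eq eqxx /=.
  by case: b => /=; rewrite ?mul1r ?mulr1 ?mul0r ?mulr0 ?addr0 ?add0r.
 rewrite !mxE !eqxx /= -[idxE i']/(idx i' true) -[idxF i']/(idx i' false) !idx_eq (negPf i'i) /=.
 by rewrite mul0r mulr0 addr0.
rewrite jj big1 ?add0r => [|i _]; last first.
 rewrite !mxE /=; have e b : (idx i b == j) = false.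
  by apply/negP => /eqP E; move: jj; rewrite -E idx_rev_neq.
 rewrite -[idxE i]/(idx i true) -[idxF i]/(idx i false) !e mul0r mulr0 addr0 //.
rewrite (bigD1 j) //= mxE !eqxx mul1r big1 ?addr0 => [|j' /andP[_ j'j]].
 by rewrite (eqP jj).
by rewrite mxE (negPf j'j) andbF mul0r mul0rn.
Qed.

Lemma qform_ev j : qform (ev j) = (rev_ord j == j)%:R.
apply/eqP; rewrite -(eqr_pMn2r (n := 2)) // -bformvv bform_ev mxE eqxx /=.
by case: (rev_ord j == j); rewrite ?mul0rn.
Qed.

Lemma cl_idx i b x (I : {set 'I_m./2}) :
 cf (cl (ev (idx i b)) x) I = if (i \in I) == b then ext_sign R i I * cf x (toggle i I) else 0.
rewrite cf_cl [X in _ + X]big1 ?addr0; last first.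
 move=> j jj; rewrite mxE eqxx /=; case: eqP => [E|]; last by rewrite mul0r.
 by move: jj; rewrite E idx_rev_neq.
rewrite (bigD1 i) //= big1 ?addr0 => [|i' i'i].
 rewrite !mxE !eqxx /= -[idxE i]/(idx i true) -[idxF i]/(idx i false) !idx_eq eqxx /= /toggle.
 by case: (i \in I); case: b => /=; rewrite ?mul1r ?mul0r.
rewrite !mxE !eqxx /= -[idxE i']/(idx i' true) -[idxF i']/(idx i' false) !idx_eq (negPf i'i) /=.
by case: ifP; rewrite mul0r.
Qed.

Lemma clifford_mid j x (I : {set 'I_m./2}) : rev_ord j == j ->
 cf (cl (ev j) x) I = (-1) ^+ #|I| * cf x I.
move=> jj; rewrite cf_cl big1 ?add0r => [|i _].
 rewrite (bigD1 j) //= mxE !eqxx mul1r big1 ?addr0 // => j' /andP[_ j'j].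
 by rewrite mxE (negPf j'j) andbF mul0r.
have e b : (idx i b == j) = false.
 by apply/negP => /eqP E; move: jj; rewrite -E idx_rev_neq.
by rewrite !mxE -[idxE i]/(idx i true) -[idxF i]/(idx i false) !e !andbF !mul0r; case: ifP.
Qed.

Lemma spinor_sum x : x = \sum_I cf x I *: basis_spinor R I.
apply: spinorP => I; rewrite cf_sum.
transitivity (\sum_J (if J == I then cf x J else 0)); first by rewrite -big_mkcond big_pred1_eq.
apply: eq_bigr => J _; rewrite cfZ cf_basis eq_sym.
by case: eqP; rewrite ?mulr1 ?mulr0.
Qed.

Lemma mem_Delta l x : (x \in Delta R m l) <-> forall I : {set 'I_m./2}, ~~ label_parity l #|I| -> cf x I = 0.
split=> [/memv_sumP[f fP ->] I nI|H].
 rewrite cf_sum big1 // => J Jl; have /vlineP[a ->] := fP _ Jl.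
 rewrite cfZ cf_basis; case: eqP => [E|]; last by rewrite mulr0.
 by rewrite -E (negPf nI) in Jl.
rewrite [x]spinor_sum; apply: memv_suml => I _.
have [lI|/H ->] := boolP (label_parity l #|I|); last by rewrite scale0r mem0v.
by apply: memvZ; apply: (subvP (sumv_sup I lI (subvv _))); rewrite memv_line.
Qed.

Lemma parity_toggle l i (I : {set 'I_m./2}) : label_parity (opp_label l) #|toggle i I| = label_parity l #|I|.
have odd_toggle : odd #|toggle i I| = ~~ odd #|I|.
 rewrite /toggle; case: ifP => iI; last by rewrite cardsU1 iI.
 by rewrite (cardsD1 i I) iI /= negbK.
by case: l => //=; rewrite odd_toggle ?negbK.
Qed.

Lemma clifford_Delta l v x : label_ok m l -> x \in Delta R m l -> cl v x \in Delta R m (opp_label l).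
move=> ok /mem_Delta xl; apply/mem_Delta => I lI.
rewrite (vec_ev v) cl_suml cf_sum big1 // => j _; rewrite cliffordZl cfZ.
have [[i [b ->]]|jj] := idx_cases j.
 rewrite cl_idx xl ?mulr0 ?if_same ?mulr0 //.
 by rewrite -(parity_toggle _ i) toggleK.
have mo : odd m by move/eqP/(congr1 val): jj => /=; have := ltn_ord j; lia.
by move: ok lI; case: (l) => //=; rewrite mo.
Qed.

Lemma clifford_im_gen (U : {vspace V}) (D : {vspace Spn}) u y :
 u \in U -> y \in D -> cl u y \in clifford_im U D.
move=> uU yD; rewrite (coord_vbasis uU) cl_suml; apply: memv_suml => i _.
rewrite cliffordZl; apply: memvZ; rewrite /clifford_im (big_nth 0) big_mkord.
have si : (i < size (vbasis U))%N by rewrite size_tuple.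
apply: (subvP (sumv_sup (Ordinal si) isT (subvv _))).
by apply/memv_imgP; exists y; rewrite // lfunE /= clE.
Qed.

Lemma cim_sub (U : {vspace V}) (D X : {vspace Spn}) :
 (forall u y, u \in U -> y \in D -> cl u y \in X) -> (clifford_im U D <= X)%VS.
move=> H; rewrite /clifford_im big_seq; elim/big_rec: _ => [|u S uU hS]; first exact: sub0v.
rewrite subv_add hS andbT; apply/subvP => z /memv_imgP[y yD ->].
by rewrite lfunE /= clE; apply: H => //; apply: vbasis_mem.
Qed.

Lemma spinor_neq0 : exists x : Spn, x != 0.
exists (basis_spinor R finset.set0); apply/eqP => /(congr1 (cf^~ finset.set0)) /=.
by rewrite cf_basis eqxx cf0 => /eqP; rewrite oner_eq0.
Qed.

(** The anticommutator of v with the opposite basis vectors recovers the coordinates of v. *)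
Lemma clifford_faithful v : (forall x, cl v x = 0) -> v = 0.
move=> H; apply/rowP => j; rewrite mxE; have [x x0] := spinor_neq0.
have := cliff_anti (ev (rev_ord j)) v x; rewrite !H cliff0r subr0 => /esym/eqP.
rewrite scaler_eq0 (negPf x0) orbF bform_ev rev_ordK mulrn_eq0 /=.
by move/eqP.
Qed.

(** An element of the Clifford group, given by its vector and its spin representation. Orthogonality
    of g is not imposed: it follows, see [qform_cpair]. *)
Definition cpair (g : 'M[C]_m) (h : 'End(Spn)) : Prop :=
 [/\ g \in unitmx, lker h == 0%VS,
   forall v x, h (cl v x) = cl (v *m g) (h x) &
   forall l, label_ok m l -> (h @: Delta R m l = Delta R m l)%VS].

Lemma cpairI (g : 'M[C]_m) (h : 'End(Spn)) : lker h == 0%VS ->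
 (forall v x, h (cl v x) = cl (v *m g) (h x)) ->
 (forall l x, label_ok m l -> x \in Delta R m l -> h x \in Delta R m l) -> cpair g h.
move=> h0 hc hD; split=> //.
 rewrite -row_free_unit; apply: inj_row_free => v vg.
 apply: clifford_faithful => x; have := hc v x; rewrite vg clifford0l => /eqP.
 by rewrite -memv_ker (eqP h0) memv0 => /eqP.
move=> l ok; apply/eqP; rewrite eqEdim limg_dim_eq ?(eqP h0) ?capv0 // leqnn andbT.
by apply/subvP => y /memv_imgP[x xD ->]; apply: hD.
Qed.

Lemma cpair1 : cpair 1%:M \1%VF.
apply: cpairI => [|v x|l x _ //]; last by rewrite lfunE.
 by apply/lker0P => x y; rewrite !lfunE.
by rewrite !lfunE mulmx1.
Qed.

Lemma cpair_comp g h g' h' : cpair g h -> cpair g' h' -> cpair (g *m g') (h' \o h)%VF.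
move=> [gu h0 hc hD] [gu' h0' hc' hD']; apply: cpairI => [|v x|l x ok xD].
- by apply/lker0P => x y; rewrite !lfunE /= => /(lker0P h0')/(lker0P h0).
- by rewrite !lfunE /= hc hc' mulmxA.
- by rewrite lfunE /= -(hD' l ok) memv_img // -(hD l ok) memv_img.
Qed.

Lemma cpair_inv g h : cpair g h -> cpair (invmx g) (h^-1)%VF.
move=> [gu h0 hc hD]; apply: cpairI => [|v x|l x ok].
- by apply/lker0P => x y /(congr1 h); rewrite !lker0_lfunVK.
- rewrite -[x in LHS](lker0_lfunVK h0) -[v in LHS](mulmxKV gu) -hc.
 by rewrite lker0_lfunK.
by rewrite -{1}(hD l ok) => /memv_imgP[y yD ->]; rewrite lker0_lfunK.
Qed.

Section Transport.
Variables (g : 'M[C]_m) (h : 'End(Spn)).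
Hypothesis gh : cpair g h.

(** A vector acts on spinors with square the scalar [qform], and h intertwines the actions of v and
    of its image under g. *)
Lemma qform_cpair v : qform (v *m g) = qform v.
have [gu h0 hc _] := gh; have [x x0] := spinor_neq0.
have hx0 : h x != 0 by rewrite -memv_ker (eqP h0) memv0.
apply/eqP; rewrite -subr_eq0 -(orbF (_ == 0)) -(negPf hx0) -scaler_eq0 scalerBl.
by rewrite -clK -!hc clK linearZ subrr.
Qed.

Lemma bform_cpair u v : bform (u *m g) (v *m g) = bform u v.
by rewrite /bform -mulmxDl !qform_cpair. Qed.

Lemma clifford_im_cpair (k : nat) (U : Gr R k m) l : label_ok m l ->
 clifford_im (val (gla g U)) (Delta R m l) = (h @: clifford_im (val U) (Delta R m l))%VS.
move=> ok; have [gu h0 hc hD] := gh; apply/eqP; rewrite eqEsubv; apply/andP; split.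
 apply: cim_sub => u y; rewrite mem_gl_act // => uU; rewrite -{1}(hD l ok).
 move=> /memv_imgP[x xD ->]; rewrite -[u](mulmxKV gu) -hc memv_img //.
 exact: clifford_im_gen.
apply/subvP => z /memv_imgP[y yU ->]; set X := clifford_im _ _.
rewrite memv_preim; move: y yU; apply/subvP.
apply: cim_sub => u y uU yD; rewrite -memv_preim hc clifford_im_gen //.
 by rewrite mem_glM.
by rewrite -(hD l ok) memv_img.
Qed.

Lemma OG_cpair (k : nat) (U : Gr R k m) : OG R k m U -> OG R k m (gla g U).
have [gu _ _ _] := gh; move=> UO u; rewrite mem_gl_act // => /UO.
by rewrite -(qform_cpair (u *m _)) mulmxKV.
Qed.

Lemma OGmax_cpair l (U : Gr R m./2 m) : label_ok m l -> OGmax R m l U -> OGmax R m l (gla g U).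
move=> ok [UO Ud]; split; first exact: OG_cpair.
rewrite clifford_im_cpair ?label_ok_opp // limg_dim_eq //.
by have [_ /eqP -> _ _] := gh; rewrite capv0.
Qed.

Lemma mem_im_cpair (k : nat) (U : Gr R k m) l x : label_ok m l ->
 x \in clifford_im (val U) (Delta R m l) ->
 h x \in clifford_im (val (gla g U)) (Delta R m l).
by move=> ok xU; rewrite clifford_im_cpair // memv_img. Qed.

Lemma vanish_cpair (k : nat) (U : Gr R k m) l x : label_ok m l ->
 vanish l x U -> vanish l (h x) (gla g U).
move=> ok; have ok' : label_ok m (opp_label l) by rewrite label_ok_opp.
have [gu h0 hc hD] := gh.
have hO (W : Gr R m./2 m) : vanish_O1 l x W -> vanish_O1 l (h x) (gla g W).
 exact: (@mem_im_cpair _ W (opp_label l) x ok').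
have hU (W : Gr R m./2 m) : vanish_U1 l x W -> vanish_U1 l (h x) (gla g W).
 move=> H v; rewrite -[v](mulmxKV gu) clE -hc -clE.
 exact: (@mem_im_cpair _ W l _ ok (H _)).
have hcok : vanish_coker l x (val U) -> vanish_coker l (h x) (val (gla g U)).
 exact: (@mem_im_cpair _ U (opp_label l) x ok').
rewrite /vanish; case: (odd m || _); first exact: hcok.
case: (k.+1 == _) => -[W].
 move=> [WO UW xW]; exists (gla g W); split; [exact: (OGmax_cpair ok)| |exact: hO].
 by apply/subvP => v; rewrite !mem_gl_act // => vU; exact: (subvP UW).
move=> WU H; exists (gla g W); first by rewrite !val_gl_act // WU.
case: H => -[WO xW]; [left|right].
 by split; [exact: (OGmax_cpair ok)|exact: hO].
by split; [exact: (OGmax_cpair ok')|exact: hU].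
Qed.
End Transport.

Definition Eop u w (c : C) : Spn -> Spn := fun x => x + c *: cl u (cl w x).

Lemma Eop_is_linear u w c : linear (Eop u w c).
move=> a x y; rewrite /Eop !cliffr; move: (cl u (cl w x)) (cl u (cl w y)) => x' y'.
by apply: spinorP => I; rewrite !cfE; ring.
Qed.
HB.instance Definition _ u w c := GRing.isLinear.Build C Spn Spn *:%R (Eop u w c) (Eop_is_linear u w c).

Definition Eden u w (c : C) : C := 1 + c * bform u w.
Definition bcol w : 'cV[C]_m := \col_j bform w (ev j).

Lemma mulmx_bcol v w : v *m bcol w = (bform w v)%:M.
apply/matrixP => i j; rewrite !ord1 !mxE eqxx mulr1n [in RHS](vec_ev v) bformC bform_suml.
by apply: eq_bigr => r _; rewrite bformZl mxE bformC.
Qed.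

(** Matrix of the conjugation of vectors by 1 + c u w. For isotropic u one has u w u w = b(u, w) u
    w, so the inverse of 1 + c u w is 1 - (c / Eden) u w, whence the denominators. *)
Definition Emx u w (c : C) : 'M[C]_m :=
 1%:M + c *: (bcol w *m u) - (c / Eden u w c) *: (bcol u *m w)
 - (c ^+ 2 * qform w / Eden u w c) *: (bcol u *m u).

Lemma mul_Emx u w c v : v *m Emx u w c =
 v + (c * bform w v) *: u - (c / Eden u w c * bform u v) *: w
 - (c ^+ 2 * qform w / Eden u w c * bform u v) *: u.
rewrite /Emx !mulmxBr !mulmxDr mulmx1 -!scalemxAr !mulmxA !mulmx_bcol !mul_scalar_mx.
by rewrite !scalerA.
Qed.

Lemma cpair_E u w c : qform u = 0 -> Eden u w c != 0 -> cpair (Emx u w c) (linfun (Eop u w c)).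
move=> qu D0; have uu x : cl u (cl u x) = 0 by rewrite clK qu scale0r.
have wuw x : cl w (cl u (cl w x)) = bform u w *: cl w x - qform w *: cl u x.
 by rewrite cliff_anti clK cliffZr bformC.
have uwuw x : cl u (cl w (cl u (cl w x))) = bform u w *: cl u (cl w x).
 by rewrite wuw !cliffr uu scaler0 subr0.
apply: cpairI => [|v x|l x ok xD].
- apply/lker0P => x y; rewrite !lfunE /= /Eop => /(congr1 (Eop u w (- (c / Eden u w c)))).
 have K z : Eop u w (- (c / Eden u w c)) (z + c *: cl u (cl w z)) = z.
  rewrite /Eop !cliffr uwuw; move: (cl u (cl w z)) => z'.
  by move: D0; rewrite /Eden => D0'; apply: spinorP => I; rewrite !cfE; field.
 by move=> h; exact: etrans (esym (K x)) (etrans h (K y)).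
- rewrite !lfunE /= mul_Emx /Eop !cliffordBl !cliffordD !cliffordZl !cliffr uu wuw scaler0.
 have -> : cl v (cl u (cl w x)) = cl u (cl w (cl v x))
   - bform w v *: cl u x + bform u v *: cl w x.
  rewrite (cliff_anti v u) (cliff_anti v w) !cliffr (bformC v u) (bformC v w).
  by rewrite opprB addrC.
 move: (cl v x) (cl w x) (cl u x) (cl u (cl w (cl v x))) => z4 z3 z2 z1.
 by move: D0; rewrite /Eden addr0 => D0'; apply: spinorP => I; rewrite !cfE; field.
- rewrite lfunE /= /Eop; apply: memvD => //; apply: memvZ; rewrite -[l]opp_labelK.
 by rewrite clifford_Delta ?label_ok_opp // clifford_Delta.
Qed.

Definition coord_fun (I : {set 'I_m./2}) (x : Spn) : C^o := cf x I.
Lemma coord_fun_is_linear I : linear (coord_fun I).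
by move=> a x y; rewrite /coord_fun !cfE. Qed.
HB.instance Definition _ I := GRing.isLinear.Build C Spn C^o *:%R (coord_fun I) (coord_fun_is_linear I).
Definition coord_at I : 'Hom(Spn, C^o) := linfun (coord_fun I).

Section CoordSubspace.
Variables (k : nat) (c : 'I_k -> 'I_m./2) (eps : 'I_k -> bool).
Hypothesis c_inj : injective c.

Definition bidx (i : 'I_k) : 'I_m := idx (c i) (eps i).

(** The monomials that no vector of the subspace produces: a wedge with index c i yields only sets
    containing c i, a contraction only sets avoiding it. *)
Definition forb (I : {set 'I_m./2}) : bool := [forall i, (c i \in I) != eps i].

Lemma mem_im_coord (U : {vspace V}) l x : label_ok m l ->
 (forall v, (v \in U) <-> exists a : 'I_k -> C, v = \sum_i a i *: ev (bidx i)) ->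
 (x \in clifford_im U (Delta R m (opp_label l))) <->
 (x \in Delta R m l /\ forall I, forb I -> cf x I = 0).
move=> ok UP; split=> [|[/mem_Delta xl xf]].
 move=> xU; split.
  move: x xU; apply/subvP/cim_sub => u y _ yD.
  by rewrite -[l]opp_labelK clifford_Delta ?label_ok_opp.
 move=> I fI; suff /subvP/(_ _ xU) : (clifford_im U (Delta R m (opp_label l)) <=
   lker (coord_at I))%VS.
  by rewrite memv_ker lfunE => /eqP.
 apply: cim_sub => u y /UP[a ->] _; rewrite memv_ker lfunE /= /coord_fun cl_suml cf_sum.
 apply/eqP/big1 => i _; rewrite cliffordZl cfZ cl_idx.
 by move/fintype.forallP/(_ i)/negPf: fI => ->; rewrite mulr0.
rewrite [x]spinor_sum; apply: memv_suml => I _.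
have [lI|/xl ->] := boolP (label_parity l #|I|); last by rewrite scale0r mem0v.
have [/xf ->|] := boolP (forb I); first by rewrite scale0r mem0v.
rewrite negb_forall => /fintype.existsP[i /negbNE iI]; apply: memvZ.
have -> : basis_spinor R I = ext_sign R (c i) I *: cl (ev (bidx i)) (basis_spinor R (toggle (c i) I)).
 apply: spinorP => J; rewrite cfZ cl_idx cf_basis cf_basis.
 rewrite (can2_eq (toggleK _) (toggleK _)) toggleK.
 case: eqP => [->|_]; last by rewrite mulr0 if_same mulr0.
 by rewrite iI mulr1 /ext_sign -exprD -signr_odd oddD addbb.
apply: memvZ; apply: clifford_im_gen.
 apply/UP; exists (fun j => (j == i)%:R); rewrite (bigD1 i) //= eqxx scale1r big1 ?addr0 // => j /negPf ->.
 by rewrite scale0r.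
apply/mem_Delta => J; rewrite cf_basis; case: eqP => [->|//].
by rewrite parity_toggle lI.
Qed.
End CoordSubspace.
End Clifford.

(** * Charts of the orthogonal Grassmannian by unipotent elements *)

Section Coord.
Variables (R : realType) (m : nat).
Notation C := (R[i]).
Notation V := 'rV[C]_m.
Notation Spn := (spinor R m).
Notation ev := (@ev R m).
Implicit Types (x y : Spn) (l : spin_label).

Section General.
Variables (k : nat) (c : 'I_k -> 'I_m./2) (eps : 'I_k -> bool).
Hypothesis c_inj : injective c.
Notation b := (bidx c eps).
Notation bf := [ffun i => b i].

Lemma EopE (u w : V) (c0 : C) x : Eop u w c0 x = x + c0 *: cl u (cl w x).
by []. Qed.

Lemma evE j a : ev j 0 a = (a == j)%:R.
by rewrite mxE eqxx. Qed.

Definition coord_mx : 'M[C]_(k, m) := \matrix_i ev (b i).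

Lemma b_inj : injective b.
by move=> i j /eqP; rewrite idx_eq => /andP[/eqP/c_inj]. Qed.

Lemma b_rev i j : (b i == rev_ord (b j)) = false.
rewrite rev_idx idx_eq; case: eqP => [/c_inj -> /=|//].
by case: (eps j).
Qed.

Lemma coord_mx_b i j : coord_mx i (b j) = (i == j)%:R.
by rewrite !mxE eqxx /= (inj_eq b_inj) eq_sym. Qed.

Lemma row_free_coord : row_free coord_mx.
apply/row_freeP; exists (\matrix_(a, j) (a == b j)%:R).
apply/matrixP => i j; rewrite !mxE (bigD1 (b j)) //= big1 ?addr0.
 by rewrite coord_mx_b mxE eqxx mulr1.
by move=> a ab; rewrite [X in _ * X]mxE (negPf ab) mulr0.
Qed.

Definition Ucoord : Gr R k m := mx_Gr row_free_coord.

Lemma in_Ucoord (v : V) : (v \in val Ucoord) <-> exists a : 'I_k -> C, v = \sum_i a i *: ev (b i).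
rewrite mem_mx_Gr; split=> [[x ->]|[a ->]].
 by exists (fun i => x 0 i); rewrite mulmx_sum_row; apply: eq_bigr => i _; rewrite rowK.
exists (\row_i a i); rewrite mulmx_sum_row; apply: eq_bigr => i _.
by rewrite mxE rowK.
Qed.

Lemma ev_Ucoord i : ev (b i) \in val Ucoord.
apply/in_Ucoord; exists (fun j => (j == i)%:R).
rewrite (bigD1 i) //= eqxx scale1r big1 ?addr0 // => j /negPf ->.
by rewrite scale0r.
Qed.

Lemma bform_b i j : bform (ev (b i)) (ev (b j)) = 0.
by rewrite bform_ev mxE eqxx /= [_ == b j]eq_sym b_rev mul0rn. Qed.

Lemma qform_b i : qform (ev (b i)) = 0 :> C.
by rewrite qform_ev idx_rev_neq. Qed.

Lemma OG_Ucoord : OG R k m Ucoord.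
move=> v /in_Ucoord[a ->].
have bz w j : (exists s : seq 'I_k, w = \sum_(i <- s) a i *: ev (b i)) -> bform w (ev (b j)) = 0.
 by move=> [s ->]; rewrite bform_suml big1 // => i _; rewrite bformZl bform_b mulr0.
elim: (index_enum _) => [|i s IH]; first by rewrite big_nil -(scale0r (0 : V)) qformZ expr0n mul0r.
rewrite big_cons qformD qformZ qform_b IH mulr0 !add0r bformZl bformC bz ?mulr0 //.
by exists s.
Qed.

Lemma minor_Ucoord : minor (bmx Ucoord) bf != 0.
have [|c0 c0P E] := @pluckerB R k m Ucoord coord_mx _ row_free_coord.
 by move=> i; rewrite rowK ev_Ucoord.
have : minor coord_mx bf = 1.
 rewrite /minor -[RHS](det1 C k); congr (\det _); apply/matrixP => i j.
 by rewrite mxE ffunE coord_mx_b mxE.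
by rewrite E => E1; apply: contra_eq_neq E1 => ->; rewrite mulr0 eq_sym oner_neq0.
Qed.

Lemma chart_mx_uniq (W : Gr R k m) (M : 'M[C]_(k, m)) : minor (bmx W) bf != 0 ->
 (forall i, row i M \in val W) -> (forall i j, M i (b j) = (i == j)%:R) -> cmx bf W = M.
move=> pW MW Mb; have [A AE] := basis_change MW.
have bu : bsq bf W \in unitmx by rewrite unitmxE unitfE.
have EA : M = (A *m bsq bf W) *m cmx bf W by rewrite cmxE -mulmxA mulKVmx.
have cb i j : cmx bf W i (b j) = (i == j)%:R by rewrite -(chart_mx_b pW i j) ffunE.
move: (A *m bsq bf W) EA => B EA; suff B1 : B = 1%:M by rewrite EA B1 mul1mx.
apply/matrixP => i j; rewrite [RHS]mxE -Mb EA mxE (bigD1 j) //= cb eqxx mulr1 big1 ?addr0 // => r rj.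
by rewrite cb (negPf rj) mulr0.
Qed.

(** The free entries of row i of an isotropic matrix normalized at the columns b: orthogonality of
    the rows i and i' with i' <= i determines the entry of row i at the column opposite to b i'. *)
Definition allowed (i : 'I_k) (j : 'I_m) : bool :=
 [forall i', j != b i'] && [forall i' : 'I_k, (i' <= i)%N ==> (j != rev_ord (b i'))].

Definition cvec (W : Gr R k m) (i : 'I_k) : V :=
 - \sum_(j | allowed i j) cmx bf W i j *: ev j.

Definition bdual i : V := ev (rev_ord (b i)).

(** The inverse, on spinors, of the element [chart_g] that carries the centre of the chart to the
    space with coordinates xs; it pulls a section back to the centre. *)
Definition chart_op (xs : 'I_k -> V) (s : Spn) : Spn :=
 foldl (fun s i => Eop (bdual i) (xs i) (-1) s) s (enum 'I_k).

Lemma qform_bdual i : qform (bdual i) = 0.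
by rewrite qform_ev rev_ordK eq_sym idx_rev_neq. Qed.

Lemma bform_bdual i (v : V) : bform (bdual i) v = v 0 (b i).
by rewrite bform_ev rev_ordK eq_sym idx_rev_neq addn0 mulr1n. Qed.

Section Chart.
Variable xs : 'I_k -> V.
Hypothesis xs_allowed : forall i j, ~~ allowed i j -> xs i 0 j = 0.

Lemma xs_b i j : xs i 0 (b j) = 0.
apply: xs_allowed; rewrite negb_and; apply/orP; left.
by apply/fintype.forallPn; exists j; rewrite eqxx.
Qed.

Lemma xs_rev (i j : 'I_k) : (j <= i)%N -> xs i 0 (rev_ord (b j)) = 0.
move=> ji; apply: xs_allowed; rewrite negb_and; apply/orP; right.
by apply/fintype.forallPn; exists j; rewrite ji eqxx.
Qed.

Definition gmx i : 'M[C]_m := Emx (bdual i) (xs i) 1.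

Lemma Eden_xs i c0 : Eden (bdual i) (xs i) c0 = 1.
by rewrite /Eden bform_bdual xs_b mulr0 addr0. Qed.

Lemma cpair_gmx i : cpair (gmx i) (linfun (Eop (bdual i) (xs i) 1)).
by apply: cpair_E; rewrite ?qform_bdual // Eden_xs oner_neq0. Qed.

Lemma mul_gmx i v : v *m gmx i =
 v + bform (xs i) v *: bdual i - v 0 (b i) *: xs i - (qform (xs i) * v 0 (b i)) *: bdual i.
by rewrite mul_Emx Eden_xs bform_bdual mul1r expr1n divr1 !mul1r divr1.
Qed.

Lemma EopK i s : Eop (bdual i) (xs i) 1 (Eop (bdual i) (xs i) (-1) s) = s.
rewrite !EopE !cliffr scaleN1r scale1r.
have -> : cl (xs i) (cl (bdual i) (cl (xs i) s)) = - (qform (xs i) *: cl (bdual i) s).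
 by rewrite cliff_anti clK !cliffr bformC bform_bdual xs_b scale0r add0r.
have uu y : cl (bdual i) (cl (bdual i) y) = 0 by rewrite clK qform_bdual scale0r.
rewrite !cliffr uu scaler0 oppr0 scaler0 addr0; exact: subrK.
Qed.

Definition chart_g (s : seq 'I_k) : 'M[C]_m := foldr (fun i G => G *m gmx i) 1%:M s.

Lemma cpair_chart (s : seq 'I_k) : exists H, cpair (chart_g s) H /\
 forall y, H (foldl (fun s i => Eop (bdual i) (xs i) (-1) s) y s) = y.
elim: s => [|i s [H [gH HK]]] /=.
 by exists \1%VF; split=> [|y]; [exact: cpair1 | rewrite lfunE].
exists (linfun (Eop (bdual i) (xs i) 1) \o H)%VF; split.
 exact: cpair_comp gH (cpair_gmx i).
by move=> y; rewrite !lfunE /= HK lfunE /= EopK.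
Qed.

(** The factors act from the last index down. Those of index above i fix the basis vector b i, the
    factor i subtracts xs i up to a multiple of the vector opposite to b i, and the remaining ones
    only add multiples of vectors opposite to b j with j < i. *)
Lemma chart_g_coord (s : seq 'I_k) i : sorted ltn (map val s) ->
 let r := ev (b i) *m chart_g s in
 if i \in s then forall a : 'I_m, (forall j : 'I_k, (j <= i)%N -> a != rev_ord (b j)) ->
   r 0 a = (ev (b i) - xs i) 0 a
 else (forall j, j \in s -> (i < j)%N) -> r = ev (b i).
elim: s => [|j s IH] /=; first by rewrite mulmx1.
move=> ps; have {}IH := IH (path_sorted ps); have mins := order_path_min ltn_trans ps.
rewrite inE mulmxA; have [ij|ij] /= := eqVneq i j.
 have ns : i \in s = false.
  by apply/negP => si; have /allP/(_ _ (map_f val si)) := mins; rewrite ij ltnn.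
 rewrite ns in IH; rewrite IH => [|j' j's]; last first.
  by have /allP/(_ _ (map_f val j's)) := mins; rewrite ij.
 move=> a ha; have /negPf aj : a != rev_ord (b j) by apply: ha; rewrite ij.
 rewrite mul_gmx ij.
 by rewrite /bdual !mxE !eqxx aj /= !mulr0 addr0 subr0 mul1r.
case: ifP IH => si IH.
 move=> a ha; rewrite mul_gmx.
 have ji : (j < i)%N by have /allP/(_ _ (map_f val si)) := mins.
 have rj : (ev (b i) *m chart_g s) 0 (b j) = 0.
  rewrite IH => [|j' _]; last by rewrite b_rev.
  by rewrite !mxE xs_b eqxx (inj_eq b_inj) eq_sym (negPf ij) subr0.
 rewrite rj mulr0 !scale0r !subr0 mxE IH // [X in _ + X]mxE /bdual evE.
 have /negPf -> : a != rev_ord (b j) by apply: ha; exact: ltnW.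
 by rewrite mulr0 addr0.
move=> hs; have ij' : (i < j)%N by apply: hs; rewrite mem_head.
rewrite IH => [|j' j's]; last by apply: hs; rewrite inE j's orbT.
rewrite mul_gmx [ev _ 0 _]mxE eqxx (inj_eq b_inj) eq_sym (negPf ij) mulr0 !scale0r !subr0.
by rewrite bformC bform_ev xs_rev ?(ltnW ij') // mul0rn scale0r addr0.
Qed.
End Chart.

Lemma chart_vecP W i j : ~~ allowed i j -> cvec W i 0 j = 0.
move=> nij; rewrite /cvec mxE summxE big1 ?oppr0 // => j' aij'.
rewrite mxE evE; case: eqP => [E|]; last by rewrite mulr0.
by rewrite E aij' in nij.
Qed.

Lemma chart_vecE W i j : allowed i j -> cvec W i 0 j = - cmx bf W i j.
move=> aij; rewrite /cvec mxE summxE (bigD1 j) //= mxE evE eqxx mulr1 big1 ?addr0 //.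
by move=> j' /andP[_ /negPf j'j]; rewrite mxE evE eq_sym j'j mulr0.
Qed.

(** Both sides are isotropic frames with the same free entries. Their difference d is supported, in
    row i, at the columns opposite to b j with j <= i, and orthogonality of the rows makes these
    entries vanish one by one; the diagonal ones occur twice, whence a division by two. *)
Lemma chart_mx_OG W : OG R k m W -> minor (bmx W) bf != 0 ->
 forall i, row i (cmx bf W) = ev (b i) *m chart_g (cvec W) (enum 'I_k).
move=> WO pW; set G := chart_g _ _; set M := cmx bf W.
have [H [gH _]] := cpair_chart (@chart_vecP W) (enum 'I_k).
have Mb i j : M i (b j) = (i == j)%:R by rewrite -(chart_mx_b pW i j) ffunE.
pose r i := ev (b i) *m G; pose d i := r i - row i M.
have so : sorted ltn (map val (enum 'I_k)) by rewrite val_enum_ord iota_ltn_sorted.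
have rE (i : 'I_k) (a : 'I_m) : (forall j : 'I_k, (j <= i)%N -> a != rev_ord (b j)) -> r i 0 a = (ev (b i) - cvec W i) 0 a.
 move=> ha; have := @chart_g_coord _ (@chart_vecP W) (enum 'I_k) i so.
 by rewrite mem_enum inE => /(_ a ha).
have d0 (i : 'I_k) (a : 'I_m) : (forall j : 'I_k, (j <= i)%N -> a != rev_ord (b j)) -> d i 0 a = 0.
 move=> ha; rewrite /d mxE rE // mxE evE [(- row i M) 0 a]mxE [row i M 0 a]mxE [(- cvec W i) 0 a]mxE; case aij: (allowed i a).
  rewrite chart_vecE // opprK; have /negPf -> : a != b i by move/andP: aij => [/forallP/(_ i)].
  by rewrite add0r subrr.
 rewrite chart_vecP ?aij // subr0; move/negbT: aij; rewrite negb_and => /orP[].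
  by move=> /fintype.forallPn[j]; rewrite negbK => /eqP ->; rewrite Mb (inj_eq b_inj) eq_sym subrr.
 by move=> /fintype.forallPn[j]; rewrite negb_imply negbK => /andP[/ha/negPf ->].
have bd (i : 'I_k) (v : V) : bform v (d i) = \sum_(j : 'I_k | (j <= i)%N) d i 0 (rev_ord (b j)) * v 0 (b j).
 rewrite [d i in LHS]vec_ev bformC bform_suml.
 rewrite (bigID (fun a => [exists j : 'I_k, (j <= i)%N && (a == rev_ord (b j))])) /= addrC big1 ?add0r.
  rewrite (reindex_onto (fun j => rev_ord (b j)) (fun a => odflt i [pick j : 'I_k | (j <= i)%N && (a == rev_ord (b j))])) /=.
   apply: eq_big => [j|j _]; last by rewrite bformZl -/(bdual j) bform_bdual.
   case: pickP => [j' /andP[ji /eqP E]|no] /=.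
    have jj : j' = j by apply/b_inj/rev_ord_inj/esym.
    by rewrite jj eqxx andbT; apply/idP/idP => [_|ji']; [rewrite -jj | apply/fintype.existsP; exists j; rewrite ji' eqxx].
   have := no j; rewrite eqxx andbT => ->; apply/negP => /andP[/fintype.existsP[j'']].
   by rewrite no.
  move=> a /fintype.existsP[j /andP[ji /eqP E]]; case: pickP => [j' /andP[_ /eqP ->] //|/(_ j)].
  by rewrite ji E eqxx.
 move=> a /fintype.existsPn ha; rewrite bformZl d0 ?mul0r // => j ji.
 by have := ha j; rewrite ji.
have dd i j : bform (d i) (d j) = 0.
 rewrite bd big1 // => j' _; rewrite (d0 i) ?mulr0 // => i' _.
 by rewrite b_rev.
have WOb u v : u \in val W -> v \in val W -> bform u v = 0.
 by move=> uW vW; rewrite /bform !WO ?memvD // !subr0.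
have rr i j : bform (r i) (r j) = 0 by rewrite (bform_cpair gH) bform_b.
have rM i : r i = row i M + d i by rewrite /d addrC subrK.
have rdef i : r i = ev (b i) *m G by [].
clearbody d r.
have key i j : bform (row i M) (d j) + bform (row j M) (d i) = 0.
 have := rr i j; rewrite !rM !bformDl !bformDr dd addr0 (bformC (d i)).
 by rewrite (WOb _ _ (cmx_mem bf W i) (cmx_mem bf W j)) add0r.
have rowMd (i j : 'I_k) : bform (row i M) (d j) = if (i <= j)%N then d j 0 (rev_ord (b i)) else 0.
 rewrite bd; case: ifP => ij.
  rewrite (bigD1 i) //= mxE Mb eqxx mulr1 big1 ?addr0 // => i' /andP[_ i'i].
  by rewrite mxE Mb eq_sym (negPf i'i) mulr0.
 rewrite big1 // => i' i'j; rewrite mxE Mb; case: eqP => [E|]; last by rewrite mulr0.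
 by rewrite E i'j in ij.
have dz (i j : 'I_k) : (j <= i)%N -> d i 0 (rev_ord (b j)) = 0.
 move=> ji; have := key j i; rewrite !rowMd ji; case: (ltngtP i j) => [|ij|/val_inj ->].
 - by rewrite ltnNge ji.
 - by rewrite addr0.
 - by move/eqP; rewrite -mulr2n mulrn_eq0 => /eqP.
move=> i; rewrite -rdef rM; suff -> : d i = 0 by rewrite addr0.
apply/rowP => a; rewrite [RHS]mxE.
case: (pickP (fun j : 'I_k => (j <= i)%N && (a == rev_ord (b j)))) => [j /andP[ji /eqP ->]|no].
 exact: dz.
by apply: d0 => j ji; have := no j; rewrite ji /= => ->.
Qed.

Theorem chart_gl W : OG R k m W -> minor (bmx W) bf != 0 ->
 gla (chart_g (cvec W) (enum 'I_k)) Ucoord = W.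
move=> WO pW; have [H [[gu _ _ _] _]] := cpair_chart (@chart_vecP W) (enum 'I_k).
set G := chart_g _ _ in gu *.
have sub v : v \in val Ucoord -> v *m G \in val W.
 move=> /in_Ucoord[a ->]; rewrite mulmx_suml; apply: memv_suml => i _.
 by rewrite -scalemxAl memvZ // -chart_mx_OG // cmx_mem.
have sv : (val (gla G Ucoord) <= val W)%VS.
 by apply/subvP => v; rewrite mem_gl_act // => /sub; rewrite mulmxKV.
by apply/val_inj/eqP; rewrite eqEdim sv !dimGr leqnn.
Qed.

Lemma chart_vec_Ucoord i : cvec Ucoord i = 0.
have E : cmx bf Ucoord = coord_mx.
 apply: chart_mx_uniq; [exact: minor_Ucoord| |exact: coord_mx_b].
 by move=> j; rewrite rowK ev_Ucoord.
apply/rowP => j; rewrite [RHS]mxE; case aij: (allowed i j).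
 rewrite chart_vecE // E !mxE; have /negPf -> : j != b i by move/andP: aij => [/forallP/(_ i)].
 by rewrite andbF oppr0.
by rewrite chart_vecP ?aij.
Qed.

Lemma chart_op0 s : chart_op (fun=> 0) s = s.
rewrite /chart_op; elim: (enum _) s => //= i t IH s.
by rewrite IH EopE clifford0l ?cliff0r ?scaler0 ?addr0.
Qed.

Lemma rgl_cl (v : Gr R k m -> V) (s : Gr R k m -> Spn) I :
 (forall j, rgl bf (fun W => v W 0 j)) -> (forall J, rgl bf (fun W => cf (s W) J)) ->
 rgl bf (fun W => cf (cl (v W) (s W)) I).
move=> hv hs; apply: rgl_ext (fun W _ => cf_cl _ _ _) _; apply: rgl_add.
 apply: rgl_sum => i; case: (i \in I); apply: rgl_mul => //; apply: rgl_mul => //; exact: rgl_const.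
apply: rgl_sum => i; apply: rgl_mul => //; apply: rgl_mul => //; exact: rgl_const.
Qed.

Lemma rgl_chart_op (s : Spn) I : rgl bf (fun W => cf (chart_op (cvec W) s) I).
rewrite /chart_op; suff H (t : seq 'I_k) (s0 : Gr R k m -> Spn) : (forall J, rgl bf (fun W => cf (s0 W) J)) ->
  rgl bf (fun W => cf (foldl (fun s i => Eop (bdual i) (cvec W i) (-1) s) (s0 W) t) I).
 by apply: (H _ (fun=> s)) => J; apply: rgl_const.
elim: t s0 => [|i t IH] s0 hs //=.
apply: (IH (fun W => Eop (bdual i) (cvec W i) (-1) (s0 W))) => J.
apply: (@rgl_ext R k m bf _ (fun W => cf (s0 W) J + (-1) * cf (cl (bdual i) (cl (cvec W i) (s0 W))) J)).
 by move=> U _; rewrite EopE cfD cfZ.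
apply: rgl_add => //; apply: rgl_mul; first exact: rgl_const.
apply: rgl_cl => [j|J']; first exact: rgl_const.
apply: rgl_cl => // j; case aij: (allowed i j).
 apply: rgl_ext (fun W _ => chart_vecE W aij) _.
 apply: (@rgl_ext R k m bf _ (fun W => (-1) * cmx bf W i j)) => [W _|]; first by rewrite mulN1r.
 by apply: rgl_mul; [exact: rgl_const|exact: rgl_chart_mx].
by apply: rgl_ext (rgl_const _ 0) => W _; rewrite chart_vecP ?aij.
Qed.
End General.
End Coord.

(** * Vanishing of sections at coordinate subspaces *)

Section VanishCoord.
Variables (R : realType) (m : nat).
Notation C := (R[i]).
Notation Spn := (spinor R m).
Implicit Types (x : Spn) (l : spin_label) (I : {set 'I_m./2}).

(** With this choice of signs, I is the only monomial outside the Clifford image, so the parity of I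
    tells the family of the subspace. *)
Definition Wmax I : Gr R m./2 m := @Ucoord R m m./2 id (fun j => j \notin I) (fun _ _ => id).

Lemma forb_Wmax I J : forb id (fun j => j \notin I) J = (J == I).
apply/fintype.forallP/eqP => [H|-> j]; last by case: (j \in I).
by apply/setP => j; have := H j; case: (j \in J); case: (j \in I).
Qed.

Lemma mem_im_Wmax l x I : label_ok m l ->
 (x \in clifford_im (val (Wmax I)) (Delta R m (opp_label l))) <-> (x \in Delta R m l /\ cf x I = 0).
move=> ok; split=> [|[xl xI]].
 move=> /(mem_im_coord x ok (@in_Ucoord R m m./2 id (fun j => j \notin I) (fun _ _ => id)))[xl H].
 by split=> //; apply: H; rewrite forb_Wmax.
apply/(mem_im_coord x ok (@in_Ucoord R m m./2 id (fun j => j \notin I) (fun _ _ => id))).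
by split=> // J; rewrite forb_Wmax => /eqP ->.
Qed.

Lemma basis_Delta l I : label_parity l #|I| -> basis_spinor R I \in Delta R m l.
by move=> lI; apply/mem_Delta => J; rewrite cf_basis; case: eqP => // ->; rewrite lI. Qed.

Lemma OGmax_Wmax l I : label_ok m l -> OGmax R m l (Wmax I) <-> label_parity l #|I|.
move=> ok; set D := Delta R m l; set X := clifford_im (val (Wmax I)) (Delta R m (opp_label l)).
have XP x : (x \in X) <-> (x \in D /\ cf x I = 0) by exact: mem_im_Wmax.
have XD : (X <= D)%VS by apply/subvP => x /XP[].
split=> [[_ dimE]|lI].
 apply: contraT => nlI; suff : (D <= X)%VS by move/dimvS; rewrite -/D -/X in dimE *; rewrite dimE ltnn.
 by apply/subvP => x xD; apply/XP; split=> //; move/mem_Delta: xD; apply.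
split; first exact: OG_Ucoord.
rewrite -/D -/X; have DE : D = (X + <[basis_spinor R I]>)%VS.
 apply/eqP; rewrite eqEsubv subv_add XD -memvE (basis_Delta lI) !andbT.
 apply/subvP => x xD; rewrite -[x](subrK (cf x I *: basis_spinor R I)).
 apply: memv_add; last by rewrite memvZ ?memv_line.
 apply/XP; split; first by rewrite memvB // memvZ ?basis_Delta.
 by rewrite cfD cfN cfZ cf_basis eqxx mulr1 subrr.
rewrite DE dimv_disjoint_sum.
 rewrite dim_vline; have -> : basis_spinor R I != 0; last by rewrite addn1.
 by apply/eqP => /(congr1 (fun y => cf y I)); rewrite cf_basis eqxx cf0 => /eqP; rewrite oner_eq0.
apply/eqP; rewrite -subv0; apply/subvP => x; rewrite memv_cap memv0 => /andP[/XP[_ xI] /vlineP[a E]].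
by move: xI; rewrite E cfZ cf_basis eqxx mulr1 => ->; rewrite scale0r.
Qed.

Section General.
Variables (k : nat) (c : 'I_k -> 'I_m./2) (eps : 'I_k -> bool).
Hypothesis c_inj : injective c.
Notation U := (Ucoord R eps c_inj).

Lemma vanish_coord_coker l x : odd m || (k.+1 < m./2)%N -> label_ok m l -> x \in Delta R m l ->
 vanish l x U <-> forall I, forb c eps I -> cf x I = 0.
move=> km ok xl; rewrite /vanish km /vanish_coker.
split=> [/(mem_im_coord x ok (@in_Ucoord R m k c eps c_inj))[]//|H].
by apply/(mem_im_coord x ok (@in_Ucoord R m k c eps c_inj)).
Qed.

(** A single index is not of the form c i, so two forbidden monomials differ at most there, and
    toggling an index changes the parity. *)
Lemma forb_parity_uniq l I J : k.+1 = m./2 -> l <> Sfull -> forb c eps I -> forb c eps J ->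
 label_parity l #|I| -> label_parity l #|J| -> I = J.
move=> kn lS fI fJ pI pJ; apply/setP => j; apply/eqP; apply: contraT => jIJ.
have agree i : (c i \in I) = (c i \in J).
 move/fintype.forallP/(_ i): fI; move/fintype.forallP/(_ i): fJ.
 by case: (c i \in I); case: (c i \in J); case: (eps i).
have cov j' : j' != j -> exists i, j' = c i.
 move=> j'j; apply: contrapT => H.
 have : (#|[set c i | i : 'I_k]| <= #|[set~ j] :\ j'|)%N.
  apply: subset_leq_card; apply/fintype.subsetP => y /imsetP[i _ ->]; rewrite !inE.
  apply/andP; split; first by apply/eqP => E; apply: H; exists i.
  by apply/eqP => E; move: jIJ; rewrite -E agree eqxx.
 rewrite card_imset // card_ord; have := cardsC1 j; rewrite card_ord (cardsD1 j').
 rewrite !inE j'j /=; set N := #|_|; move: kn; clear; lia.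
have JE : J = toggle j I.
 apply/setP => j'; rewrite in_toggle; have [->|/cov[i ->]] /= := eqVneq j' j.
  by move: jIJ; case: (j \in I); case: (j \in J).
 by rewrite agree.
by move: pJ; rewrite JE -[l]opp_labelK parity_toggle; move: pI lS; case: (l) => //= [/negPf ->|->].
Qed.

(** The Clifford image of U in [Delta l] is already a hyperplane. The image of any W of the family l
    that contains U is a hyperplane containing it, so the two agree, and vanishing can be read on
    the coordinate space [Wmax I0]. *)
Lemma vanish_coord_n1 l x : ~~ odd m -> k.+1 = m./2 -> l <> Sfull -> x \in Delta R m l ->
 vanish l x U <-> forall I, forb c eps I -> cf x I = 0.
move=> mo kn lS xl; have ok : label_ok m l by case: (l).
have XP y := mem_im_coord y ok (@in_Ucoord R m k c eps c_inj).
rewrite /vanish (negPf mo) /= kn ltnn eqxx.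
have [j0 j0P] : exists j0, forall i, c i != j0.
 apply: contrapT => H; have : (#|'I_m./2| <= #|[set c i | i : 'I_k]|)%N.
  rewrite -cardsT; apply: subset_leq_card; apply/fintype.subsetP => j _.
  apply/imsetP; apply: contrapT => H'; apply: H; exists j => i.
  by apply/eqP => E; apply: H'; exists i.
 by rewrite card_imset // !card_ord -kn ltnn.
(* The two forbidden monomials differ by j0; the one with the parity of l is chosen. *)
have [I0 fI0 pI0] : exists2 I0, forb c eps I0 & label_parity l #|I0|.
 pose I0 : {set 'I_m./2} := [set j | [exists i, (c i == j) && ~~ eps i]]%SET.
 have f0 : forb c eps I0.
  apply/fintype.forallP => i; rewrite inE; case e: (eps i) => /=.
   by apply/eqP => /fintype.existsP[i' /andP[/eqP/c_inj ->]]; rewrite e.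
  by rewrite eqbF_neg negbK; apply/fintype.existsP; exists i; rewrite eqxx e.
 have [p0|p0] := boolP (label_parity l #|I0|); first by exists I0.
 exists (toggle j0 I0).
  apply/fintype.forallP => i; rewrite in_toggle (negPf (j0P i)).
  by move/fintype.forallP/(_ i): f0.
 by rewrite -[l]opp_labelK parity_toggle; move: p0 lS; case: (l) => //= /negbNE.
have sub : (val U <= val (Wmax I0))%VS.
 apply/subvP => v /in_Ucoord[a ->]; apply: memv_suml => i _; apply: memvZ.
 have -> : bidx c eps i = bidx id (fun j => j \notin I0) (c i).
  by rewrite /bidx; congr idx; move/fintype.forallP/(_ i): fI0; case: (c i \in I0); case: (eps i).
 exact: ev_Ucoord.
split=> [[W [Wm UW xW]] I fI|H].
 have [pI|pI] := boolP (label_parity l #|I|); last by move/mem_Delta: xl; apply.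
 set X := clifford_im (val W) (Delta R m (opp_label l)).
 have UX : (clifford_im (val U) (Delta R m (opp_label l)) <= X)%VS.
  by apply: cim_sub => u y uU yD; apply: clifford_im_gen => //; apply: (subvP UW).
 have XD : (X <= Delta R m l)%VS.
  apply: cim_sub => u y _ yD.
  by rewrite -[l]opp_labelK clifford_Delta ?label_ok_opp.
 have [_ dimW] := Wm.
 have -> : I = I0 by apply: (forb_parity_uniq kn lS).
 apply/eqP; apply: contraT => x0; suff : (Delta R m l <= X)%VS.
  by move/dimvS; rewrite dimW ltnn.
 have inX z : z \in Delta R m l -> cf z I0 = 0 -> z \in X.
  move=> zD z0; apply: (subvP UX); apply/XP; split=> // J fJ.
  have [pJ|pJ] := boolP (label_parity l #|J|); last by move/mem_Delta: zD; apply.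
  by rewrite -(forb_parity_uniq kn lS fI0 fJ).
 apply/subvP => y yD; rewrite -[y](subrK ((cf y I0 / cf x I0) *: x)).
 apply: memvD; last by apply: memvZ.
 by apply: inX; rewrite ?memvB ?memvZ // cfD cfN cfZ divfK // subrr.
exists (Wmax I0); split=> //; first by apply/OGmax_Wmax.
by rewrite /vanish_O1; apply/mem_im_Wmax => //; split=> //; apply: H.
Qed.
End General.

Lemma vanish_max l x I : ~~ odd m -> l <> Sfull -> x \in Delta R m l -> label_parity l #|I| ->
 vanish l x (Wmax I) <-> cf x I = 0.
move=> mo lS xl pI; have ok : label_ok m l by case: (l).
rewrite /vanish (negPf mo) orFb ltnNge leqnSn [~~ true]/negb gtn_eqF //.
split=> [[W /val_inj -> [[_ /mem_im_Wmax[]//]|[+ _]]]|x0].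
 move/OGmax_Wmax; rewrite label_ok_opp => /(_ ok).
 by move: pI lS; case: (l) => //= [/negPf ->|->].
exists (Wmax I) => //; left; split; first by apply/OGmax_Wmax.
by apply/mem_im_Wmax.
Qed.

(** On the opposite family the section pairs v.delta with the monomial I, so it sees the
    coefficients of delta at the neighbours of I. *)
Lemma vanish_max_opp l x I : ~~ odd m -> l <> Sfull -> x \in Delta R m l -> ~~ label_parity l #|I| ->
 vanish l x (Wmax I) <-> forall i, cf x (toggle i I) = 0.
move=> mo lS xl pI; have ok : label_ok m l by case: (l).
have ok' : label_ok m (opp_label l) by rewrite label_ok_opp.
have pI' : label_parity (opp_label l) #|I| by move: pI lS; case: (l) => //= /negbNE.
rewrite /vanish (negPf mo) orFb ltnNge leqnSn [~~ true]/negb gtn_eqF //.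
have UP : vanish_U1 l x (Wmax I) <-> forall i, cf x (toggle i I) = 0.
 have im y : (y \in clifford_im (val (Wmax I)) (Delta R m l)) <-> (y \in Delta R m (opp_label l) /\ cf y I = 0).
  by rewrite -{1}[l]opp_labelK; apply: mem_im_Wmax.
 split=> [H i|H v].
  have /im[_] := H (ev R (idx i (i \in I))); rewrite clE cl_idx eqxx => /eqP.
  rewrite mulf_eq0 /ext_sign signr_eq0 => /eqP //.
 apply/im; rewrite clE; split; first exact: clifford_Delta.
 rewrite (vec_ev v) cl_suml cf_sum big1 // => j _; rewrite cliffordZl cfZ.
 have [[i [b ->]]|jj] := idx_cases j; first by rewrite cl_idx H mulr0 if_same mulr0.
 by move: mo; have -> : odd m by move/eqP/(congr1 val): jj => /=; have := ltn_ord j; lia.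
split=> [[W /val_inj -> [[+ _]|[_ /UP]//]]|x0].
 by move/OGmax_Wmax => /(_ ok); rewrite (negPf pI).
exists (Wmax I) => //; right; split; first by apply/OGmax_Wmax.
exact/UP.
Qed.

Section VanishZ.
Variables (k : nat) (W : Gr R k m).
Lemma vanishZ l x (a : C) : vanish l x W -> vanish l (a *: x) W.
rewrite /vanish; case: (odd m || _) => [xW|]; first exact: memvZ.
case: (k.+1 == _) => [[W' [W'm WW' xW]]|[W' WW' [[W'm xW]|[W'm xW]]]].
- by exists W'; split=> //; apply: memvZ.
- by exists W' => //; left; split=> //; apply: memvZ.
- exists W'; first exact: WW'.
 right; split; first exact: W'm.
 by move=> v; rewrite clE cliffZr -clE; apply: memvZ; exact: xW.
Qed.
End VanishZ.
End VanishCoord.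

(** * Polynomial functions and group words acting on sections *)

Section PolyFun.
Variable F : numFieldType.
Variable n : nat.

Definition mpf (f : ('I_n -> F) -> F) : Prop := exists p : {mpoly F[n]}, forall x, f x = p.@[x].

Lemma mpfE f g : (forall x, f x = g x) -> mpf g -> mpf f.
by move=> fg [p pE]; exists p => x; rewrite fg. Qed.
Lemma mpfC c : mpf (fun=> c). by exists c%:MP => x; rewrite mevalC. Qed.
Lemma mpfX i : mpf (fun x => x i). by exists 'X_i => x; rewrite mevalXU. Qed.
Lemma mpfD f g : mpf f -> mpf g -> mpf (fun x => f x + g x).
by move=> [p pE] [q qE]; exists (p + q) => x; rewrite mevalD pE qE. Qed.
Lemma mpfM f g : mpf f -> mpf g -> mpf (fun x => f x * g x).
by move=> [p pE] [q qE]; exists (p * q) => x; rewrite mevalM pE qE. Qed.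
Lemma mpf_sum (I : Type) (s : seq I) (P : pred I) (f : I -> ('I_n -> F) -> F) :
 (forall i, mpf (f i)) -> mpf (fun x => \sum_(i <- s | P i) f i x).
move=> h; elim: s => [|i s IH].
 by apply: mpfE (mpfC 0) => x; rewrite big_nil.
case Pi: (P i); last by apply: mpfE IH => x; rewrite big_cons Pi.
by apply: mpfE (mpfD (h i) IH) => x; rewrite big_cons Pi.
Qed.
Lemma mpf_prod (I : Type) (s : seq I) (f : I -> ('I_n -> F) -> F) :
 (forall i, mpf (f i)) -> mpf (fun x => \prod_(i <- s) f i x).
move=> h; elim: s => [|i s IH].
 by apply: mpfE (mpfC 1) => x; rewrite big_nil.
by apply: mpfE (mpfM (h i) IH) => x; rewrite big_cons.
Qed.
Lemma mpf_horner (p : {poly F}) f : mpf f -> mpf (fun x => p.[f x]).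
move=> hf; elim/poly_ind: p => [|p c IH].
 by apply: mpfE (mpfC 0) => x; rewrite horner0.
apply: mpfE (mpfD (mpfM IH hf) (mpfC c)) => x.
by rewrite hornerD hornerM hornerX hornerC.
Qed.
Lemma mpfme (r : nat) (q : {mpoly F[r]}) (f : 'I_r -> ('I_n -> F) -> F) :
 (forall i, mpf (f i)) -> mpf (fun x => q.@[fun i => f i x]).
move=> /fin_all_exists[p pE]; exists (q \mPo [tuple p i | i < r]) => x.
by rewrite comp_mpoly_meval; apply: meval_eq => i; rewrite tnth_mktuple pE.
Qed.
End PolyFun.

(** [EV a c] stands for the element 1 + t e_a e_c, and [ES j] for a rescaling of the summand j of
    the bundle. *)
Variant selem (m N : nat) := EV of 'I_m & 'I_m | ES of 'I_N.

Section Sections.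
Variables (R : realType) (m : nat) (E : seq spin_label).
Notation C := (R[i]).
Notation Spn := (spinor R m).
Notation N := (size E).
Notation Sec := {ffun 'I_N -> Spn}.
Notation K := ('I_N * {set 'I_m./2})%type.
Notation selem := (selem m N).
Implicit Types (s : Sec) (e : selem) (kap : K) (A : {set K}).

Definition sc s kap : C := cf (s kap.1) kap.2.

Lemma scP s s' : (forall kap, sc s kap = sc s' kap) -> s = s'.
by move=> H; apply/ffunP => i; apply: spinorP => I; apply: (H (i, I)). Qed.
Lemma scD s s' kap : sc (s + s') kap = sc s kap + sc s' kap.
by rewrite /sc ffunE cfD. Qed.
Lemma scZ (a : C) s kap : sc (a *: s) kap = a * sc s kap.
by rewrite /sc ffunE cfZ. Qed.
Lemma sc0 kap : sc 0 kap = 0.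
by rewrite /sc ffunE cf0. Qed.
Lemma sc_sum (I : Type) (r : seq I) (P : pred I) (f : I -> Sec) kap :
 sc (\sum_(i <- r | P i) f i) kap = \sum_(i <- r | P i) sc (f i) kap.
elim: r => [|i r IH]; first by rewrite !big_nil sc0.
by rewrite !big_cons; case: ifP; rewrite ?scD IH.
Qed.

Definition sec_of (f : K -> C) : Sec := [ffun i => ([ffun I => f (i, I)] : Spn)].
Lemma sc_sec_of f kap : sc (sec_of f) kap = f kap.
by case: kap => i I; rewrite /sc /sec_of ffunE -cfunE ffunE. Qed.

Definition Nop e s : Sec :=
 match e with
 | EV a c => [ffun i => cl (ev R a) (cl (ev R c) (s i))]
 | ES j => [ffun i => if i == j then s i else 0]
 end.

Definition sden e : C := if e is EV a c then bform (ev R a) (ev R c) else 1.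
Definition sel_ok e : bool := if e is EV a c then rev_ord a != a else true.

Fixpoint word (L : seq selem) (t : nat -> C) s : Sec :=
 if L is e :: L' then let s' := word L' (fun i => t i.+1) s in s' + t 0%N *: Nop e s'
 else s.

Lemma word0 L s : word L (fun=> 0) s = s.
by elim: L s => //= e L IH s; rewrite IH scale0r addr0. Qed.

(** This identifies the derivatives of a word at the zero parameters with the operators [Nop], so
    that conditions on these operators are Jacobian conditions. *)
Lemma word_delta L (l : 'I_(size L)) (t : C) s :
 word L (fun i => if i == l then t else 0) s = s + t *: Nop (tnth (in_tuple L) l) s.
elim: L l => [[]//|e L IH] [[|l] hl] /=.
 by rewrite word0 (tnth_nth e).
have hl' : (l < size L)%N by [].
rewrite scale0r addr0; have := IH (Ordinal hl').
by rewrite (tnth_nth e) (tnth_nth e).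
Qed.

Lemma mpf_cl (n : nat) (v : 'rV[C]_m) (x : ('I_n -> C) -> Spn) :
 (forall I, mpf (fun t => cf (x t) I)) -> forall I, mpf (fun t => cf (cl v (x t)) I).
move=> hx I; apply: mpfE (fun t => cf_cl _ _ _) _; apply: mpfD; apply: mpf_sum => i.
 by case: (i \in I); apply: mpfM; try exact: mpfC; apply: mpfM => //; exact: mpfC.
by apply: mpfM; try exact: mpfC; apply: mpfM => //; exact: mpfC.
Qed.

Lemma mpf_Nop (n : nat) e (s : ('I_n -> C) -> Sec) :
 (forall kap, mpf (fun t => sc (s t) kap)) -> forall kap, mpf (fun t => sc (Nop e (s t)) kap).
move=> hs [i I]; case: e => [a c|j].
 apply: (@mpfE _ _ _ (fun t => cf (cl (ev R a) (cl (ev R c) (s t i))) I)).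
  by move=> t; rewrite /sc ffunE.
 by apply: mpf_cl => J; apply: mpf_cl => J'; apply: (hs (i, J')).
have [->|ij] := eqVneq i j.
 by apply: mpfE (hs (j, I)) => t; rewrite /sc ffunE eqxx.
by apply: mpfE (mpfC _ 0) => t; rewrite /sc ffunE (negPf ij) cf0.
Qed.

Lemma mpf_word (n : nat) (L : seq selem) (t : ('I_n -> C) -> nat -> C) (s : ('I_n -> C) -> Sec) :
 (forall i, mpf (fun x => t x i)) -> (forall kap, mpf (fun x => sc (s x) kap)) ->
 forall kap, mpf (fun x => sc (word L (t x) (s x)) kap).
elim: L t => //= e L IH t ht hs kap.
have {}IH kp := IH (fun x i => t x i.+1) (fun i => ht i.+1) hs kp.
apply: mpfE (fun x => scD _ _ _) _; apply: mpfD => //.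
apply: mpfE (fun x => scZ _ _ _) _; apply: mpfM => //.
exact: mpf_Nop.
Qed.

Definition supp A s : Prop := forall kap, kap \notin A -> sc s kap = 0.
Definition qev A (q : {mpoly C[#|A|]}) s : C := q.@[fun j => sc s (enum_val j)].

Lemma suppD A s s' : supp A s -> supp A s' -> supp A (s + s').
by move=> h h' kap hk; rewrite scD h ?h' ?addr0. Qed.
Lemma suppZ A (a : C) s : supp A s -> supp A (a *: s).
by move=> h kap hk; rewrite scZ h ?mulr0. Qed.

Lemma supp_exists A (y : 'I_#|A| -> C) : exists2 s, supp A s & forall j, sc s (enum_val j) = y j.
exists (sec_of (fun kap => if [pick j | enum_val j == kap] is Some j then y j else 0)).
 move=> kap kA; rewrite sc_sec_of; case: pickP => // j /eqP jE.
 by rewrite -jE enum_valP in kA.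
move=> j; rewrite sc_sec_of; case: pickP => [j' /eqP/enum_val_inj -> //|/(_ j)].
by rewrite eqxx.
Qed.

(** Transversality at mu: in the coordinates A, the operators applied to the base section, together
    with the derivative of the base family in mu, span everything. *)
Definition spans (A : {set K}) (L : seq selem) (base : C -> Sec) (bp : K -> {poly C}) (mu : C) : Prop :=
 forall kap, kap \in A -> exists (a : 'I_(size L) -> C) (a0 : C), forall kap', kap' \in A ->
  \sum_r a r * sc (Nop (tnth (in_tuple L) r) (base mu)) kap' + a0 * ((bp kap')^`()).[mu] = (kap == kap')%:R.

(** [dominant_image] for the map that sends (t, mu) to the word applied to the base section,
    restricted to the parameters for which all factors are invertible. *)
Theorem dominate A (L : seq selem) (base : C -> Sec) (bp : K -> {poly C}) (mu0 : C) (psi0 : {poly C}) :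
 (forall mu kap, sc (base mu) kap = (bp kap).[mu]) -> psi0 != 0 ->
 spans A L base bp mu0 ->
 exists2 q : {mpoly C[#|A|]}, q != 0 & forall s, supp A s -> qev q s != 0 ->
  exists (mu : C) (t : nat -> C), [/\ psi0.[mu] != 0,
   forall r, 1 + t (val r) * sden (tnth (in_tuple L) r) != 0 &
   forall kap, kap \in A -> sc s kap = sc (word L t (base mu)) kap].
move=> baseE psi00 span; set n := (size L).+1.
(* [word] reads parameters indexed by natural numbers; the last of the n variables is mu and must
   not be read as one of them. *)
pose tt (x : 'I_n -> C) (i : nat) : C := if (i < size L)%N then x (inord i) else 0.
have ttE (x : 'I_n -> C) (r : 'I_(size L)) : tt x r = x (widen_ord (leqnSn _) r).
 by rewrite /tt ltn_ord; congr x; apply/val_inj; rewrite /= inordK // ltnS ltnW.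
have /fin_all_exists[G GE] : forall j : 'I_#|A|, exists p : {mpoly C[n]}, forall x,
  sc (word L (tt x) (base (x ord_max))) (enum_val j) = p.@[x].
 move=> j; apply: (@mpf_word n L tt (fun x => base (x ord_max))) => [i|kap].
  by rewrite /tt; case: (i < size L)%N; [exact: mpfX|exact: mpfC].
 apply: (@mpfE _ _ _ (fun x : 'I_n -> C => (bp kap).[x ord_max])) => [x|]; first by rewrite baseE.
 by apply: mpf_horner; apply: mpfX.
have [psi psiE] : mpf (fun x : 'I_n -> C => psi0.[x ord_max] *
  \prod_(r < size L) (1 + tt x r * sden (tnth (in_tuple L) r))).
 apply: mpfM; first by apply: mpf_horner; apply: mpfX.
 apply: mpf_prod => r; apply: mpfD; first exact: mpfC.
 apply: mpfM; last exact: mpfC.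
 by rewrite /tt; case: (val r < size L)%N; [exact: mpfX|exact: mpfC].
have psin0 : psi != 0.
 have [mu1 hmu1] : exists mu, psi0.[mu] != 0.
  apply: contrapT => H; case/eqP: psi00; apply: polyP_eval => x.
  by apply/eqP; apply: contraT => h; case: H; exists x.
 apply/eqP => p0; have := psiE (fun i => if i == ord_max then mu1 else 0).
 rewrite p0 meval0 eqxx big1 => [|r _]; first by rewrite mulr1 => /eqP; rewrite (negPf hmu1).
 rewrite ttE; case: eqP => [/(congr1 val) /= h|]; last by rewrite mul0r addr0.
 by have := ltn_ord r; rewrite h ltnn.
pose x0 (i : 'I_n) : C := if i == ord_max then mu0 else 0.
have wne (r : 'I_(size L)) : (widen_ord (leqnSn (size L)) r == ord_max) = false.
 by apply/eqP => /(congr1 val) /= h; have := ltn_ord r; rewrite h ltnn.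
have ttl (r : 'I_(size L)) (x : 'I_n -> C) (eps : C) :
  (forall i : 'I_n, i != ord_max -> x i = (i == widen_ord (leqnSn (size L)) r)%:R * eps) ->
  tt x = fun i => if i == r :> nat then eps else 0.
 move=> hx; apply/funext => i; rewrite /tt; case: ltnP => h; last first.
  by rewrite gtn_eqF // (leq_trans _ h).
 have iv : (inord i : 'I_n) = i :> nat by rewrite inordK // ltnS ltnW.
 rewrite hx; last by apply/eqP => /(congr1 val) /= h'; rewrite -h' iv ltnn in h.
 rewrite -val_eqE /= iv; case: eqP; by rewrite ?mul1r ?mul0r.
have tt0 (x : 'I_n -> C) : (forall i : 'I_n, i != ord_max -> x i = 0) -> tt x = fun=> 0.
 move=> hx; apply/funext => i; rewrite /tt; case: ltnP => // h.
 have iv : (inord i : 'I_n) = i :> nat by rewrite inordK // ltnS ltnW.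
 by apply: hx; apply/eqP => /(congr1 val) /= h'; rewrite -h' iv ltnn in h.
have dG j (l : 'I_n) : exists g : {poly C},
  (forall e : C, g.[e] = sc (word L (tt (fun i : 'I_n => x0 i + e * (i == l)%:R)) (base (x0 ord_max + e * ((ord_max : 'I_n) == l)%:R))) (enum_val j))
  /\ g^`().[0] = ((G j)^`M(l)).@[x0].
 have [g [gE gD]] := meval_line (G j) x0 (fun i => (i == l)%:R).
 exists g; split=> [e|]; first by rewrite gE GE.
 rewrite gD (bigD1 l) //= eqxx mul1r big1 ?addr0 // => i /negPf ->; by rewrite mul0r.
have x0m : x0 ord_max = mu0 by rewrite /x0 eqxx.
have x0n i : i != ord_max -> x0 i = 0 by rewrite /x0 => /negPf ->.
have dGr j (r : 'I_(size L)) : ((G j)^`M(widen_ord (leqnSn _) r)).@[x0] =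
  sc (Nop (tnth (in_tuple L) r) (base mu0)) (enum_val j).
 have [g [gE <-]] := dG j (widen_ord (leqnSn _) r).
 have -> : g = (sc (base mu0) (enum_val j))%:P + (sc (Nop (tnth (in_tuple L) r) (base mu0)) (enum_val j))%:P * 'X.
  apply/eqP; rewrite -subr_eq0; apply/eqP/polyP_eval => e.
  rewrite !hornerE gE x0m eq_sym wne mulr0 addr0 (@ttl r _ e) ?word_delta.
   by rewrite scD scZ; ring.
  by move=> i im; rewrite x0n // add0r mulrC.
 by rewrite derivD derivC add0r derivM derivC mul0r add0r derivX mulr1 hornerC.
have dGm j : ((G j)^`M(ord_max)).@[x0] = ((bp (enum_val j))^`()).[mu0].
 have [g [gE <-]] := dG j ord_max.
 have -> : g = bp (enum_val j) \Po ('X + mu0%:P).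
  apply/eqP; rewrite -subr_eq0; apply/eqP/polyP_eval => e.
  rewrite hornerD hornerN horner_comp !hornerE gE x0m eqxx mulr1 tt0 ?word0 ?baseE.
   by rewrite [e + _]addrC subrr.
  by move=> i im; rewrite x0n // (negPf im) mulr0 addr0.
 by rewrite deriv_comp derivD derivX derivC addr0 mulr1 horner_comp !hornerE.
have [j|q q0 qP] := @dominant_image _ _ _ [tuple G j | j < #|A|] psi x0 psin0.
 have [a [a0 aE]] := span _ (enum_valP j).
 exists (fun i => if (insub (val i) : option 'I_(size L)) is Some r then a r else a0) => j'.
 rewrite big_ord_recr /= tnth_mktuple dGm; case: insubP => [r|_]; first by rewrite ltnn.
 rewrite -(inj_eq enum_val_inj) -(aE _ (enum_valP j')); congr (_ + _).
 apply: eq_bigr => r _; rewrite dGr; case: insubP => [r' _ /val_inj -> //|].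
 by rewrite /= ltn_ord.
exists q => // s sA /qP[x [px Gx]]; exists (x ord_max), (tt x).
move: px; rewrite -psiE neqM => /andP[p0 /prodf_neq0 pr]; split=> // [r|kap kA].
 exact: pr.
have := Gx (enum_rank_in kA kap); rewrite tnth_mktuple -GE.
by rewrite enum_rankK_in.
Qed.

Definition act (h : 'End(Spn)) (a : 'I_N -> C) s : Sec := [ffun i => a i *: h (s i)].

Lemma act_comp h a h' a' s : act h' a' (act h a s) = act (h' \o h)%VF (fun i => a' i * a i) s.
by apply/ffunP => i; rewrite !ffunE linearZ /= scalerA comp_lfunE. Qed.

Lemma act1 s : act \1%VF (fun=> 1) s = s.
by apply/ffunP => i; rewrite ffunE scale1r id_lfunE. Qed.

Lemma act_inv h (a : 'I_N -> C) s : lker h == 0%VS -> (forall i, a i != 0) ->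
 act h^-1%VF (fun i => (a i)^-1) (act h a s) = s.
move=> h0 a0; apply/ffunP => i; rewrite !ffunE linearZ /= scalerA mulVf // scale1r.
by rewrite lker0_lfunK.
Qed.

(** A relation rather than a function, because the lift h of g to spinors and the scalings of the
    summands are not determined by g. *)
Definition gact (g : 'M[C]_m) s s' : Prop :=
 exists h a, [/\ cpair g h, forall i, a i != 0 & s' = act h a s].

Lemma gact1 s : gact 1%:M s s.
by exists \1%VF, (fun=> 1); split; [exact: cpair1|move=> _; exact: oner_neq0|rewrite act1]. Qed.

Lemma gact_comp g g' s s' s'' : gact g s s' -> gact g' s' s'' -> gact (g *m g') s s''.
move=> [h [a [gh a0 ->]]] [h' [a' [gh' a'0 ->]]]; exists (h' \o h)%VF, (fun i => a' i * a i).
by split; [exact: cpair_comp|move=> i; rewrite mulf_neq0|rewrite act_comp].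
Qed.

Lemma gact_inv g s s' : gact g s s' -> gact (invmx g) s' s.
move=> [h [a [gh a0 ->]]]; exists h^-1%VF, (fun i => (a i)^-1).
split; [exact: cpair_inv|by move=> i; rewrite invr_eq0|].
by rewrite act_inv //; case: gh.
Qed.

Lemma gact_un g s s' : gact g s s' -> g \in unitmx.
by case=> h [a [[]]]. Qed.

Section Act.
Hypothesis lok : forall i : 'I_N, label_ok m (label_at i).

Lemma gact_sections g s s' : gact g s s' ->
 s \in @global_sections R m E -> s' \in @global_sections R m E.
move=> [h [a [[_ _ _ hD] _ ->]]]; rewrite !inE => sD i; rewrite ffunE rpredZ //.
by rewrite -(hD _ (lok i)) memv_img.
Qed.

Section Zero.
Variables (k : nat) (Y : set (Gr R k m)).
Hypothesis Ycp : forall g h, cpair g h -> forall U, Y U -> Y (gla g U).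

Lemma zero_gact1 g s s' U : gact g s s' -> zero_locus Y s U -> zero_locus Y s' (gla g U).
move=> [h [a [gh a0 ->]]] [YU vU]; split; first exact: Ycp gh _ YU.
by move=> i; rewrite ffunE; apply: vanishZ; apply: (vanish_cpair gh).
Qed.

Lemma zero_gact g s s' U : gact g s s' -> zero_locus Y s U <-> zero_locus Y s' (gla g U).
move=> gs; split; first exact: zero_gact1.
by move/(zero_gact1 (gact_inv gs)); rewrite gl_actK // (gact_un gs).
Qed.

End Zero.

Lemma gact_Nop e s t : sel_ok e -> 1 + t * sden e != 0 ->
 gact (if e is EV a c then Emx (ev R a) (ev R c) t else 1%:M) s (s + t *: Nop e s).
case: e => [a c|j] /= ok t0.
 exists (linfun (Eop (ev R a) (ev R c) t)), (fun=> 1); split=> [|_|].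
 - by apply: cpair_E => //; rewrite qform_ev (negPf ok).
 - exact: oner_neq0.
 by apply/ffunP => i; rewrite !ffunE scale1r lfunE /= EopE.
exists \1%VF, (fun i => if i == j then 1 + t else 1); split=> [|i|]; first exact: cpair1.
 by move: t0; rewrite mulr1; case: (i == j) => // _; exact: (oner_neq0 C).
apply/ffunP => i; rewrite !ffunE id_lfunE; case: eqP => _.
 by rewrite scalerDl scale1r.
by rewrite scale1r scaler0 addr0.
Qed.

Fixpoint wordg (L : seq selem) (t : nat -> C) : 'M[C]_m :=
 if L is e :: L' then wordg L' (fun i => t i.+1) *m
  (if e is EV a c then Emx (ev R a) (ev R c) (t 0%N) else 1%:M)
 else 1%:M.

Lemma gact_word L t s : all sel_ok L ->
 (forall r : 'I_(size L), 1 + t (val r) * sden (tnth (in_tuple L) r) != 0) ->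
 gact (wordg L t) s (word L t s).
elim: L t => [|e L IH] t; first by move=> _ _; apply: gact1.
move=> /= /andP[eok Lok] tok.
have h0 := tok (Ordinal (isT : (0 < size (e :: L))%N)); rewrite (tnth_nth e) /= in h0.
apply: gact_comp (gact_Nop _ eok h0); apply: IH => // r.
have hr : (r.+1 < size (e :: L))%N by rewrite /= ltnS.
by have := tok (Ordinal hr); rewrite !(tnth_nth e).
Qed.

Section Stab.
Variables (k : nat) (c : 'I_k -> 'I_m./2) (eps : 'I_k -> bool).
Hypothesis c_inj : injective c.
Notation b := (bidx c eps).
Notation U0 := (Ucoord R eps c_inj).

Definition inb (j : 'I_m) : bool := [exists i, j == b i].

(** The matrix of 1 + t e_a e_a' adds multiples of e_a and e_a' governed by the coordinates opposite
    to a' and a; the two implications keep these multiples inside U0. *)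
Definition stabU (e : selem) : bool :=
 if e is EV a a' then (inb (rev_ord a') ==> inb a) && (inb (rev_ord a) ==> inb a') else true.

Lemma coord_U0 v j : v \in val U0 -> ~~ inb j -> v 0 j = 0.
move=> /in_Ucoord[a ->] /fintype.existsPn jb; rewrite summxE big1 // => i _.
by rewrite mxE evE (negPf (jb i)) mulr0.
Qed.

Lemma ev_inb j : inb j -> ev R j \in val U0.
by move=> /fintype.existsP[i /eqP ->]; apply: ev_Ucoord. Qed.

Lemma bform_U0 v j : v \in val U0 -> ~~ inb (rev_ord j) -> bform (ev R j) v = 0.
by move=> vU jb; rewrite bform_ev (coord_U0 vU jb) mul0rn. Qed.

Lemma gl_act_stab g : g \in unitmx -> (forall v, v \in val U0 -> v *m g \in val U0) ->
 gla g U0 = U0.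
move=> gu gU; apply/val_inj; apply/eqP; rewrite eqEdim !dimGr leqnn andbT.
rewrite val_gl_act //; apply/subvP => _ /memv_imgP[v vU ->]; rewrite lfunE /=; exact: gU.
Qed.

Lemma stab_Emx (a a' : 'I_m) (t : C) v : rev_ord a != a -> stabU (EV N a a') -> v \in val U0 ->
 v *m Emx (ev R a) (ev R a') t \in val U0.
move=> aok /andP[/implyP h1 /implyP h2] vU; rewrite mul_Emx.
have H1 (x : C) : (x * bform (ev R a') v) *: ev R a \in val U0.
 case: (boolP (inb (rev_ord a'))) => i1; first by rewrite rpredZ // ev_inb // h1.
 by rewrite bform_U0 // mulr0 scale0r rpred0.
have H2 (x : C) : (x * bform (ev R a) v) *: ev R a' \in val U0.
 case: (boolP (inb (rev_ord a))) => i1; first by rewrite rpredZ // ev_inb // h2.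
 by rewrite bform_U0 // mulr0 scale0r rpred0.
rewrite !rpredB ?rpredD //.
case: (boolP (inb (rev_ord a))) => i1; last by rewrite bform_U0 // mulr0 scale0r rpred0.
have /fintype.existsP[i /eqP ->] := h2 i1.
by rewrite qform_b mulr0 mul0r mul0r scale0r rpred0.
Qed.

Lemma stab_wordg L t : all sel_ok L -> all stabU L ->
 (forall r : 'I_(size L), 1 + t (val r) * sden (tnth (in_tuple L) r) != 0) ->
 gla (wordg L t) U0 = U0.
move=> Lok Lst tok; apply: gl_act_stab; first exact: gact_un (gact_word 0 Lok tok).
elim: L t Lok Lst {tok} => [|e L IH] t; first by move=> _ _ v; rewrite mulmx1.
move=> /= /andP[eok Lok] /andP[est Lst] v vU; rewrite mulmxA.
have := IH (fun i => t i.+1) Lok Lst v vU.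
case: e eok est => [a a'|j] eok est hv; last by rewrite mulmx1.
exact: stab_Emx.
Qed.

End Stab.
End Act.

Definition Aall : {set K} := [set kap : K | label_parity (label_at kap.1) #|kap.2|]%SET.

Lemma supp_all s : supp Aall s <-> @global_sections R m E s.
split=> [h i|h [i I]]; first by apply/mem_Delta => I nI; apply: (h (i, I)); rewrite inE.
by rewrite inE /= => nI; have /mem_Delta := h i; apply.
Qed.

Lemma mpf1_poly (F : numFieldType) (f : F -> F) : mpf (fun x : 'I_1 -> F => f (x ord0)) ->
 exists p : {poly F}, forall x, f x = p.[x].
move=> [p pE]; have [g [gE _]] := meval_line p (fun=> 0) (fun=> 1).
by exists g => x; rewrite gE -pE add0r mulr1.
Qed.

(** A general section is a word applied to some base section, so its zero locus is a translate of
    one for which Q is known. *)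
Theorem general_orbit (k : nat) (Y : set (Gr R k m)) (Q : set (Gr R k m) -> Prop)
 (L : seq selem) (base : C -> Sec) (bp : K -> {poly C}) (mu0 : C) (psi : {poly C}) :
 (forall i : 'I_N, label_ok m (label_at i)) ->
 (forall g h, cpair g h -> forall U, Y U -> Y (gla g U)) ->
 (forall g X X', g \in unitmx -> (forall U, X U <-> X' (gla g U)) -> Q X -> Q X') ->
 all sel_ok L ->
 (forall mu kap, sc (base mu) kap = (bp kap).[mu]) ->
 (forall mu, supp Aall (base mu)) ->
 psi != 0 ->
 (forall mu, psi.[mu] != 0 -> Q (zero_locus Y (base mu))) ->
 spans Aall L base bp mu0 ->
 general_zero_locus Y E Q.
move=> lok Ycp Qgl Lok baseE bsupp psi0 Qb span.
have [q q0 qP] := dominate baseE psi0 span.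
pose lin (j : 'I_#|Aall|) : {mpoly C[\dim {:Sec}]} :=
 \sum_(i < \dim {:Sec}) (sc ((vbasis {:Sec})`_i : Sec) (enum_val j : K)) *: 'X_i.
pose p := q \mPo [tuple lin j | j < #|Aall|].
have pE s : p.@[fun i => coord (vbasis {:Sec}) i s] = qev q s.
 rewrite /p comp_mpoly_meval; apply: meval_eq => j; rewrite tnth_mktuple.
 rewrite {2}(coord_vbasis (memvf s)) sc_sum raddf_sum /=; apply: eq_bigr => i _.
 by rewrite mevalZ mevalXU scZ mulrC.
exists (fun p' => p' = p) => nz; split.
 have [y y0] := meval_neq0 q0; have [s sA sE] := supp_exists y.
 exists s; first exact/supp_all.
 exists p => //; rewrite pE.
 by have -> : qev q s = q.@[y] by apply: meval_eq => j; rewrite sE.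
move=> s /supp_all sA [_ ->]; rewrite pE => qs.
have [mu [t [pmu tok st]]] := qP s sA qs.
have gs : gact (wordg L t) (base mu) s.
 have -> : s = word L t (base mu); last exact: gact_word.
 apply: scP => kap; case: (boolP (kap \in Aall)) => kA; first exact: st.
 have h := gact_sections lok (gact_word (base mu) Lok tok) (mem_set ((supp_all _).1 (bsupp mu))).
 by rewrite sA // ((supp_all _).2 (set_mem h)).
apply: Qgl (Qb _ pmu); first exact: gact_un gs.
by move=> U; exact: (zero_gact lok Ycp U gs).
Qed.

(** * The open-orbit criterion *)

Section QH.
Variables (k : nat) (Y : set (Gr R k m)) (c : 'I_k -> 'I_m./2) (eps : 'I_k -> bool).
Hypothesis c_inj : injective c.
Variable kill : 'I_N -> pred {set 'I_m./2}.
Notation U0 := (Ucoord R eps c_inj).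
Notation b := (bidx c eps).
Notation bf := [ffun i => b i].
Hypotheses (lok : forall i : 'I_N, label_ok m (label_at i))
 (Ycp : forall g h, cpair g h -> forall U, Y U -> Y (gla g U))
 (YOG : Y `<=` OG R k m)
 (YU0 : Y U0).
Hypothesis vanU0 : forall (i : 'I_N) x, x \in Delta R m (label_at i) ->
 (vanish (label_at i) x U0 <-> forall I, kill i I -> cf x I = 0).

Definition AK : {set K} := [set kap in Aall | ~~ kill kap.1 kap.2]%SET.

Lemma supp_K s : supp AK s <-> supp Aall s /\ zero_locus Y s U0.
split=> [h|[hA [_ h]]].
 have hA : supp Aall s by move=> kap kA; apply: h; rewrite inE (negPf kA).
 split=> //; split=> // i; apply/vanU0 => [|I kI]; first exact: (supp_all s).1 hA i.
 by apply: (h (i, I)); rewrite inE /= kI andbF.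
move=> [i I]; rewrite inE negb_and negbK => /orP[kA|/= kI]; first exact: hA.
by apply: ((vanU0 _).1 (h i)) => //; exact: (supp_all s).1 hA i.
Qed.

Lemma Aall_gact g s s' : gact g s s' -> supp Aall s -> supp Aall s'.
move=> gs /supp_all sA; apply/supp_all; have := gact_sections lok gs.
by rewrite !inE; apply.
Qed.

Definition chart_sec (W : Gr R k m) s : Sec := [ffun i => chart_op c eps (cvec c eps W) (s i)].

Lemma chart_sec_U0 s : chart_sec U0 s = s.
have e : cvec c eps U0 = fun=> 0 by apply/funext => j; apply: chart_vec_Ucoord.
by apply/ffunP => i; rewrite ffunE e chart_op0.
Qed.

Lemma gact_chart W s : Y W -> minor (bmx W) bf != 0 ->
 exists2 g, gact g (chart_sec W s) s & gla g U0 = W.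
move=> YW mW; have [H [cH HE]] := cpair_chart (@chart_vecP R m k c eps W) (enum 'I_k).
exists (chart_g c eps (cvec c eps W) (enum 'I_k)); last exact: chart_gl (YOG YW) mW.
exists H, (fun=> 1); split=> // [_|]; first exact: oner_neq0.
by apply/ffunP => i; rewrite !ffunE scale1r HE.
Qed.

Lemma supp_chart W s : supp Aall s -> zero_locus Y s W -> minor (bmx W) bf != 0 ->
 supp AK (chart_sec W s).
move=> sA zW mW; have [g gs gW] := gact_chart s zW.1 mW; apply/supp_K; split.
 exact: Aall_gact (gact_inv gs) sA.
by apply/(zero_gact lok Ycp _ gs); rewrite gW.
Qed.

(** For W in X near U0, the section pulled back to U0 along the chart is generically a word applied
    to some [base mu']. Equivalent base sections being equal, [base mu'] is [base mu], and the
    elements found so far compose to one that fixes s and carries U0 to W. *)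
Theorem qh_slice (L1 L2 : seq selem) (base : C -> Sec) (bp : K -> {poly C})
 (mu1 mu2 : C) (psi0 : {poly C}) :
 all sel_ok L1 -> all sel_ok L2 -> all (stabU c eps) L2 ->
 (forall mu kap, sc (base mu) kap = (bp kap).[mu]) ->
 (forall mu, supp AK (base mu)) ->
 psi0 != 0 ->
 (forall g mu mu', psi0.[mu] != 0 -> psi0.[mu'] != 0 -> gact g (base mu) (base mu') ->
   base mu = base mu') ->
 spans Aall L1 base bp mu1 ->
 spans AK L2 base bp mu2 ->
 general_zero_locus Y E quasi_homogeneous.
move=> L1ok L2ok L2st baseE bK psi00 inv span1 span2.
have bA mu : supp Aall (base mu) by have /supp_K[] := bK mu.
have [q q0 qP] := dominate baseE psi00 span2.
have wK t mu : (forall r : 'I_(size L2), 1 + t (val r) * sden (tnth (in_tuple L2) r) != 0) ->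
  gact (wordg L2 t) (base mu) (word L2 t (base mu)) /\ supp AK (word L2 t (base mu)).
 move=> tok; have gs := gact_word (base mu) L2ok tok; split=> //; apply/supp_K; split.
  exact: Aall_gact gs (bA mu).
 have := (zero_gact lok Ycp U0 gs).1 ((supp_K _).1 (bK mu)).2.
 by rewrite (stab_wordg c_inj L2ok L2st tok).
have eqK s s' : supp AK s -> supp AK s' -> (forall kap, kap \in AK -> sc s kap = sc s' kap) -> s = s'.
 move=> hs hs' ss'; apply: scP => kap; case: (boolP (kap \in AK)) => kA; first exact: ss'.
 by rewrite hs ?hs'.
have [y y0] := meval_neq0 q0; have [s1 s1K s1E] := supp_exists y.
have qs1 : qev q s1 != 0.
 by have -> : qev q s1 = q.@[y] by apply: meval_eq => j; rewrite s1E.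
have [mus [ts [pmus tsok s1t]]] := qP s1 s1K qs1.
have {}s1t := eqK _ _ s1K (wK ts mus tsok).2 s1t.
have [psi1 psi1E] : exists psi1 : {poly C}, forall mu, qev q (word L2 ts (base mu)) = psi1.[mu].
 apply: mpf1_poly; rewrite /qev; apply: mpfme => j.
 apply: (@mpf_word 1 L2 (fun=> ts) (fun x => base (x ord0))) => [i|kap].
  exact: mpfC.
 by apply: mpfE (fun x => baseE _ _) _; apply: mpf_horner; apply: mpfX.
have psi10 : psi1 * psi0 != 0.
 rewrite mulf_neq0 //; apply/eqP => p0; move: qs1; rewrite s1t psi1E p0 horner0 eqxx //.
apply: (general_orbit lok Ycp _ L1ok baseE bA psi10 _ span1) => [|mu].
 by move=> g X X' gu XX'; apply: qh_gl gu XX'.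
rewrite hornerM neqM -psi1E => /andP[qmu pmu].
have [gst sK] := wK ts mu tsok; move: (word L2 ts (base mu)) qmu gst sK => s qmu gst sK.
apply: (@qh_gl R k m (zero_locus Y s) _ (invmx (wordg L2 ts))).
- by rewrite unitmx_inv; apply: gact_un gst.
- by move=> U; exact: (zero_gact lok Ycp U (gact_inv gst)).
have [sA zU0] := (supp_K s).1 sK.
exists U0 => //.
apply: (@aut_orbit_open R k m _ _ [set W | [/\ zero_locus Y s W, minor (bmx W) bf != 0 &
  qev q (chart_sec W s) != 0]]) => //.
- apply: rgl_open; apply: rgl_meval => j.
 apply: (@rgl_ext _ _ _ _ _ (fun W => cf (chart_op c eps (cvec c eps W) (s (enum_val j).1)) (enum_val j).2)).
  by move=> W _; rewrite /sc ffunE.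
 exact: rgl_chart_op.
- by split; [exact: zU0|exact: minor_Ucoord|rewrite /mkset /= chart_sec_U0; exact: qmu].
move=> W [zW mW qW]; have [G gG GW] := gact_chart s zW.1 mW.
have WK := supp_chart sA zW mW.
have [mu' [t [pmu' tok st]]] := qP _ WK qW.
have [gt tK] := wK t mu' tok; have {}st := eqK _ _ WK tK st.
have bb : base mu = base mu'.
 apply: (inv _ _ _ pmu pmu' (gact_comp gst (gact_comp (gact_inv gG) _))).
 by rewrite st; apply: gact_inv gt.
have ss : gact (invmx (wordg L2 ts) *m (wordg L2 t *m G)) s s.
 apply: gact_comp (gact_inv gst) _; rewrite bb; apply: gact_comp gt _; by rewrite -st.
exists (gla (invmx (wordg L2 ts) *m (wordg L2 t *m G))).
 apply: gl_aut (gact_un ss) _ => U; exact: (zero_gact lok Ycp U ss).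
have uts := gact_un gst; have ut := gact_un gt; have uG := gact_un gG.
rewrite -gl_actM ?unitmx_inv ?unitmx_mul ?ut // -gl_actM // -GW.
congr (gla _ _); rewrite -{2}(stab_wordg c_inj L2ok L2st tsok) gl_actK //.
by rewrite (stab_wordg c_inj L2ok L2st tok).
Qed.
End QH.
End Sections.

(** * Integer models of subsets, signs and spinors *)

Section Bits.
Variable n : nat.
Implicit Types (I : {set 'I_n}) (v : seq bool).

Definition bits I : seq bool := [seq i \in I | i <- enum 'I_n].
Definition tog j v : seq bool := set_nth false v j (~~ nth false v j).
Definition sgnb j v : bool := odd (count id (take j v)).

Lemma size_bits I : size (bits I) = n.
by rewrite size_map size_enum_ord. Qed.

Lemma nth_bits I (i : 'I_n) : nth false (bits I) i = (i \in I).
by rewrite (nth_map i) ?size_enum_ord // nth_ord_enum. Qed.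

Lemma bits_inj : injective bits.
by move=> I J IJ; apply/setP => i; rewrite -!nth_bits IJ. Qed.

Lemma count_bits I : count id (bits I) = #|I|.
by rewrite /bits enumT count_map cardE /enum_mem size_filter; apply: eq_count. Qed.

Lemma count_take_bits I (i : 'I_n) : count id (take i (bits I)) = #|[set j in I | (j < i)%N]|.
set P := nth false (bits I).
rewrite -[bits I](mkseq_nth false) size_bits /mkseq -map_take take_iota count_map.
rewrite (minn_idPl (ltnW (ltn_ord i))) cardE /enum_mem size_filter -enumT.
have -> : count (mem [set j in I | (j < i)%N]) (enum 'I_n) =
  count (fun t => P t && (t < i)%N) (map val (enum 'I_n)).
 by rewrite count_map; apply: eq_count => j; rewrite /= inE /P nth_bits.
rewrite val_enum_ord.
have -> : iota 0 n = iota 0 i ++ iota i (n - i) by rewrite -iotaD subnKC // ltnW.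
rewrite count_cat.
have -> : count (fun t => P t && (t < i)%N) (iota i (n - i)) = 0%N.
 by apply/eqP; rewrite -leqn0 leqNgt -has_count; apply/hasPn => t; rewrite mem_iota => /andP[it _]; rewrite [(t < i)%N]ltnNge it andbF.
by rewrite addn0; apply: eq_in_count => t; rewrite mem_iota /= => ->; rewrite andbT.
Qed.

Lemma bits_set1 I (i : 'I_n) (b : bool) : bits (if b then i |: I else I :\ i) = set_nth false (bits I) i b.
apply: (@eq_from_nth _ false) => [|j]; rewrite ?size_set_nth !size_bits.
 by rewrite (maxn_idPr _) // ltn_ord.
move=> jn; rewrite nth_set_nth /=; have := nth_bits _ (Ordinal jn) => /= ->.
have := nth_bits I (Ordinal jn) => /= ->; case: b; rewrite !inE -val_eqE /=;
 by case: (j == i).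
Qed.

End Bits.

Lemma bits_toggle m (I : {set 'I_m./2}) (i : 'I_m./2) : bits (toggle i I) = tog i (bits I).
rewrite /tog -bits_set1 nth_bits /toggle; by case: (i \in I).
Qed.

Delimit Scope Z_scope with ZZ.

Section Z.
Variable (F : numFieldType).
Definition zC (z : Z) : F := (int_of_Z z)%:~R.
Lemma zC0 : zC 0%ZZ = 0. by []. Qed.
Lemma zC1 : zC 1%ZZ = 1. by []. Qed.
Lemma zCD x y : zC (x + y)%ZZ = zC x + zC y.
by rewrite /zC -intrD; congr (_%:~R); lia. Qed.
Lemma zCM x y : zC (x * y)%ZZ = zC x * zC y.
by rewrite /zC -intrM; congr (_%:~R); lia. Qed.
Lemma zCN x : zC (- x)%ZZ = - zC x.
by rewrite /zC -mulrNz; congr (_%:~R); lia. Qed.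
Lemma zC_neq0 x : x <> 0%ZZ -> zC x != 0.
by rewrite /zC intr_eq0 => h; apply/eqP; lia. Qed.
End Z.

(** * Certified integer linear algebra *)

Section Elimination.
Variable C : numFieldType.
Notation zC := (@zC C).

Definition addz := fix addz (u w : seq Z) : seq Z :=
 match u, w with a :: u', c :: w' => (a + c)%ZZ :: addz u' w' | [::], _ => w | _, [::] => u end.
Definition scz (a : Z) (u : seq Z) := if Z.eqb a 0 then [::] else [seq (a * c)%ZZ | c <- u].
Definition lincomb (a : seq Z) (rows : seq (seq Z)) : seq Z :=
 foldr (fun p acc => addz (scz p.1 p.2) acc) [::] (zip a rows).

Lemma nth_addz u w t : nth 0%ZZ (addz u w) t = (nth 0%ZZ u t + nth 0%ZZ w t)%ZZ.
elim: u w t => [|a u IH] [|c w] [|t] //=; rewrite ?nth_nil ?Z.add_0_r //.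
Qed.
Lemma nth_scz a u t : nth 0%ZZ (scz a u) t = (a * nth 0%ZZ u t)%ZZ.
rewrite /scz; case: Z.eqb_spec => [->|_]; first by rewrite nth_nil.
have [h|h] := ltnP t (size u); first by rewrite (nth_map 0%ZZ).
by rewrite !nth_default ?size_map // Z.mul_0_r.
Qed.
Lemma nth_lincomb a rows t :
 zC (nth 0%ZZ (lincomb a rows) t) = \sum_(r < size rows) zC (nth 0%ZZ a r) * zC (nth 0%ZZ (nth [::] rows r) t).
elim: rows a => [|u rows IH] a; first by rewrite big_ord0; case: a t => [|? ?] [|?].
rewrite big_ord_recl; case: a => [|a0 a] /=.
 by rewrite nth_nil zC0 mul0r add0r big1 // => r _; rewrite mul0r.
by rewrite /lincomb /= nth_addz zCD nth_scz zCM -IH.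
Qed.

(** Fraction-free: each row carries its coefficients in terms of the original rows, and the common
    divisor of both is removed to limit their growth. *)
Definition reduce (c : nat) (p r : seq Z * seq Z) : seq Z * seq Z :=
 let a := nth 0%ZZ p.1 c in let e := nth 0%ZZ r.1 c in
 if Z.eqb e 0 then r else
 let r1 := addz (scz a r.1) (scz (- e) p.1) in
 let r2 := addz (scz a r.2) (scz (- e) p.2) in
 let g := foldl Z.gcd (foldl Z.gcd 0%ZZ r1) r2 in
 if Z.eqb g 0 then (r1, r2) else ([seq Z.div x g | x <- r1], [seq Z.div x g | x <- r2]).

Definition elim_step (st : seq (nat * (seq Z * seq Z))) (r : seq Z * seq Z) :=
 let r' := foldl (fun r cp => reduce cp.1 cp.2 r) r st in
 let c := find (fun z => ~~ Z.eqb z 0) r'.1 in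
 if (c < size r'.1)%N then (c, r') :: [seq (cp.1, reduce c r' cp.2) | cp <- st] else st.

Definition unitz (q : nat) : seq Z := ncons q 0%ZZ [:: 1%ZZ].

Definition eliminate (rows : seq (seq Z)) : seq (nat * (seq Z * seq Z)) :=
 foldl elim_step [::] [seq (p.1, unitz p.2) | p <- zip rows (iota 0 (size rows))].

Definition unit_check (q : nat) (t : nat) (u : seq Z) : bool :=
 (~~ Z.eqb (nth 0%ZZ u t) 0) &&
 all (fun t' => (t' == t) || Z.eqb (nth 0%ZZ u t') 0) (iota 0 q).

(** The elimination is not trusted: its coefficients are applied again to the given rows, and only
    these combinations enter the soundness proof. *)
Definition spanck (q : nat) (rows : seq (seq Z)) : bool :=
 let el := eliminate rows in
 all (fun t => has (fun cp => (cp.1 == t) && unit_check q t (lincomb cp.2.2 rows)) el) (iota 0 q).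

Lemma span_checkP q rows t : spanck q rows -> (t < q)%N ->
 exists a : nat -> C, forall t', (t' < q)%N ->
  \sum_(r < size rows) a r * zC (nth 0%ZZ (nth [::] rows r) t') = (t == t')%:R.
move=> /allP h tq; have := h t; rewrite mem_iota tq => /(_ isT)/hasP[[c [u a]] _ /= /andP[_ /andP[d0 /allP hz]]].
set w := lincomb a rows in d0 hz; have d0' : zC (nth 0%ZZ w t) != 0.
 by apply: zC_neq0 => e; rewrite e in d0.
exists (fun r => (zC (nth 0%ZZ w t))^-1 * zC (nth 0%ZZ a r)) => t' t'q.
under eq_bigr => r _ do rewrite -mulrA.
rewrite -mulr_sumr -nth_lincomb -/w; have := hz t'; rewrite mem_iota t'q => /(_ isT).
rewrite eq_sym; case: eqVneq => [<- _|_ /= /Z.eqb_eq ->]; first by rewrite mulVf.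
by rewrite zC0 mulr0.
Qed.

End Elimination.

(** * The open-orbit criterion as an integer computation *)

Section Model.
Variables (R : realType) (m : nat) (E : seq spin_label).
Notation C := (R[i]).
Notation n := m./2.
Notation Spn := (spinor R m).
Notation N := (size E).
Notation Sec := {ffun 'I_N -> Spn}.
Notation K := ('I_N * {set 'I_n})%type.
Notation selem := (selem m N).
Notation zC := (@zC C).
Implicit Types (s : Sec) (v : seq bool) (x : seq bool -> Z) (y : nat -> seq bool -> Z).

Definition zsg (b : bool) : Z := if b then (-1)%ZZ else 1%ZZ.

Definition mcl (j : nat) x v : Z :=
 if (j < n)%N then
  if nth false v j then (zsg (sgnb j v) * x (tog j v))%ZZ else 0%ZZ
 else if (m - j.+1 < n)%N then
  if nth false v (m - j.+1) then 0%ZZ else (zsg (sgnb (m - j.+1) v) * x (tog (m - j.+1) v))%ZZ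
 else (zsg (odd (count id v)) * x v)%ZZ.

Definition mNop (e : selem) y (i : nat) v : Z :=
 match e with
 | EV a c => mcl a (mcl c (y i)) v
 | ES j => if i == val j then y i v else 0%ZZ
 end.

Definition sval_model y s : Prop := forall kap : K, sc s kap = zC (y (val kap.1) (bits kap.2)).

Lemma zsgE b : zC (zsg b) = (-1) ^+ b.
by case: b; rewrite ?expr1 ?expr0 //. Qed.

Lemma ext_sign_bits (i : 'I_n) (I : {set 'I_n}) : ext_sign R i I = zC (zsg (sgnb i (bits I))).
by rewrite zsgE /sgnb count_take_bits signr_odd. Qed.

Lemma cf_cl_model (j : 'I_m) x (u : Spn) : (forall I, cf u I = zC (x (bits I))) ->
 forall I, cf (cl (ev R j) u) I = zC (mcl j x (bits I)).
move=> ux I; rewrite /mcl; have [[i [b ->]]|jm] := idx_cases j.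
 rewrite cl_idx ext_sign_bits; case: b => /=.
  by rewrite ltn_ord nth_bits; case: (i \in I); rewrite ?zC0 // zCM ux bits_toggle.
 have im := ltn_ord i; have h : (m - (m - i.+1).+1 = i)%N by lia.
 rewrite h ltn_ord nth_bits; case: ltnP => [|_]; first by lia.
 by case: (i \in I); rewrite ?zC0 // zCM ux bits_toggle.
rewrite clifford_mid //; have /= jv := congr1 val (eqP jm).
have jm' := ltn_ord j.
case: ltnP => [|_]; first by lia.
case: ltnP => [|_]; first by lia.
by rewrite zCM zsgE signr_odd count_bits ux.
Qed.

Lemma model_Nop e y s : sval_model y s -> sval_model (mNop e y) (Nop e s).
move=> ys [i I]; case: e => [a c|j] /=.
 rewrite /sc ffunE; apply: cf_cl_model => J; apply: cf_cl_model => J'; exact: (ys (i, J')).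
rewrite /sc ffunE /=; case: eqVneq => [->|ij]; first by rewrite eqxx; apply: (ys (j, I)).
by rewrite -val_eqE /= in ij; rewrite cf0 ifN_eq.
Qed.

Definition sec_model y : Sec := sec_of (fun kap : K => zC (y (val kap.1) (bits kap.2))).
Lemma sec_modelP y : sval_model y (sec_model y).
by move=> kap; rewrite sc_sec_of. Qed.

Definition baseM y y' (mu : C) : Sec := sec_model y + mu *: sec_model y'.
Definition bpM y y' (kap : K) : {poly C} :=
 (sc (sec_model y) kap)%:P + (sc (sec_model y') kap)%:P * 'X.
Lemma baseME y y' mu kap : sc (baseM y y' mu) kap = (bpM y y' kap).[mu].
by rewrite scD scZ /bpM !hornerE mulrC. Qed.
Lemma bpM_deriv y y' kap mu : (bpM y y' kap)^`().[mu] = zC (y' (val kap.1) (bits kap.2)).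
by rewrite /bpM derivD derivC derivM derivC mul0r !add0r derivX mulr1 hornerC sec_modelP.
Qed.
Lemma baseM_model y y' z : sval_model (fun i v => y i v + z * y' i v)%ZZ (baseM y y' (zC z)).
by move=> kap; rewrite scD scZ !sec_modelP zCD zCM. Qed.

Definition mrow (Al : seq (nat * seq bool)) y : seq Z := [seq y kp.1 kp.2 | kp <- Al].
(** The last row is the derivative of the base family in its parameter; it is zero for a constant
    family. *)
Definition mrows (Al : seq (nat * seq bool)) (L : seq selem) y y' :=
 rcons [seq mrow Al (mNop e y) | e <- L] (mrow Al y').

Lemma span_model (Al : seq (nat * seq bool)) (A : {set K}) (L : seq selem) y y' z :
 (forall kap, kap \in A -> (val kap.1, bits kap.2) \in Al) ->
 spanck (size Al) (mrows Al L (fun i v => y i v + z * y' i v)%ZZ y') ->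
 spans A L (baseM y y') (bpM y y') (zC z).
move=> AAl chk kap kA.
pose ix (kp : K) := index (val kp.1, bits kp.2) Al.
have ixl kp : kp \in A -> (ix kp < size Al)%N by move=> h; rewrite index_mem AAl.
have ixE kp kp' : kp \in A -> kp' \in A -> (ix kp == ix kp') = (kp == kp').
 move=> h h'; apply/eqP/eqP => [|-> //] e.
 have := nth_index (0%N, [::]) (AAl _ h); rewrite -/(ix kp) e nth_index ?AAl //.
 by case: kp kp' {h h' e} => [i I] [i' I'] /= [/val_inj -> /bits_inj ->].
have [a aE] := span_checkP C chk (ixl _ kA).
have szr : size (mrows Al L (fun i v => y i v + z * y' i v)%ZZ y') = (size L).+1.
 by rewrite size_rcons size_map.
exists (fun r => a (val r)), (a (size L)) => kap' kA'.
rewrite -(ixE _ _ kA kA') -(aE _ (ixl _ kA')) szr big_ord_recr /=; congr (_ + _ * _).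
 apply: eq_bigr => r _; rewrite (model_Nop _ (baseM_model _ _ _)); congr (_ * zC _).
 rewrite /mrows nth_rcons size_map ltn_ord (nth_map (tnth (in_tuple L) r)) //.
 rewrite /mrow (nth_map (0%N, [::])) ?ixl // nth_index ?AAl //=.
 by congr (mNop _ _ _ _); apply: tnth_nth.
rewrite bpM_deriv; congr (zC _); rewrite /mrows nth_rcons size_map ltnn eqxx.
by rewrite /mrow (nth_map (0%N, [::])) ?ixl // nth_index ?AAl.
Qed.
End Model.

Fixpoint allbits (n : nat) : seq (seq bool) :=
 if n is p.+1 then map (cons false) (allbits p) ++ map (cons true) (allbits p) else [:: [::]].

Lemma mem_allbits v : v \in allbits (size v).
elim: v => //= b v IH; rewrite mem_cat; case: b; rewrite map_f ?orbT //.
Qed.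

Lemma bits_allbits n (I : {set 'I_n}) : bits I \in allbits n.
by have := mem_allbits (bits I); rewrite size_bits. Qed.

Section Model.
Variables (R : realType) (m : nat) (E : seq spin_label).
Notation C := (R[i]).
Notation n := m./2.
Notation N := (size E).
Notation K := ('I_N * {set 'I_n})%type.
Notation selem := (selem m N).
Notation zC := (@zC C).
Implicit Types (v : seq bool) (y : nat -> seq bool -> Z).

Definition kept (kl : nat -> seq bool -> bool) : seq (nat * seq bool) :=
 [seq kp <- [seq (i, v) | i <- iota 0 N, v <- allbits n] |
   label_parity (nth Sfull E kp.1) (count id kp.2) && ~~ kl kp.1 kp.2].

Lemma mem_kept kl (kap : K) : ((val kap.1, bits kap.2) \in kept kl) =
 label_parity (label_at kap.1) #|kap.2| && ~~ kl (val kap.1) (bits kap.2).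
rewrite mem_filter /= count_bits /label_at (tnth_nth Sfull) /=.
have -> : (val kap.1, bits kap.2) \in [seq (i, v) | i <- iota 0 N, v <- allbits n].
 apply/allpairsP; exists (val kap.1, bits kap.2); split=> //=.
  by rewrite mem_iota ltn_ord.
 exact: bits_allbits.
by rewrite andbT.
Qed.

Definition stabm (bl : seq nat) (e : selem) : bool :=
 if e is EV a c then (((m - c.+1)%N \in bl) ==> (val a \in bl)) && (((m - a.+1)%N \in bl) ==> (val c \in bl))
 else true.

Definition suppck kl y : bool :=
 all (fun kp => (kp \in kept kl) || Z.eqb (y kp.1 kp.2) 0)
  [seq (i, v) | i <- iota 0 N, v <- allbits n].

Lemma baseM0 y mu : baseM m E y (fun _ _ => 0%ZZ) mu = sec_model R m E y.
have e : sec_model R m E (fun _ _ => 0%ZZ) = 0.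
 by apply: scP => kap; apply: (etrans (sec_modelP R _ kap)); rewrite (sc0 R kap); apply: zC0.
by rewrite /baseM e; apply/ffunP => i; rewrite !ffunE scaler0 addr0.
Qed.

Section QH.
Variables (k : nat) (Y : set (Gr R k m)) (c : 'I_k -> 'I_n) (eps : 'I_k -> bool).
Hypothesis c_inj : injective c.
Variable kl : nat -> seq bool -> bool.
Notation kill := (fun (i : 'I_N) (I : {set 'I_n}) => kl i (bits I)).
Notation U0 := (Ucoord R eps c_inj).
Notation AK := (@AK m E kill).

Lemma mem_AK (kap : K) : (kap \in AK) = ((val kap.1, bits kap.2) \in kept kl).
by rewrite mem_kept !inE. Qed.

Lemma mem_Aall (kap : K) : (kap \in @Aall m E) = ((val kap.1, bits kap.2) \in kept (fun _ _ => false)).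
by rewrite mem_kept !inE andbT. Qed.

Lemma supp_checkP y s : suppck kl y -> sval_model (R:=R) y s -> supp AK s.
move=> /allP h ys kap; rewrite mem_AK ys => kA.
have := h (val kap.1, bits kap.2); rewrite (negPf kA) /=.
have -> : (val kap.1, bits kap.2) \in [seq (i, v) | i <- iota 0 N, v <- allbits n].
 apply/allpairsP; exists (val kap.1, bits kap.2); split=> //=.
  by rewrite mem_iota ltn_ord.
 exact: bits_allbits.
by move=> /(_ isT)/Z.eqb_eq ->.
Qed.

Variable bl : seq nat.
Hypothesis blP : forall j : 'I_m, inb c eps j = (val j \in bl).

Lemma stabmP (e : selem) : stabm bl e -> stabU c eps e.
by case: e => //= a a'; rewrite !blP. Qed.

Hypotheses (lok : forall i : 'I_N, label_ok m (label_at i))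
 (Ycp : forall g h, cpair g h -> forall U, Y U -> Y (gla g U))
 (YOG : Y `<=` OG R k m)
 (YU0 : Y U0).
Hypothesis vanU0 : forall (i : 'I_N) x, x \in Delta R m (label_at i) ->
 (vanish (label_at i) x U0 <-> forall I, kill i I -> cf x I = 0).

Theorem qh_model (L1 L2 : seq selem) y y' (z1 z2 : Z) (psi0 : {poly C}) :
 all (@sel_ok m E) L1 -> all (@sel_ok m E) L2 -> all (stabm bl) L2 ->
 suppck kl y -> suppck kl y' ->
 psi0 != 0 ->
 (forall g mu mu', psi0.[mu] != 0 -> psi0.[mu'] != 0 ->
   gact g (baseM m E y y' mu) (baseM m E y y' mu') ->
   baseM m E y y' mu = baseM m E y y' mu') ->
 (let Al := kept (fun _ _ => false) in
  spanck (size Al) (mrows Al L1 (fun i v => y i v + z1 * y' i v)%ZZ y')) ->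
 (let Al := kept kl in
  spanck (size Al) (mrows Al L2 (fun i v => y i v + z2 * y' i v)%ZZ y')) ->
 general_zero_locus Y E quasi_homogeneous.
move=> L1ok L2ok L2st ys y's psi inv sp1 sp2.
have L2st' : all (stabU c eps) L2 by apply: sub_all L2st => e; apply: stabmP.
have bK (mu : C) : supp AK (baseM m E y y' mu).
 apply: suppD; last apply: suppZ.
  exact: (supp_checkP ys (sec_modelP R y)).
 exact: (supp_checkP y's (sec_modelP R y')).
have s1 : forall kap, kap \in @Aall m E -> _ := @span_model R m E _ (@Aall m E) L1 y y' z1 (fun kap kA => etrans (esym (mem_Aall kap)) kA) sp1.
have s2 : forall kap, kap \in AK -> _ := @span_model R m E _ AK L2 y y' z2 (fun kap kA => etrans (esym (mem_AK kap)) kA) sp2.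
exact: (@qh_slice R m E k Y c eps c_inj kill lok Ycp YOG YU0 vanU0 L1 L2 (baseM m E y y') (bpM R y y') (zC z1) (zC z2) psi0 L1ok L2ok L2st' (@baseME R m E y y') bK psi inv s1 s2).
Qed.

(** The summand 0 keeps the checked matrices convertible with those of [qh_model] for the zero
    direction. *)
Theorem qh_const (L1 L2 : seq selem) y :
 all (@sel_ok m E) L1 -> all (@sel_ok m E) L2 -> all (stabm bl) L2 ->
 suppck kl y ->
 (let Al := kept (fun _ _ => false) in
  spanck (size Al) (mrows Al L1 (fun i v => y i v + 0)%ZZ (fun _ _ => 0%ZZ))) ->
 (let Al := kept kl in
  spanck (size Al) (mrows Al L2 (fun i v => y i v + 0)%ZZ (fun _ _ => 0%ZZ))) ->
 general_zero_locus Y E quasi_homogeneous.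
move=> L1ok L2ok L2st ys sp1 sp2.
have z0 : suppck kl (fun _ _ => 0%ZZ) by apply/allP => kp _; rewrite orbT.
apply: (@qh_model L1 L2 y (fun _ _ => 0%ZZ) 0%ZZ 0%ZZ 1 L1ok L2ok L2st ys z0 _ _ sp1 sp2).
 exact: oner_neq0.
by move=> g mu mu' _ _ _; rewrite !baseM0.
Qed.
End QH.
End Model.

Definition is_full (l : spin_label) : bool := if l is Sfull then true else false.
Definition lab_ok (m : nat) (l : spin_label) : bool := is_full l == odd m.

Lemma label_okbP m l : lab_ok m l -> label_ok m l.
by case: l => //; rewrite /lab_ok eq_sym; case: (odd m). Qed.

Lemma all_labels (P : pred spin_label) (E : seq spin_label) : all P E -> forall i : 'I_(size E), P (label_at i).
by move=> /(all_nthP Sfull) h i; rewrite /label_at (tnth_nth Sfull); apply: h. Qed.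

(** * The criterion at standard base spaces of each type *)

Section OrthogonalGrassmannians.
Variables (R : realType) (k m : nat) (E : seq spin_label).
Hypothesis km : (k <= m./2)%N.
Notation c := (widen_ord km).
Notation eps := (fun _ : 'I_k => true).

Lemma wid_inj : injective c.
by move=> i j /(congr1 val) /= /val_inj. Qed.

Definition kl_OG (i : nat) (v : seq bool) : bool := ~~ has id (take k v).

Lemma forb_OG (I : {set 'I_m./2}) i : forb c eps I = kl_OG i (bits I).
have sz : size (take k (bits I)) = k by rewrite size_takel // size_bits.
apply/fintype.forallP/hasPn => [h b|h j].
 move=> /(nthP false)[p]; rewrite sz => pk <-.
 have := h (Ordinal pk); rewrite nth_take //.
 by have /= -> := nth_bits I (c (Ordinal pk)); case: (_ \in I).
rewrite eqb_id; apply: (h (c j \in I)); rewrite -nth_bits -(nth_take false (ltn_ord j)) /=.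
by apply: mem_nth; rewrite sz.
Qed.

Lemma inb_OG (j : 'I_m) : inb c eps j = (val j \in iota 0 k).
rewrite mem_iota /=; apply/fintype.existsP/idP => [[i /eqP ->]|jk]; first by rewrite /bidx /idx /= ltn_ord.
by exists (Ordinal jk); apply/eqP/val_inj.
Qed.

Hypotheses (labels : all (lab_ok m) E)
 (km1 : odd m || (k.+1 <= m./2)%N).

Lemma vanish_OG (i : 'I_(size E)) x : x \in Delta R m (label_at i) ->
 (vanish (label_at i) x (Ucoord R eps wid_inj) <-> forall I, kl_OG i (bits I) -> cf x I = 0).
move=> xD; have lok := all_labels labels i.
have e : (forall I, kl_OG i (bits I) -> cf x I = 0) <-> (forall I, forb c eps I -> cf x I = 0).
 by split=> h I; have := h I; rewrite (forb_OG I i).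
rewrite e; case: (boolP (odd m || (k.+1 < m./2)%N)) => h.
 by apply: vanish_coord_coker => //; apply: label_okbP.
move: h; rewrite negb_or -leqNgt => /andP[om h].
apply: vanish_coord_n1 => //.
 by apply/eqP; rewrite eqn_leq h andbT; move: km1; rewrite (negPf om).
by move=> lf; move: lok; rewrite lf /lab_ok /= (negPf om).
Qed.

Theorem qh_OG_span (L1 L2 : seq (selem m (size E))) y :
 all (@sel_ok m E) L1 -> all (@sel_ok m E) L2 -> all (stabm (iota 0 k)) L2 ->
 suppck m E kl_OG y ->
 (let Al := kept m E (fun _ _ => false) in
  spanck (size Al) (mrows Al L1 (fun i v => y i v + 0)%ZZ (fun _ _ => 0%ZZ))) ->
 (let Al := kept m E kl_OG in
  spanck (size Al) (mrows Al L2 (fun i v => y i v + 0)%ZZ (fun _ _ => 0%ZZ))) ->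
 general_zero_locus (OG R k m) E quasi_homogeneous.
apply: (@qh_const R m E k (OG R k m) c eps wid_inj kl_OG (iota 0 k) inb_OG) => //.
- by move=> i; apply: label_okbP; apply: (all_labels labels).
- by move=> g h gh U; apply: (OG_cpair gh).
- exact: OG_Ucoord.
exact: vanish_OG.
Qed.
End OrthogonalGrassmannians.

Definition om (m j : nat) (hm : (0 < m)%N) : 'I_m := Ordinal (ltn_pmod j hm).

(** The least significant bit belongs to the first basis vector, so 3 encodes the wedge of the first
    two. *)
Fixpoint bitsN (n x : nat) : seq bool := if n is p.+1 then odd x :: bitsN p x./2 else [::].

(* The section whose [i]-th component is the sum of the monomials encoded in [l`_i]. *)
Definition ones (m : nat) (l : seq (seq nat)) (i : nat) (v : seq bool) : Z :=
 if v \in [seq bitsN m./2 x | x <- nth [::] l i] then 1%ZZ else 0%ZZ.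

Section Lists.
Variables (m : nat) (E : seq spin_label) (hm : (0 < m)%N) (hN : (0 < size E)%N).
Notation selem := (selem m (size E)).

Definition pairs_lt : seq (nat * nat) := [seq ac <- [seq (a, c) | a <- iota 0 m, c <- iota 0 m] | (ac.1 < ac.2)%N].
Definition all_elems : seq selem :=
 [seq e <- [seq EV (size E) (om ac.1 hm) (om ac.2 hm) | ac <- pairs_lt] ++ [seq ES m (om i hN) | i <- iota 0 (size E)]
  | sel_ok e].
Definition stab_elems (bl : seq nat) : seq selem := [seq e <- all_elems | stabm bl e].

Definition qh_check (bl : seq nat) (kl : nat -> seq bool -> bool) (y : nat -> seq bool -> Z) : bool :=
 let y0 i v := (y i v + 0)%ZZ in let z i v := 0%ZZ in
 let Al := kept m E (fun _ _ => false) in let AlK := kept m E kl in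
 [&& suppck m E kl y, spanck (size Al) (mrows Al all_elems y0 z)
  & spanck (size AlK) (mrows AlK (stab_elems bl) y0 z)].

Lemma all_elems_ok : all (@sel_ok m E) all_elems.
exact: filter_all. Qed.
Lemma stab_elems_ok bl : all (@sel_ok m E) (stab_elems bl) && all (stabm bl) (stab_elems bl).
rewrite /stab_elems filter_all andbT; elim: all_elems all_elems_ok => //= e L IH /andP[eok Lok].
by case: ifP => _ /=; rewrite ?eok IH.
Qed.
End Lists.

Theorem qh_OG (R : realType) (k m : nat) (E : seq spin_label)
 (hm : (0 < m)%N) (hN : (0 < size E)%N) (l : seq (seq nat)) :
 (k <= m./2)%N -> all (lab_ok m) E -> odd m || (k.+1 <= m./2)%N ->
 qh_check hm hN (iota 0 k) (kl_OG k) (ones m l) ->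
 general_zero_locus (OG R k m) E quasi_homogeneous.
move=> km lab km1 /and3P[sup s1 s2]; have /andP[ok2 st2] := stab_elems_ok hm hN (iota 0 k).
exact: (qh_OG_span R km lab km1 (all_elems_ok hm hN) ok2 st2 sup s1 s2).
Qed.

Section Families.
Variables (R : realType) (m : nat) (fam : spin_label) (E : seq spin_label).
Hypothesis (m_even : ~~ odd m) (labels : all (lab_ok m) E) (famok : lab_ok m fam).
Variable I0 : {set 'I_m./2}.
Hypothesis famI0 : label_parity fam #|I0|.
Variables (kl : nat -> seq bool -> bool) (bl : seq nat).

Lemma id_inj : injective (fun i : 'I_m./2 => i). by []. Qed.

Hypothesis klP : forall (i : 'I_(size E)) (x : spinor R m),
 (forall I, kl i (bits I) -> cf x I = 0) <->
 (if label_parity (label_at i) #|I0| then cf x I0 = 0 else forall j, cf x (toggle j I0) = 0).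
Hypothesis blP : forall j : 'I_m, inb (fun i : 'I_m./2 => i) (fun j => j \notin I0) j = (val j \in bl).

Lemma vanish_family (i : 'I_(size E)) x : x \in Delta R m (label_at i) ->
 (vanish (label_at i) x (Wmax R I0) <-> forall I, kl i (bits I) -> cf x I = 0).
move=> xD; rewrite klP; have lok := all_labels labels i.
have lf : label_at i <> Sfull by move=> lf; move: lok; rewrite lf /lab_ok /= (negPf m_even).
by case: ifP => h; [apply: vanish_max|apply: vanish_max_opp => //; rewrite h].
Qed.

Theorem qh_family (hm : (0 < m)%N) (hN : (0 < size E)%N) y :
 qh_check hm hN bl kl y -> general_zero_locus (OGmax R m fam) E quasi_homogeneous.
move=> /and3P[sup s1 s2]; have /andP[ok2 st2] := stab_elems_ok hm hN bl.
have fok := label_okbP famok.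
apply: (@qh_const R m E m./2 (OGmax R m fam) _ _ id_inj kl bl blP _ _ _ _ _ _ _ y
 (all_elems_ok hm hN) ok2 st2 sup s1 s2).
- by move=> i; apply: label_okbP; apply: (all_labels labels).
- by move=> g h gh U; apply: (OGmax_cpair gh).
- by move=> U [].
- exact/OGmax_Wmax.
exact: vanish_family.
Qed.
End Families.

Section Empty.
Variables (R : realType) (m : nat).
Definition kl_empty (i : nat) (v : seq bool) : bool := ~~ has id v.

Lemma bits_empty (I : {set 'I_m./2}) i : kl_empty i (bits I) = (I == finset.set0).
by rewrite /kl_empty has_count -eqn0Ngt count_bits cards_eq0. Qed.

Lemma inb_empty (j : 'I_m) : inb (fun i : 'I_m./2 => i) (fun j => j \notin (finset.set0 : {set 'I_m./2})) j = (val j \in iota 0 m./2).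
rewrite mem_iota /=; apply/fintype.existsP/idP => [[i /eqP ->]|jk].
 by rewrite /bidx /idx inE /= ltn_ord.
by exists (Ordinal jk); apply/eqP/val_inj; rewrite /bidx inE.
Qed.

Theorem qh_OGplus (E : seq spin_label) (hm : (0 < m)%N) (hN : (0 < size E)%N) l :
 ~~ odd m -> all (fun l => if l is Splus then true else false) E ->
 qh_check hm hN (iota 0 m./2) kl_empty (ones m l) ->
 general_zero_locus (OGmax R m Splus) E quasi_homogeneous.
move=> om Ep; apply: (@qh_family R m Splus E om _ _ finset.set0) => //.
- by apply: sub_all Ep => -[] //; rewrite /lab_ok /= (negPf om).
- by rewrite cards0.
- move=> i x; have := all_labels Ep i; case: (label_at i) => // _; rewrite cards0 /=.
 split=> [h|h I]; first by apply: h; rewrite bits_empty.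
 by rewrite bits_empty => /eqP ->.
exact: inb_empty.
Qed.
End Empty.

Section Last.
Variables (R : realType) (m n' : nat).
Hypotheses (mE : m./2 = n'.+1)
 (m_even : ~~ odd m).

(** The family [Sminus] needs a base space given by a set of odd cardinality; here it is spanned by
    all basis vectors of E but the last, and by the opposite of the last. *)
Definition lastI : {set 'I_m./2} := [set j | val j == n']%SET.
Lemma val_lastI (j : 'I_m./2) : (j \in lastI) = (val j == n'). by rewrite inE. Qed.

Lemma card_lastI : #|lastI| = 1%N.
have h : (n' < m./2)%N by rewrite mE.
have -> : lastI = [set Ordinal h]%SET by apply/setP => j; rewrite !inE -val_eqE.
by rewrite cards1.
Qed.

Definition kl_last (i : nat) (v : seq bool) : bool :=
 has (fun j => v == tog j (ncons n' false [:: true])) (iota 0 n'.+1).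

Lemma bits_lastI : bits lastI = ncons n' false [:: true].
apply: (@eq_from_nth _ false) => [|j]; first by rewrite size_bits size_ncons /= addn1.
rewrite size_bits => jn; have := nth_bits lastI (Ordinal jn) => /= ->.
rewrite val_lastI /= nth_ncons; case: ltngtP => // [h|<-]; last by rewrite subnn.
by move: jn; rewrite mE ltnS leqNgt h.
Qed.

Lemma kl_lastP i (I : {set 'I_m./2}) : kl_last i (bits I) = [exists j, I == toggle j lastI].
apply/hasP/fintype.existsP => [[j]|[j /eqP ->]].
 rewrite mem_iota /= add0n -mE => jn; rewrite -bits_lastI.
 have /= <- := bits_toggle lastI (Ordinal jn); move/eqP/bits_inj => ->.
 by exists (Ordinal jn).
exists (val j); first by rewrite mem_iota /= add0n -mE ltn_ord.
by rewrite -bits_lastI bits_toggle.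
Qed.

(** The index n' + 1 is opposite to n', because m = 2 n' + 2. *)
Definition bl_last : seq nat := rcons (iota 0 n') n'.+1.

Lemma inb_last (j : 'I_m) : inb (fun i : 'I_m./2 => i) (fun j => j \notin lastI) j = (val j \in bl_last).
have hm : m = (n'.+1).*2 by rewrite -[LHS]odd_double_half (negPf m_even) mE.
rewrite mem_rcons inE mem_iota /= add0n; apply/fintype.existsP/idP => [[i /eqP ->]|].
 rewrite /bidx val_lastI /idx; have ile : (i <= n')%N by have := ltn_ord i; lia.
 have [h|ne] := eqVneq (val i) n'; last by rewrite /= (ltn_neqAle i) ne ile orbT.
 by apply/orP; left; apply/eqP; rewrite /=; move: hm h; rewrite /=; lia.
case/orP => [/eqP h|h].
 have hn : (n' < m./2)%N by rewrite mE.
 exists (Ordinal hn); apply/eqP/val_inj; rewrite /bidx val_lastI /idx /= eqxx /= h.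
 by move: hm; lia.
have hn : (j < m./2)%N by rewrite mE; lia.
exists (Ordinal hn); apply/eqP/val_inj; rewrite /bidx val_lastI /idx /=.
by rewrite (ltn_eqF h).
Qed.

Theorem qh_OGminus (hm : (0 < m)%N) (hN : (0 < size [:: Splus])%N) l :
 qh_check hm hN bl_last kl_last (ones m l) ->
 general_zero_locus (OGmax R m Sminus) [:: Splus] quasi_homogeneous.
apply: (@qh_family R m Sminus [:: Splus] m_even _ _ lastI).
- by rewrite /= /lab_ok /= (negPf m_even).
- by rewrite /lab_ok /= (negPf m_even).
- by rewrite card_lastI.
- move=> i x; have -> : label_at i = Splus by case: i => [[|]].
 rewrite card_lastI /=; split=> [h j|h I].
  by apply: h; rewrite kl_lastP; apply/fintype.existsP; exists j.
 by rewrite kl_lastP => /fintype.existsP[j /eqP ->].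
exact: inb_last.
Qed.
End Last.

(** * The invariant pairing of spinors and its covariants *)

Section Pairing.
Variables (R : realType) (m : nat).
Notation C := (R[i]).
Notation n := m./2.
Notation V := 'rV[C]_m.
Notation Spn := (spinor R m).
Hypothesis m_even : ~~ odd m.
Implicit Types (x y u w : Spn) (v : V) (I J : {set 'I_n}).

Definition bsg I : C := (-1) ^+ (\sum_(i in I) i).
(* The sign makes every vector self-adjoint for this pairing. *)
Definition beta x y : C := \sum_I bsg I * (cf x I * cf y (~: I)%SET).

Lemma betaDl x x' y : beta (x + x') y = beta x y + beta x' y.
by rewrite -big_split; apply: eq_bigr => I _; rewrite cfD mulrDl mulrDr. Qed.
Lemma betaDr x y y' : beta x (y + y') = beta x y + beta x y'.
by rewrite -big_split; apply: eq_bigr => I _; rewrite cfD !mulrDr. Qed.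
Lemma betaZl (a : C) x y : beta (a *: x) y = a * beta x y.
by rewrite mulr_sumr; apply: eq_bigr => I _; rewrite cfZ -mulrA mulrCA. Qed.
Lemma betaZr (a : C) x y : beta x (a *: y) = a * beta x y.
by rewrite mulr_sumr; apply: eq_bigr => I _; rewrite cfZ; ring. Qed.

Lemma bsg_toggle i I : bsg (toggle i I) = (-1) ^+ i * bsg I.
rewrite /bsg /toggle; case: (boolP (i \in I)) => iI.
 rewrite [in RHS](big_setD1 i) //= exprD mulrA -exprD addnn -[_ ^+ _.*2]signr_odd odd_double.
 by rewrite mul1r.
by rewrite big_setU1 //= exprD.
Qed.

Lemma setC_toggle i I : (~: toggle i I)%SET = toggle i (~: I)%SET.
by apply/setP => j; rewrite !inE !in_toggle inE; case: (j == i); case: (j \in I). Qed.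

Lemma ext_signC i I : ext_sign R i I * ext_sign R i (~: I)%SET = (-1) ^+ i.
rewrite /ext_sign -exprD; congr (_ ^+ _).
have -> : ([set j in ~: I | (j < i)%N] = [set j : 'I_n | (j < i)%N] :\: [set j in I | (j < i)%N])%SET.
 by apply/setP => j; rewrite !inE; case: (j \in I); rewrite ?andbF ?andbT //=; case: (j < i)%N.
have hs : ([set j in I | (j < i)%N] \subset [set j : 'I_n | (j < i)%N])%SET.
 by apply/fintype.subsetP => j; rewrite !inE => /andP[].
rewrite cardsD (finset.setIidPr hs) subnKC ?subset_leq_card //.
rewrite cardE /enum_mem size_filter -enumT.
have -> : count (mem [set j : 'I_n | (j < i)%N]%SET) (enum 'I_n) = count (fun t => (t < i)%N) (map val (enum 'I_n)).
 by rewrite count_map; apply: eq_count => j; rewrite /= inE.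
rewrite val_enum_ord; have -> : iota 0 n = iota 0 i ++ iota i (n - i) by rewrite -iotaD subnKC // ltnW.
rewrite count_cat (eq_in_count (a2 := predT)) ?count_predT ?size_iota => [|t]; last by rewrite mem_iota.
rewrite (eq_in_count (a2 := pred0)) ?count_pred0 ?addn0 // => t; rewrite mem_iota => /andP[it _].
by rewrite ltnNge it.
Qed.

Lemma ext_sign_sq i I : ext_sign R i I * ext_sign R i I = 1.
by rewrite -exprD addnn -signr_odd odd_double. Qed.

Lemma toggle_inj i : injective (toggle i : {set 'I_n} -> {set 'I_n}).
by apply: (can_inj (toggleK i)). Qed.

Lemma beta_idx i b x y : beta (cl (ev R (idx i b)) x) y = beta x (cl (ev R (idx i b)) y).
rewrite /beta (reindex_inj (@toggle_inj i)); apply: eq_bigr => I _.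
rewrite !cl_idx setC_toggle toggleK in_toggle eqxx inE.
have -> : (true (+) (i \in I) == b) = ((i \notin I) == b) by case: (i \in I).
case: eqP => _; last by rewrite !(mul0r, mulr0).
rewrite bsg_toggle ext_sign_toggle ltnn -(ext_signC i I).
rewrite -[RHS]mul1r -{1}(ext_sign_sq i I); ring.
Qed.

Lemma idx_ex (j : 'I_m) : exists i b, j = idx i b.
have [//|jm] := idx_cases j; have /= := congr1 val (eqP jm).
by have := ltn_ord j; move: m_even; lia.
Qed.

Lemma beta_ev j x y : beta (cl (ev R j) x) y = beta x (cl (ev R j) y).
by have [i [b ->]] := idx_ex j; apply: beta_idx. Qed.

Lemma beta_suml (T : Type) (s : seq T) (f : T -> Spn) y :
 beta (\sum_(t <- s) f t) y = \sum_(t <- s) beta (f t) y.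
elim: s => [|t s IH]; last by rewrite !big_cons betaDl IH.
by rewrite !big_nil /beta big1 // => I _; rewrite cf0 mul0r mulr0.
Qed.
Lemma beta_sumr (T : Type) (s : seq T) (f : T -> Spn) x :
 beta x (\sum_(t <- s) f t) = \sum_(t <- s) beta x (f t).
elim: s => [|t s IH]; last by rewrite !big_cons betaDr IH.
by rewrite !big_nil /beta big1 // => I _; rewrite cf0 !mulr0.
Qed.

Lemma beta_cl v x y : beta (cl v x) y = beta x (cl v y).
rewrite (vec_ev v) !cl_suml beta_suml beta_sumr; apply: eq_bigr => j _.
by rewrite !cliffordZl betaZl betaZr beta_ev.
Qed.

Lemma cl_basis i b I : cl (ev R (idx i b)) (basis_spinor R I) =
 if (i \in I) == b then 0 else ext_sign R i I *: basis_spinor R (toggle i I).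
apply: spinorP => J; rewrite cl_idx cf_basis.
have -> : (toggle i J == I) = (J == toggle i I).
 by apply/eqP/eqP => [<-|->]; rewrite toggleK.
have [->|ne] := eqVneq J (toggle i I); last first.
 by rewrite mulr0 if_same; case: ifP => _; rewrite ?cf0 // cfZ cf_basis (negPf ne) mulr0.
rewrite in_toggle eqxx ext_sign_toggle ltnn; case: (i \in I); case: b => //=;
 by rewrite ?cf0 // cfZ cf_basis eqxx.
Qed.

Section Unique.
Variable D : Spn -> Spn -> C.
Hypotheses (DDl : forall x x' y, D (x + x') y = D x y + D x' y)
 (DDr : forall x y y', D x (y + y') = D x y + D x y')
 (DZl : forall (a : C) x y, D (a *: x) y = a * D x y)
 (DZr : forall (a : C) x y, D x (a *: y) = a * D x y)
 (Dev : forall j x y, D (cl (ev R j) x) y = D x (cl (ev R j) y))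
 (D0 : D (basis_spinor R finset.set0) (basis_spinor R finset.setT) = 0).

(** Vectors move across D. If I is empty and J is not full, J arises from a larger set by a
    contraction, which kills the empty monomial on the other side. If I is non-empty, one of its
    wedges is moved to the other side and the cardinality of I drops. *)
Lemma pairing_zero_basis I J : D (basis_spinor R I) (basis_spinor R J) = 0.
have [q] := ubnP #|I|; elim: q => // q IH in I J *; rewrite ltnS => Iq.
have D0r x : D x 0 = 0 by rewrite -[0](scale0r (0 : Spn)) DZr mul0r.
have D0l x : D 0 x = 0 by rewrite -[0](scale0r (0 : Spn)) DZl mul0r.
have [->|[i iI]] := set_0Vmem I.
 have [->//|nJ] := eqVneq J finset.setT.
 have [i iJ] : exists i, i \notin J.
  by apply/existsP; apply: contraNT nJ => /existsPn h; apply/eqP/setP => i; rewrite inE; apply/negPn/h.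
 have -> : basis_spinor R J = ext_sign R i J *: cl (ev R (idx i false)) (basis_spinor R (toggle i J)).
  rewrite cl_basis in_toggle eqxx (negPf iJ) /= toggleK ext_sign_toggle ltnn scalerA.
  by rewrite ext_sign_sq scale1r.
 by rewrite DZr -Dev cl_basis inE /= D0l mulr0.
have -> : basis_spinor R I = ext_sign R i I *: cl (ev R (idx i true)) (basis_spinor R (I :\ i)).
 have -> : I :\ i = toggle i I by rewrite /toggle iI.
 rewrite cl_basis in_toggle eqxx iI /= toggleK ext_sign_toggle ltnn scalerA.
 by rewrite ext_sign_sq scale1r.
rewrite DZl Dev cl_basis; case: ifP => _; first by rewrite D0r mulr0.
by rewrite DZr IH ?mulr0 //; move: Iq; rewrite (cardsD1 i I) iI.
Qed.

Lemma pairing_zero x y : D x y = 0.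
have Dsl (T : Type) (s : seq T) (f : T -> Spn) z : D (\sum_(t <- s) f t) z = \sum_(t <- s) D (f t) z.
 elim: s => [|t s IH]; last by rewrite !big_cons DDl IH.
 by rewrite !big_nil -[0](scale0r (0 : Spn)) DZl mul0r.
have Dsr (T : Type) (s : seq T) (f : T -> Spn) z : D z (\sum_(t <- s) f t) = \sum_(t <- s) D z (f t).
 elim: s => [|t s IH]; last by rewrite !big_cons DDr IH.
 by rewrite !big_nil -[0](scale0r (0 : Spn)) DZr mul0r.
rewrite (spinor_sum x) (spinor_sum y) Dsl big1 // => I _; rewrite DZl Dsr big1 ?mulr0 // => J _.
by rewrite DZr pairing_zero_basis mulr0.
Qed.
End Unique.

Lemma beta_vac : beta (basis_spinor R finset.set0) (basis_spinor R finset.setT) = 1.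
rewrite /beta (bigD1 finset.set0) //= big1 => [|I nI].
 by rewrite !cf_basis finset.setC0 !eqxx /bsg big_set0 expr0 !mulr1 addr0.
by rewrite cf_basis (negPf nI) mul0r mulr0.
Qed.

(** Transported by h, beta is again a pairing for which vectors are self-adjoint, and such a pairing
    is determined by its value on the empty and the full monomial. *)
Lemma beta_cpair g h : cpair g h -> exists c : C, forall x y, beta (h x) (h y) = c * beta x y.
move=> [gu _ hv _]; exists (beta (h (basis_spinor R finset.set0)) (h (basis_spinor R finset.setT))) => x y.
apply/eqP; rewrite -subr_eq0; apply/eqP.
have [c cE] : exists c, beta (h (basis_spinor R finset.set0)) (h (basis_spinor R finset.setT)) = c by eexists.
rewrite cE.
apply: (@pairing_zero (fun x y => beta (h x) (h y) - c * beta x y)) => [x1 x2 z|x1 x2 z|a x1 z|a x1 z|j x1 z|].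
- by rewrite linearD !betaDl; ring.
- by rewrite linearD !betaDr; ring.
- by rewrite linearZ /= !betaZl; ring.
- by rewrite linearZ /= !betaZr; ring.
- by rewrite !hv !beta_cl.
by rewrite beta_vac mulr1 cE subrr.
Qed.

Definition phi x v : C := beta x (cl v x).

(** A quadratic covariant with values in V, dual to v -> beta(x, v.x). Both [J2] and the square of
    [beta] have bidegree (2, 2) in (x, y), and their ratio is the modulus used on OG(3,10). *)
Definition wvec x : V := \sum_j phi x (ev R j) *: ev R (rev_ord j).
Definition J2 x y : C := bform (wvec x) (wvec y).

Lemma bform_ev_even j v : bform (ev R j) v = v 0 (rev_ord j).
have [i [b ->]] := idx_ex j; by rewrite bform_ev idx_rev_neq addn0 mulr1n.
Qed.

Lemma bform_wvec x v : bform (wvec x) v = phi x v.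
rewrite /wvec bform_suml (vec_ev v) {2}/phi cl_suml beta_sumr; apply: eq_bigr => j _.
rewrite bformZl bform_ev_even rev_ordK -(vec_ev v) cliffordZl betaZr.
by rewrite mulrC.
Qed.

Lemma bform_nondeg (u w : V) : (forall v, bform u v = bform w v) -> u = w.
move=> h; apply/rowP => j; have := h (ev R (rev_ord j)).
by rewrite !(bformC _ (ev R _)) !bform_ev_even rev_ordK.
Qed.

Lemma J2E x y : J2 x y = \sum_j phi x (ev R j) * phi y (ev R (rev_ord j)).
by rewrite /J2 {1}/wvec bform_suml; apply: eq_bigr => j _; rewrite bformZl bformC bform_wvec.
Qed.

Lemma J_cpair g h : cpair g h -> exists c : C, (forall x y, beta (h x) (h y) = c * beta x y) /\
 (forall x y, J2 (h x) (h y) = c ^+ 2 * J2 x y).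
move=> gh; have [c cE] := beta_cpair gh; exists c; split=> // x y.
have gu : g \in unitmx by case: gh.
have hv v z : h (cl v z) = cl (v *m g) (h z) by case: gh.
have wE z : wvec (h z) = c *: (wvec z *m g).
 apply: bform_nondeg => v; rewrite bform_wvec bformZl.
 rewrite -{2}(mulmxKV gu v) (bform_cpair gh) bform_wvec /phi -cE hv.
 by rewrite mulmxKV.
by rewrite /J2 !wE bformZl bformC bformZl (bform_cpair gh) bformC expr2 mulrA.
Qed.
Lemma J_scale g h (a b : C) : cpair g h -> exists c : C, forall x y x' y',
 x' = a *: h x -> y' = b *: h y -> beta x' y' = c * beta x y /\ J2 x' y' = c ^+ 2 * J2 x y.
move=> /J_cpair[c [c1 c2]]; exists (a * b * c) => x y _ _ -> ->; split.
 by rewrite betaZl betaZr c1; ring.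
have phiZ (z : Spn) (d : C) v : phi (d *: z) v = d ^+ 2 * phi z v.
 by rewrite /phi cliffZr betaZl betaZr; ring.
transitivity (a ^+ 2 * b ^+ 2 * J2 (h x) (h y)); last by rewrite c2; ring.
by rewrite !J2E mulr_sumr; apply: eq_bigr => j _; rewrite !phiZ; ring.
Qed.
Notation zC := (@zC C).

Definition zbeta (x y : seq bool -> Z) : Z :=
 foldr (fun b acc => zsg (odd (sumn [seq i <- iota 0 n | nth false b i])) * (x b * y (map negb b)) + acc)%ZZ
  0%ZZ (allbits n).

Lemma uniq_allbits p : uniq (allbits p).
elim: p => //= p IH; rewrite cat_uniq !map_inj_uniq ?IH //=; try by move=> ? ? [].
by rewrite andbT; apply/hasPn => _ /mapP[v _ ->]; apply/mapP => -[w].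
Qed.

Lemma size_allbits p b : b \in allbits p -> size b = p.
elim: p b => [|p IH] b /=; first by rewrite inE => /eqP ->.
by rewrite mem_cat => /orP[]/mapP[w /IH wp ->] /=; rewrite wp.
Qed.

Lemma perm_bits : perm_eq (map (@bits n) (enum {: {set 'I_n}})) (allbits n).
apply: uniq_perm => [||v]; first by rewrite map_inj_uniq ?enum_uniq //; apply: bits_inj.
 exact: uniq_allbits.
apply/mapP/idP => [[I _ ->]|/size_allbits vn]; first exact: bits_allbits.
exists [set i : 'I_n | nth false v i]%SET; first by rewrite mem_enum.
apply: (@eq_from_nth _ false) => [|i]; first by rewrite size_bits.
by rewrite vn => lt_i; have /= -> := nth_bits [set i : 'I_n | nth false v i]%SET (Ordinal lt_i); rewrite inE.
Qed.

Lemma bits_setC (I : {set 'I_n}) : bits (~: I)%SET = map negb (bits I).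
by rewrite /bits -map_comp; apply: eq_map => i /=; rewrite inE. Qed.

Lemma beta_model u w (x y : seq bool -> Z) : (forall I, cf u I = zC (x (bits I))) ->
 (forall I, cf w I = zC (y (bits I))) -> beta u w = zC (zbeta x y).
move=> ux wy; rewrite /zbeta.
have -> s : zC (foldr (fun b acc => zsg (odd (sumn [seq i <- iota 0 n | nth false b i])) * (x b * y (map negb b)) + acc)%ZZ 0%ZZ s)
  = \sum_(b <- s) zC (zsg (odd (sumn [seq i <- iota 0 n | nth false b i]))) * (zC (x b) * zC (y (map negb b))).
 by elim: s => [|v s IH]; rewrite ?big_nil ?big_cons ?zC0 // zCD !zCM IH.
rewrite -(perm_big _ perm_bits) big_map big_enum /beta; apply: eq_bigr => I _.
rewrite ux wy bits_setC zsgE signr_odd; congr (_ ^+ _ * _).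
rewrite sumnE big_filter big_mkcond [RHS]big_mkcond /=.
have -> : iota 0 n = index_iota 0 n by rewrite /index_iota subn0.
rewrite big_mkord; apply: eq_bigr => i _.
by rewrite nth_bits.
Qed.
End Pairing.

(** * The one-parameter slice for two summands on OG(3,10) *)

Section Slice.
Variable R : realType.
Notation C := (R[i]).
Notation zC := (@zC C).
Notation E := [:: Splus; Sminus].

Definition yA := ones 10 [:: [:: 6; 9; 15]; [:: 4; 25]]%N.
Definition yB := ones 10 [:: [:: 18]]%N.

Definition zsum10 (F : nat -> Z) : Z := foldr (fun j a => F j + a)%ZZ 0%ZZ (iota 0 10).

Lemma zsum10E (F : nat -> Z) : \sum_(j < 10) zC (F j) = zC (zsum10 F).
rewrite -(big_mkord xpredT (fun j => zC (F j))) /index_iota subn0 /zsum10.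
by elim: (iota 0 10) => [|j s IH]; rewrite ?big_nil ?big_cons //= zCD IH.
Qed.

Definition zphi (x y : seq bool -> Z) (j : nat) : Z := zbeta 10 x (mcl 10 j y).

Lemma slice_invariants :
 [&& Z.eqb (zbeta 10 (yA 0%N) (yA 1%N)) (-1), Z.eqb (zbeta 10 (yB 0%N) (yA 1%N)) 0,
   Z.eqb (zsum10 (fun j => zphi (yA 0%N) (yA 0%N) j * zphi (yA 1%N) (yA 1%N) (10 - j.+1))%ZZ) 0,
   Z.eqb (zsum10 (fun j => (zphi (yA 0%N) (yB 0%N) j + zphi (yB 0%N) (yA 0%N) j) * zphi (yA 1%N) (yA 1%N) (10 - j.+1))%ZZ) (-4)
  & Z.eqb (zsum10 (fun j => zphi (yB 0%N) (yB 0%N) j * zphi (yA 1%N) (yA 1%N) (10 - j.+1))%ZZ) 0].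
by_vm. Qed.

Let i0 : 'I_(size E) := Ordinal (isT : 0 < 2)%N.
Let i1 : 'I_(size E) := Ordinal (isT : 1 < 2)%N.
Notation sA := (sec_model R 10 E yA).
Notation sB := (sec_model R 10 E yB).

Lemma cf_model y (i : 'I_(size E)) I : cf (sec_model R 10 E y i) I = zC (y (val i) (bits I)).
exact: (sec_modelP R (m := 10) (E := E) y (i, I)). Qed.

Lemma baseM_at (mu : C) i : baseM 10 E yA yB mu i = sA i + mu *: sB i.
by rewrite /baseM ffunE [X in _ + X]ffunE. Qed.

Lemma sB1 : sB i1 = 0.
by apply: spinorP => I; rewrite cf_model cf0. Qed.

Lemma phi_model (x y : spinor R 10) f g j : (forall I, cf x I = zC (f (bits I))) ->
 (forall I, cf y I = zC (g (bits I))) -> beta x (cl (ev R j) y) = zC (zphi f g j).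
by move=> xf yg; apply: beta_model => // I; apply: cf_cl_model. Qed.

Lemma slice_J1 (mu : C) : beta (baseM 10 E yA yB mu i0) (baseM 10 E yA yB mu i1) = -1.
have /and5P[/Z.eqb_spec e1 /Z.eqb_spec e2 _ _ _] := slice_invariants.
rewrite !baseM_at sB1 scaler0 addr0 betaDl betaZl.
rewrite (beta_model (cf_model yA i0) (cf_model yA i1)) e1.
by rewrite (beta_model (cf_model yB i0) (cf_model yA i1)) e2 zC0 mulr0 addr0.
Qed.

Lemma slice_J2 (mu : C) : J2 (baseM 10 E yA yB mu i0) (baseM 10 E yA yB mu i1) = - (mu *+ 4).
have /and5P[_ _ /Z.eqb_spec e1 /Z.eqb_spec e2 /Z.eqb_spec e3] := slice_invariants.
rewrite !baseM_at sB1 scaler0 addr0 J2E //.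
have step (j : 'I_10) : phi (sA i0 + mu *: sB i0) (ev R j) * phi (sA i1) (ev R (rev_ord j)) =
  zC (zphi (yA 0%N) (yA 0%N) j * zphi (yA 1%N) (yA 1%N) (10 - j.+1))%ZZ +
  mu * zC ((zphi (yA 0%N) (yB 0%N) j + zphi (yB 0%N) (yA 0%N) j) * zphi (yA 1%N) (yA 1%N) (10 - j.+1))%ZZ +
  mu ^+ 2 * zC (zphi (yB 0%N) (yB 0%N) j * zphi (yA 1%N) (yA 1%N) (10 - j.+1))%ZZ.
 rewrite /phi !cliffr !(betaDl, betaDr, betaZl, betaZr).
 rewrite (phi_model j (cf_model yA i0) (cf_model yA i0)).
 rewrite (phi_model j (cf_model yB i0) (cf_model yA i0)).
 rewrite (phi_model j (cf_model yA i0) (cf_model yB i0)).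
 rewrite (phi_model j (cf_model yB i0) (cf_model yB i0)).
 rewrite (phi_model (rev_ord j) (cf_model yA i1) (cf_model yA i1)).
 rewrite !zCM zCD /=; ring.
rewrite (eq_bigr _ (fun j _ => step j)) !big_split /= -!mulr_sumr.
pose F1 j := (zphi (yA 0%N) (yA 0%N) j * zphi (yA 1%N) (yA 1%N) (10 - j.+1))%ZZ.
pose F2 j := ((zphi (yA 0%N) (yB 0%N) j + zphi (yB 0%N) (yA 0%N) j) * zphi (yA 1%N) (yA 1%N) (10 - j.+1))%ZZ.
pose F3 j := (zphi (yB 0%N) (yB 0%N) j * zphi (yA 1%N) (yA 1%N) (10 - j.+1))%ZZ.
have := zsum10E F1; have := zsum10E F2; have := zsum10E F3; rewrite /F1 /F2 /F3 => -> -> ->.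
rewrite e1 e2 e3 zC0 add0r mulr0 addr0.
by rewrite -mulr_natr -mulrN; congr (_ * _).
Qed.

(** On the whole line beta is -1, so an equivalence multiplies beta by 1, and therefore preserves J2
    = -4 mu. *)
Lemma slice_inv g (mu mu' : C) : gact g (baseM 10 E yA yB mu) (baseM 10 E yA yB mu') -> mu = mu'.
move=> [h [a [gh _ e]]].
have eI i : baseM 10 E yA yB mu' i = a i *: h (baseM 10 E yA yB mu i) by rewrite e ffunE.
have [c cE] := J_scale (isT : ~~ odd 10) (a i0) (a i1) gh.
have [c1 c2] := cE _ _ _ _ (eI i0) (eI i1).
have {}c1 := etrans (esym (slice_J1 mu')) (etrans c1 (congr1 (fun z => c * z) (slice_J1 mu))).
have {}c2 := etrans (esym (slice_J2 mu')) (etrans c2 (congr1 (fun z => c ^+ 2 * z) (slice_J2 mu))).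
have {}c1 : c = 1 by rewrite -[RHS]opprK c1; ring.
move: c2; rewrite c1 expr1n mul1r => /oppr_inj /eqP.
by rewrite -subr_eq0 -mulrnBl mulrn_eq0 /= subr_eq0 => /eqP ->.
Qed.

Definition L1s := @all_elems 10 E isT isT.
Definition L2s := @stab_elems 10 E isT isT (iota 0 3).

Lemma slice_checks : let y i v := (yA i v + 1 * yB i v)%ZZ in
 let Al := kept 10 E (fun _ _ => false) in let AlK := kept 10 E (kl_OG 3) in
 [&& suppck 10 E (kl_OG 3) yA, suppck 10 E (kl_OG 3) yB,
   spanck (size Al) (mrows Al L1s y yB) & spanck (size AlK) (mrows AlK L2s y yB)].
by_vm. Qed.

Theorem qh_OG3_10 : general_zero_locus (OG R 3 10) E quasi_homogeneous.
have /and4P[s1 s2 s3 s4] := slice_checks.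
have /andP[ok2 st2] := @stab_elems_ok 10 E isT isT (iota 0 3).
have km : (3 <= 10./2)%N by [].
have lab : all (lab_ok 10) E by [].
apply: (@qh_model R 10 E 3 (OG R 3 10) _ _ (@wid_inj 3 10 km) (kl_OG 3) (iota 0 3)
 (inb_OG km) _ _ _ _ _ L1s L2s yA yB 1%ZZ 1%ZZ 1 (@all_elems_ok 10 E isT isT) ok2 st2 s1 s2 _ _ s3 s4).
- by move=> i; apply: label_okbP; apply: (all_labels lab).
- by move=> g h gh U; apply: (OG_cpair gh).
- by [].
- exact: OG_Ucoord.
- by apply: vanish_OG.
- exact: oner_neq0.
by move=> g mu mu' _ _ /slice_inv ->.
Qed.
End Slice.

(** * Dickson's lemma and Hilbert's basis theorem *)

Section Dickson.
Variable n : nat.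

(** Successive indices are chosen where u attains its minimum over a tail. *)
Lemma nat_seq_mono (u : nat -> nat) : exists g : nat -> nat,
 (forall i j, (i < j)%N -> (g i < g j)%N) /\ forall i j, (i <= j)%N -> (u (g i) <= u (g j))%N.
have /choice[h hP] : forall N, exists p, (N <= p)%N /\ forall q, (N <= q)%N -> (u p <= u q)%N.
 move=> N; have : exists v, `[< exists2 p, (N <= p)%N & u p = v >].
  by exists (u N); apply/asboolP; exists N.
 move=> ex; case: (ex_minnP ex) => v /asboolP[p Np <-] vmin; exists p; split=> // q Nq.
 by apply: vmin; apply/asboolP; exists q.
pose g := fix g i := if i is i'.+1 then h (g i').+1 else h 0%N.
have gS i : (g i < g i.+1)%N by case: (hP (g i).+1).
have glt i j : (i < j)%N -> (g i < g j)%N.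
 elim: j => // j IH; rewrite ltnS leq_eqVlt => /orP[/eqP ->|/IH lt]; first exact: gS.
 exact: ltn_trans (gS j).
exists g; split=> // i j; rewrite leq_eqVlt => /orP[/eqP -> //|/glt lt].
case: i lt => [|i] lt; first by case: (hP 0%N) => _; apply.
case: (hP (g i).+1) => _; apply; exact: leq_ltn_trans (ltnW (gS i)) lt.
Qed.

Lemma mnm_seq_mono (f : nat -> 'X_{1..n}) : exists g : nat -> nat,
 (forall i j, (i < j)%N -> (g i < g j)%N) /\ forall i j, (i <= j)%N -> (f (g i) <= f (g j))%MM.
suff /(_ n)[g [g1 g2]] : forall k, exists g : nat -> nat, (forall i j, (i < j)%N -> (g i < g j)%N) /\
  forall i j (c : 'I_n), (c < k)%N -> (i <= j)%N -> (f (g i) c <= f (g j) c)%N.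
 by exists g; split=> // i j ij; apply/mnm_lepP => c; apply: g2.
elim=> [|k [g [g1 g2]]]; first by exists id.
case: (ltnP k n) => [kn|nk]; last first.
 by exists g; split=> // i j c _; apply: g2; apply: leq_trans nk.
have [h [h1 h2]] := nat_seq_mono (fun i => f (g i) (Ordinal kn)).
have hle i j : (i <= j)%N -> (h i <= h j)%N by rewrite leq_eqVlt => /orP[/eqP -> //|/h1/ltnW].
exists (g \o h); split=> [i j /h1/g1 //|i j c ck ij] /=.
move: ck; rewrite ltnS leq_eqVlt => /orP[/eqP ck|ck]; last by apply: g2 => //; apply: hle.
by have -> : c = Ordinal kn; [apply/val_inj|apply: h2].
Qed.

Lemma dickson (P : 'X_{1..n} -> Prop) : exists l : seq 'X_{1..n},
 (forall m, m \in l -> P m) /\ forall m, P m -> exists2 m', m' \in l & (m' <= m)%MM.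
apply: contrapT => H.
have /choice[next nP] : forall l : seq 'X_{1..n}, exists m, (forall m', m' \in l -> P m') ->
  P m /\ forall m', m' \in l -> ~~ (m' <= m)%MM.
 move=> l; apply: contrapT => H'; apply: H; exists l; split=> [m ml|m Pm]; apply: contrapT => K.
  by apply: H'; exists 0%MM => h; case: K; apply: h.
 apply: H'; exists m => _; split=> // m' m'l; apply/negP => le; apply: K.
 by exists m'.
pose L := fix L i := if i is i'.+1 then rcons (L i') (next (L i')) else [::].
have LP i m : m \in L i -> P m.
 elim: i m => //= i IH m; rewrite mem_rcons inE => /orP[/eqP ->|/IH //].
 by case: (nP (L i)).
have Lin i j : (i < j)%N -> next (L i) \in L j.
 elim: j => // j IH; rewrite ltnS leq_eqVlt => /orP[/eqP ->|/IH h] /=; rewrite mem_rcons inE ?eqxx //.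
 by rewrite h orbT.
have [g [g1 g2]] := mnm_seq_mono (fun i => next (L i)).
case: (nP (L (g 1%N))) => [m|_ /(_ _ (Lin _ _ (g1 0%N 1%N isT)))/negP]; first exact: LP.
by apply; apply: g2.
Qed.
End Dickson.

Theorem hilbert_basis (F : numFieldType) (n : nat) (S : {mpoly F[n]} -> Prop) :
 exists l : seq {mpoly F[n]}, (forall p, p \in l -> S p) /\
  forall x, (forall p, p \in l -> p.@[x] = 0) -> forall p, S p -> p.@[x] = 0.
pose J (p : {mpoly F[n]}) := exists l : seq {mpoly F[n]}, (forall q, q \in l -> S q) /\
 forall x, (forall q, q \in l -> q.@[x] = 0) -> p.@[x] = 0.
have [lm [lmP lmD]] := dickson (fun m => exists p, [/\ J p, p != 0 & mlead p = m]).
have /choice[rep repP] : forall m, exists p, m \in lm -> [/\ J p, p != 0 & mlead p = m].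
 move=> m; case: (boolP (m \in lm)) => h; last by exists 0.
 by have [p hp] := lmP m h; exists p.
have van x : (forall m, m \in lm -> (rep m).@[x] = 0) -> forall p, J p -> p.@[x] = 0.
 move=> xz p; have [m mp] : exists m, mlead p = m by exists (mlead p).
 elim/(well_founded_ind (@ltom_wf n)): m p mp => m IH p mp Jp.
 have [->|p0] := eqVneq p 0; first by rewrite meval0.
 have [m' m'l m'm] := lmD m (ex_intro _ p (And3 Jp p0 mp)).
 have [Jq q0 mq] := repP m' m'l; set q := rep m' in Jq q0 mq.
 pose c := mleadc p / mleadc q; pose r := p - c *: ('X_[m - m'] * q).
 have xq : ('X_[m - m'] * q).@[x] = 0 by rewrite mevalM /q xz // mulr0.
 suff : r.@[x] = 0 by rewrite mevalB mevalZ xq mulr0 subr0.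
 have Jr : J r.
  have [l1 [l1S l1v]] := Jp; have [l2 [l2S l2v]] := Jq.
  exists (l1 ++ l2); split=> [t|y yz]; first by rewrite mem_cat => /orP[/l1S|/l2S].
  rewrite mevalB mevalZ mevalM l1v ?l2v ?mulr0 ?subr0 // => t tl; apply: yz; rewrite mem_cat tl ?orbT //.
 have cX : mleadc ('X_[m - m'] : {mpoly F[n]}) = 1 by rewrite mleadXm mcoeffX eqxx.
 have lXq : mlead ('X_[m - m'] * q) = m.
  rewrite mleadM_proper; last by rewrite cX mul1r mleadc_eq0.
  by rewrite mleadXm mq submK.
 have [->|r0] := eqVneq r 0; first by rewrite meval0.
 apply: (IH (mlead r)) => //.
 have le : (mlead r <= m)%O.
  apply: le_trans (mleadB_le _ _) _; rewrite leUx mp lexx /=.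
  by apply: le_trans (mleadZ_le _ _) _; rewrite lXq.
 rewrite lt_neqAle le andbT; apply/eqP => rm; move/eqP: r0; apply; apply/eqP.
 rewrite -mleadc_eq0 rm mcoeffB mcoeffZ -{2}lXq mleadcM_proper ?cX ?mul1r ?mleadc_eq0 //.
 by rewrite -mp /c divfK ?subrr // mleadc_eq0.
have /choice[ls lsP] : forall m, exists l : seq {mpoly F[n]}, m \in lm -> (forall q, q \in l -> S q) /\
  forall x, (forall q, q \in l -> q.@[x] = 0) -> (rep m).@[x] = 0.
 move=> m; case: (boolP (m \in lm)) => h; last by exists [::].
 by have [[l hl] _ _] := repP m h; exists l.
exists (flatten [seq ls m | m <- lm]); split=> [p /flatten_mapP[m /lsP[h _] /h]//|x xz p Sp].
apply: van.
 move=> m ml; have [_ h] := lsP m ml; apply: h => q qm; apply: xz; apply/flatten_mapP.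
 by exists m.
by exists [:: p]; split=> [q|y h]; [rewrite inE => /eqP ->|apply: h; rewrite inE].
Qed.

(** * Dependencies obtained by counting monomials *)

Section Counting.
Variable F : numFieldType.

Lemma linear_dependency (I K : finType) (M : I -> K -> F) : (#|K| < #|I|)%N ->
 exists c : I -> F, (exists i, c i != 0) /\ forall l, \sum_i c i * M i l = 0.
move=> KI; pose A := \matrix_(i < #|I|, l < #|K|) M (enum_val i) (enum_val l).
have : kermx A != 0.
 by rewrite kermx_eq0 /row_free neq_ltn (leq_ltn_trans (rank_leq_col _) KI).
move=> /rowV0Pn[v /sub_kermxP vA v0].
exists (fun i => v 0 (enum_rank i)); split.
 apply: contrapT => H; case/eqP: v0; apply/rowP => j; rewrite mxE.
 apply/eqP; apply: contraT => vj; case: H; exists (enum_val j); by rewrite enum_valK.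
move=> l; have /matrixP/(_ 0 (enum_rank l)) := vA; rewrite !mxE => e0; rewrite -[RHS]e0.
rewrite [RHS](reindex (@enum_rank I)) /=; last exact: onW_bij (enum_rank_bij _).
by apply: eq_bigr => i _; rewrite mxE !enum_rankK.
Qed.

Definition lin_indep (T : Type) (P : T -> Prop) (I : finType) (f : I -> T -> F) : Prop :=
 forall c : I -> F, (forall x, P x -> \sum_i c i * f i x = 0) -> forall i, c i = 0.

Lemma card_box (n b : nat) : #|{ffun 'I_n -> 'I_b}| = (b ^ n)%N.
by rewrite card_ffun !card_ord. Qed.

Definition boxm (n b : nat) (al : {ffun 'I_n -> 'I_b}) : 'X_{1..n} := [multinom (al i : nat) | i < n].

Lemma boxm_inj n b : injective (@boxm n b).
move=> al be /mnmP e; apply/ffunP => i; have := e i.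
by rewrite !mnmE => /val_inj.
Qed.

Lemma mpoly_box (n b : nat) (p : {mpoly F[n]}) : (msize p <= b)%N ->
 p = \sum_(al : {ffun 'I_n -> 'I_b}) p@_(boxm al) *: 'X_[boxm al].
move=> pb; apply/mpolyP => m; rewrite raddf_sum /=.
under eq_bigr => al _ do rewrite mcoeffZ mcoeffX.
case: (pselect (exists al : {ffun 'I_n -> 'I_b}, boxm al = m)) => [[al <-]|H].
 rewrite (bigD1 al) //= eqxx mulr1 big1 ?addr0 // => be /negPf ne.
 by rewrite (inj_eq (@boxm_inj n b)) ne mulr0.
rewrite big1 => [|al _]; last by case: eqP => [e|]; rewrite ?mulr0 //; case: H; exists al.
apply: memN_msupp_eq0; apply/negP => /msize_mdeg_lt mp; apply: H.
have mb i : (m i < b)%N.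
 apply: leq_trans pb; apply: leq_ltn_trans mp; rewrite mdegE (bigD1 i) //=; exact: leq_addr.
exists [ffun i => Ordinal (mb i)]; apply/mnmP => i; by rewrite mnmE ffunE.
Qed.

Lemma msizeM_lt (n a b : nat) (p q : {mpoly F[n]}) : (msize p <= a.+1)%N -> (msize q <= b.+1)%N ->
 (msize (p * q) <= (a + b).+1)%N.
move=> pa qb; have [->|p0] := eqVneq p 0; first by rewrite mul0r msize0.
have [->|q0] := eqVneq q 0; first by rewrite mulr0 msize0.
rewrite msizeM //; move: pa qb; move: (msize p) (msize q) => x y; lia.
Qed.

Lemma msizeX_lt (n a e : nat) (p : {mpoly F[n]}) : (msize p <= a.+1)%N -> (msize (p ^+ e) <= (e * a).+1)%N.
move=> pa; elim: e => [|e IH]; first by rewrite expr0 msize1.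
by rewrite exprS mulSn; apply: msizeM_lt.
Qed.

Lemma msize_prod_lt (n a : nat) (I : Type) (s : seq I) (p : I -> {mpoly F[n]}) :
 (forall i, (msize (p i) <= a.+1)%N) -> (msize (\prod_(i <- s) p i) <= (size s * a).+1)%N.
move=> pa; elim: s => [|i s IH]; first by rewrite big_nil msize1.
by rewrite big_cons mulSn; apply: msizeM_lt.
Qed.

Lemma power_gt (n N a : nat) : (n < N)%N -> exists j, (0 < j)%N /\ ((j * a.+1) ^ n < j ^ N)%N.
move=> nN; exists (a.+1 ^ n).+1; split=> //; rewrite expnMn.
have -> : N = (n + (N - n))%N by rewrite subnKC // ltnW.
rewrite expnD ltn_pmul2l ?expn_gt0 //.
have : (0 < N - n)%N by rewrite subn_gt0.
case: (N - n)%N => // q _; rewrite expnS; apply: leq_pmulr; by rewrite expn_gt0.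
Qed.

(** The j^N monomials in the components of G with exponents below j lie in a space of dimension (j
    (N b + 1))^n, which is smaller for large j because n < N. *)
Theorem poly_dependency (n N : nat) (G : N.-tuple {mpoly F[n]}) : (n < N)%N ->
 exists2 f : {mpoly F[N]}, f != 0 & f \mPo G = 0.
move=> nN.
have [b Gb] : exists b, forall j, (msize (tnth G j) <= b.+1)%N.
 exists (\max_j msize (tnth G j))%N => j; apply: leq_trans (leqnSn _); exact: leq_bigmax.
have [j [j0 jN]] := power_gt (N * b) nN.
pose Ga (al : {ffun 'I_N -> 'I_j}) : {mpoly F[n]} := \prod_i (tnth G i) ^+ (al i).
have Gs al : (msize (Ga al) <= j * (N * b).+1)%N.
 have := @msize_prod_lt n (j * b) _ (enum 'I_N) (fun i => (tnth G i) ^+ al i).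
 rewrite big_enum /= -/(Ga al) size_enum_ord => h; apply: leq_trans (h _) _ => [i|].
  apply: leq_trans (msizeX_lt _ (Gb i)) _; rewrite ltnS leq_mul2r ltnW ?orbT //.
 by rewrite mulnS mulnCA -[X in (X <= _)%N]addn1 addnC leq_add2r.
have [] := @linear_dependency {ffun 'I_N -> 'I_j} {ffun 'I_n -> 'I_(j * (N * b).+1)}
 (fun al be => (Ga al)@_(boxm be)); first by rewrite !card_box.
move=> c [[al cal] cM]; exists (\sum_al c al *: 'X_[boxm al]).
 apply/eqP => /mpolyP/(_ (boxm al)); rewrite mcoeff0 raddf_sum /=.
 rewrite (bigD1 al) //= mcoeffZ mcoeffX eqxx mulr1 big1 ?addr0 => [|be /negPf ne].
  by move/eqP; apply/negP.
 by rewrite mcoeffZ mcoeffX (inj_eq (@boxm_inj _ _)) ne mulr0.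
rewrite raddf_sum /=.
have -> : \sum_i ((c i *: 'X_[boxm i]) \mPo G) = \sum_i c i *: Ga i.
 apply: eq_bigr => be _; rewrite comp_mpolyZ; congr (_ *: _).
 rewrite comp_mpolyX /Ga; apply: eq_bigr => i _; by rewrite mnmE.
have sz : (msize (\sum_i c i *: Ga i) <= j * (N * b).+1)%N.
 apply: leq_trans (msize_sum _ _ _) _; apply/bigmax_leqP => i _.
 exact: leq_trans (msizeZ_le _ _) (Gs i).
rewrite (mpoly_box sz) big1 // => be _; rewrite raddf_sum /=.
by under eq_bigr => i _ do rewrite mcoeffZ; rewrite cM scale0r.
Qed.
End Counting.

Section PolyMatrices.
Variable F : numFieldType.
Variable n : nat.

Lemma deriv_bigsum (I : Type) (s : seq I) (f : I -> {poly F}) :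
 (\sum_(i <- s) f i)^`() = \sum_(i <- s) (f i)^`().
exact: raddf_sum. Qed.

Lemma mpf_det (p : nat) (A : ('I_n -> F) -> 'M[F]_p) :
 (forall i j, mpf (fun x => A x i j)) -> mpf (fun x => \det (A x)).
move=> Ap; apply: mpfE (fun x => erefl _) _; apply: mpf_sum => s.
by apply: mpfM; [exact: mpfC|apply: mpf_prod => i; apply: Ap].
Qed.

Lemma mpfMx (p q r : nat) (A : ('I_n -> F) -> 'M[F]_(p, q)) (B : ('I_n -> F) -> 'M[F]_(q, r)) :
 (forall i j, mpf (fun x => A x i j)) -> (forall i j, mpf (fun x => B x i j)) ->
 forall i j, mpf (fun x => (A x *m B x) i j).
move=> Ap Bp i j; apply: mpfE (fun=> mxE _ _ _ _) _.
by apply: mpf_sum => l; apply: mpfM.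
Qed.

Lemma mpf_tuple (r : nat) (f : 'I_r -> ('I_n -> F) -> F) : (forall j, mpf (f j)) ->
 exists G : r.-tuple {mpoly F[n]}, forall j x, (tnth G j).@[x] = f j x.
move=> fp; have /fin_all_exists[g gE] : forall j, exists p : {mpoly F[n]}, forall x, f j x = p.@[x] by [].
by exists (mktuple g) => j x; rewrite tnth_mktuple gE.
Qed.

Lemma mprod_neq0 (f g : ('I_n -> F) -> F) : mpf f -> mpf g ->
 (exists x, f x != 0) -> (exists x, g x != 0) -> exists x, f x != 0 /\ g x != 0.
move=> [p pE] [q qE] [x fx] [y gy].
have p0 : p != 0 by apply: contraNneq fx => p0; rewrite pE p0 meval0.
have q0 : q != 0 by apply: contraNneq gy => q0; rewrite qE q0 meval0.
have [z] := meval_neq0 (mulf_neq0 p0 q0); rewrite mevalM neqM => /andP[pz qz].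
by exists z; rewrite pE qE.
Qed.
End PolyMatrices.

(** * Zariski closure, irreducibility and dimension *)

Section Zariski.
Variables (R : realType) (k m : nat).
Notation C := (R[i]).
Notation Gr := (Gr R k m).
Notation poly := {mpoly C[plucker_dim k m]}.
Implicit Types (U W : Gr) (X Y Z D O : set Gr) (p q : poly).

Definition zv D p : Prop := forall U, D U -> p.@[plucker U] = 0.
Definition zcl D : set Gr := [set U | forall d p, p \is d.-homog -> zv D p -> p.@[plucker U] = 0].

Lemma zcl_sub D : D `<=` zcl D.
by move=> U DU d p _ ; apply. Qed.
Lemma zv_zcl D d p : p \is d.-homog -> zv D p -> zv (zcl D) p.
by move=> hp h U UD; apply: UD hp h. Qed.
Lemma zcl_min D E : D `<=` zcl E -> zcl D `<=` zcl E.
by move=> DE U UD d p hp pE; apply: (UD d p hp) => W /DE h; apply: h hp pE. Qed.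
Lemma zcl_mono D E : D `<=` E -> zcl D `<=` zcl E.
by move=> DE; apply: zcl_min => U /DE; apply: zcl_sub. Qed.

Lemma zclosed_inP X Z : zclosed_in X Z <-> Z `<=` X /\ X `&` zcl Z `<=` Z.
split=> [[S Sh ->]|[ZX Zc]].
 split=> [U [] //|U [XU UZ]]; split=> // p Sp; have [d pd] := Sh p Sp.
 by apply: (UZ d p pd) => W [_]; apply.
exists [set p | (exists d, p \is d.-homog) /\ zv Z p] => [p [] //|].
apply/seteqP; split=> U /=; first by move=> ZU; split=> [|p [_ h]]; [apply: ZX|apply: h].
by move=> [XU h]; apply: Zc; split=> // d p hp pZ; apply: h; split=> //; exists d.
Qed.

(** Phrased with forms so as to apply to arbitrary subsets: the families and slices below are not
    closed. *)
Definition irr D : Prop := D !=set0 /\ forall d e p q, p \is d.-homog -> q \is e.-homog ->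
 zv D (p * q) -> zv D p \/ zv D q.

Lemma zirreducibleP Z : zirreducible Z <-> irr Z.
split=> -[Z0 ZP]; split=> //.
 move=> d e p q hp hq pq.
 have cl (r : poly) f : r \is f.-homog -> zclosed_in Z [set U | Z U /\ r.@[plucker U] = 0].
  move=> hr; exists [set r] => [_ ->|]; first by exists f.
  by apply/seteqP; split=> U /= [ZU h]; [split=> // _ ->|split=> //; apply: h].
 case: (ZP _ _ (cl p d hp) (cl q e hq)) => [|E|E].
 - apply/seteqP; split=> U /= => [ZU|[][]//].
  by have := pq U ZU; rewrite mevalM => /eqP; rewrite mulf_eq0 => /orP[/eqP|/eqP] h; [left|right].
 - by left=> U; rewrite E => -[].
 - by right=> U; rewrite E => -[].
move=> Z1 Z2 [S1 h1 E1] [S2 h2 E2] E.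
apply: contrapT => /not_orP[n1 n2].
have ex (S : set poly) Z' : Z' = [set U | Z U /\ forall p, S p -> p.@[plucker U] = 0] -> Z <> Z' ->
  exists p U, [/\ S p, Z U & p.@[plucker U] <> 0].
 move=> -> ne; apply: contrapT => H; apply: ne; apply/seteqP; split=> U /= => [ZU|[]//].
 by split=> // p Sp; apply: contrapT => h; apply: H; exists p, U.
have [p [U [Sp ZU pU]]] := ex _ _ E1 n1; have [q [W [Sq ZW qW]]] := ex _ _ E2 n2.
have [d hp] := h1 p Sp; have [e hq] := h2 q Sq.
have pq : zv Z (p * q).
 move=> T; rewrite E mevalM => -[]; rewrite ?E1 ?E2 => -[_ h].
  by rewrite (h p) ?mul0r.
 by rewrite (h q) ?mulr0.
by case: (ZP d e p q hp hq pq) => h; [case: pU; apply: h|case: qW; apply: h].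
Qed.

Lemma irr_zcl D : irr D -> irr (zcl D).
move=> [[U DU] h]; split; first by exists U; apply: zcl_sub.
move=> d e p q hp hq pq; case: (h d e p q hp hq) => [W DW|hv|hv].
- exact: (pq W (zcl_sub DW)).
- by left; apply: (zv_zcl hp hv).
- by right; apply: (zv_zcl hq hv).
Qed.

Lemma irr_open D d p : irr D -> p \is d.-homog -> ~ zv D p ->
 irr [set U | D U /\ p.@[plucker U] != 0] /\ D `<=` zcl [set U | D U /\ p.@[plucker U] != 0].
move=> [D0 h] hp npD.
have key e (q : poly) : q \is e.-homog -> zv [set U | D U /\ p.@[plucker U] != 0] q -> zv D q.
 move=> hq qv; case: (h d e p q hp hq) => // U DU; rewrite mevalM.
 by have [->|pU] := eqVneq p.@[plucker U] 0; [rewrite mul0r|rewrite qv ?mulr0].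
split; last by move=> U DU e q hq /(key _ _ hq); apply.
split.
 apply: contrapT => H; apply: npD => U DU; apply/eqP; apply: contraT => pU.
 by case: H; exists U.
move=> e f q r hq hr qr; have hqr : q * r \is (e + f).-homog by apply: dhomogM.
have /(h e f q r hq hr)[hv|hv] := key _ _ hqr qr; [left|right] => U [DU _]; exact: hv.
Qed.

Lemma zcl_setU D E : zcl (D `|` E) `<=` zcl D `|` zcl E.
move=> U h; apply: contrapT => /not_orP[nD nE].
have [d [p [hp pD pU]]] : exists d p, [/\ p \is d.-homog, zv D p & p.@[plucker U] <> 0].
 by apply: contrapT => H; apply: nD => d p hp pD; apply: contrapT => h'; apply: H; exists d, p.
have [e [q [hq qE qU]]] : exists d p, [/\ p \is d.-homog, zv E p & p.@[plucker U] <> 0].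
 by apply: contrapT => H; apply: nE => d' p' hp' pD'; apply: contrapT => h'; apply: H; exists d', p'.
have hpq : p * q \is (d + e).-homog by apply: dhomogM.
have : (p * q).@[plucker U] = 0.
 by apply: (h _ _ hpq) => W [/pD|/qE] w; rewrite mevalM w ?mul0r ?mulr0.
by rewrite mevalM => /eqP; rewrite mulf_eq0 => /orP[/eqP|/eqP].
Qed.

Lemma irr_sub_setU Z D E : irr Z -> Z `<=` zcl D `|` zcl E -> Z `<=` zcl D \/ Z `<=` zcl E.
move=> [_ h] ZDE; apply: contrapT => /not_orP[nD nE].
have ex S : ~ Z `<=` zcl S -> exists d p, [/\ p \is d.-homog, zv S p & ~ zv Z p].
 move=> ns; apply: contrapT => H; apply: ns => U ZU d p hp pS; apply: contrapT => pU.
 by apply: H; exists d, p; split=> // /(_ U ZU).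
have [d [p [hp pD pZ]]] := ex _ nD; have [e [q [hq qE qZ]]] := ex _ nE.
case: (h d e p q hp hq) => // U /ZDE[/(_ _ _ hp pD)|/(_ _ _ hq qE)] w; rewrite mevalM w ?mul0r ?mulr0 //.
Qed.

Lemma zcl_dcc (Xs : nat -> set Gr) : (forall i, zcl (Xs i) `<=` Xs i) ->
 (forall i, Xs i.+1 `<=` Xs i) -> exists N, forall i, (N <= i)%N -> Xs i = Xs N.
move=> Xcl Xd.
have Xle i j : (i <= j)%N -> Xs j `<=` Xs i.
 elim: j => [|j IH]; first by rewrite leqn0 => /eqP ->.
 by rewrite leq_eqVlt => /orP[/eqP -> //|]; rewrite ltnS => /IH h U /Xd/h.
have [l [lP lV]] := hilbert_basis (fun p : poly => exists d i, p \is d.-homog /\ zv (Xs i) p).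
have [N NP] : exists N, forall p, p \in l -> zv (Xs N) p.
 elim: l lP {lV} => [|p l IH] lP; first by exists 0%N.
 have [N NP] : exists N, forall p, p \in l -> zv (Xs N) p.
  by apply: IH => q ql; apply: lP; rewrite inE ql orbT.
 have [d [i [_ pi]]] := lP p (mem_head _ _).
 exists (maxn N i) => q; rewrite inE => /orP[/eqP ->|/NP h] U UX.
  by apply: pi; apply: Xle UX; apply: leq_maxr.
 by apply: h; apply: Xle UX; apply: leq_maxl.
exists N => i Ni; apply/seteqP; split; first exact: Xle.
move=> U UN; apply: Xcl => d p hp pX; apply: (lV (plucker U)) => [q ql|]; first exact: NP.
by exists d, i.
Qed.

(** Noetherian induction: a closed set that is not a finite union of irreducible ones properly
    contains another such set, and iterating contradicts the descending chain condition. *)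
Lemma irr_decomposition X : zcl X `<=` X -> exists l : seq (set Gr),
 (forall i, (i < size l)%N -> irr (nth set0 l i) /\ zcl (nth set0 l i) `<=` nth set0 l i) /\
 X = [set U | exists2 i, (i < size l)%N & nth set0 l i U].
move=> Xc; apply: contrapT => nX.
pose good Y := exists l : seq (set Gr),
 (forall i, (i < size l)%N -> irr (nth set0 l i) /\ zcl (nth set0 l i) `<=` nth set0 l i) /\
 Y = [set U | exists2 i, (i < size l)%N & nth set0 l i U].
have step Y : exists Y', zcl Y `<=` Y -> ~ good Y ->
  [/\ zcl Y' `<=` Y', ~ good Y', Y' `<=` Y & Y' <> Y].
 case: (pselect (good Y)) => [gY|nY]; first by exists Y.
 have [Y0|Y0] := pselect (Y !=set0); last first.
  exists Y; case: nY; exists [::]; split=> //; apply/seteqP; split=> U; last by case.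
  by move=> YU; case: Y0; exists U.
 case: (pselect (irr Y)) => [iY|niY].
  exists Y => Yc; case: nY; exists [:: Y]; split=> [[|]//|]; apply/seteqP; split=> U /=.
   by move=> YU; exists 0%N.
  by move=> [[|]].
 have [d [e [p [q [hp hq pq [np nq]]]]]] : exists d e p q, [/\ p \is d.-homog, q \is e.-homog,
   zv Y (p * q) & ~ zv Y p /\ ~ zv Y q].
  apply: contrapT => H; apply: niY; split=> // d e p q hp hq pq.
  apply: contrapT => /not_orP np; apply: H; by exists d, e, p, q.
 have cl (r : poly) f : r \is f.-homog -> zcl Y `<=` Y ->
   zcl [set U | Y U /\ r.@[plucker U] = 0] `<=` [set U | Y U /\ r.@[plucker U] = 0].
  move=> hr Yc U h; split; last by apply: (h f r hr) => W [].
  by apply: Yc; apply: zcl_mono h => W [].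
 case: (pselect (good [set U | Y U /\ p.@[plucker U] = 0])) => g1; last first.
  exists [set U | Y U /\ p.@[plucker U] = 0] => Yc _; split=> //; first exact: cl hp Yc.
   by move=> U [].
  by move=> E; apply: np => U; rewrite -E => -[].
 case: (pselect (good [set U | Y U /\ q.@[plucker U] = 0])) => g2; last first.
  exists [set U | Y U /\ q.@[plucker U] = 0] => Yc _; split=> //; first exact: cl hq Yc.
   by move=> U [].
  by move=> E; apply: nq => U; rewrite -E => -[].
 case: nY; have [l1 [h1 E1]] := g1; have [l2 [h2 E2]] := g2.
 exists (l1 ++ l2); split.
  move=> i; rewrite size_cat nth_cat; case: (ltnP i (size l1)) => [i1 _|i1 i2]; first exact: h1.
  by apply: h2; rewrite ltn_subLR.
 apply/seteqP; split=> U /=.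
  move=> YU; have := pq U YU; rewrite mevalM => /eqP; rewrite mulf_eq0 => /orP[]/eqP h.
   have : [set U | Y U /\ p.@[plucker U] = 0] U by [].
   by rewrite E1 => -[i i1 iU]; exists i; rewrite ?size_cat ?nth_cat ?i1 // ltn_addr.
  have : [set U | Y U /\ q.@[plucker U] = 0] U by [].
  rewrite E2 => -[i i1 iU]; exists (size l1 + i)%N; first by rewrite size_cat ltn_add2l.
  by rewrite nth_cat ltnNge leq_addr /= addKn.
 case=> i; rewrite size_cat nth_cat; case: (ltnP i (size l1)) => [i1 _ iU|i1 i2 iU].
  have : [set U | Y U /\ p.@[plucker U] = 0] U by rewrite E1; exists i.
  by case.
 have : [set U | Y U /\ q.@[plucker U] = 0] U.
  by rewrite E2; exists (i - size l1)%N => //; rewrite ltn_subLR.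
 by case.
have /choice[f fP] := step.
pose Xs := fix Xs i := if i is i'.+1 then f (Xs i') else X.
have XsP i : zcl (Xs i) `<=` Xs i /\ ~ good (Xs i).
 by elim: i => //= i [h1 h2]; have [] := fP _ h1 h2.
have [|N NP] := zcl_dcc (fun i => (XsP i).1).
 by move=> i; have [h1 h2] := XsP i; have [_ _] := fP _ h1 h2.
have [h1 h2] := XsP N; have [_ _ _] := fP _ h1 h2; apply.
exact: (NP N.+1 (leqnSn N)).
Qed.

(** X is a finite union of irreducible closed sets. The product of forms that vanish on those not
    inside Z, but not on Z, cuts out an open subset of X contained in Z. *)
Lemma component_open X Z : zcl X `<=` X -> irr Z -> zcl Z `<=` Z -> Z `<=` X ->
 (forall Y, irr Y -> zcl Y `<=` Y -> Z `<=` Y -> Y `<=` X -> Y `<=` Z) ->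
 exists d p, [/\ p \is d.-homog, ~ zv Z p & forall U, X U -> p.@[plucker U] != 0 -> Z U].
move=> Xc iZ Zc ZX Zmax; have [l [lP lE]] := irr_decomposition Xc.
have lX i : (i < size l)%N -> nth set0 l i `<=` X by move=> il U h; rewrite lE; exists i.
suff [d [p [hp npZ pl]]] : exists d p, [/\ p \is d.-homog, ~ zv Z p &
  forall i, (i < size l)%N -> ~ nth set0 l i `<=` Z -> zv (nth set0 l i) p].
 exists d, p; split=> // U; rewrite lE => -[i il iU] pU.
 case: (pselect (nth set0 l i `<=` Z)) => [|ni]; first exact.
 by rewrite (pl i il ni U iU) eqxx in pU.
have {lE} : forall i, (i < size l)%N -> ~ nth set0 l i `<=` Z -> ~ Z `<=` nth set0 l i.
 move=> i il ni Zi; apply: ni; have [h1 h2] := lP i il; exact: Zmax (lX i il).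
elim: l lP {lX} => [|Y l IH] lP nZ.
 exists 0%N, 1; split=> //; first exact: dhomog1.
 by have [[U ZU] _] := iZ; move=> /(_ U ZU)/eqP; rewrite meval1 oner_eq0.
have [||d [p [hp np pl]]] := IH; first by move=> i il; apply: (lP i.+1).
 by move=> i il; apply: (nZ i.+1).
case: (pselect (Y `<=` Z)) => [YZ|nYZ].
 by exists d, p; split=> // -[|i]; [move=> _ /(_ YZ)|exact: pl].
have [iY Yc] := lP 0%N isT; have nZY := nZ 0%N isT nYZ.
have [e [q [hq qY nq]]] : exists e q, [/\ q \is e.-homog, zv Y q & ~ zv Z q].
 apply: contrapT => H; apply: nZY => U ZU; apply: Yc => e q hq qY.
 apply: contrapT => h; apply: H; exists e, q; split=> // /(_ U ZU); exact: h.
exists (d + e)%N, (p * q); split; first exact: dhomogM.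
 by case: iZ => _ h /(h _ _ _ _ hp hq)[].
by move=> [|i] il ni U YU; rewrite mevalM ?(qY U YU) ?(pl i il ni U YU) ?mulr0 ?mul0r.
Qed.

Lemma quasi_compact X (I : Type) (i0 : I) (Os : I -> set Gr) : (forall i, zopen_in X (Os i)) ->
 exists l : seq I, forall i, Os i `<=` [set U | exists2 j, (j < size l)%N & Os (nth i0 l j) U].
move=> Oop.
have [l [lP lV]] := hilbert_basis (fun p : poly => exists d i, p \is d.-homog /\
 forall W, X W -> p.@[plucker W] != 0 -> Os i W).
have [s sP] : exists s : seq I, forall p, p \in l -> forall W, X W -> p.@[plucker W] != 0 ->
  exists2 j, (j < size s)%N & Os (nth i0 s j) W.
 elim: l lP {lV} => [|p l IH] lP; first by exists [::].
 have [s sP] := IH (fun q ql => lP q (@mem_behead _ (p :: l) q ql)).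
 have [d [i [_ pi]]] := lP p (mem_head _ _).
 exists (i :: s) => q; rewrite inE => /orP[/eqP ->|/sP h] W XW qW.
  by exists 0%N => //; apply: pi.
 by have [j js jW] := h W XW qW; exists j.+1.
exists s => i U iU /=; have [OX /(_ U iU)[d [p [hp pU pO]]]] := (zopenP _ _).1 (Oop i).
apply: contrapT => H; move/eqP: pU; apply; apply: lV; last by exists d, i.
move=> q ql; apply/eqP; apply: contraT => qU; case: H; apply: (sP q) => //; exact: OX iU.
Qed.

Lemma irr_cancel D d e p q : irr D -> p \is d.-homog -> ~ zv D p -> q \is e.-homog ->
 zv D (p * q) -> zv D q.
by move=> [_ h] hp np hq /(h _ _ _ _ hp hq)[]. Qed.

Lemma dhomog_exp d n p : p \is d.-homog -> p ^+ n \is (n * d).-homog.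
move=> hp; elim: n => [|n IH]; first by rewrite expr0 dhomog1.
by rewrite exprS mulSn; apply: dhomogM.
Qed.

Lemma nzvX D d n p : irr D -> p \is d.-homog -> ~ zv D p -> ~ zv D (p ^+ n).
move=> iD hp np; elim: n => [|n IH].
 by have [[U DU] _] := iD; move=> /(_ U DU)/eqP; rewrite expr0 meval1 oner_eq0.
by rewrite exprS => /(irr_cancel iD hp np (dhomog_exp n hp)).
Qed.

Definition pev p U : C := p.@[plucker U].

Lemma mevalXn (n e : nat) (x : 'I_n -> C) (p : {mpoly C[n]}) : (p ^+ e).@[x] = p.@[x] ^+ e.
exact: rmorphXn. Qed.

Lemma degE (i j a b : nat) : (i <= j)%N ->
 (j * (b + a) = i * b + (b * (j - i) * 1 + j * a))%N.
by move=> ij; rewrite muln1 addnA (mulnC i) -(mulnDr b) subnKC // mulnDr (mulnC b). Qed.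

(** A lower bound for the growth of a Hilbert function. Take g vanishing on Z e but not on Z e.+1,
    and multiply the forms independent on Z e by the powers of g, padding degrees with powers of a
    linear form l. In a relation on Z e.+1 one cancels the lowest power of g and restricts to Z
    e. *)
Theorem chain_growth (e : nat) (Z : nat -> set Gr) :
 (forall i, (i <= e)%N -> irr (Z i)) ->
 (forall i, (i < e)%N -> Z i `<=` Z i.+1 /\
   exists d g, [/\ g \is d.-homog, zv (Z i) g & ~ zv (Z i.+1) g]) ->
 exists a : nat, forall j : nat, exists (I : finType) (p : I -> poly),
  [/\ #|I| = (j.+1 ^ e)%N, forall i, p i \is (j * a).-homog &
   lin_indep (Z e) (fun i => pev (p i))].
elim: e => [|e IH] Zi Zs.
 exists 0%N => j; exists unit, (fun=> 1); split=> [|i|c h [] ]; first by rewrite card_unit.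
  by rewrite muln0 dhomog1.
 have [[U ZU] _] := Zi 0%N isT; have := h U ZU.
 by rewrite (big_pred1 tt) => [|[]//]; rewrite /pev meval1 mulr1.
have [||a aP] := IH; first by move=> i ie; apply: Zi; rewrite leqW.
 by move=> i ie; apply: Zs; rewrite leqW.
have [ZZ [b [g [hg gZ gZ']]]] := Zs e (ltnSn e).
have iZ := Zi e (leqnSn e); have iZ' := Zi e.+1 (leqnn _).
have [U0 ZU0] := iZ.1; have [a0 pa0] := plucker_neq0 U0.
pose l : poly := 'X_a0.
have hl : l \is 1.-homog by rewrite dhomogX /= mdeg1.
have nl : ~ zv (Z e) l by move=> /(_ _ ZU0)/eqP; rewrite mevalXU; apply/negP.
exists (b + a)%N => j; have [I [p [cI hp ip]]] := aP j.
pose q (x : 'I_j.+1 * I) : poly := g ^+ x.1 * (l ^+ (b * (j - x.1)) * p x.2).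
have le1 (i : 'I_j.+1) : (i <= j)%N by rewrite -ltnS.
exists ('I_j.+1 * I)%type, q; split.
- by rewrite card_prod card_ord cI expnS.
- move=> [i x]; rewrite /q /=.
 have -> : (j * (b + a) = i * b + (b * (j - i) * 1 + j * a))%N.
  exact: degE.
 apply: dhomogM; first exact: dhomog_exp.
 by apply: dhomogM => //; apply: dhomog_exp.
move=> c h [i x]; have [t] := ubnP (i : nat); elim: t i x => // t IHt i x; rewrite ltnS => it.
have {}IHt (i' : 'I_j.+1) y : (i' < i)%N -> c (i', y) = 0 by move=> h'; apply: IHt; apply: leq_trans it.
(* The relation divided by g^i: the terms with lower powers of g are already known to vanish. *)
pose f : poly := \sum_(y : 'I_j.+1 * I | (i <= y.1)%N) c y *: (g ^+ (y.1 - i) * (l ^+ (b * (j - y.1)) * p y.2)).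
have hf : f \is (j * (b + a) - i * b).-homog.
 apply: rpred_sum => -[i' y] /= ii'; apply: rpredZ.
 have -> : (j * (b + a) - i * b = (i' - i) * b + (b * (j - i') * 1 + j * a))%N.
  by rewrite (degE _ _ (le1 i')) mulnBl -addnBAC // leq_mul2r ii' orbT.
 apply: dhomogM; first exact: dhomog_exp.
 by apply: dhomogM => //; apply: dhomog_exp.
have fZ' : zv (Z e.+1) f.
 refine (irr_cancel iZ' (dhomog_exp i hg) (nzvX (n := i) iZ' hg gZ') hf _) => U ZU.
 rewrite -(h U ZU) mevalM raddf_sum /= mulr_sumr [RHS](bigID (fun y : 'I_j.+1 * I => (i <= y.1)%N)) /=.
 rewrite [X in _ = _ + X]big1 ?addr0 => [|[i' y]]; last first.
  by rewrite -ltnNge => /IHt ->; rewrite mul0r.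
 apply: eq_bigr => -[i' y] /= ii'; rewrite /pev /q mevalZ !(mevalM, mevalXn) /= mulrCA; congr (_ * _).
 by rewrite [LHS]mulrA; congr (_ * _); rewrite -exprD subnKC.
have hs : \sum_y c (i, y) *: p y \is (j * a).-homog by apply: rpred_sum => y _; apply: rpredZ.
have sZ : zv (Z e) (\sum_y c (i, y) *: p y).
 refine (irr_cancel iZ (dhomog_exp (b * (j - i)) hl) (nzvX (n := (b * (j - i))%N) iZ hl nl) hs _) => U ZU.
 rewrite -(fZ' U (ZZ U ZU)) mevalM !raddf_sum /= mulr_sumr.
 rewrite [RHS](bigID (fun y : 'I_j.+1 * I => y.1 == i)) /= [X in _ = _ + X]big1 ?addr0 => [|[i' y] /= /andP[ii' ni]].
  rewrite [RHS](eq_bigl (fun y : 'I_j.+1 * I => (y.1 == i) && true)) => [|[i' y] /=]; last first.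
   by case: eqP => [->|]; rewrite ?leqnn ?andbF.
  pose F (i' : 'I_j.+1) y := (c (i', y) *: (g ^+ (i' - i) * (l ^+ (b * (j - i')) * p y))).@[plucker U].
  transitivity (\sum_(i' | i' == i) \sum_(y | true) F i' y); last first.
   by rewrite pair_big; apply: eq_bigr => -[].
  rewrite big_pred1_eq; apply: eq_bigr => y _.
  by rewrite /F !mevalZ mevalM mevalM subnn expr0 meval1 mul1r mulrCA.
 have : (0 < i' - i)%N by rewrite subn_gt0 ltn_neqAle ii' andbT eq_sym.
 rewrite mevalZ mevalM mevalXn gZ //.
 by case: (i' - i)%N => // ? _; rewrite exprS !mul0r mulr0.
apply: (ip (fun y => c (i, y)) _ x) => U ZU; have := sZ U ZU; rewrite raddf_sum /= => e0.
by rewrite -[RHS]e0; apply: eq_bigr => y _; rewrite mevalZ.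
Qed.

Lemma zv_neq D p : ~ zv D p -> exists2 U, D U & p.@[plucker U] != 0.
move=> H; apply: contrapT => H'; apply: H => U DU; apply/eqP; apply: contraT => pU.
by case: H'; exists U.
Qed.

Lemma zopen_neq X d p : p \is d.-homog -> zopen_in X [set U | X U /\ p.@[plucker U] != 0].
by move=> hp; apply/zopenP; split=> [U []//|U [XU pU]]; exists d, p. Qed.

Lemma sub_zclP X D E : D `<=` X -> E `<=` X ->
 D `<=` zcl E <-> forall O, zopen_in X O -> (D `&` O) !=set0 -> (E `&` O) !=set0.
move=> DX EX; split=> [DE O oO [U [DU OU]]|H U DU d p hp pE].
 have [_ /(_ U OU)[d [p [hp pU pO]]]] := (zopenP X O).1 oO.
 apply: contrapT => H; case/eqP: pU; apply: (DE U DU d p hp) => W EW.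
 apply/eqP; apply: contraT => pW; case: H; exists W; split=> //; exact: pO (EX W EW) pW.
apply/eqP; apply: contraT => pU.
have [|W [EW [_ /eqP]]] := H _ (zopen_neq X hp); first by exists U; split=> //; split=> //; apply: DX.
by rewrite pE.
Qed.

Lemma irr_openP X D : D `<=` X -> irr D <-> D !=set0 /\
 forall O1 O2, zopen_in X O1 -> zopen_in X O2 -> (D `&` O1) !=set0 -> (D `&` O2) !=set0 ->
  (D `&` (O1 `&` O2)) !=set0.
move=> DX; split=> [[D0 iD]|[D0 H]]; split=> //.
 move=> O1 O2 o1 o2 [U1 [D1 OU1]] [U2 [D2 OU2]].
 have [_ /(_ _ OU1)[d1 [p1 [h1 pU1 pO1]]]] := (zopenP X O1).1 o1.
 have [_ /(_ _ OU2)[d2 [p2 [h2 pU2 pO2]]]] := (zopenP X O2).1 o2.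
 apply: contrapT => H; case: (iD _ _ p1 p2 h1 h2) => [W DW|h|h]; last 2 first.
 - by case/eqP: pU1; apply: h.
 - by case/eqP: pU2; apply: h.
 rewrite mevalM; apply/eqP; apply: contraT; rewrite neqM => /andP[n1 n2].
 case: H; exists W; split=> //; split; [exact: pO1 (DX W DW) n1|exact: pO2 (DX W DW) n2].
move=> d e p q hp hq pq; case: (pselect (zv D p)) => [|np]; first by left.
right; apply: contrapT => nq.
have [U DU pU] := zv_neq np; have [V DV qV] := zv_neq nq.
have [||W [DW [[_ pW] [_ qW]]]] := H _ _ (zopen_neq X hp) (zopen_neq X hq).
- by exists U; split=> //; split=> //; apply: DX.
- by exists V; split=> //; split=> //; apply: DX.
by have /eqP := pq W DW; rewrite mevalM mulf_eq0 (negPf pW) (negPf qW).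
Qed.

Lemma irr_between D E : irr D -> D `<=` E -> E `<=` zcl D -> irr E.
move=> [[U DU] iD] DE ED; split; first by exists U; apply: DE.
move=> d e p q hp hq pq; have : zv D (p * q) by move=> W DW; apply/pq/DE.
by move=> /(iD d e p q hp hq)[] h; [left|right] => W /ED EW; [exact: EW hp h|exact: EW hq h].
Qed.

(** Chains of irreducible subsets that need not be closed, compared through their closures;
    [has_dimP] shows that they give the same dimension. *)
Definition echain X (e : nat) (D : nat -> set Gr) : Prop :=
 (forall i, (i <= e)%N -> irr (D i) /\ D i `<=` X) /\
 (forall i, (i < e)%N -> D i `<=` zcl (D i.+1) /\ ~ (D i.+1 `<=` zcl (D i))).

Lemma echain_sub X Y e (D : nat -> set Gr) : X `<=` Y -> echain X e D -> echain Y e D.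
move=> XY [h1 h2]; split=> // i /h1[iD DX]; split=> // U /DX; exact: XY.
Qed.

Lemma echain_zcl X e (D : nat -> set Gr) : zcl X `<=` X -> echain X e D -> echain X e (fun i => zcl (D i)).
move=> cX [h1 h2]; split=> i ie.
 have [iD DX] := h1 i ie; split; first exact: irr_zcl.
 by move=> U /(zcl_mono DX)/cX.
have [DD nD] := h2 i ie; split; first by move=> U /(zcl_min DD); apply: zcl_sub.
by move=> H; apply: nD => U /(@zcl_sub _)/H; apply: zcl_min.
Qed.

Lemma echain_cons X e (D : nat -> set Gr) E : echain X e D -> irr E -> E `<=` X -> D e `<=` zcl E ->
 ~ (E `<=` zcl (D e)) -> echain X e.+1 (fun i => if (i <= e)%N then D i else E).
move=> [h1 h2] iE EX DE nE; split=> i.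
 by rewrite leq_eqVlt => /predU1P[->|ie]; [rewrite ltnn|rewrite -ltnS ie; apply: h1; rewrite -ltnS].
rewrite ltnS => ie; rewrite ie; move: ie; rewrite leq_eqVlt => /predU1P[->|ie]; first by rewrite ltnn.
by rewrite ie; apply: h2.
Qed.

Lemma has_dimP X d : has_dim X d <->
 (exists D : nat -> set Gr, echain X d D) /\
 (forall e (D : nat -> set Gr), echain X e D -> (e <= d)%N).
have to_e e (Z : nat -> set Gr) : irreducible_chain X e Z -> echain X e Z.
 move=> [h1 h2]; split=> i ie.
  by have [/zclosed_inP[ZX _] /zirreducibleP iZ] := h1 i ie.
 have [ZZ nZ] := h2 i ie; split; first by move=> U /ZZ; apply: zcl_sub.
 have [/zclosed_inP[_ cZ] _] := h1 i (ltnW ie); have [/zclosed_inP[ZX _] _] := h1 i.+1 ie.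
 by move=> H; apply: nZ => U ZU; apply: cZ; split; [apply: ZX|apply: H].
have of_e e (D : nat -> set Gr) : echain X e D -> irreducible_chain X e (fun i => X `&` zcl (D i)).
 move=> [h1 h2]; split=> i ie.
  have [iD DX] := h1 i ie; split.
   apply/zclosed_inP; split=> [U []//|U [XU UZ]]; split=> //.
   by apply: (zcl_min (D := X `&` zcl (D i))) UZ => W [].
  apply/zirreducibleP; apply: (irr_between iD) => [U DU|U []//].
  by split; [apply: DX|apply: zcl_sub].
 have [DD nD] := h2 i ie; split; first by move=> U [XU UD]; split=> //; apply: zcl_min UD.
 have [_ DX] := h1 i.+1 ie.
 move=> H; apply: nD => U DU.
 by have [] := H U (conj (DX U DU) (@zcl_sub _ U DU)).
split=> -[[D hD] H]; split.
- by exists D; apply: to_e.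
- by move=> e E /of_e/H.
- by exists (fun i => X `&` zcl (D i)); apply: of_e.
- by move=> e Z /to_e/H.
Qed.

Lemma has_dim_set X Y d : (forall U, X U <-> Y U) -> has_dim X d -> has_dim Y d.
by move=> h; have -> : Y = X by apply/seteqP; split=> U /h. Qed.

Section Homeo.
Variables (X X' : set Gr) (f g : Gr -> Gr).
Hypotheses (fm : mor X X' f)
 (gm : mor X' X g)
 (fK : forall U, X U -> g (f U) = U)
 (gK : forall U, X' U -> f (g U) = U).

Lemma image_open O : zopen_in X O -> zopen_in X' (f @` O).
move=> oO; have OX := oO.1.
have -> : f @` O = [set W | X' W /\ O (g W)]; last exact: mor_zopen gm oO.
apply/seteqP; split=> W [].
 by move=> U OU <-; split; [apply: fm.1; apply: OX|rewrite fK //; apply: OX].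
by move=> XW OW; exists (g W) => //; apply: gK.
Qed.

Lemma image_irr D : D `<=` X -> irr D -> irr (f @` D).
move=> DX /(irr_openP DX)[[U DU] H]; apply/(irr_openP (X := X')).
 by move=> _ [W DW <-]; apply: fm.1; apply: DX.
split; first by exists (f U), U.
have pre O : zopen_in X' O -> ((f @` D) `&` O) !=set0 -> (D `&` [set U | X U /\ O (f U)]) !=set0.
 by move=> _ [_ [[W DW <-] OW]]; exists W; split=> //; split=> //; apply: DX.
move=> O1 O2 o1 o2 /(pre _ o1) n1 /(pre _ o2) n2.
have [W [DW [[_ O1W] [_ O2W]]]] := H _ _ (mor_zopen fm o1) (mor_zopen fm o2) n1 n2.
by exists (f W); split; [exists W|].
Qed.

Lemma image_sub_zcl D E : D `<=` X -> E `<=` X -> D `<=` zcl E -> f @` D `<=` zcl (f @` E).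
move=> DX EX /(sub_zclP DX EX) H; apply/(sub_zclP (X := X')).
- by move=> _ [W DW <-]; apply: fm.1; apply: DX.
- by move=> _ [W DW <-]; apply: fm.1; apply: EX.
move=> O oO [_ [[W DW <-] OW]].
have [|V [EV [_ OV]]] := H _ (mor_zopen fm oO); first by exists W; split=> //; split=> //; apply: DX.
by exists (f V); split=> //; exists V.
Qed.
End Homeo.

Lemma image_echain X X' f g A e (D : nat -> set Gr) : mor X X' f -> mor X' X g ->
 (forall U, X U -> g (f U) = U) -> (forall U, X' U -> f (g U) = U) ->
 A `<=` X -> echain A e D -> echain (f @` A) e (fun i => f @` D i).
move=> fm gm fK gK AX [h1 h2].
have DX i : (i <= e)%N -> D i `<=` X by move=> /h1[_ DA] U /DA/AX.
split=> i ie.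
 have [iD DA] := h1 i ie; split; first exact: (image_irr fm (DX i ie)).
 by move=> _ [U DU <-]; exists U => //; apply: DA.
have DXi := DX i (ltnW ie); have DXi' := DX _ ie; have [DD nD] := h2 i ie; split.
 exact: (image_sub_zcl fm DXi DXi').
have gf j : (j <= e)%N -> g @` (f @` D j) = D j.
 move=> /DX DXj; apply/seteqP; split=> [_ [_ [U DU <-] <-]|U DU]; first by rewrite fK //; apply: DXj.
 by exists (f U); [exists U|rewrite fK //; apply: DXj].
have fX j : (j <= e)%N -> f @` D j `<=` X' by move=> /DX DXj _ [U DU <-]; apply/fm.1/DXj.
move=> H; apply: nD; rewrite -(gf _ ie) -(gf _ (ltnW ie)).
exact: (image_sub_zcl gm (fX _ ie) (fX _ (ltnW ie))).
Qed.

Lemma image_has_dim X X' f g A d : mor X X' f -> mor X' X g ->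
 (forall U, X U -> g (f U) = U) -> (forall U, X' U -> f (g U) = U) ->
 A `<=` X -> has_dim A d -> has_dim (f @` A) d.
move=> fm gm fK gK AX /has_dimP[[D hD] H]; apply/has_dimP; split.
 by exists (fun i => f @` D i); apply: (image_echain fm gm fK gK AX hD).
move=> e E hE; apply: (H e (fun i => g @` E i)).
have fA : f @` A `<=` X' by move=> _ [U AU <-]; apply/fm.1/AX.
have := image_echain gm fm gK fK fA hE; congr echain; apply/seteqP; split=> [_ [_ [U AU <-] <-]|U AU].
 by rewrite fK //; apply: AX.
by exists (f U); [exists U|rewrite fK //; apply: AX].
Qed.

Lemma coh_gl (c : nat) X X' g : g \in unitmx -> (forall U, X U <-> X' (gla g U)) ->
 cohomogeneity_at_most c X -> cohomogeneity_at_most c X'.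
move=> ug XX' [c' [d [e [O [dX oO dO orb dE]]]] cc]; exists c' => //; subst d.
have ug' : invmx g \in unitmx by rewrite unitmx_inv.
have XX'' W : X' W <-> X (gla (invmx g) W) by rewrite XX' glKV.
have fm : mor X X' (gla g) by apply: gl_mor => // U /XX'.
have gm : mor X' X (gla (invmx g)) by apply: gl_mor => // U /XX''.
have fK U : X U -> gla (invmx g) (gla g U) = U by move=> _; rewrite gl_actK.
have gK U : X' U -> gla g (gla (invmx g) U) = U by move=> _; rewrite glKV.
have OX := oO.1.
exists (e + c')%N, e, (gla g @` O); split=> //.
- have -> : X' = gla g @` X; last exact: (image_has_dim fm gm fK gK).
 apply/seteqP; split=> [W /XX'' XW|_ [U /XX' XU <-]//].
 by exists (gla (invmx g) W) => //; apply: glKV.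
- exact: (image_open fm gm fK gK oO).
- move=> O1 o1 [W OW]; have [|U [[XU O1U] OU]] := dO _ (mor_zopen fm o1).
  by exists (gla (invmx g) W); split=> /=; [apply/XX''; apply: o1.1|rewrite glKV].
 by exists (gla g U); split=> //; exists U.
move=> _ [U OU <-]; have XU := OX U OU.
apply: (@has_dim_set (gla g @` aut_orbit X U)) => [W|]; last first.
 apply: (image_has_dim fm gm fK gK) (orb U OU) => W [f [[fX _] _] ->]; exact: fX.
rewrite (aut_orbit_gl ug XX' XU); split=> [[V AV <-]|AW]; first by rewrite gl_actK.
by exists (gla (invmx g) W) => //; apply: glKV.
Qed.

Lemma zcl_rgl b f D W : rgl b f -> (forall U, D U -> minor (bmx U) b != 0 -> f U = 0) ->
 zcl D W -> minor (bmx W) b != 0 -> f W = 0.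
move=> [d [F [hF E]]] fD DW bW.
have : (F * 'X_(enum_rank b)).@[plucker W] = 0.
 apply: (DW (d + 1)%N); first by apply: dhomogM => //; exact: Xb_homog.
 move=> U DU; rewrite mevalM mevalXb; have [->|bU] := eqVneq (minor (bmx U) b) 0; first by rewrite mulr0.
 have := fD U DU bU; rewrite E // => /eqP; rewrite mulf_eq0 invr_eq0 expf_eq0 (negPf bU) andbF orbF.
 by move=> /eqP ->; rewrite mul0r.
by rewrite mevalM mevalXb => /eqP; rewrite mulf_eq0 (negPf bW) orbF E // => /eqP ->; rewrite mul0r.
Qed.

Definition mxf (f : 'M[C]_(k, m) -> C) : Prop :=
 exists p : {mpoly C[k * m]}, forall M, f M = p.@[fun i => mxvec M 0 i].

Lemma rgl_mxf (b : {ffun 'I_k -> 'I_m}) f (A : 'M[C]_k) : mxf f -> rgl b (fun U => f (A *m cmx b U)).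
move=> [p fE]; apply: rgl_ext (fun U _ => fE _) _; apply: rgl_meval => i.
case/mxvec_indexP: i => i j; apply: (@rgl_ext _ _ _ _ _ (fun U => \sum_l A i l * cmx b U l j)) => [U _|].
 by rewrite mxvecE mxE.
apply: rgl_sum => l; apply: rgl_mul; [exact: rgl_const|exact: rgl_chart_mx].
Qed.

(** Since A is arbitrary, the condition can be tested on the normalized bases of a chart, where it
    becomes a regular function; f itself need not be homogeneous. *)
Lemma zcl_bases D f W : mxf f -> (forall U A, D U -> f (A *m bmx U) = 0) -> zcl D W ->
 forall A, f (A *m bmx W) = 0.
move=> pf fD DW A; have [h hW] := row_free_minor (bmx_free W).
have bu : bsq h W \in unitmx by rewrite unitmxE unitfE.
have <- : (A *m bsq h W) *m cmx h W = A *m bmx W by rewrite cmxE mulmxA mulmxK.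
apply: (zcl_rgl (rgl_mxf h (A *m bsq h W) pf)) DW hW => U DU _.
by rewrite cmxE !mulmxA fD.
Qed.

Lemma mx_Gr_eq (B : 'M[C]_(k, m)) (rB : row_free B) U :
 (forall i, row i B \in val U) -> U = mx_Gr rB.
move=> BU; have [A BA] := basis_change BU.
have Au : A \in unitmx.
 rewrite -row_free_unit /row_free eqn_leq rank_leq_row /=.
 have rk : \rank B = k by apply/eqP.
 by have := mxrankM_maxl A (bmx U); rewrite -BA rk.
apply: Gr_eqP => v; apply/idP/idP => [/memGr[x ->]|/mem_mx_Gr[x ->]].
 by apply/mem_mx_Gr; exists (x *m invmx A); rewrite BA mulmxA mulmxKV.
by apply/memGr; exists (x *m A); rewrite BA mulmxA.
Qed.

Definition plm (B : 'M[C]_(k, m)) (a : 'I_(plucker_dim k m)) : C := minor B (enum_val a).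

Lemma plm_mx_Gr (B : 'M[C]_(k, m)) (rB : row_free B) d (F : poly) : F \is d.-homog ->
 exists2 c : C, c != 0 & F.@[plm B] = c * F.@[plucker (mx_Gr rB)].
move=> hF; have [|c c0 cE] := @pluckerB _ _ _ (mx_Gr rB) B _ rB.
 by move=> i; apply/mem_mx_Gr; exists (delta_mx 0 i); rewrite rowE.
exists (c ^+ d); first by rewrite expf_neq0.
rewrite -(meval_dhomogZ c (plucker (mx_Gr rB)) hF); apply: meval_eq => a.
by rewrite /plm cE pluckerE.
Qed.

(** * Families of subspaces parametrized by an affine space *)

Section Fam.
Variables (r : nat) (P : 'I_k -> 'I_m -> {mpoly C[r]}).
Definition fmx (v : 'I_r -> C) : 'M[C]_(k, m) := \matrix_(i, j) (P i j).@[v].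
Hypothesis Mf : forall v, row_free (fmx v).
Definition fam v : Gr := mx_Gr (Mf v).
Definition famset : set Gr := [set U | exists v, U = fam v].

Lemma fmx_mpf i j : mpf (fun v => fmx v i j).
by exists (P i j) => v; rewrite mxE. Qed.

Lemma fam_mpf (F : poly) : mpf (fun v => F.@[plm (fmx v)]).
by apply: mpfme => a; apply: mpf_det => i j; apply: mpfE (fun=> mxE _ _ _ _) _; exact: fmx_mpf. Qed.

Lemma fam_zv d (F : poly) : F \is d.-homog -> zv famset F <-> forall v, F.@[plm (fmx v)] = 0.
move=> hF; split=> [H v|H _ [v ->]]; have [c c0 cE] := plm_mx_Gr (Mf v) hF.
 by rewrite cE H ?mulr0 //; exists v.
by have /eqP := H v; rewrite cE mulf_eq0 (negPf c0) => /eqP.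
Qed.

Lemma fam_neq d (F : poly) v : F \is d.-homog -> (F.@[plm (fmx v)] != 0) = (F.@[plucker (fam v)] != 0).
by move=> hF; have [c c0 ->] := plm_mx_Gr (Mf v) hF; rewrite neqM c0. Qed.

Lemma irr_fam : irr famset.
split; first by exists (fam (fun=> 0)); exists (fun=> 0).
move=> d e p q hp hq /(fam_zv (dhomogM hp hq)) pq; apply: contrapT => H.
have np : exists v, p.@[plm (fmx v)] != 0.
 apply: contrapT => n; apply: H; left; apply/(fam_zv hp) => v; apply/eqP; apply: contraT => h.
 by case: n; exists v.
have nq : exists v, q.@[plm (fmx v)] != 0.
 apply: contrapT => n; apply: H; right; apply/(fam_zv hq) => v; apply/eqP; apply: contraT => h.
 by case: n; exists v.
have [v [/negPf p0 /negPf q0]] := mprod_neq0 (fam_mpf p) (fam_mpf q) np nq.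
by have /eqP := pq v; rewrite mevalM mulf_eq0 p0 q0.
Qed.

Lemma fam_row v i : row i (fmx v) \in val (fam v).
by apply/mem_mx_Gr; exists (delta_mx 0 i); rewrite rowE. Qed.

Lemma fam_bmx v : exists2 A : 'M[C]_k, A \in unitmx & bmx (fam v) = A *m fmx v.
have [A AE] : exists A : 'M[C]_k, bmx (fam v) = A *m fmx v.
 have /fin_all_exists[x xE] : forall i, exists x, row i (bmx (fam v)) = x *m fmx v.
  by move=> i; apply/mem_mx_Gr; rewrite row_bmx; apply: vbasis_mem; rewrite mem_nth // size_tuple dimGr.
 by exists (\matrix_i x i); apply/row_matrixP => i; rewrite row_mul rowK.
exists A => //; rewrite -row_free_unit /row_free eqn_leq rank_leq_row /=.
have rk : \rank (bmx (fam v)) = k by apply/eqP/bmx_free.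
by have := mxrankM_maxl A (fmx v); rewrite -AE rk.
Qed.

(* Parameters (A, v) of all bases A *m fmx v of the spaces of the family. *)
Definition par (t : 'I_(k * k + r) -> C) : 'M[C]_k * ('I_r -> C) :=
 (vec_mx (\row_i t (lshift r i)), fun l => t (rshift (k * k) l)).
Definition unpar (A : 'M[C]_k) (v : 'I_r -> C) (i : 'I_(k * k + r)) : C :=
 match split i with inl a => mxvec A 0 a | inr l => v l end.

Lemma par_unpar A v : (par (unpar A v)).1 = A /\ forall l, (par (unpar A v)).2 l = v l.
have eL a : unpar A v (lshift r a) = mxvec A 0 a by rewrite /unpar -[lshift r a]/(unsplit (inl a)) unsplitK.
have eR l : unpar A v (rshift (k * k) l) = v l by rewrite /unpar -[rshift _ l]/(unsplit (inr l)) unsplitK.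
split=> [|l]; last exact: eR.
by apply: (can_inj mxvecK); rewrite vec_mxK; apply/rowP => i; rewrite mxE eL.
Qed.

Definition bas t : 'M[C]_(k, m) := (par t).1 *m fmx (par t).2.

Lemma fmx_ext v w : (forall l, v l = w l) -> fmx v = fmx w.
by move=> h; apply/matrixP => i j; rewrite !mxE; apply: meval_eq. Qed.

Lemma bas_unpar A v : bas (unpar A v) = A *m fmx v.
by rewrite /bas; have [-> h] := par_unpar A v; congr (_ *m _); apply: fmx_ext. Qed.

Lemma par1_mpf i j : mpf (fun t => (par t).1 i j).
by exists 'X_(lshift r (mxvec_index i j)) => t; rewrite mevalXU !mxE. Qed.

Lemma par2_mpf l : mpf (fun t => (par t).2 l).
by exists 'X_(rshift (k * k) l) => t; rewrite mevalXU. Qed.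

Lemma fmx_par_mpf i j : mpf (fun t => fmx (par t).2 i j).
by apply: mpfE (fun t => mxE _ _ _ _) _; apply: mpfme => l; apply: par2_mpf. Qed.

Lemma bas_mpf i j : mpf (fun t => bas t i j).
by apply: mpfMx; [exact: par1_mpf|exact: fmx_par_mpf]. Qed.

(** [image_generic] is applied to the map that produces all bases of the members of the family; the
    open condition so obtained on matrices is then rewritten as a form in a chart. *)
Theorem fam_image : exists d (q : poly), [/\ q \is d.-homog, ~ zv famset q &
 forall U, zcl famset U -> q.@[plucker U] != 0 -> famset U].
have [h h0] := row_free_minor (Mf (fun=> 0)).
have [G GE] := mpf_tuple (f := fun (a : 'I_(k * m)) t => mxvec (bas t) 0 a)
 (fun a => ltac:(by case/mxvec_indexP: a => i j; apply: mpfE (fun t => mxvecE _ _ _) _; exact: bas_mpf)).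
have [q q0 qP] := image_generic G (oner_neq0 {mpoly C[k * k + r]}).
have [q' q'E] : mpf (fun t => q.@[fun a => mxvec (bas t) 0 a]).
 by apply: mpfme => a; exists (tnth G a) => t; rewrite GE.
pose bf t := \det (par t).1.
pose gf t := minor (fmx (par t).2) h.
have bfp : mpf bf by apply: mpf_det; exact: par1_mpf.
have gfp : mpf gf by apply: mpf_det => i j; apply: mpfE (fun=> mxE _ _ _ _) _; exact: fmx_par_mpf.
have [||t1 [b1 g1]] := mprod_neq0 bfp gfp.
- by exists (unpar 1%:M (fun=> 0)); rewrite /bf; have [-> _] := par_unpar 1%:M (fun=> 0); rewrite det1 oner_neq0.
- exists (unpar 1%:M (fun=> 0)); rewrite /gf; have [_ e] := par_unpar 1%:M (fun=> 0); by rewrite (fmx_ext e).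
have [||t [qt]] := mprod_neq0 (ex_intro _ _ q'E) (mpfM bfp gfp).
- have [t qt] := meval_neq0 q0; exists t; move: qt; rewrite comp_mpoly_meval.
 by congr (_ != 0); apply: meval_eq => a; rewrite GE.
- by exists t1; apply: (mulf_neq0 b1 g1).
rewrite neqM => /andP[bt gt].
set A0 := (par t).1; set v1 := (par t).2; rewrite -/A0 -/v1 in bt gt.
have [B Bu BE] := fam_bmx v1.
have hU1 : minor (bmx (fam v1)) h != 0.
 by rewrite BE minor_mulmx mulf_neq0 // -unitfE -unitmxE.
have bu1 : bsq h (fam v1) \in unitmx by rewrite unitmxE unitfE.
(* A1 turns the normalized basis of the member v1 into [bas t], where q does not vanish. *)
pose A1 := A0 *m invmx B *m bsq h (fam v1).
have A1E : A1 *m cmx h (fam v1) = bas t.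
 by rewrite /A1 cmxE -!mulmxA (mulKVmx bu1) BE (mulKmx Bu).
have A1u : A1 \in unitmx.
 by rewrite /A1 !unitmx_mul bu1 unitmx_inv Bu !andbT unitmxE unitfE.
have [d [F [hF FE]]] := rgl_mxf h A1 (ex_intro _ q (fun M => erefl)).
exists (1 + d)%N, ('X_(enum_rank h) * F); split.
- by apply: dhomogM => //; apply: Xb_homog.
- move=> /(_ (fam v1) (ex_intro _ _ erefl))/eqP; apply/negP.
 rewrite mevalM mevalXb mulf_neq0 //.
 have := FE _ hU1; rewrite A1E => e; apply: contra_neq qt => F0.
 by rewrite e F0 mul0r.
move=> U DU; rewrite mevalM mevalXb neqM => /andP[hU FU].
have := FE U hU; set y := A1 *m _ => yE.
have [||t' [_ t'E]] := qP (fun a => mxvec y 0 a).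
- move=> p pG; have [B' B'E] := basis_change (fun i => cmx_mem h U i).
 rewrite /y B'E mulmxA.
 apply: (@zcl_bases famset (fun M => p.@[fun a => mxvec M 0 a])) DU _.
  by exists p.
 move=> V A [v ->]; have [B2 _ ->] := fam_bmx v; rewrite mulmxA -bas_unpar.
 rewrite -[RHS](meval0 (unpar (A *m B2) v)) -pG comp_mpoly_meval; apply: meval_eq => a.
 by rewrite GE.
- by rewrite yE mulf_neq0 // invr_eq0 expf_neq0.
have byE : bas t' = y by apply: (can_inj mxvecK); apply/rowP => a; rewrite -t'E GE.
exists (par t').2; symmetry.
have ry : row_free y.
 rewrite /y /row_free mxrankMfree ?mxrank_unit //.
 rewrite cmxE /row_free mxrankMfree ?bmx_free // mxrank_unit // unitmx_inv unitmxE unitfE //.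
have -> : U = mx_Gr ry.
 apply: mx_Gr_eq => i; rewrite /y row_mul; apply/memGr.
 have [B' B'E] := basis_change (fun i => cmx_mem h U i).
 by exists (row i A1 *m B'); rewrite B'E mulmxA.
apply: mx_Gr_eq => i; rewrite -byE /bas row_mul; apply/mem_mx_Gr.
by exists (row i (par t').1).
Qed.
End Fam.

Definition mxdot (L B : 'M[C]_(k, m)) : C := \sum_i \sum_j L i j * B i j.

Lemma mpf_mxdot (n : nat) (L : 'M[C]_(k, m)) (B : ('I_n -> C) -> 'M[C]_(k, m)) :
 (forall i j, mpf (fun t => B t i j)) -> mpf (fun t => mxdot L (B t)).
by move=> h; apply: mpf_sum => i; apply: mpf_sum => j; apply: mpfM => //; apply: mpfC. Qed.

(* A family with more independent directions, including those that change the
  basis, than the other one has parameters, is not in its closure. *)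
Theorem fam_strict (r r' n : nat) (P : 'I_k -> 'I_m -> {mpoly C[r]}) (P' : 'I_k -> 'I_m -> {mpoly C[r']})
  (Mf : forall v, row_free (fmx P v)) (Mf' : forall v, row_free (fmx P' v))
  (v0 : 'I_r -> C) (L : 'I_n -> 'M[C]_(k, m)) :
 (k * k + r' < n)%N ->
 (forall i, exists (A : 'M[C]_k) (v : 'I_r -> C), forall j,
   mxdot (L j) (A *m fmx P v0 + \matrix_(a, b) \sum_l v l * ((P a b)^`M(l)).@[v0]) = (i == j)%:R) ->
 ~ (famset Mf `<=` zcl (famset Mf')).
move=> rn jac H.
have [G GE] := mpf_tuple (fun j => mpf_mxdot (L j) (bas_mpf P)).
have [G' GE'] := mpf_tuple (fun j => mpf_mxdot (L j) (bas_mpf P')).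
have [f f0 fG'] := poly_dependency G' rn.
case/eqP: f0; apply: (@comp_mpoly_inj_jac _ _ _ G (unpar 1%:M v0)) => [i|].
 have [A [v Av]] := jac i; exists (unpar A v) => j; rewrite -Av.
 have [g [gE g0]] := meval_line (tnth G j) (unpar 1%:M v0) (unpar A v).
 rewrite -g0.
 have /fin_all_exists[lin linE] : forall ab : 'I_k * 'I_m, exists g : {poly C},
   (forall e, g.[e] = (P ab.1 ab.2).@[fun l => v0 l + e * v l]) /\
   g^`().[0] = \sum_l v l * ((P ab.1 ab.2)^`M(l)).@[v0].
  by move=> ab; apply: meval_line.
 have e1 : g = \sum_a \sum_b (L j a b)%:P * (lin (a, b) + 'X * \sum_c (A a c)%:P * lin (c, b)).
  apply/eqP; rewrite -subr_eq0; apply/eqP; apply: polyP_eval => e; rewrite hornerD hornerN gE GE.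
  have -> : bas P (fun i0 => unpar 1%:M v0 i0 + e * unpar A v i0) =
    (1%:M + e *: A) *m fmx P (fun l => v0 l + e * v l).
   rewrite -bas_unpar; congr (bas P _); apply/funext => s; rewrite /unpar; case: (split s) => // a.
   by rewrite linearD linearZ !mxE.
  rewrite horner_sum; apply/eqP; rewrite subr_eq0; apply/eqP; apply: eq_bigr => a _.
  rewrite horner_sum; apply: eq_bigr => b _; rewrite hornerM hornerC; congr (_ * _).
  rewrite hornerD hornerM hornerX (linE (a, b)).1 mulmxDl mul1mx -scalemxAl !mxE; congr (_ + _ * _).
  rewrite horner_sum; apply: eq_bigr => c _; by rewrite hornerM hornerC (linE (c, b)).1 mxE.
 rewrite e1 /mxdot deriv_bigsum horner_sum; apply: eq_bigr => a _.
 rewrite deriv_bigsum horner_sum; apply: eq_bigr => b _.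
 rewrite derivM derivC mul0r add0r hornerM hornerC; congr (_ * _).
 rewrite derivD derivM derivX mul1r hornerD (linE (a, b)).2 addrC hornerD hornerM hornerX mul0r addr0.
 rewrite [RHS]mxE [X in _ = X + _]mxE [X in _ = _ + X]mxE; congr (_ + _).
 rewrite horner_sum; apply: eq_bigr => c _; rewrite hornerM hornerC (linE (c, b)).1 mxE; congr (_ * _).
 by apply: meval_eq => l; rewrite mul0r addr0.
apply: meval_eq0 => t; rewrite comp_mpoly_meval.
transitivity (f.@[fun j => mxdot (L j) (bas P t)]); first by apply: meval_eq => j; rewrite GE.
have [A0 A0u A0E] := fam_bmx Mf (par t).2.
have -> : bas P t = ((par t).1 *m invmx A0) *m bmx (fam Mf (par t).2).
 by rewrite A0E mulmxA mulmxKV.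
apply: (@zcl_bases (famset Mf') (fun B => f.@[fun j => mxdot (L j) B])).
- have [p pE] : mpf (fun x : 'I_(k * m) -> C => f.@[fun j => mxdot (L j) (vec_mx (\row_i x i))]).
  apply: mpfme => j; apply: mpf_mxdot => a b; exists 'X_(mxvec_index a b) => x.
  by rewrite mevalXU !mxE.
 exists p => B; rewrite -pE; apply: meval_eq => j; congr (mxdot _ _).
 by apply: (can_inj mxvecK); rewrite vec_mxK; apply/rowP => i; rewrite mxE.
- move=> U A [v ->]; have [B _ ->] := fam_bmx Mf' v; rewrite mulmxA -bas_unpar.
 rewrite -[RHS](meval0 (unpar (A *m B) v)) -fG' comp_mpoly_meval; apply: meval_eq => j.
 by rewrite GE'.
by apply: H; exists (par t).2.
Qed.
End Zariski.

(** * Finite sets of parameters and homographies *)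

Section Infinite.
Variable F : numClosedFieldType.
Implicit Types (S : F -> Prop) (r p q : {poly F}).

Definition fins S : Prop := exists l : seq F, forall x, S x -> x \in l.

Lemma fins_roots r : r != 0 -> fins (fun x => r.[x] = 0).
move=> r0; have [rs rE] := closed_field_poly_normal r; exists rs => x /eqP.
by rewrite -/(root r x) {1}rE rootZ ?lead_coef_eq0 // root_prod_XsubC.
Qed.

Lemma inf_poly S r : ~ fins S -> (forall x, S x -> r.[x] = 0) -> r = 0.
move=> iS Sr; apply/eqP; apply: contraT => /fins_roots[l lP]; case: iS; exists l => x /Sr; exact: lP.
Qed.

Lemma inf_minus S (l : seq F) : ~ fins S -> ~ fins (fun x => S x /\ x \notin l).
move=> iS [l' lP]; apply: iS; exists (l ++ l') => x Sx; rewrite mem_cat.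
by case: (boolP (x \in l)) => //= nx; apply: lP.
Qed.

Lemma inf_roots S r : ~ fins S -> r != 0 -> ~ fins (fun x => S x /\ r.[x] != 0).
move=> iS /fins_roots[l lP]; apply: contra_not (inf_minus (l := l) iS) => -[l' lP'].
exists l' => x [Sx xl]; apply: lP'; split=> //; apply: contraNneq xl; exact: lP.
Qed.

Lemma inf_pick S (l : seq F) : ~ fins S -> exists x, S x /\ x \notin l.
move=> iS; apply: contrapT => H; apply: iS; exists l => x Sx; apply: contraT => xl.
by case: H; exists x.
Qed.

Lemma inf_all : ~ fins (fun=> True).
move=> [l lP]; have /eqP : \prod_(z <- l) ('X - z%:P) = 0 :> {poly F}.
 by apply: polyP_eval => x; apply/eqP; rewrite -/(root _ _) root_prod_XsubC lP.
by apply/negP; apply/monic_neq0/monic_prod_XsubC.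
Qed.

Lemma fins_rel (T : eqType) S (l : seq T) (Q : F -> T -> Prop) :
 (forall c, S c -> exists2 x, x \in l & Q c x) ->
 (forall c c' x, S c -> S c' -> Q c x -> Q c' x -> c = c') -> fins S.
move=> H fQ; suff h (l' : seq T) : exists s : seq F, forall c x, S c -> x \in l' -> Q c x -> c \in s.
 have [s sP] := h l; exists s => c Sc; have [x xl Qx] := H c Sc; exact: sP Sc xl Qx.
elim: l' => [|x l' [s sP]]; first by exists [::].
case: (pselect (exists c, S c /\ Q c x)) => [[c [Sc Qc]]|nc].
 exists (c :: s) => c' y Sc'; rewrite !inE => /predU1P[-> Qy|yl Qy].
  by rewrite (fQ _ _ _ Sc' Sc Qy Qc) eqxx.
 by rewrite (sP c' y) ?orbT.
exists s => c' y Sc'; rewrite inE => /predU1P[-> Qy|]; last exact: sP.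
by case: nc; exists c'.
Qed.

(* The form of degree e - 1 obtained by homogenizing r, evaluated at (p, q). *)
Definition hom (e : nat) r p q : {poly F} := \sum_(i < e) r`_i *: (p ^+ i * q ^+ (e.-1 - i)).

Lemma homE e r p q x z : (size r <= e)%N -> p.[x] = z * q.[x] ->
 (hom e r p q).[x] = q.[x] ^+ e.-1 * r.[z].
move=> re pz; rewrite (horner_coef_wide z re) mulr_sumr horner_sum; apply: eq_bigr => i _.
have ie : (i <= e.-1)%N by have := ltn_ord i; case: e {re} i => // e i; rewrite ltnS.
rewrite hornerZ hornerM !horner_exp pz exprMn -[in RHS](subnKC ie) exprD.
move: (q.[x] ^+ i) (q.[x] ^+ (e.-1 - i)) (z ^+ i) => a b c; ring.
Qed.

Lemma dvdp_bigsum (I : Type) (s : seq I) (d : {poly F}) (f : I -> {poly F}) :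
 (forall i, d %| f i) -> d %| \sum_(i <- s) f i.
move=> h; elim: s => [|i s IH]; first by rewrite big_nil dvdp0.
by rewrite big_cons dvdp_add.
Qed.

(** The hypothesis says that p'/q' composed with p/q is the identity. In the resulting relation,
    whose coefficients [c i] are linear polynomials, p divides c_0 times a power of q, and q divides
    the top coefficient times a power of p; coprimality then bounds both degrees by one. *)
Lemma hom_degree e p q p' q' : coprimep p q -> coprimep p' q' -> (size p' <= e)%N -> (size q' <= e)%N ->
 (p'`_e.-1 != 0) || (q'`_e.-1 != 0) ->
 hom e p' p q = 'X * hom e q' p q -> (size p <= 2)%N /\ (size q <= 2)%N.
move=> cpq cpq' pe qe top E.
pose c i : {poly F} := (p'`_i)%:P - 'X * (q'`_i)%:P.
have cE : \sum_(i < e) c i * (p ^+ i * q ^+ (e.-1 - i)) = 0.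
 move/eqP: E; rewrite -subr_eq0 => /eqP E; rewrite -[RHS]E /hom mulr_sumr -sumrB; apply: eq_bigr => i _.
 by rewrite /c mulrBl -!mul_polyC (mulrA 'X).
have cs i : (size (c i) <= 2)%N.
 apply: leq_trans (size_polyD _ _) _; rewrite geq_max size_polyN.
 rewrite (leq_trans (size_polyC_leq1 _)) //.
 by rewrite mulrC mul_polyC; apply: leq_trans (size_scale_leq _ _) _; rewrite size_polyX.
have c0 i : (p'`_i != 0) || (q'`_i != 0) -> c i != 0.
 apply: contraTneq => /polyP h; have := h 0%N; have := h 1%N.
 rewrite /c !coefB !coefC !coefXM !coefC /= subr0 sub0r => /eqP.
 by rewrite oppr_eq0 => /eqP -> ->; rewrite eqxx.
case: e => [|e] in pe qe top E cE.
 move: pe qe top; rewrite !leqn0 !size_poly_eq0 => /eqP -> /eqP ->; by rewrite coef0 eqxx.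
rewrite /= in top cE.
split.
- have pc0 : c 0%N != 0.
  apply: c0; rewrite -negb_and; apply: contraL cpq' => /andP[/eqP a /eqP b].
  apply/negP => /coprimep_root/(_ (_ : root p' 0)) h.
  by move: (h); rewrite /root !horner_coef0 a b eqxx => /(_ isT)/eqP; apply/negP; rewrite negbK.
 have : p %| c 0%N * q ^+ e.
  move: cE; rewrite big_ord_recl /= expr0 mul1r subn0 => /eqP; rewrite addr_eq0 => /eqP ->.
  rewrite dvdpNr; apply: dvdp_bigsum => i.
  by rewrite dvdp_mull // dvdp_mulr // exprS dvdp_mulr // dvdpp.
 rewrite Gauss_dvdpl ?coprimep_expr // => /dvdp_leq; move/(_ pc0) => h; exact: leq_trans h (cs _).
have : q %| c e * p ^+ e.
 move: cE; rewrite big_ord_recr /= subnn expr0 mulr1 => /eqP; rewrite addrC addr_eq0 => /eqP ->.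
 rewrite dvdpNr; apply: dvdp_bigsum => i.
 rewrite dvdp_mull // dvdp_mull //.
 have : (0 < e - i)%N by rewrite subn_gt0.
 by case: (e - i)%N => // j _; rewrite exprS dvdp_mulr // dvdpp.
rewrite Gauss_dvdpl ?coprimep_expr 1?coprimep_sym // => /dvdp_leq.
by move=> /(_ (c0 _ top)) h; apply: leq_trans h (cs _).
Qed.

Lemma size2M p q : (size p <= 2)%N -> (size q <= 2)%N -> (size (p * q)%R <= 3)%N.
move=> sp sq; apply: leq_trans (size_polyMleq _ _) _.
by have := leq_add sp sq; case: (size p + size q)%N.
Qed.
End Infinite.

Section Slices.
Variables (F : numClosedFieldType) (n : nat).
Implicit Types (v : 'I_n.+1 -> F).

Definition updt v (t : F) : 'I_n.+1 -> F := fun l => if l == ord0 then t else v l.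

Lemma updt_id v l : updt v (v ord0) l = v l.
by rewrite /updt; case: eqP => // ->. Qed.

Lemma mpf_ext1 (f : ('I_n.+1 -> F) -> F) v w : mpf f -> (forall l, v l = w l) -> f v = f w.
by move=> [p pE] h; rewrite !pE; apply: meval_eq. Qed.

Lemma mpf_univ (f : ('I_n.+1 -> F) -> F) v : mpf f -> exists r : {poly F}, forall t, r.[t] = f (updt v t).
move=> [p pE]; have [g [gE _]] := meval_line p (updt v 0) (fun l => (l == ord0)%:R).
exists g => t; rewrite gE pE; apply: meval_eq => l; rewrite /updt; case: eqP => _.
 by rewrite add0r mulr1.
by rewrite mulr0 addr0.
Qed.

Lemma mpf_inf (f : ('I_n.+1 -> F) -> F) (S : F -> Prop) : mpf f -> ~ fins S ->
 (forall v, S (v ord0) -> f v = 0) -> forall v, f v = 0.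
move=> fp iS fS v; have [r rE] := mpf_univ v fp.
rewrite -(mpf_ext1 fp (updt_id v)) -rE (inf_poly iS (r := r)) ?horner0 // => x Sx.
by rewrite rE fS // /updt eqxx.
Qed.

Lemma mpf_updt (f : ('I_n.+1 -> F) -> F) t : mpf f -> mpf (fun v => f (updt v t)).
move=> [p pE]; apply: (mpfE (fun v => pE (updt v t))); apply: mpfme => l.
by rewrite /updt; case: eqP => _; [exact: mpfC|exact: mpfX].
Qed.

(** A slice is an affine space, hence irreducible: a quotient f / g with finitely many values where
    D is non-zero is constant on it. *)
Lemma slice_const (f g D : ('I_n.+1 -> F) -> F) (t : F) (l : seq F) : mpf f -> mpf g -> mpf D ->
 (exists v, v ord0 = t /\ D v != 0) ->
 (forall v, v ord0 = t -> D v != 0 -> exists2 c, c \in l & f v = c * g v) ->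
 exists c, forall v, v ord0 = t -> f v = c * g v.
move=> fp gp Dp [v0 [v0t Dv0]] H; apply: contrapT => nc.
have up v : updt v t ord0 = t by rewrite /updt eqxx.
suff [v] : exists v, D (updt v t) * \prod_(c <- l) (f (updt v t) - c * g (updt v t)) != 0.
 rewrite neqM => /andP[/(H _ (up v))[c cl fc]]; apply/negP/negPn.
 by rewrite prodf_seq_eq0; apply/hasP; exists c => //=; rewrite fc subrr.
have idv v : v ord0 = t -> forall s, updt v t s = v s by move=> <-; exact: updt_id.
elim: l {H} => [|c l [v Dv]].
 by exists v0; rewrite big_nil mulr1 (mpf_ext1 Dp (idv _ v0t)).
have ap (h : ('I_n.+1 -> F) -> F) : mpf h -> mpf (fun v => h (updt v t)) by exact: mpf_updt.
have sp c' : mpf (fun v => f (updt v t) - c' * g (updt v t)).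
 apply: (mpfE (g := fun v => f (updt v t) + (- c') * g (updt v t))) => [x|]; first by rewrite mulNr.
 by apply: mpfD; [exact: ap|apply: mpfM; [exact: mpfC|exact: ap]].
have [||w [w1 w2]] := @mprod_neq0 _ _ (fun v => D (updt v t) * \prod_(c <- l) (f (updt v t) - c * g (updt v t)))
  (fun v => f (updt v t) - c * g (updt v t)) _ (sp c) (ex_intro _ v Dv).
- by apply: mpfM; [exact: ap|apply: mpf_prod => c'; exact: sp].
- apply: contrapT => H; apply: nc; exists c => w wt; apply/eqP; rewrite -subr_eq0; apply: contraT => h.
 case: H; exists w; by rewrite (mpf_ext1 fp (idv _ wt)) (mpf_ext1 gp (idv _ wt)).
by exists w; rewrite big_cons mulrCA mulf_neq0.
Qed.
End Slices.

(** * Cohomogeneity at most one from a family of orbits *)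

Section Abstract.
Variables (R : realType) (k m n : nat).
Notation C := (R[i]).
Notation Gr := (Gr R k m).
Notation poly := {mpoly C[plucker_dim k m]}.
Variables (X : set Gr) (P : 'I_k -> 'I_m -> {mpoly C[n.+1]}).
Hypothesis Mf : forall v, row_free (fmx P v).
Notation Psi := (fam Mf).
Notation pl v := (plm (fmx P v)).
Definition slice (t : C) : set Gr := [set U | exists2 v, v ord0 = t & U = Psi v].
Hypotheses (cX : zcl X `<=` X)
 (XPsi : forall v, X (Psi v))
 (orb : forall v w, v ord0 = w ord0 -> aut_orbit X (Psi v) (Psi w)).
Variables (D : nat) (T1 T2 : poly).
Hypotheses (hT1 : T1 \is D.-homog)
 (hT2 : T2 \is D.-homog)
 (T1E : forall v, T1.@[pl v] = v ord0 * T2.@[pl v])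
 (T2n : exists v, T2.@[pl v] != 0)
 (dim_le : forall e Ds, echain X e Ds -> (e <= n.+1)%N).
Variable bad : seq C.
Hypothesis slice_chain : forall t, t \notin bad ->
 exists2 Ds : nat -> set Gr, echain (slice t) n Ds & Ds n = slice t.
Hypothesis dense : forall (rho : {mpoly C[n.+1]}) O, rho != 0 -> zopen_in X O -> O !=set0 ->
 exists f v, [/\ automorphism X f, rho.@[v] != 0 & O (f (Psi v))].

Notation I0 := (famset Mf).
(** Recovers the parameter of the slice through U wherever T2 is non-zero; by the convention on
    division it is 0 elsewhere. *)
Definition tt (U : Gr) : C := T1.@[plucker U] / T2.@[plucker U].

Lemma T1Psi v : T1.@[plucker (Psi v)] = v ord0 * T2.@[plucker (Psi v)].
have hF : T1 - v ord0 *: T2 \is D.-homog by apply: rpredB => //; apply: rpredZ.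
have [c c0] := plm_mx_Gr (Mf v) hF; rewrite mevalB mevalZ T1E subrr => /esym/eqP.
by rewrite mulf_eq0 (negPf c0) /= mevalB mevalZ subr_eq0 => /eqP.
Qed.

Lemma ttPsi v : T2.@[plucker (Psi v)] != 0 -> tt (Psi v) = v ord0.
by move=> h; rewrite /tt T1Psi mulfK. Qed.

Lemma I0X : I0 `<=` X. by move=> _ [v ->]. Qed.
Lemma slice_I0 t : slice t `<=` I0. by move=> _ [v _ ->]; exists v. Qed.

Lemma off_slice t : exists v, v ord0 != t /\ T2.@[plucker (Psi v)] != 0.
have tp : mpf (fun v : 'I_n.+1 -> C => v ord0 - t).
 by exists ('X_ord0 - t%:MP) => x; rewrite mevalB mevalXU mevalC.
have tn : exists v : 'I_n.+1 -> C, v ord0 - t != 0.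
 by exists (fun=> t + 1); rewrite addrAC subrr add0r oner_neq0.
have [v [vt Tv]] := mprod_neq0 tp (fam_mpf P T2) tn T2n.
by exists v; rewrite -subr_eq0 -(fam_neq Mf _ hT2).
Qed.

Lemma slice_proper t E : zcl I0 `<=` zcl E -> ~ (E `<=` zcl (slice t)).
move=> IE H.
have hF : T1 - t *: T2 \is D.-homog by apply: rpredB => //; apply: rpredZ.
have vF : zv (slice t) (T1 - t *: T2).
 by move=> _ [v <- ->]; rewrite mevalB mevalZ T1Psi subrr.
have [w [wt Tw]] := off_slice t.
have : zcl (slice t) (Psi w) by apply: (zcl_min H); apply: IE; apply: zcl_sub; exists w.
move=> /(_ _ _ hF vF)/eqP; rewrite mevalB mevalZ T1Psi -mulrBl mulf_eq0 (negPf Tw) orbF subr_eq0.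
exact/negP.
Qed.

Lemma I0_dim : has_dim X n.+1.
apply/has_dimP; split; last exact: dim_le.
have [t [_ tb]] := inf_pick bad (@inf_all (R[i])).
have [Ds hD Dn] := slice_chain tb.
have h : echain X n Ds by apply: echain_sub hD => U /(@slice_I0 t)/I0X.
eexists; apply: (echain_cons h (irr_fam Mf) I0X); rewrite Dn.
 by move=> U /(@slice_I0 t); apply: zcl_sub.
by apply: slice_proper.
Qed.

(** A larger irreducible closed set would prolong the chain formed by a slice and I0 to length n +
    2, against [dim_le]. *)
Lemma I0_max (Y : set Gr) : irr Y -> zcl Y `<=` Y -> zcl I0 `<=` Y -> Y `<=` X -> Y `<=` zcl I0.
move=> iY cY IY YX; apply: contrapT => nY.
have [t [_ tb]] := inf_pick bad (@inf_all (R[i])).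
have [Ds hD Dn] := slice_chain tb.
have h : echain X n Ds by apply: echain_sub hD => U /(@slice_I0 t)/I0X.
have h1 := echain_cons h (irr_fam Mf) I0X.
have := echain_cons (h1 _ _) iY YX; rewrite Dn ltnn => H.
have /dim_le : echain X n.+2 (fun i => if (i <= n.+1)%N then if (i <= n)%N then Ds i else I0 else Y).
 apply: H => //.
 - by move=> U /(@slice_I0 t); apply: zcl_sub.
 - by apply: slice_proper.
 - by move=> U /(@zcl_sub _ _ _ I0)/IY; apply: zcl_sub.
by rewrite ltnn.
Qed.

Definition good (p : poly) : Prop := (exists d, p \is d.-homog) /\ ~ zv I0 p.

Lemma goodM p q : good p -> good q -> good (p * q).
move=> [[d hp] np] [[e hq] nq]; split; first by exists (d + e)%N; apply: dhomogM.
by move=> /(irr_cancel (irr_fam Mf) hp np hq).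
Qed.

Lemma good_prod (l : seq C) : good (\prod_(b <- l) (T1 - b *: T2)).
elim: l => [|b l IH].
 rewrite big_nil; split; first by exists 0%N; apply: dhomog1.
 by move=> /(_ (Psi (fun=> 0)))/(_ (ex_intro _ _ erefl))/eqP; rewrite meval1 oner_eq0.
rewrite big_cons; apply: goodM IH; split; first by exists D; apply: rpredB => //; apply: rpredZ.
move=> vF; have [w [wt Tw]] := off_slice b.
have /eqP := vF (Psi w) (ex_intro _ _ erefl).
by rewrite mevalB mevalZ T1Psi -mulrBl mulf_eq0 (negPf Tw) orbF subr_eq0 (negPf wt).
Qed.

Lemma good_T2 : good T2.
split; first by exists D.
have [v [_ Tv]] := off_slice 0 => /(_ _ (ex_intro _ v erefl))/eqP; exact/negP.
Qed.

Definition nzero (p : poly) : set Gr := [set U | X U /\ p.@[plucker U] != 0].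

(* A principal open subset of X on which tt parametrizes the slices. *)
Lemma base_open : exists p0, [/\ good p0, forall U, nzero p0 U ->
 exists v, [/\ U = Psi v, tt U = v ord0 & v ord0 \notin bad] &
 forall U, nzero p0 U -> T2.@[plucker U] != 0].
have iI := irr_fam Mf.
have [d1 [p1 [h1 n1 pX]]] := component_open cX (irr_zcl iI) (fun U => @zcl_min _ _ _ _ I0 (fun V h => h) U)
 (fun U h => cX (zcl_mono I0X h)) (fun Y iY cY IY YX => I0_max iY cY IY YX).
have [d2 [p2 [h2 n2 pI]]] := fam_image Mf.
exists (p1 * (p2 * (T2 * \prod_(b <- bad) (T1 - b *: T2)))); split; last 1 first.
- by move=> U [_]; rewrite !mevalM !mulf_eq0 !negb_or => /and4P[].
- apply: goodM; first by split; [exists d1|move=> H; apply: n1; apply: zv_zcl h1 H].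
 apply: goodM; first by split; [exists d2|].
 by apply: goodM; [exact: good_T2|exact: good_prod].
move=> U [XU]; rewrite !mevalM !mulf_eq0 !negb_or => /and4P[/(pX U XU) IU p2U TU bU].
have [v UE] := pI U IU p2U; subst U; exists v; split=> //; first exact: ttPsi.
apply: contra bU => vb; rewrite rmorph_prod /= prodf_seq_eq0; apply/hasP; exists (v ord0) => //=.
by rewrite mevalB mevalZ T1Psi subrr.
Qed.

Lemma orbit_trans U W V : aut_orbit X U W -> aut_orbit X W V -> aut_orbit X U V.
by move=> [f fa ->] [g ga ->]; exists (g \o f) => //; apply: aut_comp. Qed.

Lemma aut_orbit_sym U W : X U -> aut_orbit X U W -> aut_orbit X W U.
move=> XU [f fa ->]; have [g ga gf] := aut_inv fa.
by exists g => //; rewrite (gf U XU).1.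
Qed.

Lemma aut_orbitX U : X U -> aut_orbit X U `<=` X.
by move=> XU _ [f [[fX _] _] ->]; apply: fX. Qed.

Lemma orbit_dim_le U e Ds : X U -> echain (aut_orbit X U) e Ds -> (e <= n.+1)%N.
by move=> XU /(echain_sub (aut_orbitX XU))/dim_le. Qed.

Section Classes.
Variable p0 : poly.
Hypotheses (gp0 : good p0)
 (p0P : forall U, nzero p0 U -> exists v, [/\ U = Psi v, tt U = v ord0 & v ord0 \notin bad])
 (p0T2 : forall U, nzero p0 U -> T2.@[plucker U] != 0).
Notation N0 := (nzero p0).

Lemma N0X U : N0 U -> X U. by case. Qed.

(** The set A of the overview for the orbit of U, read off on the open part N0. *)
Definition cls U (t : C) : Prop := exists W, [/\ N0 W, aut_orbit X U W & tt W = t].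

Lemma slice_orbit U W : N0 U -> aut_orbit X U W -> N0 W -> slice (tt W) `<=` aut_orbit X U.
move=> NU AW NW _ [v vt ->]; have [w [WE tW _]] := p0P NW.
by apply: orbit_trans AW _; rewrite WE; apply: orb; rewrite vt tW.
Qed.

Lemma N0_refl U : N0 U -> aut_orbit X U U.
by move=> /p0P[v [-> _ _]]; exact: orb. Qed.

Lemma orbit_chain U : N0 U -> exists2 Ds : nat -> set Gr, echain (aut_orbit X U) n Ds & Ds n = slice (tt U).
move=> NU; have [v [UE tU vb]] := p0P NU; rewrite -tU in vb.
have [Ds hD Dn] := slice_chain vb; exists Ds => //; apply: echain_sub hD.
exact: (slice_orbit NU (N0_refl NU) NU).
Qed.

(** The slices with parameter in an infinite set are dense in I0. Their union is therefore
    irreducible, lies in the orbit, and prolongs the chain of a single slice by one. *)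
Lemma inf_dim U : N0 U -> ~ fins (cls U) -> has_dim (aut_orbit X U) n.+1.
move=> NU iU; have [Ds hD Dn] := orbit_chain NU; have XU := N0X NU.
apply/has_dimP; split; last by move=> e Es; exact: orbit_dim_le.
pose E : set Gr := [set W | exists2 v, cls U (v ord0) & W = Psi v].
have EI : E `<=` I0 by move=> _ [v _ ->]; exists v.
have zvE d (F : poly) : F \is d.-homog -> zv E F -> zv I0 F.
 move=> hF EF; apply/(fam_zv Mf hF); apply: (mpf_inf (fam_mpf P F) iU) => v cv.
 by have [c c0 ->] := plm_mx_Gr (Mf v) hF; rewrite EF ?mulr0 //; exists v.
have zE : zcl I0 `<=` zcl E.
 by apply: zcl_min => W IW d F hF /(zvE _ _ hF); apply.
have iE : irr E.
 have [v [UE tU vb]] := p0P NU.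
 split; first by exists (Psi v), v => //; exists U; split=> //; exact: N0_refl.
 move=> d e p q hp hq /(zvE _ _ (dhomogM hp hq))/((irr_fam Mf).2 _ _ _ _ hp hq)[] h; [left|right] => W /EI; exact: h.
eexists; apply: (echain_cons hD iE).
- by move=> _ [v [W [NW AW tW]] ->]; apply: (slice_orbit NU AW NW); exists v.
- by rewrite Dn => W /(@slice_I0 _)/(@zcl_sub _ _ _ I0)/zE.
- by rewrite Dn; apply: slice_proper.
Qed.

(** An automorphism moves the top of a chain so that it passes through U. Its part in N0 lies in
    finitely many slices, so by irreducibility it lies in the closure of one of them. Then I0 can be
    added on top, and the chain had length at most n. *)
Lemma fin_dim U : N0 U -> fins (cls U) -> has_dim (aut_orbit X U) n.
move=> NU [l lP]; have [Ds hD Dn] := orbit_chain NU; have XU := N0X NU.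
apply/has_dimP; split; first by exists Ds.
move=> e Es hE; have [h1 h2] := hE.
have [[[V EV] iV] EA] := h1 e (leqnn e).
have [f fa VE] := EA V EV; have [g ga gf] := aut_inv fa.
have [fm gm] : mor X X f /\ mor X X g by split; [exact: fa.1|exact: ga.1].
have AX := aut_orbitX XU.
have gfK W : X W -> f (g W) = W by move=> /gf[].
have fgK W : X W -> g (f W) = W by move=> /gf[].
have hE' := image_echain gm fm gfK fgK AX hE.
have gA : g @` aut_orbit X U `<=` aut_orbit X U.
 by move=> _ [W AW <-]; apply: orbit_trans AW _; exists g.
set E' := g @` Es e.
have E'U : E' U by exists V => //; rewrite VE fgK.
have [iE' E'A] : irr E' /\ E' `<=` aut_orbit X U.
 by have [iE' h] := hE'.1 e (leqnn e); split=> // W /h/gA.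
have [[d hp] _] := gp0.
have np : ~ zv E' p0 by move=> /(_ _ E'U)/eqP; apply/negP; exact: NU.2.
have [iE'' E'c] := irr_open iE' hp np.
pose S (s : seq C) : set Gr := [set W | exists2 t, t \in s & slice t W].
have E'S : E' `<=` zcl (S [seq t <- l | t \notin bad]).
 move=> W /E'c; apply: zcl_mono => {W} W [E'W pW].
 have NW : N0 W by split=> //; apply: (aut_orbitX XU); apply: E'A.
 have [v [WE tW vb]] := p0P NW; exists (v ord0); last by exists v.
 by rewrite mem_filter vb; apply: lP; exists W; split=> //; exact: E'A.
have [t tb E't] : exists2 t, t \notin bad & E' `<=` zcl (slice t).
 move: (filter_all (fun t => t \notin bad) l) E'S.
 elim: [seq t <- l | t \notin bad] => [_ H|t s IH /= /andP[tb sb] H].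
  have := H _ E'U => /(_ 0%N 1 (dhomog1 _ _)) h; have := oner_neq0 C.
  by rewrite -(meval1 (plucker U)) h ?eqxx // => W [].
 have [|h|h] := @irr_sub_setU _ _ _ E' (slice t) (S s) iE'; last 2 first.
 - by exists t.
 - exact: IH sb h.
 move=> W /H; suff -> : S (t :: s) = slice t `|` S s by exact: zcl_setU.
 apply/seteqP; split=> [V' [t']|V' [h|[t' ts h]]].
 - by rewrite inE => /predU1P[->|ts] h; [left|right; exists t'].
 - by exists t; rewrite ?mem_head.
 - by exists t' => //; rewrite inE ts orbT.
have E'I : E' `<=` zcl I0 by move=> W /E't; apply: zcl_mono; exact: slice_I0.
have hX : echain X e (fun i => g @` Es i).
 by apply: echain_sub hE' => W [W' AW <-]; apply: ga.1.1; apply: AX.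
have /dim_le := echain_cons hX (irr_fam Mf) I0X E'I (fun h => slice_proper (t := t) (fun W hW => hW) (fun W hW => zcl_min E't (h W hW))).
by rewrite ltnS.
Qed.

Lemma N0_open : zopen_in X N0.
by have [[d hp] _] := gp0; exact: zopen_neq hp. Qed.

Lemma N0_Psi v : p0.@[pl v] != 0 -> N0 (Psi v).
by have [[d hp] _] := gp0; rewrite (fam_neq Mf v hp) => h; split. Qed.

(* In the coordinates of the family, tt (f (Psi v)) is a quotient of
  polynomials near every point that f maps from N0 to N0. *)
Lemma local_data f v1 : automorphism X f -> N0 (Psi v1) -> N0 (f (Psi v1)) ->
 exists P1 Q1 D1 : ('I_n.+1 -> C) -> C, [/\ mpf P1, mpf Q1, mpf D1 & D1 v1 != 0 /\
  forall v, D1 v != 0 -> [/\ N0 (Psi v), N0 (f (Psi v)), Q1 v != 0 & P1 v = tt (f (Psi v)) * Q1 v]].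
move=> [[fX reg] _] N1 Nf1; have [d0 hp0] := gp0.1.
have [O [d [F [oO O1 hF fE]]]] := reg _ (XPsi v1).
have [_ /(_ _ O1)[e [o [ho o1 oP]]]] := (zopenP X O).1 oO.
pose y v a := (F a).@[pl v].
have yE v : O (Psi v) -> exists2 c : C, c != 0 & forall e q, q \is e.-homog ->
  q.@[plucker (f (Psi v))] = c ^+ e * q.@[y v].
 move=> Ov; have [c cE] := fE _ Ov.
 have [c1 c10 c1E] := @pluckerB _ _ _ (Psi v) (fmx P v) (fam_row Mf v) (Mf v).
 have yE a : y v a = c1 ^+ d * (F a).@[plucker (Psi v)].
  rewrite /y -(meval_dhomogZ c1 _ (hF a)); apply: meval_eq => b.
  by rewrite /plm c1E pluckerE.
 have c0 := plucker_scale_neq0 cE.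
 exists (c / c1 ^+ d); first by rewrite mulf_neq0 // invr_eq0 expf_neq0.
 move=> e' q hq; rewrite -(meval_dhomogZ _ _ hq); apply: meval_eq => a.
 by rewrite cE yE mulrA mulfVK // expf_neq0.
have ym q : mpf (fun v => q.@[y v]).
 by apply: mpfme => a; apply: fam_mpf.
exists (fun v => T1.@[y v]), (fun v => T2.@[y v]),
 (fun v => p0.@[pl v] * (o.@[pl v] * (p0.@[y v] * T2.@[y v]))).
split; [exact: ym|exact: ym| |].
 apply: mpfM; [exact: fam_mpf|apply: mpfM; [exact: fam_mpf|apply: mpfM; exact: ym]].
have T2N U : N0 U -> T2.@[plucker U] != 0.
 move=> /p0T2; exact.
split.
 have [c c0 cE] := yE _ O1.
 apply: mulf_neq0; [|apply: mulf_neq0; [|apply: mulf_neq0]].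
 - by rewrite (fam_neq Mf v1 hp0); case: N1.
 - by rewrite (fam_neq Mf v1 ho).
 - by have := Nf1.2; rewrite (cE _ _ hp0) neqM => /andP[].
 - by have := T2N _ Nf1; rewrite (cE _ _ hT2) neqM => /andP[].
move=> v; rewrite !mulf_eq0 !negb_or => /and4P[pv ov pfv Tv].
have Ov : O (Psi v) by apply: oP; [exact: XPsi|rewrite -(fam_neq Mf v ho); exact: ov].
have [c c0 cE] := yE _ Ov; split; [| |exact: Tv|].
- exact: N0_Psi.
- split; first by apply: fX; exact: XPsi.
 by rewrite (cE _ _ hp0) mulf_neq0 // expf_neq0.
- by rewrite /tt (cE _ _ hT1) (cE _ _ hT2) -mulf_div divff ?expf_neq0 // mul1r mulfVK.
Qed.

Definition fin_vals (t : C) : Prop := exists U, [/\ N0 U, tt U = t & fins (cls U)].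
Definition rho_of f (p q : {poly C}) : Prop := coprimep p q /\
 forall U, N0 U -> N0 (f U) -> q.[tt U] != 0 /\ p.[tt U] = tt (f U) * q.[tt U].
Definition meets f := exists U, N0 U /\ N0 (f U).

Lemma mpf_horner0 (p : {poly C}) : mpf (fun v : 'I_n.+1 -> C => p.[v ord0]).
by apply: mpf_horner; exact: mpfX. Qed.

Lemma mpf_sub (f g : ('I_n.+1 -> C) -> C) : mpf f -> mpf g -> mpf (fun v => f v - g v).
by move=> [p pE] [q qE]; exists (p - q) => v; rewrite mevalB pE qE. Qed.

(** On a slice of finite class, tt after f takes finitely many values, hence is constant by
    [slice_const]. Holding for infinitely many slices, the resulting polynomial identity is general,
    and tt after f is a rational function of tt alone. *)
Lemma rational f : ~ fins fin_vals -> automorphism X f -> meets f -> exists p q, rho_of f p q.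
move=> iF fa [U1 [N1 Nf1]]; have [v1 [UE t1 _]] := p0P N1; subst U1.
have [P1 [Q1 [D1 [P1p Q1p D1p [D11 DP]]]]] := local_data fa N1 Nf1.
have [p1 p1E] := mpf_univ v1 P1p; have [q1 q1E] := mpf_univ v1 Q1p; have [d1 d1E] := mpf_univ v1 D1p.
have d10 : d1 != 0.
 by apply: contraNneq D11 => d0; rewrite -(mpf_ext1 D1p (updt_id v1)) -d1E d0 horner0.
have iS := inf_roots iF d10.
have H1 v : P1 v * q1.[v ord0] - p1.[v ord0] * Q1 v = 0.
 have Hp : mpf (fun v => P1 v * q1.[v ord0] - p1.[v ord0] * Q1 v).
  by apply: mpf_sub; apply: mpfM => //; exact: mpf_horner0.
 apply: (mpf_inf Hp iS) => {}v [[U [NU tU [l lP]]] dv].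
 have upt t : updt v1 t ord0 = t by rewrite /updt eqxx.
 have [v' [UE t' _]] := p0P NU.
 have [||c cE] := @slice_const _ _ P1 Q1 D1 (v ord0) l P1p Q1p D1p.
 - by exists (updt v1 (v ord0)); rewrite upt -d1E.
 - move=> w wt Dw; have [Nw Nfw Qw Pw] := DP w Dw; exists (tt (f (Psi w))) => //.
  apply: lP; exists (f (Psi w)); split=> //.
  apply: (@orbit_trans _ (Psi w)); last by exists f.
  by rewrite UE; apply: orb; rewrite wt -t' tU.
 by rewrite (cE v) // p1E (cE (updt v1 (v ord0))) // -q1E; ring.
have Q11 : Q1 v1 != 0 by have [] := DP _ D11.
have q10 : q1 != 0.
 by apply: contraNneq Q11 => q0; rewrite -(mpf_ext1 Q1p (updt_id v1)) -q1E q0 horner0.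
pose g := gcdp p1 q1.
have g0 : g != 0 by rewrite gcdp_eq0 negb_and q10 orbT.
have [p pE] : exists p, p1 = p * g by exists (p1 %/ g); rewrite divpK // dvdp_gcdl.
have [q qE] : exists q, q1 = q * g by exists (q1 %/ g); rewrite divpK // dvdp_gcdr.
have cpq : coprimep p q.
 have : coprimep (p1 %/ g) (q1 %/ g) by apply: coprimep_div_gcd; rewrite q10 orbT.
 by rewrite pE qE !mulpK.
have H2 v : P1 v * q.[v ord0] - p.[v ord0] * Q1 v = 0.
 apply/eqP; apply: contraT => nv; exfalso.
 have [|||| w [w1 w2]] := @mprod_neq0 _ _ (fun v => P1 v * q.[v ord0] - p.[v ord0] * Q1 v) (fun v => g.[v ord0]).
 - by apply: mpf_sub; apply: mpfM => //; exact: mpf_horner0.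
 - exact: mpf_horner0.
 - by exists v.
 - have [t gt] : exists t, g.[t] != 0.
   apply: contrapT => h; case/eqP: g0; apply: polyP_eval => t; apply/eqP; apply: contraT => gt.
   by case: h; exists t.
  by exists (fun=> t).
 have /eqP := H1 w; rewrite pE qE !hornerM => h; case/negP: (mulf_neq0 w1 w2).
 by move: h; congr (_ == _); ring.
exists p, q; split=> // U2 N2 Nf2; have [v2 [UE t2 _]] := p0P N2; subst U2.
(* A second set of local data carries the identity from the neighbourhood of v1 to the given point:
   two non-empty open sets of parameters meet. *)
have [P2 [Q2 [D2 [P2p Q2p D2p [D22 DP2]]]]] := local_data fa N2 Nf2.
have H3 v : P2 v * q.[v ord0] - p.[v ord0] * Q2 v = 0.
 apply/eqP; apply: contraT => nv; exfalso.
 have [|||| w [w1]] := @mprod_neq0 _ _ (fun v => P2 v * q.[v ord0] - p.[v ord0] * Q2 v) (fun v => D1 v * D2 v).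
 - by apply: mpf_sub; apply: mpfM => //; exact: mpf_horner0.
 - exact: mpfM.
 - by exists v.
 - by have [w [a b]] := mprod_neq0 D1p D2p (ex_intro (fun v => D1 v != 0) v1 D11) (ex_intro (fun v => D2 v != 0) v2 D22); exists w; apply: mulf_neq0.
 rewrite neqM => /andP[/DP[_ _ Qw Pw] /DP2[_ _ _ Pw2]].
 have /eqP := H2 w; rewrite Pw (_ : _ - _ = Q1 w * (tt (f (Psi w)) * q.[w ord0] - p.[w ord0])); last by ring.
 rewrite mulf_eq0 (negPf Qw) /= => /eqP h; case/eqP: w1.
 have -> : P2 w * q.[w ord0] - p.[w ord0] * Q2 w = Q2 w * (tt (f (Psi w)) * q.[w ord0] - p.[w ord0]).
  by rewrite Pw2; ring.
 by rewrite h mulr0.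
have [_ _ Qv Pv] := DP2 _ D22.
have /eqP := H3 v2; rewrite Pv (_ : _ - _ = Q2 v2 * (tt (f (Psi v2)) * q.[v2 ord0] - p.[v2 ord0])); last by ring.
rewrite mulf_eq0 (negPf Qv) /= subr_eq0 t2 => /eqP pq2; split=> //.
apply: contraTneq cpq => q0; apply/negP => /coprimep_root/(_ (_ : root p (v2 ord0))) h.
have rp : root p (v2 ord0) by rewrite /root -pq2 q0 mulr0.
by have := h rp; rewrite q0 eqxx.
Qed.

Lemma common f g : automorphism X f -> automorphism X g -> meets f -> meets g ->
 ~ fins (fun t => exists U, [/\ N0 U, N0 (f U), N0 (g U) & tt U = t]).
move=> fa ga [U1 [N1 Nf1]] [U2 [N2 Ng2]].
have [v1 [UE1 _ _]] := p0P N1; have [v2 [UE2 _ _]] := p0P N2; subst U1 U2.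
have [P1 [Q1 [D1 [_ _ D1p [D11 DP1]]]]] := local_data fa N1 Nf1.
have [P2 [Q2 [D2 [_ _ D2p [D22 DP2]]]]] := local_data ga N2 Ng2.
have [w [a b]] := mprod_neq0 D1p D2p (ex_intro (fun v => D1 v != 0) v1 D11) (ex_intro (fun v => D2 v != 0) v2 D22).
have [r rE] := mpf_univ w (mpfM D1p D2p).
have r0 : r != 0.
 by apply: contraNneq (mulf_neq0 a b) => r0; rewrite -(mpf_ext1 (mpfM D1p D2p) (updt_id w)) -rE r0 horner0.
have := inf_roots (@inf_all C) r0; apply: contra_not => -[l lP]; exists l => t [_].
rewrite rE neqM => /andP[d1 d2]; apply: lP.
have [Nw Nf _ _] := DP1 _ d1; have [_ Ng _ _] := DP2 _ d2.
exists (Psi (updt w t)); split; [exact: Nw|exact: Nf|exact: Ng|].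
by rewrite (ttPsi (p0T2 Nw)) /updt eqxx.
Qed.

Lemma meets_inv f g : (forall U, X U -> g (f U) = U) -> meets f -> meets g.
move=> gf [U [NU NfU]]; have e := gf U (N0X NU).
by exists (f U); split; [exact: NfU|rewrite e; exact: NU].
Qed.

(** The inverse of f acts on tt by a quotient too, and the composite is the identity at infinitely
    many parameters, so [hom_degree] applies. *)
Lemma rho_degree f p q : ~ fins fin_vals -> automorphism X f -> meets f -> rho_of f p q ->
 (size p <= 2)%N /\ (size q <= 2)%N.
move=> iF fa mf [cpq pq]; have [g ga gf] := aut_inv fa.
have mg : meets g by apply: meets_inv mf => U /gf[].
have [p' [q' [cpq' pq']]] := rational iF ga mg.
pose e := maxn (size p') (size q').
have pe : (size p' <= e)%N by exact: leq_maxl.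
have qe : (size q' <= e)%N by exact: leq_maxr.
apply: (hom_degree cpq cpq' pe qe).
 rewrite -negb_and; apply/negP => /andP[/eqP pe0 /eqP qe0].
 have : (p' == 0) && (q' == 0).
  rewrite -!lead_coef_eq0 !lead_coefE; move: pe0 qe0; rewrite /e.
  case: (leqP (size p') (size q')) => h pe0 qe0; rewrite ?pe0 ?qe0 ?eqxx ?andbT //=.
   have q0 : q' = 0 by apply/eqP; rewrite -lead_coef_eq0 lead_coefE qe0.
   by move: h; rewrite q0 size_poly0 leqn0 size_poly_eq0 => /eqP ->; rewrite coef0.
  have p0' : p' = 0 by apply/eqP; rewrite -lead_coef_eq0 lead_coefE pe0.
  by move: h; rewrite p0' size_poly0.
 move=> /andP[/eqP p0' /eqP q0']; have [U [NU NfU]] := mg.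
 by have [] := pq' U NU NfU; rewrite q0' horner0 eqxx.
apply/eqP; rewrite -subr_eq0; apply/eqP; apply: (inf_poly (common fa fa mf mf)) => t [U [NU NfU _ tU]].
have [qU pU] := pq U NU NfU; rewrite tU in qU pU.
have NgfU : N0 (g (f U)) by rewrite (gf U (N0X NU)).1.
have [q'U p'U] := pq' _ NfU NgfU; rewrite (gf U (N0X NU)).1 tU in p'U.
rewrite hornerD hornerN hornerM hornerX !(homE _ pU) // p'U; ring.
Qed.

(** The identity holds at infinitely many parameters, hence as polynomials; it can then be used at
    points whose image under f lies outside N0. Cross-multiplication allows the common value to be
    infinite. *)
Lemma rho_comp f h g p q ph qh pg qg t : automorphism X f -> automorphism X h ->
 meets f -> meets h -> rho_of f p q -> rho_of h ph qh -> rho_of g pg qg ->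
 (forall U, X U -> g (h U) = f U) -> qh.[t] != 0 ->
 p.[t] * qg.[ph.[t] / qh.[t]] = q.[t] * pg.[ph.[t] / qh.[t]].
move=> fa ha mf mh [_ pq] [_ pqh] [_ pqg] gh qt.
pose e := maxn (size pg) (size qg).
have pe : (size pg <= e)%N by exact: leq_maxl.
have qe : (size qg <= e)%N by exact: leq_maxr.
have E : p * hom e qg ph qh - q * hom e pg ph qh = 0.
 apply: (inf_poly (common fa ha mf mh)) => s [U [NU NfU NhU tU]].
 have [qU pU] := pq U NU NfU; have [qhU phU] := pqh U NU NhU; rewrite tU in qU pU qhU phU.
 have NghU : N0 (g (h U)) by rewrite gh //; exact: N0X.
 have [qgU pgU] := pqg _ NhU NghU; rewrite (gh _ (N0X NU)) in pgU.
 rewrite hornerD hornerN !hornerM !(homE _ phU) // pgU pU; ring.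
have phE : ph.[t] = (ph.[t] / qh.[t]) * qh.[t] by rewrite mulfVK.
have := congr1 (fun r => r.[t]) E; rewrite hornerD hornerN !hornerM !(homE _ phE) // horner0.
rewrite (_ : _ - _ = qh.[t] ^+ e.-1 * (p.[t] * qg.[ph.[t] / qh.[t]] - q.[t] * pg.[ph.[t] / qh.[t]])); last by ring.
by move/eqP; rewrite mulf_eq0 expf_eq0 (negPf qt) andbF subr_eq0 => /eqP.
Qed.

(** Suppose infinitely many parameters have finite classes, and take three of them. An automorphism
    sends points of these three slices into finitely many translates, with finitely many possible
    parameters there. Two automorphisms with the same such data act on tt by homographies equal at
    three points, hence equal, so the class of U0 is finite. *)
Theorem dichotomy U0 : N0 U0 -> ~ fins (cls U0) -> fins fin_vals.
move=> N00 i0; apply: contrapT => iF; apply: i0.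
have X0 := N0X N00.
have [b1 [[U1 [N1 t1 [L1 L1P]]] _]] := inf_pick [::] iF.
have [b2 [[U2 [N2 t2 [L2 L2P]]] b21]] := inf_pick [:: b1] iF.
have [b3 [[U3 [N3 t3 [L3 L3P]]] b31]] := inf_pick [:: b1; b2] iF.
(* Indexed by all maps, with the empty set for those that are not automorphisms. By
   quasi-compactness finitely many translates of N0 cover all of them. *)
pose Os (f : Gr -> Gr) : set Gr := [set W | automorphism X f /\ (f @` N0) W].
have oOs f : zopen_in X (Os f).
 case: (pselect (automorphism X f)) => fa.
  have [g ga gf] := aut_inv fa.
  have := image_open fa.1 ga.1 (fun U XU => (gf U XU).1) (fun U XU => (gf U XU).2) N0_open.
  by congr zopen_in; apply/seteqP; split=> W //; case.
 by apply/zopenP; split=> W [].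
have [fs fsP] := quasi_compact id oOs.
pose RelI (f : Gr -> Gr) (U : Gr) (x : 'I_(size fs) * C) := exists V, [/\ automorphism X (nth id fs x.1), N0 V, f U = nth id fs x.1 V & tt V = x.2].
have relI f U L : automorphism X f -> N0 U -> (forall t, cls U t -> t \in L) ->
  exists2 x, x \in [seq (j, t) | j <- enum 'I_(size fs), t <- L] & RelI f U x.
 move=> fa NU LP; have [j jfs [ja [V NV VE]]] : exists2 j, (j < size fs)%N & Os (nth id fs j) (f U).
  by apply: (fsP f); split=> //; exists U.
 exists (Ordinal jfs, tt V); last by exists V.
 apply: allpairs_f; first by rewrite mem_enum.
 apply: LP; exists V; split=> //; have [g ga gf] := aut_inv ja.
 exists (g \o f); first exact: aut_comp.
 by rewrite /= -VE (gf V (N0X NV)).1.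
pose Rel c (x : ('I_(size fs) * C) * ('I_(size fs) * C) * ('I_(size fs) * C)) :=
 exists f, [/\ automorphism X f, N0 (f U0), tt (f U0) = c & [/\ RelI f U1 x.1.1, RelI f U2 x.1.2 & RelI f U3 x.2]].
apply: (@fins_rel _ _ _ [seq (xy, z) | xy <- [seq (x, y) | x <- [seq (j, t) | j <- enum 'I_(size fs), t <- L1],
  y <- [seq (j, t) | j <- enum 'I_(size fs), t <- L2]], z <- [seq (j, t) | j <- enum 'I_(size fs), t <- L3]] Rel).
 move=> c [W [NW [f fa WE] tW]]; subst W.
 have [x1 m1 r1] := relI f U1 L1 fa N1 L1P.
 have [x2 m2 r2] := relI f U2 L2 fa N2 L2P.
 have [x3 m3 r3] := relI f U3 L3 fa N3 L3P.
 exists ((x1, x2), x3); last by exists f.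
 by apply: allpairs_f => //; apply: allpairs_f.
move=> c c' [[x1 x2] x3] _ _ [f [fa Nf tf [r1 r2 r3]]] [f' [fa' Nf' tf' [r1' r2' r3']]].
have mf : meets f by exists U0.
have mf' : meets f' by exists U0.
have [p [q pq]] := rational iF fa mf; have [p' [q' pq']] := rational iF fa' mf'.
have [sp sq] := rho_degree iF fa mf pq; have [sp' sq'] := rho_degree iF fa' mf' pq'.
(* At tt U the homography of f1 takes the same value, possibly infinite, as that of the covering
   automorphism at x.2. *)
have key f1 p1 q1 U x : automorphism X f1 -> meets f1 -> rho_of f1 p1 q1 -> N0 U -> RelI f1 U x ->
  forall pg qg, rho_of (nth id fs x.1) pg qg -> p1.[tt U] * qg.[x.2] = q1.[tt U] * pg.[x.2].
 move=> f1a m1 pq1 NU [V [ga NV fUE <-]] pg qg pqg; set gj := nth id fs x.1 in ga fUE pqg *.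
 have [h ha hg] := aut_inv ga.
 have hfa : automorphism X (h \o f1) by exact: aut_comp.
 have hfU : h (f1 U) = V by rewrite fUE (hg V (N0X NV)).1.
 have mh : meets (h \o f1) by exists U; rewrite /= hfU.
 have [ph [qh pqh]] := rational iF hfa mh.
 have NhU : N0 ((h \o f1) U) by rewrite /= hfU.
 have [qhU phU] := pqh.2 U NU NhU; rewrite /= hfU in phU.
 have -> : tt V = ph.[tt U] / qh.[tt U] by rewrite phU mulfK.
 have := rho_comp f1a hfa m1 mh pq1 pqh pqg; apply; last exact: qhU.
 by move=> W XW /=; apply: (hg _ (f1a.1.1 W XW)).2.
have mfs f1 U x : automorphism X f1 -> meets f1 -> N0 U -> RelI f1 U x ->
  automorphism X (nth id fs x.1) /\ meets (nth id fs x.1).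
 move=> f1a m1 NU [V [ga NV fUE _]]; set gj := nth id fs x.1 in ga fUE *; split; first exact: ga.
 have [h ha hg] := aut_inv ga.
 have hfa : automorphism X (h \o f1) by exact: aut_comp.
 have mh : meets (h \o f1) by exists U; rewrite /= fUE (hg V (N0X NV)).1.
 have [t [[W [NW NfW NhW tW]] _]] := inf_pick [::] (common f1a hfa m1 mh).
 by exists (h (f1 W)); split; [exact: NhW|rewrite (hg _ (N0X NfW)).2; exact: NfW].
have cross U x : N0 U -> RelI f U x -> RelI f' U x -> p.[tt U] * q'.[tt U] - p'.[tt U] * q.[tt U] = 0.
 move=> NU rx rx'; have [ga mg] := mfs f U x fa mf NU rx.
 have [pg [qg pqg]] := rational iF ga mg.
 have e1 := key f p q U x fa mf pq NU rx pg qg pqg.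
 have e2 := key f' p' q' U x fa' mf' pq' NU rx' pg qg pqg.
 have [qg0|qg0] := eqVneq qg.[x.2] 0.
  have pg0 : pg.[x.2] != 0.
   apply: contraTneq pqg.1 => pg0; apply/negP => /coprimep_root/(_ (_ : root pg x.2)) h.
   have rp : root pg x.2 by rewrite /root pg0.
   by have := h rp; rewrite qg0 eqxx.
  move: e1 e2; rewrite qg0 !mulr0 => /esym/eqP; rewrite mulf_eq0 (negPf pg0) orbF => /eqP ->.
  by move=> /esym/eqP; rewrite mulf_eq0 (negPf pg0) orbF => /eqP ->; rewrite !mulr0 subrr.
 apply: (mulIf qg0); rewrite mul0r.
 have -> : (p.[tt U] * q'.[tt U] - p'.[tt U] * q.[tt U]) * qg.[x.2] =
   (p.[tt U] * qg.[x.2]) * q'.[tt U] - (p'.[tt U] * qg.[x.2]) * q.[tt U] by ring.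
 by rewrite e1 e2; ring.
(* A polynomial of degree at most two with the three distinct roots b1, b2, b3. *)
have z0 : p * q' - p' * q = 0.
 apply/eqP; apply: contraT => nz; exfalso.
 have := @max_poly_roots _ _ [:: b1; b2; b3] nz; rewrite /= !inE.
 have rt U x : N0 U -> RelI f U x -> RelI f' U x -> root (p * q' - p' * q) (tt U).
  by move=> NU rx rx'; rewrite /root hornerD hornerN !hornerM (cross U x).
 move: b21 b31; rewrite !inE negb_or => b21 /andP[b31 b32].
 have R1 : root (p * q' - p' * q) b1 by rewrite -t1; exact: (rt U1 x1 N1 r1 r1').
 have R2 : root (p * q' - p' * q) b2 by rewrite -t2; exact: (rt U2 x2 N2 r2 r2').
 have R3 : root (p * q' - p' * q) b3 by rewrite -t3; exact: (rt U3 x3 N3 r3 r3').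
 rewrite R1 R2 R3.
 rewrite negb_or ![b1 == _]eq_sym b21 b31 [b2 == _]eq_sym b32 => /(_ isT isT).
 apply/negP; rewrite -leqNgt; apply: leq_trans (size_polyD _ _) _; rewrite size_polyN geq_max.
 by apply/andP; split; apply: size2M.
have [qU pU] := pq.2 U0 N00 Nf; have [qU' pU'] := pq'.2 U0 N00 Nf'.
have := congr1 (fun r => r.[tt U0]) z0; rewrite hornerD hornerN !hornerM pU pU' tf tf' horner0.
rewrite (_ : _ - _ = (c - c') * (q.[tt U0] * q'.[tt U0])); last by ring.
by move/eqP; rewrite mulf_eq0 (negPf (mulf_neq0 qU qU')) orbF subr_eq0 => /eqP.
Qed.
End Classes.

(** A principal open set need not meet every component of X, whereas the open set required by
    cohomogeneity is dense; so the union of all translates of [nzero p] is taken, on which orbit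
    dimensions do not change. *)
Lemma coh_open (p : poly) (e c : nat) : (e + c = n.+1)%N -> (c <= 1)%N -> good p ->
 (forall U, nzero p U -> has_dim (aut_orbit X U) e) -> cohomogeneity_at_most 1 X.
move=> ec c1 gp pe; exists c => //; exists n.+1, e.
have [[d hp] _] := gp.
pose O : set Gr := [set W | exists f, automorphism X f /\ (f @` nzero p) W].
exists O; split.
- exact: I0_dim.
- apply/zopenP; split=> [_ [f [fa [U [XU _] <-]]]|W [f [fa fW]]]; first exact: fa.1.1.
 have [g ga gf] := aut_inv fa.
 have := image_open fa.1 ga.1 (fun U XU => (gf U XU).1) (fun U XU => (gf U XU).2) (zopen_neq X hp).
 move=> /zopenP[_ /(_ W fW)[d' [q [hq qW qO]]]]; exists d', q; split; [exact: hq|exact: qW|].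
 by move=> V XV qV; exists f; split; [exact: fa|exact: qO XV qV].
- move=> O1 oO1 nO1; have [r rE] := fam_mpf P p.
 have r0 : r != 0.
  have [_ [v ->] pv] := zv_neq gp.2; apply: contraNneq pv => r0.
  by have := fam_neq Mf v hp; rewrite rE r0 meval0 eqxx => /esym/negbFE.
 have [f [v [fa rv Ov]]] := dense r0 oO1 nO1.
 exists (f (Psi v)); split; first exact: Ov.
 exists f; split; first exact: fa.
 exists (Psi v); last by [].
 by split; [exact: XPsi|rewrite -(fam_neq Mf v hp) rE].
- move=> _ [f [fa [U NU <-]]]; have [XU _] := NU.
 apply: (has_dim_set _ (pe U NU)) => W.
 have UfU : aut_orbit X U (f U) by exists f.
 by split; apply: orbit_trans; [exact: aut_orbit_sym|].
- by rewrite ec.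
Qed.

Theorem coh_family : cohomogeneity_at_most 1 X.
have [p0 [gp0 p0P p0T2]] := base_open.
have [d0 hp0] := gp0.1.
case: (pselect (forall U, nzero p0 U -> fins (cls p0 U))) => [allf|nf].
 apply: (@coh_open p0 n 1) => //; first by rewrite addn1.
 by move=> U NU; apply: (fin_dim gp0 p0P NU); apply: allf.
have [U0 [N00 i0]] : exists U, nzero p0 U /\ ~ fins (cls p0 U).
 apply: contrapT => H; apply: nf => U NU; apply: contrapT => i; by apply: H; exists U.
have [l lP] := dichotomy gp0 p0P p0T2 N00 i0.
apply: (@coh_open (p0 * \prod_(b <- l) (T1 - b *: T2)) n.+1 0); [by rewrite addn0|by []| |].
 by apply: goodM gp0 _; exact: good_prod.
move=> U [XU]; rewrite mevalM neqM => /andP[p0U lU].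
have NU : nzero p0 U by split.
apply: (inf_dim p0P NU) => fU; case/negP: lU.
have [v [UE tU _]] := p0P _ NU.
rewrite rmorph_prod /= prodf_seq_eq0; apply/hasP; exists (v ord0) => /=.
 by apply: lP; exists U; split; [exact: NU|exact: tU|exact: fU].
by rewrite UE mevalB mevalZ T1Psi subrr.
Qed.
End Abstract.

(** * Degree bounds, points in general position, transitivity on isotropic spaces *)

Section Degrees.
Variables (F : numFieldType) (n : nat).

Lemma msize_bigprod (I : Type) (s : seq I) (q : I -> {mpoly F[n]}) (e : I -> nat) :
 (forall i, (msize (q i) <= (e i).+1)%N) -> (msize (\prod_(i <- s) q i)%R <= (\sum_(i <- s) e i).+1)%N.
move=> qe; elim: s => [|i s IH]; first by rewrite !big_nil msize1.
by rewrite !big_cons; apply: msizeM_lt.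
Qed.

Definition mpd (d : nat) (f : ('I_n -> F) -> F) : Prop :=
 exists2 p : {mpoly F[n]}, (msize p <= d.+1)%N & forall x, f x = p.@[x].

Lemma mpd_mul d e f g : mpd d f -> mpd e g -> mpd (d + e) (fun x => f x * g x).
move=> [p pd pE] [q qd qE]; exists (p * q); first exact: msizeM_lt.
by move=> x; rewrite mevalM pE qE.
Qed.

Lemma mpd_exp d e f : mpd d f -> mpd (e * d) (fun x => f x ^+ e).
move=> [p pd pE]; exists (p ^+ e); first exact: msizeX_lt.
by move=> x; rewrite rmorphXn pE.
Qed.

Lemma mpd_prod (I : Type) (s : seq I) (f : I -> ('I_n -> F) -> F) (e : I -> nat) :
 (forall i, mpd (e i) (f i)) -> mpd (\sum_(i <- s) e i) (fun x => \prod_(i <- s) f i x).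
move=> h; have /choice[q qP] : forall i, exists q : {mpoly F[n]}, (msize q <= (e i).+1)%N /\ forall x, f i x = q.@[x].
 by move=> i; have [q a b] := h i; exists q.
exists (\prod_(i <- s) q i); first by apply: msize_bigprod => i; case: (qP i).
by move=> x; rewrite rmorph_prod; apply: eq_bigr => i _; case: (qP i) => _ ->.
Qed.

Lemma mpd_mpf (I : finType) (f : I -> ('I_n -> F) -> F) : (forall i, mpf (f i)) ->
 exists d, forall i, mpd d (f i).
move=> /fin_all_exists[p pE]; exists (\max_i msize (p i))%N => i; exists (p i) => //.
apply: leq_trans (leqnSn _); exact: leq_bigmax.
Qed.

Lemma mpd_homog (r D d : nat) (p : {mpoly F[r]}) (f : 'I_r -> ('I_n -> F) -> F) :
 p \is D.-homog -> (forall i, mpd d (f i)) -> mpd (D * d) (fun x => p.@[fun i => f i x]).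
move=> hp h; have /fin_all_exists[q qP] : forall i, exists q : {mpoly F[n]}, (msize q <= d.+1)%N /\ forall x, f i x = q.@[x].
 by move=> i; have [q a b] := h i; exists q.
exists (p \mPo (mktuple q)); last first.
 by move=> x; rewrite comp_mpoly_meval; apply: meval_eq => i; rewrite tnth_mktuple; case: (qP i).
rewrite comp_mpolyE; apply: leq_trans (msize_sum _ _ _) _; apply/bigmax_leqP_seq => m mp _.
apply: leq_trans (msizeZ_le _ _) _; apply: leq_trans (msize_bigprod (e := fun i => (m i * d)%N) _ _) _.
 by move=> i; rewrite tnth_mktuple; apply: msizeX_lt; case: (qP i).
by rewrite -big_distrl /= -mdegE; move/dhomogP: hp => /(_ m mp) ->.
Qed.
End Degrees.

Section Points.
Variable F : numFieldType.

(** If the determinant vanished for every choice of the last point, expanding along its row would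
    give a relation whose last coefficient is, up to sign, the non-zero determinant of the smaller
    case. *)
Lemma indep_points_ord (T : Type) (P : T -> Prop) (n : nat) (f : 'I_n -> T -> F) :
 lin_indep P f -> exists2 w : 'I_n -> T, forall i, P (w i) & \det (\matrix_(i, j) f j (w i)) != 0.
elim: n f => [|n IH] f fi.
 have e0 (i : 'I_0) : False by case: i.
 by exists (fun i => False_rect _ (e0 i)) => [i|]; [case: (e0 i)|rewrite det_mx00 oner_neq0].
have [|w wP wd] := IH (fun i => f (lift ord_max i)).
 move=> c h i; pose c' j := if unlift ord_max j is Some j' then c j' else 0.
 have := fi c'; move/(_ _ (lift ord_max i)); rewrite /c' liftK; apply=> x Px.
 rewrite (bigD1_ord ord_max) //= /c' unlift_none mul0r add0r -[RHS](h x Px).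
 by apply: eq_bigr => j _; rewrite liftK.
pose M x := \matrix_(i, j) f j (if unlift ord_max i is Some i' then w i' else x).
have ME x : \det (M x) = \sum_j f j x * cofactor (M x) ord_max j.
 by rewrite (expand_det_row _ ord_max); apply: eq_bigr => j _; rewrite mxE unlift_none.
have cE x y j : cofactor (M x) ord_max j = cofactor (M y) ord_max j.
 by congr (_ * \det _); apply/matrixP => a b; rewrite !mxE liftK.
have [x Px Mx] : exists2 x, P x & \det (M x) != 0.
 apply: contrapT => H.
 have [x0 Px0] : exists x, P x.
  apply: contrapT => nP; have := fi (fun=> 1); move/(_ _ ord0) => h.
  by have /eqP := h (fun x Px => False_ind _ (nP (ex_intro _ x Px))); rewrite oner_eq0.
 have h x : P x -> \sum_j cofactor (M x0) ord_max j * f j x = 0.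
  move=> Px; apply/eqP; apply: contraT => nz; case: H; exists x => //; rewrite ME.
  by congr (_ != 0): nz; apply: eq_bigr => j _; rewrite mulrC (cE x0 x).
 have := fi _ h ord_max; rewrite /cofactor => /eqP; rewrite mulf_eq0 signr_eq0 /=; apply/negP.
 move: wd; congr (\det _ != 0); apply/matrixP => a b; by rewrite !mxE liftK.
exists (fun i => if unlift ord_max i is Some i' then w i' else x) => // i.
by case: unliftP => [j|] _.
Qed.

Lemma indep_points (T : Type) (P : T -> Prop) (I : finType) (f : I -> T -> F) :
 lin_indep P f -> exists2 w : 'I_#|I| -> T, forall i, P (w i) &
  \det (\matrix_(i, j) f (enum_val j) (w i)) != 0.
move=> fi; apply: (@indep_points_ord T P #|I| (fun j => f (enum_val j))) => c h i.
have := fi (fun x => c (enum_rank x)) _ (enum_val i); rewrite enum_valK; apply=> x Px.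
rewrite -[RHS](h x Px) (reindex (@enum_rank I)) /=; last exact: onW_bij (enum_rank_bij _).
by apply: eq_bigr => j _; rewrite enum_rankK.
Qed.
End Points.

Section Charts.
Variables (R : realType) (m k : nat).
Notation C := (R[i]).
Notation V := 'rV[C]_m.
Notation Gr := (Gr R k m).

Lemma bform_sum_ev (u w : V) : bform u w = \sum_j u 0 j * (w 0 (rev_ord j) *+ (1 + (rev_ord j == j))).
rewrite {1}(vec_ev u) bform_suml; apply: eq_bigr => j _.
by rewrite bformZl bform_ev.
Qed.

(* The lexicographically first non-zero minor of an isotropic space has no two
  opposite columns. *)
Lemma OG_pivot (W : Gr) : OG R k m W -> exists (c : 'I_k -> 'I_m./2) (eps : 'I_k -> bool) (c_inj : injective c),
 minor (bmx W) [ffun i => bidx c eps i] != 0.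
move=> OW; have [h0 h0W] := row_free_minor (bmx_free W).
pose wt (h : {ffun 'I_k -> 'I_m}) := (\sum_i h i)%N.
have [h hW hmin] : exists2 h : {ffun 'I_k -> 'I_m}, minor (bmx W) h != 0 & forall h' : {ffun 'I_k -> 'I_m}, minor (bmx W) h' != 0 -> (wt h <= wt h')%N.
 case: (arg_minnP (P := fun h : {ffun 'I_k -> 'I_m} => minor (bmx W) h != 0) wt h0W) => h hW hm; by exists h.
pose M := cmx h W.
have Mh := chart_mx_b hW; rewrite -/M in Mh.
have Mlt i (l : 'I_m) : (l < h i)%N -> M i l = 0.
 move=> li; apply/eqP; apply: contraT => Ml.
 rewrite /M chart_mxE // in Ml.
 have hm : minor (bmx W) [ffun a => upd h i l a] != 0.
  have -> : minor (bmx W) [ffun a => upd h i l a] = minor (bmx W) (upd h i l).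
   by congr (\det _); apply/matrixP => a b; rewrite !mxE ffunE.
  by apply: contraNneq Ml => ->; rewrite mul0r.
 have := hmin _ hm.
 rewrite leqNgt => /negP[]; rewrite /wt (bigD1 i) //= [X in (_ < X)%N](bigD1 i) //= ffunE /upd eqxx.
 rewrite -addSn leq_add // leq_eqVlt; apply/orP; left; apply/eqP; apply: eq_bigr => a /negPf ai.
 by rewrite ffunE /upd ai.
have Mb i j : bform (row i M) (row j M) = 0.
 rewrite /bform !OW ?subrr //; [exact: cmx_mem|exact: cmx_mem|].
 by apply: memvD; exact: cmx_mem.
have hrev i j : h j != rev_ord (h i).
 apply/eqP => e; have /eqP := Mb i j; rewrite bform_sum_ev (bigD1 (h i)) //= big1 => [|l lh].
  rewrite addr0 !mxE -e !Mh !eqxx mul1r -mulr_natl mulr1 pnatr_eq0 //.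
 rewrite !mxE; have [l1|l1] := ltnP l (h i); first by rewrite Mlt // mul0r.
 rewrite (Mlt j) ?mul0rn ?mulr0 // e /=.
 have : (h i < l)%N by rewrite ltn_neqAle l1 andbT eq_sym.
 by have := ltn_ord l; have := ltn_ord (h i); lia.
have /fin_all_exists2[c _ /fin_all_exists[eps epsE]] : forall i, exists2 c : 'I_m./2, true & exists e, h i = idx c e.
 move=> i; have [[a [e eE]]|] := idx_cases (h i); first by exists a => //; exists e.
 by move/eqP => e; have := hrev i i; rewrite e eqxx.
have c_inj : injective c.
 move=> i j cij; have hE : h j = idx (c i) (eps j) by rewrite cij epsE.
 have [e|ne] := eqVneq (eps i) (eps j).
  have hh : h i = h j by rewrite hE -e epsE.
  by have := Mh i i; rewrite {1}hh Mh eqxx => /eqP; rewrite pnatr_eq1 eqb1 => /eqP.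
 have := hrev i j; rewrite hE epsE rev_idx.
 by move: ne; case: (eps i); case: (eps j); rewrite ?eqxx.
exists c, eps, c_inj; move: hW; congr (_ != 0); congr (\det _); apply/matrixP => i j.
by rewrite !mxE ffunE epsE.
Qed.

Lemma gl_act_connect (g1 g2 : 'M[C]_m) (U W W' : Gr) : g1 \in unitmx -> g2 \in unitmx ->
 gla g1 U = W -> gla g2 U = W' -> gla (invmx g1 *m g2) W = W'.
by move=> u1 u2 <- <-; rewrite -gl_actM ?unitmx_inv // gl_actK. Qed.

(** Each isotropic space lies in some chart by [OG_pivot], and W0 lies in all of them; through the
    centre of that chart the two are conjugate. *)
Lemma witt (W0 : Gr) : OG R k m W0 ->
 (forall (c : 'I_k -> 'I_m./2) (eps : 'I_k -> bool), injective c -> minor (bmx W0) [ffun i => bidx c eps i] != 0) ->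
 forall W W', OG R k m W -> OG R k m W' -> exists g h, cpair g h /\ gla g W = W'.
move=> O0 h0.
have to0 W : OG R k m W -> exists g h, cpair g h /\ gla g W0 = W.
 move=> OW; have [c [eps [ci cW]]] := OG_pivot OW.
 have e0 := chart_gl ci O0 (h0 c eps ci); have e1 := chart_gl ci OW cW.
 have [H0 [p0 _]] := cpair_chart (xs := cvec c eps W0) (fun i j => @chart_vecP R m k c eps W0 i j) (enum 'I_k).
 have [H1 [p1 _]] := cpair_chart (xs := cvec c eps W) (fun i j => @chart_vecP R m k c eps W i j) (enum 'I_k).
 have p := cpair_comp (cpair_inv p0) p1.
 eexists; eexists; split; first exact: p.
 have [u0 _ _ _] := p0; have [u1 _ _ _] := p1.
 exact: gl_act_connect e0 e1.
move=> W W' /to0[g [h [gh gW]]] /to0[g' [h' [gh' gW']]].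
have p := cpair_comp (cpair_inv gh) gh'; eexists; eexists; split; first exact: p.
have [u _ _ _] := gh; have [u' _ _ _] := gh'.
exact: gl_act_connect gW gW'.
Qed.
End Charts.

(** * Polynomial dependence of vectors, spinors and words on parameters *)

Section PolynomialMaps.
Variables (R : realType) (m n : nat).
Notation C := (R[i]).
Notation V := 'rV[C]_m.
Notation Spn := (spinor R m).
Implicit Types (v w : ('I_n -> C) -> V) (x : ('I_n -> C) -> Spn).

Definition mpv v : Prop := forall j, mpf (fun t => v t 0 j).
Definition mps x : Prop := forall I, mpf (fun t => cf (x t) I).

Lemma mps_cl v x : mpv v -> mps x -> mps (fun t => cl (v t) (x t)).
move=> vp xp I; apply: mpfE (fun t => cf_cl (v t) (x t) I) _.
apply: mpfD; apply: mpf_sum => j; last by apply: mpfM => //; apply: mpfM => //; apply: mpfC.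
by case: (j \in I); apply: mpfM => //; apply: mpfM => //; apply: mpfC.
Qed.

Lemma mps_Eop v w (c : C) x : mpv v -> mpv w -> mps x -> mps (fun t => Eop (v t) (w t) c (x t)).
move=> vp wp xp I; apply: mpfE (fun t => cfD _ _ I) _; apply: mpfD => //.
apply: mpfE (fun t => cfZ _ _ I) _; apply: mpfM; first exact: mpfC.
by apply: mps_cl => //; apply: mps_cl.
Qed.

Lemma mps_lin (h : 'End(Spn)) x : mps x -> mps (fun t => h (x t)).
move=> xp I; apply: (mpfE (g := fun t => \sum_J cf (x t) J * cf (h (basis_spinor R J)) I)) => [t|].
 rewrite {1}(spinor_sum (x t)) linear_sum cf_sum; apply: eq_bigr => J _.
 by rewrite linearZ cfZ.
by apply: mpf_sum => J; apply: mpfM => //; apply: mpfC.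
Qed.

Lemma mpf_bform v w : mpv v -> mpv w -> mpf (fun t => bform (v t) (w t)).
move=> vp wp; apply: mpfE (fun t => bformE _ _) _; apply: mpfD; apply: mpf_sum => i.
 by apply: mpfD; apply: mpfM.
by apply: mpfE (fun t => mulr2n _) _; apply: mpfD; apply: mpfM.
Qed.

Lemma mpf_qform v : mpv v -> mpf (fun t => qform (v t)).
move=> vp; apply: mpfD; apply: mpf_sum => i; first by apply: mpfM.
by apply: mpfE (fun t => expr2 _) _; apply: mpfM.
Qed.

Lemma mpv_const (v : V) : mpv (fun=> v). by move=> j; exact: mpfC. Qed.
End PolynomialMaps.

Section PolynomialWords.
Variables (R : realType) (m : nat) (E : seq spin_label).
Notation C := (R[i]).
Notation N := (size E).
Notation ev := (@ev R m).
Notation selem := (selem m N).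
Implicit Types (L : seq selem) (t : nat -> C) (e : selem).

(* Denominator-free version of wordg. *)
Definition emxp e (t : C) : 'M[C]_m :=
 match e with
 | EV a c => let d := Eden (ev a) (ev c) t in
   d *: 1%:M + (t * d) *: (bcol (ev c) *m ev a) - t *: (bcol (ev a) *m ev c)
   - (t ^+ 2 * qform (ev c)) *: (bcol (ev a) *m ev a)
 | ES _ => (1 + t) *: 1%:M
 end.
Definition edenp e (t : C) : C := if e is EV a c then Eden (ev a) (ev c) t else 1 + t.

Fixpoint wordp L t : 'M[C]_m :=
 if L is e :: L' then wordp L' (fun i => t i.+1) *m emxp e (t 0%N) else 1%:M.
Fixpoint wden L t : C :=
 if L is e :: L' then wden L' (fun i => t i.+1) * edenp e (t 0%N) else 1.

Lemma emxpE e (t : C) : edenp e t != 0 ->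
 emxp e t = edenp e t *: (if e is EV a c then Emx (ev a) (ev c) t else 1%:M).
case: e => [a c|j] //= d0; rewrite /Emx; set d := Eden _ _ _ in d0 *.
rewrite !scalerBr !scalerDr !scalerA [d * t]mulrC.
have e1 x : d * (x / d) = x by rewrite mulrCA divff // mulr1.
by rewrite !e1.
Qed.

Lemma wordpE L t : wden L t != 0 -> wordp L t = wden L t *: wordg L t.
elim: L t => [|e L IH] t /=; first by rewrite scale1r.
rewrite neqM => /andP[/IH -> d0].
by rewrite emxpE // -scalemxAl -scalemxAr scalerA.
Qed.

Lemma wordden0 L : wden L (fun=> 0) = 1.
elim: L => [|e L IH] //=; rewrite IH mul1r.
by case: e => [a c|j] /=; rewrite ?/Eden ?mul0r addr0.
Qed.

Lemma wordp0 L : wordp L (fun=> 0) = 1%:M.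
elim: L => [|e L IH] //=; rewrite IH mul1mx; case: e => [a c|j] /=; last by rewrite addr0 scale1r.
by rewrite /Eden mul0r addr0 scale1r !mul0r expr0n /= mul0r !scale0r addr0 !subr0.
Qed.

Lemma wordden_neq0 L t : (wden L t != 0) -> forall r : 'I_(size L), 1 + t (val r) * sden R (tnth (in_tuple L) r) != 0.
elim: L t => [|e L IH] t /=; first by move=> _ [].
rewrite neqM => /andP[/IH h d0] [[|r] rL].
 by rewrite (tnth_nth e) /=; case: e d0 rL => [a c|j] d0 _; rewrite ?mulr1.
have := h (Ordinal (rL : (r < size L)%N)); rewrite !(tnth_nth e) /=; exact.
Qed.

Definition extf (n : nat) (x : 'I_n -> C) (i : nat) : C := if insub i is Some l then x l else 0.

Lemma mpf_extf n i : mpf (fun x : 'I_n -> C => extf x i).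
by rewrite /extf; case: insubP => [l _ _|_]; [exact: mpfX|exact: mpfC]. Qed.

Lemma mpf_emxp n e (t : ('I_n -> C) -> C) : mpf t -> forall i j, mpf (fun x => emxp e (t x) i j).
move=> tp i j; case: e => [a c|l]; last first.
 apply: (mpfE (g := fun x => (1 + t x) * (1%:M : 'M[C]_m) i j)) => [x|]; first by rewrite mxE.
 by apply: mpfM; [apply: mpfD => //|]; exact: mpfC.
have dp : mpf (fun x => Eden (ev a) (ev c) (t x)).
 by apply: mpfD; [exact: mpfC|apply: mpfM => //; exact: mpfC].
pose M1 := bcol (ev c) *m ev a; pose M2 := bcol (ev a) *m ev c; pose M3 := bcol (ev a) *m ev a.
apply: (mpfE (g := fun x => Eden (ev a) (ev c) (t x) * ((1%:M : 'M[C]_m) i j) + t x * Eden (ev a) (ev c) (t x) * M1 i j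
  + t x * (- M2 i j) + t x * t x * (- (qform (ev c) * M3 i j)))) => [x|].
 rewrite /emxp ![in LHS]mxE -/M1 -/M2 -/M3; rewrite /M1 /M2 /M3 !mxE; ring.
do !apply: mpfD; do !apply: mpfM => //; exact: mpfC.
Qed.

Lemma mpf_wordp n L (t : ('I_n -> C) -> nat -> C) : (forall i, mpf (fun x => t x i)) ->
 forall i j, mpf (fun x => wordp L (t x) i j).
elim: L t => [|e L IH] t tp i j /=; first exact: mpfC.
apply: mpfMx => [a b|a b]; first by apply: IH.
exact: mpf_emxp.
Qed.

Lemma mpf_wordden n L (t : ('I_n -> C) -> nat -> C) : (forall i, mpf (fun x => t x i)) ->
 mpf (fun x => wden L (t x)).
elim: L t => [|e L IH] t tp /=; first exact: mpfC.
apply: mpfM; first by apply: IH.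
case: e => [a c|j] /=; last by apply: mpfD => //; exact: mpfC.
by apply: mpfD; [exact: mpfC|apply: mpfM => //; exact: mpfC].
Qed.

Lemma eq_word L t t' s : (forall i, (i < size L)%N -> t i = t' i) -> word L t s = word L t' s.
elim: L t t' => [|e L IH] t t' h; first by [].
have e1 t0 : word (e :: L) t0 s = word L (fun i => t0 i.+1) s + t0 0%N *: Nop e (word L (fun i => t0 i.+1) s) by [].
have e2 : word L (fun i => t i.+1) s = word L (fun i => t' i.+1) s by apply: IH => i iL; exact: h.
by rewrite !e1 e2 h.
Qed.

Lemma eq_wordden L t t' : (forall i, (i < size L)%N -> t i = t' i) -> wden L t = wden L t'.
elim: L t t' => //= e L IH t t' h.
by rewrite (IH _ (fun i => t' i.+1)) ?h // => i iL; apply: h.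
Qed.

Lemma ext_fun_id n (t : nat -> C) i : (i < n)%N -> extf (fun l : 'I_n => t l) i = t i.
by move=> h; rewrite /extf insubT. Qed.
End PolynomialWords.

(** * Local surjectivity in the classical topology *)

Section LocalSurjection.
Variables (R : realType).
Notation C := (R[i]).

(** The l1 norm of a complex number: it is submultiplicative and takes its values in the real field,
    where order arguments are available. *)
Definition nrm (z : C) : R := `|complex.Re z| + `|complex.Im z|.

Lemma nrm_ge0 z : 0 <= nrm z. by rewrite addr_ge0. Qed.
Lemma nrm0 : nrm 0 = 0. by rewrite /nrm /= normr0 addr0. Qed.
Lemma nrmN z : nrm (- z) = nrm z. by case: z => a b; rewrite /nrm /= !normrN. Qed.
Lemma nrmD z w : nrm (z + w) <= nrm z + nrm w.
by case: z w => [a b] [c d]; rewrite /nrm /= addrACA lerD // ler_normD. Qed.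
Lemma nrmM z w : nrm (z * w) <= nrm z * nrm w.
case: z w => [a b] [c d]; rewrite /nrm /=.
have -> : (`|a| + `|b|) * (`|c| + `|d|) = (`|a * c| + `|b * d|) + (`|a * d| + `|b * c|) by rewrite !normrM; ring.
by rewrite lerD // ?ler_normD // -[X in _ <= _ + X]normrN ler_normD.
Qed.
Lemma nrm_eq0 z : nrm z <= 0 -> z = 0.
case: z => a b; rewrite /nrm /= => h.
have /eqP : `|a| + `|b| = 0 by apply/eqP; rewrite eq_le h addr_ge0.
by rewrite paddr_eq0 // !normr_eq0 => /andP[/eqP -> /eqP ->].
Qed.
Lemma nrm_sum (I : Type) (s : seq I) (P : pred I) (f : I -> C) :
 nrm (\sum_(i <- s | P i) f i) <= \sum_(i <- s | P i) nrm (f i).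
elim/big_ind2: _ => [|x a y b xa yb|//]; first by rewrite nrm0.
by apply: le_trans (nrmD _ _) _; apply: lerD.
Qed.

Section Vectors.
Variable n : nat.
Implicit Types (x y : 'I_n -> C) (f g : ('I_n -> C) -> C) (a b : 'I_n -> C).

Definition nv x : R := \sum_j nrm (x j).
Definition lin a x : C := \sum_l a l * x l.
Definition dif x y : 'I_n -> C := fun l => x l - y l.

Lemma nv_ge0 x : 0 <= nv x. by apply: sumr_ge0 => j _; exact: nrm_ge0. Qed.
Lemma nv_tri x y z : nv (dif x z) <= nv (dif x y) + nv (dif y z).
rewrite /nv -big_split; apply: ler_sum => j _ /=.
by rewrite /dif (_ : x j - z j = (x j - y j) + (y j - z j)) ?nrmD //; ring.
Qed.
Lemma nv_coord x j : nrm (x j) <= nv x.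
by rewrite /nv (bigD1 j) //= lerDl sumr_ge0 // => l _; exact: nrm_ge0. Qed.
Lemma nrm_lin a x : nrm (lin a x) <= nv a * nv x.
apply: le_trans (nrm_sum _ _ _) _; rewrite /nv mulr_suml; apply: ler_sum => l _.
apply: le_trans (nrmM _ _) _; apply: ler_wpM2l; [exact: nrm_ge0|exact: nv_coord].
Qed.

(** Strict differentiability at the origin: both points vary, as a contraction estimate requires. *)
Definition sdiff f a : Prop := forall e : R, 0 < e -> exists2 r : R, 0 < r &
 forall x y, nv x <= r -> nv y <= r -> nrm (f x - f y - lin a (dif x y)) <= e * nv (dif x y).

Lemma sdiff_lip f a : sdiff f a -> exists2 r : R, 0 < r &
 forall x y, nv x <= r -> nv y <= r -> nrm (f x - f y) <= (1 + nv a) * nv (dif x y).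
move=> /(_ 1 ltr01)[r r0 h]; exists r => // x y xr yr.
have -> : f x - f y = (f x - f y - lin a (dif x y)) + lin a (dif x y) by ring.
apply: le_trans (nrmD _ _) _; rewrite mulrDl; apply: lerD; [exact: h|exact: nrm_lin].
Qed.

Lemma nv0 : nv (fun=> 0) = 0. by rewrite /nv big1 // => j _; exact: nrm0. Qed.
Lemma dif0 x : nv (dif x (fun=> 0)) = nv x.
by apply: eq_bigr => j _; rewrite /dif subr0. Qed.

Lemma sdiff_const c : sdiff (fun=> c) (fun=> 0).
move=> e e0; exists 1 => // x y _ _; rewrite subrr sub0r nrmN /lin big1 => [|l _]; last by rewrite mul0r.
by rewrite nrm0 mulr_ge0 ?nv_ge0 // ltW.
Qed.

Lemma sdiff_var j : sdiff (fun x => x j) (fun l => (j == l)%:R).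
move=> e e0; exists 1 => // x y _ _; rewrite /lin (bigD1 j) //= eqxx mul1r big1 => [|l /negPf]; last first.
 by rewrite eq_sym => ->; rewrite mul0r.
by rewrite /dif addr0 subrr nrm0 mulr_ge0 ?nv_ge0 // ltW.
Qed.

Lemma linD a b x : lin (fun l => a l + b l) x = lin a x + lin b x.
by rewrite /lin -big_split; apply: eq_bigr => l _; rewrite mulrDl. Qed.
Lemma linZ (c : C) a x : lin (fun l => c * a l) x = c * lin a x.
by rewrite /lin mulr_sumr; apply: eq_bigr => l _; rewrite mulrA. Qed.

Lemma sdiff_add f g a b : sdiff f a -> sdiff g b -> sdiff (fun x => f x + g x) (fun l => a l + b l).
move=> fa gb e e0; have e2 : 0 < e / 2 by lra.
have [r r0 h] := fa _ e2; have [r' r0' h'] := gb _ e2.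
exists (Order.min r r'); first by rewrite lt_min r0.
move=> x y; rewrite !le_min => /andP[xr xr'] /andP[yr yr'].
have -> : f x + g x - (f y + g y) - lin (fun l => a l + b l) (dif x y) =
  (f x - f y - lin a (dif x y)) + (g x - g y - lin b (dif x y)) by rewrite linD; ring.
apply: le_trans (nrmD _ _) _; have := h x y xr yr; have := h' x y xr' yr'; move: (nrm _) (nrm _) => u v.
by rewrite {3}(splitr e) mulrDl => h1 h2; apply: lerD.
Qed.

Lemma sdiff_mul f g a b : sdiff f a -> sdiff g b ->
 sdiff (fun x => f x * g x) (fun l => f (fun=> 0) * b l + g (fun=> 0) * a l).
move=> fa gb e e0.
have [r1 r10 lf] := sdiff_lip fa; have [r2 r20 lg] := sdiff_lip gb.
set F0 := f (fun=> 0); set G0 := g (fun=> 0).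
pose La := 1 + nv a; pose Lb := 1 + nv b.
have La1 : 1 <= La by rewrite lerDl nv_ge0.
have Lb1 : 1 <= Lb by rewrite lerDl nv_ge0.
pose B := nrm F0 + nrm G0 + La + Lb.
have B1 : 1 <= B by rewrite /B; have := nrm_ge0 F0; have := nrm_ge0 G0; lra.
pose e' := e / (4 * B).
have B0 : 0 < B by lra.
have e'0 : 0 < e' by rewrite divr_gt0 // mulr_gt0.
have [r3 r30 hf] := fa _ e'0; have [r4 r40 hg] := gb _ e'0.
pose r5 := e / (4 * (La * Lb)).
have LL : 0 < La * Lb by rewrite mulr_gt0; lra.
have r50 : 0 < r5 by rewrite divr_gt0 // mulr_gt0.
exists (Order.min 1 (Order.min (Order.min r1 r2) (Order.min (Order.min r3 r4) r5))).
 by rewrite !lt_min ltr01 r10 r20 r30 r40 r50.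
move=> x y; rewrite !le_min => /andP[x1 /andP[/andP[xr1 xr2] /andP[/andP[xr3 xr4] xr5]]].
move=> /andP[y1 /andP[/andP[yr1 yr2] /andP[/andP[yr3 yr4] yr5]]].
set D := nv (dif x y); have D0 : 0 <= D by exact: nv_ge0.
have z1 : nv (fun=> 0) <= r1 by rewrite nv0 ltW.
have z2 : nv (fun=> 0) <= r2 by rewrite nv0 ltW.
have fx0 : nrm (f x - F0) <= La * nv x by have := lf x _ xr1 z1; rewrite dif0.
have gy0 : nrm (g y - G0) <= Lb * nv y by have := lg y _ yr2 z2; rewrite dif0.
have -> : f x * g x - f y * g y - lin (fun l => F0 * b l + G0 * a l) (dif x y) =
  (f x * (g x - g y - lin b (dif x y)) + g y * (f x - f y - lin a (dif x y)))
  + ((f x - F0) * lin b (dif x y) + (g y - G0) * lin a (dif x y)).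
 by rewrite linD !linZ; ring.
have fB : nrm (f x) <= B.
 have -> : f x = F0 + (f x - F0) by ring.
 apply: le_trans (nrmD _ _) _.
 have : La * nv x <= La by rewrite -[X in _ <= X]mulr1 ler_pM2l //; lra.
 rewrite /B; have := nrm_ge0 G0; lra.
have gB : nrm (g y) <= B.
 have -> : g y = G0 + (g y - G0) by ring.
 apply: le_trans (nrmD _ _) _.
 have : Lb * nv y <= Lb by rewrite -[X in _ <= X]mulr1 ler_pM2l //; lra.
 rewrite /B; have := nrm_ge0 F0; lra.
have q : e / 4 = B * e' by rewrite /e'; field; lra.
have q' : e / 4 = La * Lb * r5 by rewrite /r5; field; apply/andP; split; lra.
have t1 : nrm (f x * (g x - g y - lin b (dif x y))) <= e / 4 * D.
 apply: le_trans (nrmM _ _) _; rewrite q -mulrA; apply: ler_pM => //; try exact: nrm_ge0; exact: hg.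
have t2 : nrm (g y * (f x - f y - lin a (dif x y))) <= e / 4 * D.
 apply: le_trans (nrmM _ _) _; rewrite q -mulrA; apply: ler_pM => //; try exact: nrm_ge0; exact: hf.
have t3 : nrm ((f x - F0) * lin b (dif x y)) <= e / 4 * D.
 apply: le_trans (nrmM _ _) _; rewrite q' (_ : La * Lb * r5 * D = (La * r5) * (Lb * D)); last by ring.
 apply: ler_pM; try exact: nrm_ge0.
  by apply: le_trans fx0 _; rewrite ler_pM2l //; lra.
 apply: le_trans (nrm_lin _ _) _; apply: ler_wpM2r => //; rewrite /Lb; lra.
have t4 : nrm ((g y - G0) * lin a (dif x y)) <= e / 4 * D.
 apply: le_trans (nrmM _ _) _; rewrite q' (_ : La * Lb * r5 * D = (Lb * r5) * (La * D)); last by ring.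
 apply: ler_pM; try exact: nrm_ge0.
  by apply: le_trans gy0 _; rewrite ler_pM2l //; lra.
 apply: le_trans (nrm_lin _ _) _; apply: ler_wpM2r => //; rewrite /La; lra.
apply: le_trans (nrmD _ _) _.
apply: le_trans (lerD (nrmD _ _) (nrmD _ _)) _.
move: t1 t2 t3 t4; move: (nrm _) (nrm _) (nrm _) (nrm _) => u1 u2 u3 u4.
have -> : e * D = (e / 4 * D + e / 4 * D) + (e / 4 * D + e / 4 * D) by field.
by move=> ? ? ? ?; do !apply: lerD.
Qed.

Lemma sdiff_mpoly (p : {mpoly C[n]}) : sdiff (fun x => p.@[x]) (fun l => (p^`M(l)).@[fun=> 0]).
have ext f g a b : (forall x, f x = g x) -> (forall l, a l = b l) -> sdiff g b -> sdiff f a.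
 move=> fg ab h e e0; have [r r0 hr] := h e e0; exists r => // x y xr yr.
 rewrite !fg (_ : lin a _ = lin b (dif x y)); first exact: hr.
 by apply: eq_bigr => l _; rewrite ab.
elim/mpoly_ring_ind: p => [c|i|p q hp hq|p q hp hq].
- by apply: ext (sdiff_const c) => [x|l]; rewrite ?mevalC // mderivC meval0.
- by apply: ext (sdiff_var i) => [x|l]; rewrite ?mevalXU // mderivXU mevalC.
- by apply: ext (sdiff_add hp hq) => [x|l]; rewrite ?mderivD mevalD.
apply: ext (sdiff_mul hp hq) => [x|l]; first by rewrite mevalM.
by rewrite mderivM mevalD !mevalM addrC [X in _ + X]mulrC.
Qed.
End Vectors.

Definition hlf (j : nat) : R := 2^-1 ^+ j.
Lemma hlf_gt0 j : 0 < hlf j. by rewrite exprn_gt0 // invr_gt0. Qed.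
Lemma hlfS j : hlf j = 2 * hlf j.+1. by rewrite /hlf exprS mulrA divff ?mul1r // pnatr_eq0. Qed.

Lemma hlf_small (B e : R) : 0 < e -> exists j, B * hlf j <= e.
move=> e0; have [B0|B0] := lerP B 0.
 by exists 0%N; apply: le_trans (mulr_le0_ge0 B0 (ltW (hlf_gt0 _))) (ltW e0).
exists (Num.bound (B / e)); rewrite -ler_pdivlMr ?hlf_gt0 // /hlf exprVn invrK.
have h1 : B / e < (Num.bound (B / e))%:R by apply: archi_boundP; rewrite divr_ge0 // ltW.
have h2 : (Num.bound (B / e))%:R <= 2 ^+ (Num.bound (B / e)) :> R.
 by rewrite -natrX ler_nat ltnW // ltn_expl.
have := lt_le_trans h1 h2; rewrite ltr_pdivrMr // mulrC => /ltW h.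
exact: h.
Qed.

Lemma le0_hlf (B z : R) : (forall j, z <= B * hlf j) -> z <= 0.
move=> h; rewrite leNgt; apply/negP => z0; have z2 : 0 < z / 2 by lra.
by have [j hj] := hlf_small B z2; have := h j; lra.
Qed.

(** The intervals of radius 2 B 2^-j around u j are nested; the limit is the supremum of their lower
    ends. *)
Lemma real_limit (u : nat -> R) (B : R) : (forall j, `|u j.+1 - u j| <= B * hlf j) ->
 exists L, forall j, `|u j - L| <= 2 * B * hlf j.
move=> hu; pose A (z : R) := exists j, z = u j - 2 * B * hlf j.
have step j : u j - 2 * B * hlf j <= u j.+1 - 2 * B * hlf j.+1 /\ u j.+1 + 2 * B * hlf j.+1 <= u j + 2 * B * hlf j.
 have := hu j; rewrite ler_norml hlfS => /andP[h1 h2].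
 split.
  have -> : 2 * B * (2 * hlf j.+1) = 2 * B * hlf j.+1 + B * (2 * hlf j.+1) by ring.
  lra.
 have -> : 2 * B * (2 * hlf j.+1) = 2 * B * hlf j.+1 + B * (2 * hlf j.+1) by ring.
 lra.
have B0 : 0 <= B.
 have := le_trans (normr_ge0 _) (hu 0%N); rewrite /hlf expr0 mulr1; exact.
have mono a d : u a - 2 * B * hlf a <= u (a + d)%N - 2 * B * hlf (a + d) /\ u (a + d)%N + 2 * B * hlf (a + d) <= u a + 2 * B * hlf a.
 elim: d => [|d [h1 h2]]; first by rewrite addn0.
 have [s1 s2] := step (a + d)%N; rewrite addnS; split; [exact: le_trans h1 s1|exact: le_trans s2 h2].
have ub i j : u i - 2 * B * hlf i <= u j + 2 * B * hlf j.
 have pos l : 0 <= 2 * B * hlf l by rewrite !mulr_ge0 // ltW // hlf_gt0.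
 have [ij|ji] := leqP i j.
  by have [h _] := mono i (j - i)%N; rewrite subnKC // in h; have := pos j; lra.
 by have [_ h] := mono j (i - j)%N; rewrite subnKC 1?ltnW // in h; have := pos i; lra.
have hs : has_sup A.
 split; first by exists (u 0%N - 2 * B * hlf 0); exists 0%N.
 by exists (u 0%N + 2 * B * hlf 0) => _ [i ->]; exact: ub.
exists (sup A) => j; rewrite ler_distlC.
apply/andP; split; first by apply: (ub_le_sup hs.2); exists j.
by apply: sup_le_ub hs.1 _ => _ [i ->]; exact: ub.
Qed.

Lemma complex_limit (u : nat -> C) (B : R) : (forall j, nrm (u j.+1 - u j) <= B * hlf j) ->
 exists L, forall j, nrm (u j - L) <= 4 * B * hlf j.
move=> hu.
have [|La hLa] := @real_limit (fun j => complex.Re (u j)) B.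
 move=> j; apply: le_trans (hu j); rewrite /nrm; case: (u j.+1) (u j) => [a b] [c d] /=.
 by rewrite lerDl.
have [|Lb hLb] := @real_limit (fun j => complex.Im (u j)) B.
 move=> j; apply: le_trans (hu j); rewrite /nrm; case: (u j.+1) (u j) => [a b] [c d] /=.
 by rewrite lerDr.
exists (La +i* Lb) => j; rewrite /nrm; have := hLa j; have := hLb j; case: (u j) => a b /=.
have -> : 4 * B * hlf j = 2 * B * hlf j + 2 * B * hlf j by ring.
by move=> h1 h2; apply: lerD.
Qed.

Lemma nrm_small_neq0 (n : nat) (Q : {mpoly C[n]}) : Q.@[fun=> 0] != 0 ->
 exists2 r : R, 0 < r & forall x, nv x <= r -> Q.@[x] != 0.
move=> Q0; have [r r0 h] := sdiff_lip (sdiff_mpoly Q).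
set a := (fun l => _) in h; have a1 : 1 <= 1 + nv a by rewrite lerDl nv_ge0.
have N0 : 0 < nrm (Q.@[fun=> 0]).
 by rewrite lt_neqAle nrm_ge0 andbT eq_sym; apply: contra_neq Q0 => e; apply: nrm_eq0; rewrite e.
have q0 : 0 < nrm (Q.@[fun=> 0]) / (2 * (1 + nv a)) by rewrite divr_gt0 // mulr_gt0 //; lra.
exists (Order.min r (nrm (Q.@[fun=> 0]) / (2 * (1 + nv a)))); first by rewrite lt_min r0.
move=> x; rewrite le_min => /andP[xr xs]; apply/negP => /eqP Qx.
have z1 : @nv n (fun=> 0) <= r by rewrite nv0 ltW.
have := h _ _ xr z1; rewrite Qx sub0r nrmN dif0 => h1.
have : (1 + nv a) * nv x <= nrm (Q.@[fun=> 0]) / 2.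
 apply: le_trans (ler_wpM2l _ xs) _; first by lra.
 rewrite (_ : (1 + nv a) * _ = nrm (Q.@[fun=> 0]) / 2) //; field; lra.
lra.
Qed.

Theorem local_surj (n m : nat) (G : 'I_n -> {mpoly C[m]}) (Q : {mpoly C[m]}) (v : 'I_n -> 'I_m -> C) :
 (forall i j, \sum_l v i l * ((G j)^`M(l)).@[fun=> 0] = (i == j)%:R) -> Q.@[fun=> 0] != 0 ->
 exists2 d : R, 0 < d & forall y, (forall j, nrm (y j - (G j).@[fun=> 0]) <= d) ->
  exists x, Q.@[x] != 0 /\ forall j, (G j).@[x] = y j.
move=> hv Q0; have [rQ rQ0 hQ] := nrm_small_neq0 Q0.
(* Newton's iteration with frozen derivative, reduced to the coordinates along v. *)
pose X (w : 'I_n -> C) : 'I_m -> C := fun l => \sum_i w i * v i l.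
pose V := \sum_i nv (v i).
have V0 : 0 <= V by apply: sumr_ge0 => i _; exact: nv_ge0.
have nX w : nv (X w) <= V * nv w.
 rewrite /nv /X; apply: (@le_trans _ _ (\sum_l \sum_i nrm (w i) * nrm (v i l))).
  apply: ler_sum => l _; apply: le_trans (nrm_sum _ _ _) _; apply: ler_sum => i _; exact: nrmM.
 rewrite exchange_big /= /V mulr_suml; apply: ler_sum => i _; rewrite -mulr_sumr mulrC.
 by apply: ler_wpM2l; [exact: nv_ge0|exact: nv_coord].
have difX w w' : dif (X w) (X w') = X (dif w w').
 apply/funext => l; rewrite /dif /X -sumrB; apply: eq_bigr => i _; ring.
have linX j w : lin (fun l => ((G j)^`M(l)).@[fun=> 0]) (X w) = w j.
 rewrite /lin /X; under eq_bigr do rewrite mulr_sumr.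
 rewrite exchange_big /= (bigD1 j) //= [X in _ + X]big1 => [|i ij].
  transitivity (w j * (j == j)%:R); last by rewrite eqxx mulr1.
  by rewrite addr0 -hv mulr_sumr; apply: eq_bigr => l _; ring.
 transitivity (w i * (i == j)%:R); last by rewrite (negPf ij) mulr0.
 by rewrite -hv mulr_sumr; apply: eq_bigr => l _; ring.
pose n1 : R := n%:R + 1.
have n10 : 0 < n1 by rewrite ltr_wpDl.
pose V1 := V + 1; have V10 : 0 < V1 by rewrite ltr_wpDl.
(* With this e the iteration T contracts by one half: n1 bounds the number of coordinates and V1 the
   norm of X. *)
pose e := (2 * n1 * V1)^-1.
have e0 : 0 < e by rewrite invr_gt0 !mulr_gt0.
have [r r0 hr] : exists2 r : R, 0 < r & forall j x y, nv x <= r -> nv y <= r ->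
  nrm ((G j).@[x] - (G j).@[y] - lin (fun l => ((G j)^`M(l)).@[fun=> 0]) (dif x y)) <= e * nv (dif x y).
 have h j := sdiff_mpoly (G j) e0.
 have h' (j : 'I_n) : exists r, 0 < r /\ forall x y, nv x <= r -> nv y <= r ->
   nrm ((G j).@[x] - (G j).@[y] - lin (fun l => ((G j)^`M(l)).@[fun=> 0]) (dif x y)) <= e * nv (dif x y).
  by have [r r0 hr] := h j; exists r.
 have [rr rrP] := choice h'.
 exists (\big[Order.min/1]_j rr j); first by elim/big_ind: _ => // [a b a0 b0|j _]; [rewrite lt_min a0|exact: (rrP j).1].
 have le j : \big[Order.min/1]_j rr j <= rr j by rewrite (bigD1 j) //= ge_min lexx.
 by move=> j x y xr yr; apply: (rrP j).2; apply: le_trans (le j).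
pose r' := Order.min r rQ; have r'0 : 0 < r' by rewrite lt_min r0.
(* The first step has size at most D = n1 d and all iterates stay within 2 D; since V1 * 2 D = r' /
   2, their images under X stay in the ball where the estimates hold. *)
pose d := r' / (4 * n1 * V1); have d0 : 0 < d by rewrite divr_gt0 // !mulr_gt0.
exists d => // y hy.
pose T (w : 'I_n -> C) : 'I_n -> C := fun j => w j - ((G j).@[X w] - y j).
have contr w w' : nv (X w) <= r -> nv (X w') <= r -> nv (dif (T w) (T w')) <= nv (dif w w') / 2.
 move=> wr wr'; apply: (@le_trans _ _ (\sum_(j < n) e * nv (dif (X w) (X w')))).
  apply: ler_sum => j _; have := hr j _ _ wr wr'; rewrite difX linX -nrmN; congr (nrm _ <= _).
  by rewrite /dif /T; ring.
 rewrite sumr_const card_ord -[X in X <= _]mulr_natl difX.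
 apply: (@le_trans _ _ (n1 * (e * (V1 * nv (dif w w'))))).
  apply: ler_pM; rewrite ?ler0n ?mulr_ge0 ?nv_ge0 ?(ltW e0) // /n1 ?lerDl //.
  rewrite ler_pM2l //; apply: le_trans (nX _) _; apply: ler_wpM2r; [exact: nv_ge0|by rewrite lerDl].
 rewrite (_ : n1 * _ = nv (dif w w') / 2) // /e; field; apply/andP; split; lra.
pose u := fix u j := if j is j'.+1 then T (u j') else (fun=> 0).
pose D := n1 * d.
have X0 : X (fun=> 0) = fun=> 0 by apply/funext => l; rewrite /X big1 // => i _; rewrite mul0r.
have D1 : nv (dif (u 1%N) (u 0%N)) <= D.
 apply: (@le_trans _ _ (\sum_(j < n) d)).
  apply: ler_sum => j _; rewrite /dif /= /T X0 subr0 sub0r opprB; exact: hy.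
 by rewrite sumr_const card_ord -[X in X <= _]mulr_natl; apply: ler_wpM2r; [exact: ltW|rewrite /n1 lerDl].
have D0 : 0 <= D by rewrite mulr_ge0 // ltW.
have VD : V * (2 * D) <= r' / 2.
 apply: (@le_trans _ _ (V1 * (2 * D))); first by apply: ler_wpM2r; [rewrite mulr_ge0|rewrite lerDl].
 rewrite (_ : V1 * _ = r' / 2) // /D /d; field; apply/andP; split; lra.
have inr w : nv w <= 2 * D -> nv (X w) <= r' / 2.
 by move=> h; apply: le_trans (nX w) _; apply: le_trans VD; apply: ler_wpM2l.
have r'r : r' / 2 <= r by apply: (@le_trans _ _ r'); [lra|rewrite ge_min lexx].
have r'Q : r' / 2 <= rQ by apply: (@le_trans _ _ r'); [lra|rewrite ge_min lexx orbT].
have pos j : 0 <= 2 * D * hlf j by apply: mulr_ge0; [exact: mulr_ge0|exact: ltW (hlf_gt0 j)].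
have inv j : nv (u j) <= 2 * D - 2 * D * hlf j /\ nv (dif (u j.+1) (u j)) <= D * hlf j.
 elim: j => [|j [h1 h2]].
  by rewrite /hlf expr0 !mulr1 subrr [nv (u 0%N)]nv0; split=> //.
 have p1 := hlf_gt0 j; have p2 := hlf_gt0 j.+1; have hS := hlfS j.
 have q1 := pos j; have q2 := pos j.+1.
 have eqh : D * hlf j = 2 * D * hlf j.+1 by rewrite hS; ring.
 have eqh2 : 2 * D * hlf j = D * hlf j + 2 * D * hlf j.+1 by rewrite hS; ring.
 have h3 : nv (u j.+1) <= 2 * D - 2 * D * hlf j.+1.
  have := nv_tri (u j.+1) (u j) (fun=> 0); rewrite !dif0 => t; lra.
 split=> //; apply: le_trans (contr _ _ _ _) _.
 - by apply: le_trans r'r; apply: inr; lra.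
 - by apply: le_trans r'r; apply: inr; lra.
 by rewrite ler_pdivrMr //; apply: le_trans h2 _; rewrite hS; lra.
have [L hL] : {L : 'I_n -> C & forall i j, nrm (u j i - L i) <= 4 * D * hlf j}.
 apply: (choice (P := fun i l => forall j, nrm (u j i - l) <= 4 * D * hlf j)) => i.
 apply: (complex_limit (u := fun j => u j i)) => j.
 by apply: le_trans (inv j).2; exact: (nv_coord (dif (u j.+1) (u j)) i).
pose B := n1 * (4 * D).
have nL j : nv (dif (u j) L) <= B * hlf j.
 apply: (@le_trans _ _ (\sum_(i < n) 4 * D * hlf j)); first by apply: ler_sum => i _; exact: hL.
 rewrite sumr_const card_ord -[X in X <= _]mulr_natl /B -[in leRHS]mulrA; apply: ler_wpM2r; last by rewrite /n1 lerDl.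
 by apply: mulr_ge0; [exact: mulr_ge0|exact: ltW (hlf_gt0 j)].
have difC w w' : nv (dif w w') = nv (dif w' w).
 by apply: eq_bigr => j _; rewrite -nrmN /dif opprB.
have Lr : nv L <= 2 * D.
 rewrite -subr_le0; apply: (@le0_hlf B) => j; have := nv_tri L (u j) (fun=> 0); rewrite !dif0 difC.
 have := nL j; have [h1 _] := inv j; have := pos j.
 lra.
have fix_L : nv (dif (T L) L) <= 0.
 apply: (@le0_hlf (2 * B + D)) => j; have [h1 h2] := inv j.
 have q2 := pos j.
 have t1 := nv_tri (T L) (u j.+1) L; have t2 := nv_tri (u j.+1) (u j) L.
 have t3 : nv (dif (T L) (u j.+1)) <= nv (dif L (u j)) / 2.
  by apply: contr; apply: le_trans r'r; apply: inr => //; lra.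
 rewrite (difC _ L) in t3; have := nL j; have b0 := nv_ge0 (dif (u j) L).
 rewrite mulrDl -mulrA; lra.
exists (X L); split; first by apply: hQ; apply: le_trans r'Q; exact: inr.
move=> j; have : nrm (dif (T L) L j) <= 0 by apply: le_trans fix_L; exact: nv_coord.
move=> /nrm_eq0; rewrite /dif /T => h.
by apply/eqP; rewrite -subr_eq0 -[_ - _]opprK -oppr0 -h; apply/eqP; ring.
Qed.
End LocalSurjection.

Lemma mderiv_curve (F : numFieldType) (n : nat) (p : {mpoly F[n]}) (l : 'I_n) (v0 : 'I_n -> F) (r : {poly F}) :
 (forall e, p.@[fun i => v0 i + e * (i == l)%:R] = r.[e]) -> (p^`M(l)).@[v0] = r^`().[0].
move=> h; have [g [gE gd]] := meval_line p v0 (fun i => (i == l)%:R).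
have -> : r = g by apply/eqP; rewrite -subr_eq0; apply/eqP; apply: polyP_eval => e; rewrite hornerD hornerN -h gE subrr.
rewrite gd (bigD1 l) //= eqxx mul1r big1 ?addr0 // => i /negPf ->; by rewrite mul0r.
Qed.

Lemma mderiv_lin (F : numFieldType) (n : nat) (p : {mpoly F[n]}) (l : 'I_n) (v0 : 'I_n -> F) (a b : F) :
 (forall e, p.@[fun i => v0 i + e * (i == l)%:R] = a + e * b) -> (p^`M(l)).@[v0] = b.
move=> h; rewrite (@mderiv_curve _ _ _ _ _ (a%:P + b%:P * 'X)).
 by rewrite derivD derivC derivM derivC derivX mul0r !add0r mulr1 hornerC.
by move=> e; rewrite h hornerD hornerM !hornerC hornerX [b * e]mulrC.
Qed.

Lemma small_nonroot (R : realType) (r : {poly R[i]}) (d : R) : r != 0 -> 0 < d ->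
 exists z, nrm z <= d /\ r.[z] != 0.
move=> r0 d0; have [e [q q0 qE]] := multiplicity_XsubC r 0; rewrite r0 /= in q0.
have [Q QE] : mpf (fun x : 'I_1 -> R[i] => q.[x ord0]) by apply: mpf_horner; exact: mpfX.
have Q0 : Q.@[fun=> 0] != 0 by rewrite -QE.
have [s s0 hs] := nrm_small_neq0 Q0.
pose t := Order.min d s; have t0 : 0 < t by rewrite lt_min d0.
have tn : nrm (t%:C) = t by rewrite /nrm /= normr0 addr0 gtr0_norm.
exists t%:C; split; first by rewrite tn ge_min lexx.
rewrite qE hornerM horner_exp hornerXsubC subr0 mulf_neq0 ?expf_neq0 //.
 by have := hs (fun=> t%:C); rewrite -QE; apply; rewrite /nv big_ord1 tn ge_min lexx orbT.
by apply/negP => /eqP [h]; rewrite h ltxx in t0.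
Qed.

Section Happ.
Variables (R : realType) (m N : nat).
Notation Spn := (spinor R m).
Notation Sec := {ffun 'I_N -> Spn}.
Definition happ (h : 'End(Spn)) (s : Sec) : Sec := locked [ffun i => h (s i)].
Lemma happE h s i : happ h s i = h (s i).
by rewrite /happ -lock ffunE. Qed.
End Happ.

Section HappSections.
Variables (R : realType) (m : nat) (E : seq spin_label).
Notation C := (R[i]).
Notation Spn := (spinor R m).
Notation Sec := {ffun 'I_(size E) -> Spn}.
Implicit Types (h : 'End(Spn)) (s : Sec).

Lemma sc_happ h s kp : sc (E := E) (happ h s) kp = cf (h (s kp.1)) kp.2.
exact (congr1 (fun y => cf y kp.2) (happE h s kp.1)). Qed.

Lemma happ_gact g h s : cpair g h -> gact (E := E) g s (happ h s).
move=> gh; exists h, (fun=> 1); split=> [//|i|]; first exact: oner_neq0.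
by apply/ffunP => i; apply: (etrans (happE h s i)); rewrite [RHS]ffunE scale1r.
Qed.

Lemma sc_happD h s s' (e : C) kp :
 sc (E := E) (happ h (s + e *: s')) kp = sc (E := E) (happ h s) kp + e * sc (E := E) (happ h s') kp.
apply: (etrans (sc_happ h (s + e *: s') kp)).
have -> : (s + e *: s') kp.1 = s kp.1 + e *: s' kp.1 by rewrite [LHS]ffunE [X in _ + X]ffunE.
rewrite linearD linearZ cfD cfZ.
by congr (_ + _ * _); [exact (esym (sc_happ h s kp))|exact (esym (sc_happ h s' kp))].
Qed.

Lemma sc_happ0 h kp : sc (E := E) (happ h 0) kp = 0.
by have := sc_happD h 0 0 (-1) kp; rewrite scaler0 addr0 mulN1r subrr. Qed.

Lemma sc_happ_sum h (I : finType) (a : I -> C) (s : I -> Sec) kp :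
 sc (E := E) (happ h (\sum_r a r *: s r)) kp = \sum_r a r * sc (E := E) (happ h (s r)) kp.
elim/big_rec2: _ => [|r x y _ <-]; first exact: sc_happ0.
have -> : a r *: s r + y = y + a r *: s r by exact: addrC.
by apply: (etrans (sc_happD _ _ _ _ _)); exact: addrC.
Qed.
End HappSections.

(** * Zero loci: closedness, dimension bound, density of the family *)

Section ZeroLoci.
Variables (R : realType) (m k : nat) (E : seq spin_label).
Notation C := (R[i]).
Notation V := 'rV[C]_m.
Notation N := (size E).
Notation Spn := (spinor R m).
Notation Sec := {ffun 'I_N -> Spn}.
Notation Gr := (Gr R k m).
Notation K := ('I_N * {set 'I_m./2})%type.
Notation ev := (@ev R m).
Notation Aall := (@Aall m E).
Notation Y := (OG R k m).
Hypotheses (k0 : (0 < k)%N)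
 (km : odd m || (k.+1 < m./2)%N)
 (lok : forall i : 'I_N, label_ok m (label_at i)).
Implicit Types (s : Sec).

Lemma OG_cp g (h : 'End(Spn)) : cpair g h -> forall U, Y U -> Y (gla g U).
by move=> gh U; apply: (OG_cpair gh). Qed.

Section Base.
Variables (c : 'I_k -> 'I_m./2) (eps : 'I_k -> bool).
Hypothesis c_inj : injective c.
Notation U0 := (Ucoord R eps c_inj).
Notation bf := [ffun i => bidx c eps i].
Notation kill := (fun (i : 'I_N) (I : {set 'I_m./2}) => forb c eps I).

Lemma van_base (i : 'I_N) x : x \in Delta R m (label_at i) ->
 (vanish (label_at i) x U0 <-> forall I, kill i I -> cf x I = 0).
by move=> xD; apply: vanish_coord_coker. Qed.

Lemma chart_zero s (W : Gr) : supp Aall s -> Y W -> minor (bmx W) bf != 0 ->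
 zero_locus Y s W <-> supp (@AK m E kill) (chart_sec c eps W s).
move=> sA YW mW; split=> [sW|sK].
 by move=> kp; apply: (supp_chart lok OG_cp (fun _ h => h) (@OG_Ucoord R m k c eps c_inj) van_base sA sW mW).
have [g ga <-] := gact_chart c_inj (fun _ h => h) s YW mW.
have sA' : supp Aall (chart_sec c eps W s) by move=> kp kA; apply: sK; rewrite inE (negPf kA).
apply: (proj1 (zero_gact lok (Y := Y) OG_cp U0 ga)).
exact: (proj2 (proj1 (supp_K (@OG_Ucoord R m k c eps c_inj) van_base (chart_sec c eps W s)) sK)).
Qed.
End Base.

Lemma zero_closed s : supp Aall s -> zcl (zero_locus Y s) `<=` zero_locus Y s.
move=> sA W ZW.
have YW : Y W.
 move=> v /memGr[x ->].
 (* The first row of a matrix A times a basis of U runs over all vectors of U, so one row expresses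
    isotropy. *)
 have mq : @mxf R k m (fun M => qform (row (Ordinal k0) M)).
  have [p pE] : mpf (fun x : 'I_(k * m) -> C => qform (row (Ordinal k0) (vec_mx (\row_i x i)))).
   have e a : mpf (fun x : 'I_(k * m) -> C => row (Ordinal k0) (vec_mx (\row_i x i)) 0 a).
    by exists 'X_(mxvec_index (Ordinal k0) a) => y; rewrite mevalXU !mxE.
   apply: mpfD; apply: mpf_sum => a; first by apply: mpfM; apply: e.
   by apply: (mpfE (fun y => expr2 _)); apply: mpfM; apply: e.
  exists p => M; rewrite -pE; congr (qform (row _ _)).
  by apply: (can_inj mxvecK); rewrite vec_mxK; apply/rowP => i; rewrite mxE.
 have h := zcl_bases mq _ ZW (\matrix_(i < k) x); rewrite row_mul rowK in h.
 apply: h => U A [YU _]; apply: YU; rewrite row_mul; apply/memGr; by exists (row (Ordinal k0) A).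
have [c [eps [ci cW]]] := OG_pivot YW.
apply/(chart_zero ci sA YW cW) => kp kpK.
have rg : rgl [ffun i => bidx c eps i] (fun U => sc (chart_sec c eps U s) kp).
 apply: rgl_ext (rgl_chart_op c eps (s kp.1) kp.2) => U _; by rewrite /sc ffunE.
apply: (zcl_rgl rg _ ZW cW) => U [YU XU] cU.
by apply: ((chart_zero ci sA YU cU).1 (conj YU XU)).
Qed.

Variables (c : 'I_k -> 'I_m./2) (eps : 'I_k -> bool).
Hypothesis c_inj : injective c.
Notation U0 := (Ucoord R eps c_inj).
Notation bf := [ffun i => bidx c eps i].
Notation kill := (fun (i : 'I_N) (I : {set 'I_m./2}) => forb c eps I).
Notation AK := (@AK m E kill).

(** The NK variables introduced here parametrize pairs of an isotropic space in the chart and a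
    section vanishing on it: the free coordinates of the space, and a section vanishing at U0 which
    is transported along the chart. *)
Definition allowed_set : {set 'I_k * 'I_m} := [set ij : 'I_k * 'I_m | allowed c eps ij.1 ij.2]%SET.
Notation NK := (#|allowed_set| + #|AK|)%N.

Definition xs (x : 'I_NK -> C) (i : 'I_k) : V := \row_j \sum_(l < #|allowed_set| | enum_val l == (i, j)) x (lshift _ l).
Definition kap (x : 'I_NK -> C) : Sec := sec_of (fun kp => \sum_(l < #|AK| | enum_val l == kp) x (rshift _ l)).

Lemma xs_allowed x i j : ~~ allowed c eps i j -> xs x i 0 j = 0.
move=> ij; rewrite mxE big1 // => l /eqP e; have := enum_valP l; rewrite e inE /=; by move/(negP ij).
Qed.

Lemma mpv_xs i : mpv (fun x => xs x i).
by move=> j; apply: mpfE (fun=> mxE _ _ _ _) _; apply: mpf_sum => l; apply: mpfX. Qed.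

Lemma mpf_kap kp : mpf (fun x => sc (kap x) kp).
by apply: mpfE (fun x => sc_sec_of _ _) _; apply: mpf_sum => l; apply: mpfX. Qed.

Lemma mpf_gmx i a j : mpf (fun x => gmx c eps (xs x) i a j).
apply: (mpfE (g := fun x => (ev a *m gmx c eps (xs x) i) 0 j)) => [x|].
 by rewrite -[ev a]/(delta_mx 0 a) -rowE [RHS]mxE.
apply: mpfE (fun x => congr1 (fun M : V => M 0 j) (mul_gmx (xs_allowed x) i (ev a))) _.
have bp := mpf_bform (@mpv_xs i) (@mpv_const R m NK (ev a)).
apply: (mpfE (g := fun x => ev a 0 j + bform (xs x i) (ev a) * bdual R c eps i 0 j
  + (- ev a 0 (bidx c eps i)) * xs x i 0 j + (- (ev a 0 (bidx c eps i) * bdual R c eps i 0 j)) * qform (xs x i))) => [x|].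
 rewrite !mxE; ring.
do !apply: mpfD; first exact: mpfC.
- by apply: mpfM => //; exact: mpfC.
- by apply: mpfM; [exact: mpfC|exact: mpv_xs].
by apply: mpfM; [exact: mpfC|apply: mpf_qform; exact: mpv_xs].
Qed.

Definition Bx x : 'M[C]_(k, m) := coord_mx R c eps *m chart_g c eps (xs x) (enum 'I_k).

Lemma mpf_Bx i j : mpf (fun x => Bx x i j).
apply: mpfMx; first by move=> *; exact: mpfC.
rewrite /chart_g; elim: (enum 'I_k) => [|l s IH] a b /=; first exact: mpfC.
apply: mpfMx => //; exact: mpf_gmx.
Qed.

Definition chart_inv (ys : 'I_k -> V) (y : Spn) : Spn :=
 foldr (fun i z => Eop (bdual R c eps i) (ys i) 1 z) y (enum 'I_k).

Lemma chart_invK x (y : Spn) : chart_inv (xs x) (chart_op c eps (xs x) y) = y.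
rewrite /chart_inv /chart_op; elim: (enum 'I_k) y => //= i l IH y.
by rewrite IH EopK //; apply: xs_allowed.
Qed.

Definition Sx x : Sec := [ffun i => chart_inv (xs x) (kap x i)].

Lemma mpf_Sx kp : mpf (fun x => sc (Sx x) kp).
apply: mpfE (fun x => congr1 (fun y => cf y kp.2) (ffunE _ kp.1)) _.
move: kp.2; rewrite /chart_inv; elim: (enum 'I_k) => [|l s IH] /=.
 by move=> I; exact: (mpf_kap (kp.1, I)).
by apply: mps_Eop; [exact: mpv_const|exact: mpv_xs|exact: IH].
Qed.

Lemma param_chart s (W : Gr) : supp Aall s -> Y W -> minor (bmx W) bf != 0 -> zero_locus Y s W ->
 exists x, cmx bf W = Bx x /\ Sx x = s.
move=> sA YW mW sW; have sK := (chart_zero c_inj sA YW mW).1 sW.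
pose x (t : 'I_NK) : C := match split t with
 | inl l => cvec c eps W (enum_val l).1 0 (enum_val l).2
 | inr l => sc (chart_sec c eps W s) (enum_val l) end.
have xL l : x (lshift _ l) = cvec c eps W (enum_val l).1 0 (enum_val l).2.
 by rewrite /x -[lshift _ l]/(unsplit (inl l)) unsplitK.
have xR l : x (rshift _ l) = sc (chart_sec c eps W s) (enum_val l).
 by rewrite /x -[rshift _ l]/(unsplit (inr l)) unsplitK.
have xsE i : xs x i = cvec c eps W i.
 apply/rowP => j; case: (boolP (allowed c eps i j)) => ij; last by rewrite xs_allowed // chart_vecP.
 have ijA : (i, j) \in allowed_set by rewrite inE.
 rewrite mxE (big_pred1 (enum_rank_in ijA (i, j))) ?xL ?enum_rankK_in // => l.
 by apply/eqP/eqP => [e|->]; [apply: enum_val_inj; rewrite e enum_rankK_in|rewrite enum_rankK_in].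
have kapE : kap x = chart_sec c eps W s.
 apply: scP => kp; rewrite sc_sec_of; case: (boolP (kp \in AK)) => kA.
  rewrite (big_pred1 (enum_rank_in kA kp)) ?xR ?enum_rankK_in // => l.
  by apply/eqP/eqP => [e|->]; [apply: enum_val_inj; rewrite e enum_rankK_in|rewrite enum_rankK_in].
 rewrite sK // big1 // => l /eqP e; have := enum_valP l; rewrite e; by move/(negP kA).
have xsf : xs x = cvec c eps W by apply/funext.
exists x; split.
 apply/row_matrixP => i; rewrite (chart_mx_OG c_inj YW mW) /Bx xsf row_mul; congr (_ *m _).
 by rewrite rowK.
apply/ffunP => i; rewrite ffunE kapE ffunE -xsf; exact: chart_invK.
Qed.

Notation NA := #|Aall|.

Lemma plmB (U : Gr) (B : 'M[C]_(k, m)) : (forall i, row i B \in val U) -> row_free B ->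
 exists2 b : C, b != 0 & forall D (p : {mpoly C[plucker_dim k m]}), p \is D.-homog ->
  p.@[plm B] = b ^+ D * p.@[plucker U].
move=> BU rB; have [b b0 bE] := pluckerB BU rB; exists b => // D p hp.
rewrite -(meval_dhomogZ b _ hp); apply: meval_eq => a; by rewrite /plm bE pluckerE.
Qed.

Definition ysec (y : 'I_NA -> C) : Sec := sec_of (fun kp => \sum_(l < NA | enum_val l == kp) y l).

Lemma sc_ysec y l : sc (ysec y) (enum_val l) = y l.
by rewrite sc_sec_of (big_pred1 l) // => l'; apply/eqP/eqP => [/enum_val_inj|->]. Qed.

Lemma supp_ysec y : supp Aall (ysec y).
move=> kp kA; rewrite sc_sec_of big1 // => l /eqP e; have := enum_valP l; by rewrite e (negPf kA).
Qed.

Lemma supp_eq s s' : supp Aall s -> supp Aall s' -> (forall kp, kp \in Aall -> sc s kp = sc s' kp) -> s = s'.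
move=> sA sA' h; apply: scP => kp; case: (boolP (kp \in Aall)) => [/h//|kA].
by rewrite sA ?sA'.
Qed.

Variable L1 : seq (selem m N).
Variable s0 : Sec.
Hypotheses (L1ok : all (@sel_ok m E) L1)
 (sA0 : supp Aall s0).
Hypothesis jac : forall kp, kp \in Aall -> exists a : 'I_(size L1) -> C, forall kp', kp' \in Aall ->
 \sum_r a r * sc (Nop (tnth (in_tuple L1) r) s0) kp' = (kp == kp')%:R.
Hypothesis witt0 : forall W : Gr, Y W -> exists g h, cpair g h /\ gla g U0 = W.

Lemma orbit_dense : exists2 q : {mpoly C[NA]}, q != 0 & forall y, q.@[y] != 0 ->
 exists x : 'I_(size L1) -> C, wden L1 (extf x) != 0 /\ word L1 (extf x) s0 = ysec y.
have [|||q q0 qP] := @dominate R m E Aall L1 (fun=> s0) (fun kp => (sc s0 kp)%:P) 0 1.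
- by move=> mu kp; rewrite hornerC.
- exact: oner_neq0.
- move=> kp kA; have [a aE] := jac kA; exists a, 0 => kp' kA'; by rewrite mul0r addr0 aE.
exists q => // y qy; have [|mu [t [_ td tE]]] := qP (ysec y) (supp_ysec y).
 by move: qy; congr (_ != 0); apply: meval_eq => l; rewrite sc_ysec.
have te i : (i < size L1)%N -> extf (fun l : 'I_(size L1) => t l) i = t i by exact: ext_fun_id.
exists (fun l => t l); split.
 rewrite (eq_wordden te).
 have : forall r : 'I_(size L1), edenp (tnth (in_tuple L1) r) (t r) != 0.
  move=> r; have := td r; case: (tnth _ r) => [a b|j] //=; by rewrite mulr1.
 elim: L1 t {td tE te} => [|e L IH] t td /=; first exact: oner_neq0.
 apply: mulf_neq0; last by have := td ord0; rewrite (tnth_nth e).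
 apply: IH => r; have := td (lift ord0 r); by rewrite !(tnth_nth e).
rewrite (eq_word _ te); apply: supp_eq; [|exact: supp_ysec|by move=> kp /tE ->].
exact: (Aall_gact lok (gact_word s0 L1ok td) sA0).
Qed.

(** The bound is the number of parameters of such pairs minus that of sections. A chain of length e
    gives about J^e independent forms; multiplied by the J^NA monomials in the section they become
    polynomials of bounded degree in NK variables, so a relation exists if e + NA > NK. At a section
    in general position in the orbit of s0 it becomes a non-trivial relation between the independent
    forms. *)
Theorem dimension_bound e (Ds : nat -> set Gr) : echain (zero_locus Y s0) e Ds -> (e + NA <= NK)%N.
move=> hD; rewrite leqNgt; apply/negP => NKe.
have cX := zero_closed sA0.
have [hZ1 hZ2] := echain_zcl cX hD.
have [||a aP] := @chain_growth R k m e (fun i => zcl (Ds i)).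
- by move=> i ie; case: (hZ1 i ie).
- move=> i ie; have [h1 h2] := hZ2 i ie; split; first by move=> U /h1; apply: zcl_min.
 apply: contrapT => H; apply: h2 => U ZU d p hp pz; apply: contrapT => pU.
 by apply: H; exists d, p; split=> // h; apply: pU; apply: h.
have [iZ ZX] := hZ1 e (leqnn e); set Z := zcl (Ds e) in iZ ZX aP.
have [[U1 ZU1] _] := iZ.
have [g0 [h0 [gh0 gU1]]] := witt0 (ZX U1 ZU1).1.
have [u0 _ _ _] := gh0; have u0' : invmx g0 \in unitmx by rewrite unitmx_inv.
(* The chart is moved by g0, so that its centre is the point U1 of Z. *)
have pm b : mpf (fun x => plm (Bx x *m g0) b).
 apply: mpf_det => i j; apply: mpfE (fun=> mxE _ _ _ _) _.
 by apply: mpfMx => *; [exact: mpf_Bx|exact: mpfC].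
have [d1 d1P] := mpd_mpf pm.
have [d2 d2P] := mpd_mpf (fun l : 'I_NA => mpf_Sx (enum_val l)).
have [J [J0 Jlt]] := power_gt (a * d1 + NA * d2) NKe.
case: J J0 Jlt => // J' _ Jlt; set J := J'.+1 in Jlt.
have [I [p [cI hp ip]]] := aP J'.
pose a' := (a * d1 + NA * d2)%N.
pose T := (I * {ffun 'I_NA -> 'I_J})%type.
have /fin_all_exists2[Phi Phis PhiE] : forall ib : T, exists2 q : {mpoly C[NK]}, (msize q <= J * a'.+1)%N &
  forall x, (p ib.1).@[plm (Bx x *m g0)] * \prod_(l < NA) sc (Sx x) (enum_val l) ^+ (ib.2 l) = q.@[x].
 move=> [i b] /=.
 have h1 := mpd_homog (hp i) d1P.
 have h2 := mpd_prod (index_enum 'I_NA) (fun l : 'I_NA => mpd_exp (b l) (d2P l)).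
 have [q qs qE] := mpd_mul h1 h2; exists q => //; apply: leq_trans qs _.
 rewrite /J mulnS addSn ltnS; apply: leq_trans (leq_addl _ _).
 have : (\sum_(l < NA) b l * d2 <= \sum_(l < NA) J * d2)%N.
  by apply: leq_sum => l _; rewrite leq_mul2r ltnW ?orbT.
 rewrite sum_nat_const card_ord /a' mulnDr => hb; apply: leq_add.
  by rewrite mulnA leq_mul2r leq_mul2r leqnSn !orbT.
 by apply: leq_trans hb _; rewrite mulnCA.
have [|cc [[[i0 b0] cc0] ccM]] := @linear_dependency C T {ffun 'I_NK -> 'I_(J * a'.+1)} (fun ib be => (Phi ib)@_(boxm be)).
 by rewrite card_prod !card_box cI -expnD.
have Phi0 : \sum_ib cc ib *: Phi ib = 0.
 have sz : (msize (\sum_ib cc ib *: Phi ib)%R <= J * a'.+1)%N.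
  apply: leq_trans (msize_sum _ _ _) _; apply/bigmax_leqP => ib _.
  exact: leq_trans (msizeZ_le _ _) (Phis ib).
 rewrite (mpoly_box sz) big1 // => be _; rewrite raddf_sum /=.
 by under eq_bigr => ib _ do rewrite mcoeffZ; rewrite ccM scale0r.
(* The coefficients of the relation between the forms p i, as polynomials in the section. *)
pose Cq i : {mpoly C[NA]} := \sum_b cc (i, b) *: 'X_[boxm b].
have CqE i y : (Cq i).@[y] = \sum_b cc (i, b) * \prod_l y l ^+ (b l).
 rewrite raddf_sum; apply: eq_bigr => b _; rewrite /= mevalZ mevalX; congr (_ * _).
 by apply: eq_bigr => l _; rewrite mnmE.
have Cq0 : Cq i0 != 0.
 apply: contraNneq cc0 => /(congr1 (fun q : {mpoly C[NA]} => q@_(boxm b0))).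
 rewrite mcoeff0 raddf_sum /= (bigD1 b0) //= mcoeffZ mcoeffX eqxx mulr1 big1 ?addr0 => [->//|b /negPf nb].
 by rewrite mcoeffZ mcoeffX (inj_eq (@boxm_inj _ _)) nb mulr0.
have E1 x : \sum_i (Cq i).@[fun l => sc (Sx x) (enum_val l)] * (p i).@[plm (Bx x *m g0)] = 0.
 transitivity (\sum_i \sum_b (cc (i, b) *: Phi (i, b)).@[x]); last first.
  rewrite -[RHS](meval0 x) -Phi0 raddf_sum /= pair_big; apply: eq_bigr => -[i b] _ //.
 apply: eq_bigr => i _; rewrite CqE mulr_suml; apply: eq_bigr => b _.
 by rewrite mevalZ -PhiE /= -mulrA; congr (_ * _); rewrite mulrC.
pose actS s : Sec := act (h0^-1)%VF (fun=> 1) s.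
have actSE s i : actS s i = (h0^-1)%VF (s i) by rewrite ffunE scale1r.
have gS s : gact (invmx g0) s (actS s).
 by exists (h0^-1)%VF, (fun=> 1); split=> [|i|//]; [exact: cpair_inv|exact: oner_neq0].
have mS n (f : ('I_n -> C) -> Sec) : (forall kp, mpf (fun t => sc (f t) kp)) -> forall kp, mpf (fun t => sc (actS (f t)) kp).
 move=> fp kp; apply: mpfE (fun t => congr1 (fun y => cf y kp.2) (actSE (f t) kp.1)) _.
 by apply: mps_lin => I'; exact: (fp (kp.1, I')).
have [q q0 qP] := orbit_dense.
have [x1 f1x1] : exists x : 'I_(size L1) -> C, (Cq i0).@[fun l => sc (actS (word L1 (extf x) s0)) (enum_val l)] != 0.
 pose f2 y := (Cq i0).@[fun l => sc (actS (ysec y)) (enum_val l)].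
 have f2p : mpf f2.
  apply: mpfme => l; apply: mS => kp; apply: mpfE (fun t => sc_sec_of _ _) _.
  by apply: mpf_sum => l'; exact: mpfX.
 have [z Cz] := meval_neq0 Cq0.
 have gI : gact g0 (ysec z) [ffun i => h0 (ysec z i)].
  exists h0, (fun=> 1); split=> [//|i|]; first exact: oner_neq0.
  by apply/ffunP => i; rewrite !ffunE scale1r.
 have f2n : exists y, f2 y != 0.
  exists (fun l => sc [ffun i => h0 (ysec z i)] (enum_val l)); move: Cz; congr (_ != 0); apply: meval_eq => l.
  rewrite -[LHS]sc_ysec; congr sc.
  have -> : ysec (fun l => sc [ffun i => h0 (ysec z i)] (enum_val l)) = [ffun i => h0 (ysec z i)].
   apply: supp_eq; [exact: supp_ysec|exact: (Aall_gact lok gI (supp_ysec z))|].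
   by move=> kp kA; rewrite -(enum_rankK_in kA kA) sc_ysec.
  have [_ k0' _ _] := gh0; apply/ffunP => i; rewrite actSE.
  have -> : [ffun i => h0 (ysec z i)] i = h0 (ysec z i) by exact: (ffunE (fun i => h0 (ysec z i)) i).
  by rewrite -comp_lfunE lker0_compVf // id_lfunE.
 have [||y [qy fy]] := @mprod_neq0 _ _ (fun y => q.@[y]) f2 (ex_intro _ q (fun y => erefl)) f2p.
 - exact: meval_neq0.
 - exact: f2n.
 by have [x [_ xE]] := qP y qy; exists x; rewrite xE.
pose f1 (x : 'I_(size L1) -> C) := (Cq i0).@[fun l => sc (actS (word L1 (extf x) s0)) (enum_val l)].
have f1p : mpf f1.
 apply: mpfme => l; apply: mS; apply: mpf_word => [i|kp]; [exact: mpf_extf|exact: mpfC].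
have ext0 : extf (fun _ : 'I_(size L1) => 0 : C) = (fun=> 0).
 by apply/funext => i; rewrite /extf; case: insubP.
pose f3 (x : 'I_(size L1) -> C) := wden L1 (extf x).
have f3p : mpf f3 by apply: mpf_wordden => i; exact: mpf_extf.
have f30 : f3 (fun=> 0) != 0 by rewrite /f3 ext0 wordden0 oner_neq0.
pose lb := gl_form (k := k) (invmx g0) (enum_rank bf).
have lbE U : lb.@[plucker U] = minor (bmx U *m invmx g0) bf by rewrite gl_formE enum_rankK.
have hlb : lb \is 1.-homog by exact: gl_form_homog.
have lbU1 : lb.@[plucker U1] != 0.
 rewrite lbE; have [b bn ->] := minor_gl U1 u0'; rewrite mulf_neq0 // -gU1 gl_actK //.
 exact: minor_Ucoord.
have nlb : ~ zv Z lb by move=> /(_ U1 ZU1)/eqP; apply/negP.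
have ind' : lin_indep (fun U => Z U /\ lb.@[plucker U] != 0) (fun i => pev (p i)).
 move=> d h; apply: ip => U ZU.
 have hs : \sum_i d i *: p i \is (J' * a).-homog by apply: rpred_sum => i _; apply: rpredZ.
 have sE U' : (\sum_i d i *: p i).@[plucker U'] = \sum_i d i * pev (p i) U'.
  by rewrite raddf_sum; apply: eq_bigr => i _; rewrite /= mevalZ.
 rewrite -sE; apply: (irr_cancel iZ hlb nlb hs) ZU => U' ZU'; rewrite mevalM.
 have [->|l0] := eqVneq lb.@[plucker U'] 0; first by rewrite mul0r.
 by rewrite sE h ?mulr0.
(* At these points of Z inside the moved chart the forms have non-zero determinant. This persists
   under words with generic parameters, for which moreover Cq i0 does not vanish at the moved
   section. *)
have [w wP wd] := indep_points ind'.
pose Mw (x : 'I_(size L1) -> C) i := bmx (w i) *m wordp L1 (extf x).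
have Mwp i a0 b : mpf (fun x => Mw x i a0 b).
 apply: mpfMx => *; [exact: mpfC|apply: mpf_wordp => j; exact: mpf_extf].
have Mw0 i : Mw (fun=> 0) i = bmx (w i) by rewrite /Mw ext0 wordp0 mulmx1.
pose f4 x := \det (\matrix_(i, j) (p (enum_val j)).@[plm (Mw x i)]).
have f4p : mpf f4.
 apply: mpf_det => i j; apply: mpfE (fun=> mxE _ _ _ _) _; apply: mpfme => b.
 by apply: mpf_det => r1 r2; apply: mpfE (fun=> mxE _ _ _ _) _; exact: Mwp.
have f40 : f4 (fun=> 0) != 0.
 move: wd; congr (\det _ != 0); apply/matrixP => i j; rewrite [LHS]mxE [RHS]mxE Mw0.
 by apply: meval_eq => b; rewrite /plm pluckerE.
pose f5 x := \prod_i minor (Mw x i *m invmx g0) bf.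
have f5p : mpf f5.
 apply: mpf_prod => i; apply: mpf_det => r1 r2; apply: mpfE (fun=> mxE _ _ _ _) _.
 by apply: mpfMx => *; [exact: Mwp|exact: mpfC].
have f50 : f5 (fun=> 0) != 0.
 apply/prodf_neq0 => i _; rewrite Mw0 -lbE; by case: (wP i).
have [x2 [a1 a3]] := mprod_neq0 f1p f3p (ex_intro (fun x => f1 x != 0) x1 f1x1) (ex_intro (fun x => f3 x != 0) _ f30).
have [x3 [a4 a5]] := mprod_neq0 f4p f5p (ex_intro (fun x => f4 x != 0) _ f40) (ex_intro (fun x => f5 x != 0) _ f50).
have [x [/andP[F1 F3] /andP[F4 F5]]] : exists x, (f1 x != 0) && (f3 x != 0) /\ (f4 x != 0) && (f5 x != 0).
 have [x [b1 b2]] := mprod_neq0 (mpfM f1p f3p) (mpfM f4p f5p)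
  (ex_intro (fun x => f1 x * f3 x != 0) x2 (mulf_neq0 a1 a3)) (ex_intro (fun x => f4 x * f5 x != 0) x3 (mulf_neq0 a4 a5)).
 by exists x; rewrite -!negb_or -!mulf_eq0.
set t := extf x in F1 F3 F4 F5; set G := wordg L1 t; set s1 := word L1 t s0.
have gG : gact G s0 s1 := gact_word s0 L1ok (wordden_neq0 F3).
have uG := gact_un gG.
have sA1 : supp Aall s1 := Aall_gact lok gG sA0.
pose s' := actS s1.
have sA' : supp Aall s' := Aall_gact lok (gS s1) sA1.
have XW i : zero_locus Y s1 (gla G (w i)).
 have XW0 : zero_locus Y s0 (w i) by apply: ZX; case: (wP i).
 exact (proj1 (zero_gact lok (Y := Y) OG_cp (w i) gG) XW0).
have key i : \sum_j (Cq j).@[fun l => sc s' (enum_val l)] * (p j).@[plm (Mw x i)] = 0.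
 set W := gla G (w i); set W' := gla (invmx g0) W.
 have XW' : zero_locus Y s' W' := proj1 (zero_gact lok (Y := Y) OG_cp W (gS s1)) (XW i).
 have MwE : Mw x i = (wden L1 t)%:M *m (bmx (w i) *m G).
  by rewrite /Mw -/t (wordpE F3) -scalemxAr mul_scalar_mx.
 have W'E : W' = gla (G *m invmx g0) (w i) by rewrite /W' /W gl_actM.
 have mW' : minor (bmx W') bf != 0.
  have : minor (Mw x i *m invmx g0) bf != 0 by move/prodf_neq0: F5 => /(_ i isT).
  rewrite MwE -!mulmxA minor_mulmx mulmxA -mulmxA neqM => /andP[_].
  have ug : G *m invmx g0 \in unitmx by rewrite unitmx_mul uG.
  by have [b bn ->] := minor_gl (w i) ug; rewrite W'E neqM => /andP[].
 have [xx [xB xS]] := param_chart sA' XW'.1 mW' XW'.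
 have [b1 b1n b1E] : exists2 b : C, b != 0 & forall D (q : {mpoly C[plucker_dim k m]}), q \is D.-homog ->
   q.@[plm (Bx xx *m g0)] = b ^+ D * q.@[plucker W].
  apply: plmB => [r|]; last first.
   apply: row_freeM => //; rewrite -xB cmxE /row_free mxrankMfree ?bmx_free //.
   by rewrite mxrank_unit // unitmx_inv unitmxE unitfE.
  have -> : row r (Bx xx *m g0) = row r (Bx xx) *m g0 by rewrite row_mul.
  have -> : W = gla g0 W' by rewrite /W' glKV.
  by rewrite mem_glM // -xB; exact: cmx_mem.
 have [b2 b2n b2E] : exists2 b : C, b != 0 & forall D (q : {mpoly C[plucker_dim k m]}), q \is D.-homog ->
   q.@[plm (Mw x i)] = b ^+ D * q.@[plucker W].
  have uw : wden L1 t *: G \in unitmx by rewrite unitmxZ // unitfE.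
  have -> : Mw x i = bmx (w i) *m (wden L1 t *: G) by rewrite /Mw -/t (wordpE F3).
  apply: plmB => [r|]; last by apply: row_freeM => //; exact: bmx_free.
  rewrite row_mul -scalemxAr; apply: memvZ; rewrite mem_glM // row_bmx.
  by apply: vbasis_mem; rewrite mem_nth // size_tuple dimGr.
 have := E1 xx; rewrite xS => e1.
 have bb : b1 ^+ (J' * a) != 0 by rewrite expf_neq0.
 apply: (mulfI bb); rewrite mulr0; transitivity (b2 ^+ (J' * a) * 0); last by rewrite mulr0.
 rewrite -[X in _ = _ * X]e1 !mulr_sumr.
 apply: eq_bigr => j _; rewrite (b1E _ _ (hp j)) (b2E _ _ (hp j)); ring.
have uM : (\matrix_(i, j) (p (enum_val j)).@[plm (Mw x i)]) \in unitmx by rewrite unitmxE unitfE.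
have v0 : \col_j (Cq (enum_val j)).@[fun l => sc s' (enum_val l)] = 0 :> 'cV[C]_#|I|.
 rewrite -[LHS](mulKmx uM); have -> : forall M (u : 'cV[C]_#|I|), M *m u = 0 -> invmx M *m (M *m u) = 0 by move=> M u ->; rewrite mulmx0.
  by [].
 apply/colP => i; rewrite !mxE; apply: etrans (key i); rewrite [RHS](reindex (@enum_val I predT)) /=; last first.
  by exists enum_rank => j _; [exact: enum_valK|exact: enum_rankK].
 by apply: eq_bigr => j _; rewrite !mxE mulrC.
case/eqP: F1; have /colP/(_ (enum_rank i0)) := v0; rewrite !mxE enum_rankK; exact.
Qed.

Variable L2 : seq (selem m N).
Hypotheses (L2ok : all (@sel_ok m E) L2)
 (L2st : all (stabU c eps) L2).
Variables (bt : C -> Sec) (bp : K -> {poly C}) (mu1 : C).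
Hypotheses (btE : forall mu kp, sc (bt mu) kp = (bp kp).[mu])
 (btA : forall mu, supp AK (bt mu)).
Hypothesis span : spans AK L2 bt bp mu1.
Variables (n : nat) (P : 'I_k -> 'I_m -> {mpoly C[n.+1]}).
Hypothesis Mf : forall v, row_free (fmx P v).
Notation X := (zero_locus Y s0).
Hypotheses (link : forall mu, exists g v, [/\ v ord0 = mu, gact g s0 (bt mu) & gla g (fam Mf v) = U0])
 (orb : forall v w, v ord0 = w ord0 -> aut_orbit X (fam Mf v) (fam Mf w)).

Let supK s : supp AK s <-> supp Aall s /\ zero_locus Y s U0 :=
 supp_K (Y := Y) (kill := kill) (@OG_Ucoord R m k c eps c_inj) (@van_base c eps c_inj) s.

Let mpf_wd kp : mpf (fun x => sc (word L1 (@extf R (size L1) x) s0) kp).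
by apply: mpf_word => [i|kp']; [exact: mpf_extf|exact: mpfC].
Qed.

Let supp_Nop_all (e : selem m N) (s : Sec) : @sel_ok m E e -> supp Aall s -> supp Aall (Nop e s).
move=> eok sA; have [t t0 td] : exists2 t : C, t != 0 & 1 + t * sden R e != 0.
 have [e1|e1] := eqVneq (1 + 1 * sden R e) 0; last by exists 1 => //; exact: oner_neq0.
 exists 2; first by rewrite pnatr_eq0.
 have -> : 1 + 2 * sden R e = 2 * (1 + 1 * sden R e) - 1 by ring.
 by rewrite e1 mulr0 sub0r oppr_eq0 oner_neq0.
have h : supp Aall (s + t *: Nop e s) := Aall_gact lok (gact_Nop s eok td) sA.
by move=> kp kA; have := h kp kA; rewrite scD (sA kp kA) add0r scZ => /eqP; rewrite mulf_eq0 (negPf t0) => /eqP.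
Qed.

(* The spinors g^-1 s0 vanishing at U0 form a slice which meets the orbit of
  s0 transversally, so every spinor of the slice close to g^-1 s0 is obtained
  from it by a small group element. *)
Lemma nearby (g : 'M[C]_m) (h : 'End(Spn)) (O : set Gr) : cpair g h -> zopen_in X O -> O (gla g U0) ->
 exists kap2, [/\ gact (invmx g) s0 kap2, supp AK kap2 &
  exists2 d : R, 0 < d & forall kap, supp AK kap -> (forall kp, nrm (sc kap kp - sc kap2 kp) <= d) ->
   exists2 G, gact G kap s0 & O (gla G U0)].
move=> gh Oo OU; have [u0 k0h _ _] := gh; have u0' : invmx g \in unitmx by rewrite unitmx_inv.
pose actS (s : Sec) : Sec := happ (h^-1)%VF s.
have gS (s : Sec) : gact (invmx g) s (actS s) by apply: happ_gact; exact: cpair_inv.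
pose kap2 := actS s0.
have [OX /(_ _ OU)[d [q [qd qU qO]]]] := (zopenP X O).1 Oo.
have kap2K : supp AK kap2.
 apply/supK; split; first exact: (Aall_gact lok (gS s0) sA0).
 have := proj1 (zero_gact lok (Y := Y) OG_cp (gla g U0) (gS s0)) (OX _ OU).
 by rewrite gl_actK.
exists kap2; split; [exact: gS|exact: kap2K|].
pose Wd (x : 'I_(size L1) -> C) := actS (word L1 (extf x) s0).
have Gp : forall l : 'I_#|Aall|, mpf (fun x => sc (Wd x) (enum_val l)).
 move=> l; apply: mpfE (fun x => sc_happ _ _ _) _.
 by apply: mps_lin => I'; exact: (mpf_wd ((enum_val l).1, I')).
have /fin_all_exists[G GE] : forall l : 'I_#|Aall|, exists p : {mpoly C[size L1]}, forall x, sc (Wd x) (enum_val l) = p.@[x].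
 by move=> l; exact: Gp.
have ext0 : extf (fun _ : 'I_(size L1) => 0 : C) = (fun=> 0).
 by apply/funext => i; rewrite /extf; case: insubP.
have G0 l : (G l).@[fun=> 0] = sc kap2 (enum_val l) by rewrite -GE /Wd ext0 word0.
(* The adjugate replaces the inverse up to a scalar, so that B, and hence the condition Q, is
   polynomial in x. *)
pose Ad (x : 'I_(size L1) -> C) : 'M[C]_m := \adj (wordp L1 (extf x)).
pose B x := bmx U0 *m g *m Ad x.
have Bp i j : mpf (fun x => B x i j).
 apply: mpfMx => [i' j'|i' j']; first exact: mpfC.
 have e x : Ad x i' j' = cofactor (wordp L1 (extf x)) j' i' by rewrite /Ad /adjugate mxE.
 apply: mpfE e _; apply: mpfM; first exact: mpfC.
 apply: mpf_det => a b; apply: mpfE (fun=> mxE _ _ _ _) _; apply: mpfE (fun=> mxE _ _ _ _) _.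
 by apply: mpf_wordp => l; exact: mpf_extf.
have [Q QE] : mpf (fun x => wden L1 (extf x) * (\det (wordp L1 (extf x)) * q.@[plm (B x)])).
 apply: mpfM; first by apply: mpf_wordden => l; exact: mpf_extf.
 apply: mpfM; first by apply: mpf_det => a b; apply: mpf_wordp => l; exact: mpf_extf.
 by apply: mpfme => a; apply: mpf_det => i j; apply: mpfE (fun=> mxE _ _ _ _) _; exact: Bp.
have plmg (A : 'M[C]_m) (z : C) : A \in unitmx -> z != 0 ->
  exists2 b : C, b != 0 & q.@[plm (bmx U0 *m (z *: A))] = b * q.@[plucker (gla A U0)].
 move=> uA zn; have [||b bn bE] := @plmB (gla A U0) (bmx U0 *m (z *: A)).
 - move=> i; rewrite row_mul -scalemxAr; apply: memvZ; rewrite mem_glM // row_bmx; by apply: vbasis_mem; rewrite mem_nth // size_tuple dimGr.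
 - by apply: row_freeM; [exact: bmx_free|rewrite unitmxZ ?unitfE].
 by exists (b ^+ d); [rewrite expf_neq0|exact: bE].
have Q0 : Q.@[fun=> 0] != 0.
 rewrite -QE ext0 wordden0 wordp0 det1 !mul1r /B /Ad ext0 wordp0 adj1 mulmx1.
 by have [b bn] := plmg g 1 u0 (oner_neq0 _); rewrite scale1r => ->; rewrite mulf_neq0.
have /fin_all_exists[v vE] : forall l : 'I_#|Aall|, exists v : 'I_(size L1) -> C,
  forall j, \sum_r v r * ((G j)^`M(r)).@[fun=> 0] = (l == j)%:R.
 (* The unit section is carried forward by h, expressed through [jac] by the operators applied to
    s0, and brought back by the inverse of h. *)
 move=> l; pose el : Sec := sec_of (fun kp => (kp == enum_val l)%:R).
 have elA : supp Aall el.
  by move=> kp kA; rewrite sc_sec_of; case: eqP => // e; rewrite e enum_valP in kA.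
 pose hel : Sec := happ h el.
 have helg : gact g el hel by exact: happ_gact.
 have helA : supp Aall hel := Aall_gact lok helg elA.
 have /fin_all_exists[a aE] : forall j : 'I_#|Aall|, exists a : 'I_(size L1) -> C, forall kp', kp' \in Aall ->
   \sum_r a r * sc (Nop (tnth (in_tuple L1) r) s0) kp' = (enum_val j == kp')%:R.
  by move=> j; apply: jac; exact: enum_valP.
 exists (fun r => \sum_j sc hel (enum_val j) * a j r) => j.
 have dG r : ((G j)^`M(r)).@[fun=> 0] = sc (actS (Nop (tnth (in_tuple L1) r) s0)) (enum_val j).
  apply: (@mderiv_lin _ _ _ _ _ (sc kap2 (enum_val j))) => e; rewrite -GE /Wd.
  have -> : word L1 (extf (fun i : 'I_(size L1) => 0 + e * (i == r)%:R)) s0 = s0 + e *: Nop (tnth (in_tuple L1) r) s0.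
   rewrite -word_delta; apply: eq_word => i iL; rewrite (ext_fun_id (fun i => 0 + e * (i == r)%:R) iL) add0r.
   by case: eqP => _; rewrite ?mulr1 ?mulr0.
  exact: sc_happD.
 have -> : \sum_r (\sum_j0 sc hel (enum_val j0) * a j0 r) * ((G j)^`M(r)).@[fun=> 0] =
   sc (actS (\sum_r (\sum_j0 sc hel (enum_val j0) * a j0 r) *: Nop (tnth (in_tuple L1) r) s0)) (enum_val j).
  rewrite sc_happ_sum; apply: eq_bigr => r _; exact (congr1 (fun z => _ * z) (dG r)).
 have -> : \sum_r (\sum_j0 sc hel (enum_val j0) * a j0 r) *: Nop (tnth (in_tuple L1) r) s0 = hel.
  apply: supp_eq => [|//|kp kA].
   move=> kp kA; rewrite sc_sum big1 // => r _; rewrite scZ.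
   have eok : @sel_ok m E (tnth (in_tuple L1) r) by rewrite (tnth_nth (tnth (in_tuple L1) r)); apply: (all_nthP _ L1ok); exact: ltn_ord.
   have hN := supp_Nop_all eok sA0.
   by rewrite (hN kp kA) mulr0.
  rewrite sc_sum; under eq_bigr do rewrite scZ mulr_suml.
  rewrite exchange_big /=; transitivity (\sum_(j0 < #|Aall|) sc hel (enum_val j0) * (enum_val j0 == kp)%:R).
   apply: eq_bigr => j0 _; under eq_bigr do rewrite -mulrA.
   by rewrite -mulr_sumr aE.
  rewrite (bigD1 (enum_rank_in kA kp)) //= [X in _ + X]big1 => [|j0 j0n].
   by rewrite enum_rankK_in // eqxx mulr1 addr0.
  case: eqP => [e|_]; last by rewrite mulr0.
  by case/eqP: j0n; apply: enum_val_inj; rewrite enum_rankK_in.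
 have -> : sc (actS hel) (enum_val j) = sc el (enum_val j).
  apply: (etrans (sc_happ _ hel (enum_val j))); rewrite /sc; congr cf; rewrite happE.
  by rewrite -comp_lfunE lker0_compVf // id_lfunE.
 by rewrite sc_sec_of (inj_eq enum_val_inj) eq_sym.
have [dl dl0 hd] := local_surj vE Q0.
exists dl => // kap kapK near.
have [x [Qx xE]] : exists x, Q.@[x] != 0 /\ forall j, (G j).@[x] = sc kap (enum_val j).
 by apply: hd => j; rewrite G0; exact: near.
move: Qx; rewrite -QE !neqM => /and3P[wd dw qB].
pose t := extf x; rewrite -/t in wd dw.
have kapE : kap = actS (word L1 t s0).
 apply: supp_eq; first by case/supK: kapK.
  exact: (Aall_gact lok (gS _) (Aall_gact lok (gact_word s0 L1ok (wordden_neq0 wd)) sA0)).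
 by move=> kp kA; rewrite -(enum_rankK_in kA kA) -xE -GE.
have gw := gact_word s0 L1ok (wordden_neq0 wd); have uw := gact_un gw.
have gG : gact (g *m invmx (wordg L1 t)) kap s0.
 rewrite kapE; apply: gact_comp (gact_inv gw).
 by have := gact_inv (gS (word L1 t s0)); rewrite invmxK.
exists (g *m invmx (wordg L1 t)) => //; apply: qO.
 apply: (proj1 (zero_gact lok (Y := Y) OG_cp U0 gG)); exact: ((supK _).1 kapK).2.
have uG := gact_un gG.
move: qB; rewrite /B -mulmxA.
have -> : Ad x = (\det (wordp L1 t) / wden L1 t) *: invmx (wordg L1 t).
 have up : wordp L1 t \in unitmx by rewrite unitmxE unitfE.
 have e : Ad x = \det (wordp L1 t) *: invmx (wordp L1 t) by rewrite /invmx up scalerA mulfV // scale1r.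
 by rewrite e (wordpE wd) invmxZ ?unitmxZ ?unitfE // scalerA.
rewrite -scalemxAr; have z0 : \det (wordp L1 t) / wden L1 t != 0 by rewrite mulf_neq0 ?invr_eq0.
by have [b bn ->] := plmg _ _ uG z0; rewrite neqM => /andP[_].
Qed.

(** Start at any point of O and pull s0 back to the section kap2 vanishing at U0. Sections close to
    kap2 lead back into O by [nearby], and some of them are words applied to a base section, which
    [link] connects with the family. *)
Theorem family_dense (rho : {mpoly C[n.+1]}) (O : set Gr) : rho != 0 -> zopen_in X O -> O !=set0 ->
 exists f v, [/\ automorphism X f, rho.@[v] != 0 & O (f (fam Mf v))].
move=> rho0 Oo [U2 OU2]; have OX : O `<=` X := ((zopenP X O).1 Oo).1.
have [g [h [gh gU]]] := witt0 (OX U2 OU2).1; rewrite -gU in OU2.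
have [kap2 [gk kK [d d0 near]]] := nearby gh Oo OU2.
have [v1 rv1] := meval_neq0 rho0.
have [psi psiE] : exists r : {poly C}, forall t, r.[t] = rho.@[updt v1 t].
 exact: (mpf_univ v1 (ex_intro _ rho (fun x => erefl))).
have psi0 : psi != 0.
 apply/eqP => e; move: rv1; have := psiE (v1 ord0); rewrite e horner0 => h0.
 by rewrite (meval_eq rho (fun l => esym (updt_id v1 l))) -h0 eqxx.
have [q q0 qP] := dominate btE psi0 span.
have [y qy] := meval_neq0 q0; have [s' s'K s'E] := supp_exists y.
(* On the line from kap2 to a section s' where q is non-zero, only finitely many z are excluded, so
   z can be taken small. *)
pose line z : Sec := kap2 + z *: (s' - kap2).
have lineK z : supp AK (line z).
 by apply: suppD => //; apply: suppZ; apply: suppD => //; rewrite -scaleN1r; apply: suppZ.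
have [Q QE] : mpf (fun x : 'I_1 -> C => qev q (line (x ord0))).
 apply: mpfme => j; apply: mpfE (fun x => scD _ _ _) _; apply: mpfD; first exact: mpfC.
 by apply: mpfE (fun x => scZ _ _ _) _; apply: mpfM; [exact: mpfX|exact: mpfC].
have [r rE] := mpf1_poly (f := fun z => qev q (line z)) (ex_intro _ Q QE).
have r0 : r != 0.
 apply/eqP => e; have := rE 1; rewrite e horner0 /line scale1r addrC subrK /qev => h0.
 by move: qy; rewrite -(meval_eq q s'E) h0 eqxx.
pose Mx : R := 1 + \sum_kp nrm (sc (s' - kap2) kp).
have Mx0 : 0 < Mx by rewrite ltr_wpDr // sumr_ge0 // => kp _; exact: nrm_ge0.
have [z [zd rz]] := small_nonroot r0 (divr_gt0 d0 Mx0).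
have qz : qev q (line z) != 0 by rewrite rE.
have [mu [t [pmu tok tE]]] := qP _ (lineK z) qz.
have [|G gG OG] := near (line z) (lineK z).
 move=> kp; have -> : sc (line z) kp - sc kap2 kp = z * sc (s' - kap2) kp by rewrite /line (scD kap2) (scZ z) addrC addKr.
 have dM : d / Mx * Mx = d by rewrite divfK // gt_eqF.
 apply: le_trans (nrmM _ _) _; rewrite -[X in _ <= X]dM; apply: ler_pM => //; try exact: nrm_ge0.
 rewrite /Mx (bigD1 kp) //= addrCA lerDl addr_ge0 // sumr_ge0 // => ? _; exact: nrm_ge0.
have gw := gact_word (bt mu) L2ok tok.
have lE : line z = word L2 t (bt mu).
 have wA : supp AK (word L2 t (bt mu)).
  apply/supK; split; first by apply: (Aall_gact lok gw); case/supK: (btA mu).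
  have := proj1 (zero_gact lok (Y := Y) OG_cp U0 gw) ((supK _).1 (btA mu)).2.
  by rewrite (stab_wordg c_inj L2ok L2st tok).
 apply: scP => kp; have [kA|kA] := boolP (kp \in AK); first exact: tE.
 by apply: (etrans (lineK z kp kA)); apply: esym; exact: (wA kp kA).
have [g3 [w [w0 g3s g3U]]] := link mu.
pose v := updt v1 mu.
have [f' f'a f'v] : aut_orbit X (fam Mf v) (fam Mf w) by apply: orb; rewrite /v /updt eqxx w0.
have gA : gact (g3 *m (wordg L2 t *m G)) s0 s0.
 by apply: gact_comp g3s _; apply: gact_comp gw _; rewrite -lE.
have aA : automorphism X (gla (g3 *m (wordg L2 t *m G))).
 apply: gl_aut (gact_un gA) _ => U; exact: (zero_gact lok (Y := Y) OG_cp U gA).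
have [f fa fE] : aut_orbit X (fam Mf v) (gla (g3 *m (wordg L2 t *m G)) (fam Mf w)).
 apply: (@orbit_trans _ _ _ _ _ (fam Mf w)); first by exists f'.
 by exists (gla (g3 *m (wordg L2 t *m G))).
exists f, v; split; [exact: fa|by rewrite -psiE|].
have u3 := gact_un g3s; have uw := gact_un gw; have uG := gact_un gG.
rewrite -fE -gl_actM ?unitmx_mul ?uw // g3U -gl_actM // (stab_wordg c_inj L2ok L2st tok) //.
Qed.
End ZeroLoci.

Lemma fam_strict_fin (R : realType) (k m r r' : nat) (T : finType)
  (P : 'I_k -> 'I_m -> {mpoly R[i][r]}) (P' : 'I_k -> 'I_m -> {mpoly R[i][r']})
  (Mf : forall v, row_free (fmx P v)) (Mf' : forall v, row_free (fmx P' v))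
  (v0 : 'I_r -> R[i]) (L : T -> 'M[R[i]]_(k, m)) :
 (k * k + r' < #|T|)%N ->
 (forall i, exists (A : 'M[R[i]]_k) (v : 'I_r -> R[i]), forall j,
   mxdot (L j) (A *m fmx P v0 + \matrix_(a, b) \sum_l v l * ((P a b)^`M(l)).@[v0]) = (i == j)%:R) ->
 ~ (famset Mf `<=` zcl (famset Mf')).
move=> lt h; apply: (@fam_strict R k m r r' #|T| P P' Mf Mf' v0 (fun l => L (enum_val l)) lt) => i.
have [A [v hv]] := h (enum_val i); exists A, v => j; rewrite hv; congr (_%:R).
by rewrite (inj_eq enum_val_inj).
Qed.

Lemma fmx_family (F : numFieldType) (k m r : nat) (M : ('I_r -> F) -> 'M[F]_(k, m)) :
 (forall i j, mpf (fun v => M v i j)) ->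
 exists P : 'I_k -> 'I_m -> {mpoly F[r]}, forall v i j, (P i j).@[v] = M v i j.
move=> h; have /fin_all_exists[P PE] : forall i : 'I_k, exists p : 'I_m -> {mpoly F[r]}, forall j v, (p j).@[v] = M v i j.
 move=> i; have /fin_all_exists[p pE] : forall j : 'I_m, exists q : {mpoly F[r]}, forall v, M v i j = q.@[v] by move=> j; exact: h.
 by exists p => j v; rewrite pE.
by exists P => v i j; exact: PE.
Qed.

(** * Chains of subfamilies inside a slice *)

Section Slices.
Variables (R : realType) (k m n : nat).
Notation C := (R[i]).
Variables (P : 'I_k -> 'I_m -> {mpoly C[n.+1]}).
Hypothesis Mf : forall v, row_free (fmx P v).
Variables (W : C -> 'M[C]_(k, m)) (A : 'I_n -> 'M[C]_m).
Hypothesis Wp : forall i j, exists p : {poly C}, forall t, W t i j = p.[t].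
(* W t is the value of the family at (t, 0), where its derivatives are the W t *m A l. *)
Hypothesis line : forall t l i j, exists p : {poly C},
 [/\ forall x, (P i j).@[fun a => if unlift ord0 a is Some b then x * (b == l)%:R else t] = p.[x],
   p.[0] = W t i j & p^`().[0] = (W t *m A l) i j].

Notation T q := ('I_k * 'I_k + 'I_q)%type.

Definition dirs t (x : T n) : 'M[C]_(k, m) :=
 match x with inl ab => delta_mx ab.1 ab.2 *m W t | inr l => W t *m A l end.

Variables (t0 : C) (L0 : T n -> 'M[C]_(k, m)).
Hypothesis dual0 : forall x y, mxdot (L0 y) (dirs t0 x) = (x == y)%:R.

(** The determinant of the pairing between the functionals L0 and the directions is polynomial in t
    and equals 1 at t0, so it vanishes for finitely many t only. *)
Lemma dual_functionals : exists bad : seq C, forall t, t \notin bad ->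
 exists L : T n -> 'M[C]_(k, m), forall x y, mxdot (L y) (dirs t x) = (x == y)%:R.
pose D t : 'M[C]_#|{: T n}| := \matrix_(i, j) mxdot (L0 (enum_val j)) (dirs t (enum_val i)).
have Dp : mpf (fun v : 'I_1 -> C => \det (D (v ord0))).
 apply: mpf_det => i j; apply: mpfE (fun=> mxE _ _ _ _) _.
 have Wm a b : mpf (fun v : 'I_1 -> C => W (v ord0) a b).
  have [p pE] := Wp a b; apply: mpfE (fun v => pE _) _; apply: mpf_horner; exact: mpfX.
 apply: mpf_mxdot => a b; case: (enum_val i) => [ab|l] /=.
  by apply: mpfMx => [? ?|? ?]; [exact: mpfC|exact: Wm].
 by apply: mpfMx => [? ?|? ?]; [exact: Wm|exact: mpfC].
have [r rE] := mpf1_poly (f := fun z => \det (D z)) Dp.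
have r0 : r != 0.
 apply/eqP => e; have := rE t0; rewrite e horner0.
 have -> : D t0 = 1%:M by apply/matrixP => i j; rewrite !mxE dual0 (inj_eq enum_val_inj).
 by rewrite det1 => /eqP; rewrite oner_eq0.
have [bad badP] := fins_roots r0; exists bad => t tb.
have uD : D t \in unitmx.
 by rewrite unitmxE unitfE rE; apply: contraNneq tb => e; apply: badP.
exists (fun y => \sum_j invmx (D t) j (enum_rank y) *: L0 (enum_val j)) => x y.
have -> : mxdot (\sum_j invmx (D t) j (enum_rank y) *: L0 (enum_val j)) (dirs t x) =
  \sum_j D t (enum_rank x) j * invmx (D t) j (enum_rank y).
 transitivity (\sum_j invmx (D t) j (enum_rank y) * mxdot (L0 (enum_val j)) (dirs t x)); last first.
  by apply: eq_bigr => j _; rewrite !mxE enum_rankK mulrC.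
 rewrite /mxdot; under [RHS]eq_bigr do rewrite mulr_sumr.
 rewrite [RHS]exchange_big /=; apply: eq_bigr => a _.
 under [RHS]eq_bigr do rewrite mulr_sumr.
 rewrite [RHS]exchange_big /=; apply: eq_bigr => b _.
 by rewrite summxE mulr_suml; apply: eq_bigr => j _; rewrite mxE mulrA.
have := mulmxV uD => /matrixP/(_ (enum_rank x) (enum_rank y)); rewrite !mxE => ->.
by rewrite (inj_eq enum_rank_inj).
Qed.

Definition incl (q : nat) (t : C) (v : 'I_q -> C) : 'I_n.+1 -> C :=
 fun a => if unlift ord0 a is Some b then extf v b else t.

Lemma mpf_incl q t a : mpf (fun v : 'I_q -> C => incl t v a).
by rewrite /incl; case: unliftP => [b _|_]; [exact: mpf_extf|exact: mpfC]. Qed.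

(** The parameters of the slice are freed one at a time. Each inclusion of closures is strict by
    [fam_strict]: one more direction is independent, modulo changes of basis, than the smaller
    family has parameters. *)
Lemma slice_chains : exists bad : seq C, forall t, t \notin bad ->
 exists2 Ds : nat -> set (Gr R k m), echain (slice Mf t) n Ds & Ds n = slice Mf t.
have [bad badP] := dual_functionals; exists bad => t /badP[L LE].
have sub q : exists Q : 'I_k -> 'I_m -> {mpoly C[q]}, forall v i j, (Q i j).@[v] = fmx P (incl t v) i j.
 apply: fmx_family => i j; apply: mpfE (fun=> mxE _ _ _ _) _.
 by apply: mpfme => a; exact: mpf_incl.
pose Q q := projT1 (cid (sub q)); have QE q := projT2 (cid (sub q)).
have QP q v : fmx (Q q) v = fmx P (incl t v) by apply/matrixP => i j; rewrite [LHS]mxE QE.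
have MQ q v : row_free (fmx (Q q) v) by rewrite QP.
have famE q v : fam (MQ q) v = fam Mf (incl t v).
 apply/esym; apply: mx_Gr_eq => i; rewrite QP; exact: fam_row.
have incl0 q v : @incl q t v ord0 = t by rewrite /incl unlift_none.
exists (fun q => famset (MQ q)); last first.
 apply/seteqP; split=> U.
  by move=> [v ->]; exists (incl t v); rewrite ?incl0 // famE.
 move=> [v v0 ->]; exists (fun l => v (lift ord0 l)); rewrite famE; congr (fam Mf _).
 apply/funext => a; rewrite /incl; case: unliftP => [b ->|->//].
 by rewrite /extf insubT //= => h; congr (v (lift _ _)); apply: val_inj.
split=> q qn.
 by split; [exact: irr_fam|move=> U [v ->]; exists (incl t v); rewrite ?incl0 // famE].
split.
 suff h : famset (MQ q) `<=` famset (MQ q.+1) by move=> U UD d p hp pz; apply: pz; exact: h.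
 move=> _ [v ->]; exists (fun l : 'I_q.+1 => extf v l); rewrite !famE; congr (fam Mf _).
 apply/funext => a; rewrite /incl; case: unliftP => [b _|//].
 rewrite {2}/extf; case: insubP => [l _ lb|]; first by rewrite lb.
 by rewrite -leqNgt => h; rewrite /extf insubF // ltnNge ltnW.
pose j (x : T q.+1) : T n := match x with inl ab => inl ab | inr l => inr (widen_ord qn l) end.
have j_inj : injective j by case=> [a|a] [b|b] //= [] => [->|/val_inj h] //; congr inr; apply: val_inj; exact: congr1 h.
have ext0 : @extf R q.+1 (fun=> 0) = fun=> 0.
 by apply/funext => i; rewrite /extf; case: insubP.
have fm0 : fmx (Q q.+1) (fun=> 0) = W t.
 apply/matrixP => a b; rewrite [LHS]mxE QE [LHS]mxE.
 have [p [pE <- _]] := line t (Ordinal qn) a b; rewrite -pE; apply: meval_eq => i.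
 by rewrite /incl; case: unliftP => [b' _|//]; rewrite ext0 mul0r.
apply: (@fam_strict_fin _ _ _ _ _ (T q.+1) _ _ _ _ (fun=> 0) (fun x => L (j x))).
 by rewrite card_sum card_prod !card_ord ltn_add2l.
move=> [ab|l].
 exists (delta_mx ab.1 ab.2), (fun=> 0) => y; rewrite fm0.
 rewrite (_ : \matrix_(_, _) _ = 0) ?addr0; first by rewrite -(inj_eq j_inj); exact: (LE (inl ab) (j y)).
 by apply/matrixP => a b; rewrite !mxE big1 // => i _; rewrite mul0r.
exists 0, (fun i => (i == l)%:R) => y; rewrite mul0mx add0r.
rewrite (_ : \matrix_(_, _) _ = W t *m A (widen_ord qn l)); first by rewrite -(inj_eq j_inj); exact: (LE (inr (widen_ord qn l)) (j y)).
apply/matrixP => a b; rewrite [LHS]mxE (bigD1 l) //= eqxx mul1r big1 ?addr0 => [|i /negPf ->]; last by rewrite mul0r.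
have [p [pE _ <-]] := line t (widen_ord qn l) a b.
apply: mderiv_curve => e; rewrite QE [LHS]mxE -pE; apply: meval_eq => i.
rewrite /incl; case: unliftP => [b' _|//]; rewrite /extf; case: insubP => [l' _ lb|].
 by rewrite add0r; congr (_ * _%:R); rewrite -!val_eqE /= lb.
rewrite -leqNgt => h; rewrite (_ : (b' == _) = false) ?mulr0 //.
by apply/negP => /eqP e'; move: h; rewrite e' /= leqNgt ltn_ord.
Qed.
End Slices.

(* Polynomials in one variable with integer coefficients, as lists. *)
Local Notation ent M i j := (nth [::] (nth [::] M i) j).

Section IntegerPolynomials.
Variable C : numFieldType.
Implicit Types (p q : seq Z) (x : C).

Fixpoint peval p x : C := if p is a :: p' then zC C a + x * peval p' x else 0.
Definition mulz p q : seq Z := foldr (fun a acc => addz (scz a q) (0%ZZ :: acc)) [::] p.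
Definition pzero p : bool := all (fun a => Z.eqb a 0) p.

Lemma pevalD p q x : peval (addz p q) x = peval p x + peval q x.
elim: p q => [|a p IH] [|b q] /=; rewrite ?add0r ?addr0 //.
by rewrite IH zCD mulrDr addrACA.
Qed.

Lemma pevalZ a p x : peval (scz a p) x = zC C a * peval p x.
rewrite /scz; case: (Z.eqb_spec a 0) => [->|_]; first by rewrite zC0 mul0r.
elim: p => [|b p IH] /=; first by rewrite mulr0.
by rewrite IH zCM mulrDr mulrCA.
Qed.

Lemma pevalM p q x : peval (mulz p q) x = peval p x * peval q x.
elim: p => [|a p IH] /=; first by rewrite mul0r.
by rewrite pevalD pevalZ /= IH zC0 add0r mulrDl mulrA.
Qed.

Lemma peval_pzero p x : pzero p -> peval p x = 0.
elim: p => [//|a p IH] /= /andP[/Z.eqb_spec -> /IH ->].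
by rewrite zC0 mulr0 addr0.
Qed.

Lemma zCm1 : zC C (-1)%ZZ = -1.
by rewrite (zCN C 1) zC1. Qed.

Definition peq p q : bool := pzero (addz p (scz (-1)%ZZ q)).
Lemma peval_peq p q x : peq p q -> peval p x = peval q x.
move=> /(peval_pzero x); rewrite pevalD pevalZ zCm1 mulN1r => /eqP.
by rewrite subr_eq0 => /eqP.
Qed.

Lemma peval_poly p : exists r : {poly C}, forall x, peval p x = r.[x].
elim: p => [|a p [r rE]]; first by exists 0 => x; rewrite horner0.
by exists ((zC C a)%:P + 'X * r) => x; rewrite /= rE hornerD hornerM hornerC hornerX.
Qed.

Lemma peval_deriv p : exists r : {poly C}, [/\ forall x, peval p x = r.[x],
 r.[0] = zC C (nth 0%ZZ p 0) & r^`().[0] = zC C (nth 0%ZZ p 1)].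
case: p => [|a p].
 by exists 0; split=> [x||]; rewrite ?horner0 ?derivC ?horner0 // zC0.
have [r rE] := peval_poly p; exists ((zC C a)%:P + 'X * r); split.
- by move=> x; rewrite /= rE hornerD hornerM hornerC hornerX.
- by rewrite hornerD hornerM hornerC hornerX mul0r addr0.
rewrite derivD derivC add0r derivM derivX mul1r hornerD hornerM hornerX mul0r addr0 -rE.
by case: p {rE} => [|b p] /=; rewrite ?zC0 // mul0r addr0.
Qed.
End IntegerPolynomials.

Definition dropnth (T : Type) j (q : seq T) : seq T := take j q ++ drop j.+1 q.

Lemma nth_dropnth (T : Type) (x0 : T) j q l : (j < size q)%N -> nth x0 (dropnth j q) l = nth x0 q (bump j l).
move=> jq; rewrite /dropnth nth_cat size_take jq /bump; case: ltnP => lj.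
 by rewrite nth_take // add0n.
by rewrite nth_drop add1n addSn subnKC.
Qed.

Lemma size_dropnth (T : Type) j (q : seq T) : (j < size q)%N -> size (dropnth j q) = (size q).-1.
by move=> jq; rewrite /dropnth size_cat size_take jq size_drop; lia. Qed.

(** * Determinants and multilinear forms over Z[x] *)

Section Determinants.
Variable C : numFieldType.
Implicit Types (f : nat -> nat -> C).

Definition sgz (j : nat) : Z := if odd j then (-1)%ZZ else 1%ZZ.
Lemma zC_sgz j : zC C (sgz j) = (-1) ^+ j.
by rewrite /sgz -signr_odd; case: (odd j); [exact: zCm1|exact: zC1]. Qed.

Lemma det_cols f (q : seq nat) d : size q = d.+1 ->
 \det (\matrix_(i < d.+1, j < d.+1) f i (nth 0%N q j)) =
 \sum_(j < d.+1) (-1) ^+ j * f 0%N (nth 0%N q j) *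
   \det (\matrix_(i < d, l < d) f i.+1 (nth 0%N (dropnth j q) l)).
move=> sq; rewrite (expand_det_row _ ord0); apply: eq_bigr => j _.
rewrite mxE /cofactor add0n mulrA [f _ _ * _]mulrC; congr (_ * \det _).
by apply/matrixP => i l; rewrite !mxE nth_dropnth ?sq // lift0.
Qed.

(** Expansion along the first row that skips zero entries, since the matrices are sparse. *)
Fixpoint detp (rows : seq (seq (seq Z))) (q : seq nat) : seq Z :=
 if rows is r :: rows' then
  foldr (fun j acc => addz (scz (sgz j) (let a := nth [::] r (nth 0%N q j) in
    if pzero a then [::] else mulz a (detp rows' (dropnth j q)))) acc) [::] (iota 0 (size q))
 else [:: 1%ZZ].

Lemma foldr_addz (s : seq nat) (F : nat -> seq Z) (x : C) :
 peval (foldr (fun j acc => addz (F j) acc) [::] s) x = \sum_(j <- s) peval (F j) x.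
by elim: s => [|j s IH] /=; rewrite ?big_nil // big_cons pevalD IH. Qed.

Lemma detpP rows q d f (x : C) : size rows = d -> size q = d ->
 (forall i a, (i < d)%N -> f i a = peval (ent rows i a) x) ->
 peval (detp rows q) x = \det (\matrix_(i < d, j < d) f i (nth 0%N q j)).
elim: rows q d f => [|r rows IH] q [|d] f //= => [_ _ _|[sr] sq fE].
 by rewrite det_mx00 mulr0 addr0 zC1.
rewrite foldr_addz det_cols // sq -[iota 0 _]/(index_iota 0 d.+1) big_mkord; apply: eq_bigr => j _.
rewrite pevalZ zC_sgz -mulrA (fE 0%N) //=.
set a := nth [::] r _; congr (_ * _); case: ifP => [/(peval_pzero x) ->|_]; first by rewrite mul0r.
rewrite pevalM; congr (_ * _); apply: (IH _ d (fun i => f i.+1)) => //; first by rewrite size_dropnth sq.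
by move=> i b id; rewrite -(fE i.+1).
Qed.

(* Multilinear forms, as lists of monomials with polynomial coefficients. *)
Fixpoint mono (q : seq nat) (rows : seq (nat -> C)) : C :=
 match q, rows with a :: q', r :: rows' => r a * mono q' rows' | _, _ => 1 end.
Definition tensor := seq (seq nat * seq Z).
Definition tev (T : tensor) (rows : seq (nat -> C)) (x : C) : C :=
 \sum_(t <- T) peval t.2 x * mono t.1 rows.

Fixpoint alt (d : nat) (q : seq nat) : tensor :=
 if d is d'.+1 then
  [seq (nth 0%N q j :: t.1, scz (sgz j) t.2) | j <- iota 0 (size q), t <- alt d' (dropnth j q)]
 else [:: ([::], [:: 1%ZZ])].

Lemma altP d q f (x : C) : size q = d ->
 tev (alt d q) [seq f i | i <- iota 0 d] x = \det (\matrix_(i < d, j < d) f i (nth 0%N q j)).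
elim: d q f => [|d IH] q f sq.
 by rewrite det_mx00 /tev big_seq1 /= mulr1 mulr0 addr0 zC1.
rewrite det_cols // /tev [alt _ _]/= big_allpairs_dep sq -[iota 0 _]/(index_iota 0 d.+1) big_mkord.
apply: eq_bigr => j _; have := IH (dropnth j q) (fun i => f i.+1).
rewrite size_dropnth sq // => /(_ erefl) <-; rewrite /tev mulr_sumr; apply: eq_bigr => t _ /=.
rewrite pevalZ zC_sgz -[iota 1 d]/(iota (1 + 0) d) iotaDl -map_comp.
by rewrite (eq_map (g := fun i => f i.+1)) //; ring.
Qed.

Definition tscale (a : Z) (T : tensor) : tensor := [seq (t.1, scz a t.2) | t <- T].
Lemma tev_scale a T rows x : tev (tscale a T) rows x = zC C a * tev T rows x.
rewrite /tev big_map mulr_sumr; apply: eq_bigr => t _ /=; by rewrite pevalZ mulrA.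
Qed.
Lemma tev_cat T T' rows x : tev (T ++ T') rows x = tev T rows x + tev T' rows x.
by rewrite /tev big_cat. Qed.

(** Cancellation is decided by grouping monomials by their first index, recursively, without a
    normal form for tensors. *)
Fixpoint tzero (n d : nat) (T : tensor) : bool :=
 nilp T || (if d is d'.+1 then
  all (fun t => if t.1 is a :: _ then (a < n)%N else false) T &&
  all (fun a => tzero n d' [seq (behead t.1, t.2) | t <- T & head 0%N t.1 == a]) (iota 0 n)
 else pzero (foldr (fun t => addz t.2) [::] T)).
Lemma tzeroP n T rows (x : C) : tzero n (size rows) T -> tev T rows x = 0.
elim: rows T => [|r rows IH] T /= /orP[/nilP ->|]; rewrite /tev ?big_nil //.
 move/(peval_pzero x) => h; rewrite -[RHS]h; elim: T {h} => [|t T e] /=; first by rewrite big_nil.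
 by rewrite big_cons pevalD e; case: t.1 => *; rewrite mulr1.
case/andP=> /allP h1 /allP h2.
transitivity (\sum_(t <- T) \sum_(a < n | head 0%N t.1 == a) r a * (peval t.2 x * mono (behead t.1) rows)).
 apply: eq_big_seq => t /h1; case: t.1 => // a q an.
 by rewrite (big_pred1 (Ordinal an)) => [|b]; rewrite /= 1?mulrCA // eq_sym.
rewrite (exchange_big_dep xpredT) //= big1 // => a _; rewrite -mulr_sumr.
have := IH _ (h2 (val a) _); rewrite mem_iota ltn_ord => /(_ isT).
by rewrite /tev big_map big_filter => ->; rewrite mulr0.
Qed.
Definition teq (n d : nat) (T T' : tensor) : bool := tzero n d (T ++ tscale (-1)%ZZ T').
Lemma teqP n d T T' rows (x : C) : size rows = d -> teq n d T T' -> tev T rows x = tev T' rows x.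
by move=> <- /(tzeroP x); rewrite tev_cat tev_scale zCm1 mulN1r => /subr0_eq. Qed.

(* Substitution of r h for the arguments r, where cols b lists the non-zero
  entries of the b-th column of h. *)
Fixpoint texp (cols : nat -> seq (nat * seq Z)) (q : seq nat) : tensor :=
 if q is b :: q' then [seq (ah.1 :: t.1, mulz ah.2 t.2) | ah <- cols b, t <- texp cols q']
 else [:: ([::], [:: 1%ZZ])].
Definition tsub cols (T : tensor) : tensor :=
 flatten [seq [seq (t'.1, mulz t.2 t'.2) | t' <- texp cols t.1] | t <- T].
Definition rmul (cols : nat -> seq (nat * seq Z)) (x : C) (r : nat -> C) (b : nat) : C :=
 \sum_(ah <- cols b) r ah.1 * peval ah.2 x.

Lemma texpP cols q rows x : size q = size rows ->
 tev (texp cols q) rows x = mono q [seq rmul cols x r | r <- rows].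
elim: q rows => [|b q IH] [|r rows] //=; first by rewrite /tev big_seq1 /= mulr0 addr0 mulr1 zC1.
move=> [s]; rewrite -(IH rows s) /tev big_allpairs_dep /rmul mulr_suml; apply: eq_bigr => ah _.
rewrite mulr_sumr; apply: eq_bigr => t _ /=; rewrite pevalM; ring.
Qed.

Lemma tsubP cols T rows x : all (fun t => size t.1 == size rows) T ->
 tev (tsub cols T) rows x = tev T [seq rmul cols x r | r <- rows] x.
rewrite /tsub; elim: T => [|t T IH] /=; first by rewrite /tev !big_nil.
case/andP=> /eqP s /IH h; rewrite tev_cat h [in RHS]/tev big_cons -texpP //; congr (_ + _).
rewrite /tev big_map mulr_sumr; apply: eq_bigr => t' _ /=; by rewrite pevalM mulrA.
Qed.
End Determinants.

(* A step (p, ws, d) stands for 1 + d e_p w, with w = sum of al.2 e_(al.1) over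
  al in ws and d a polynomial in one variable. *)
Definition step := (nat * seq (nat * Z) * seq Z)%type.

(** * Explicit words on C^14 with polynomial coefficients *)

Section Steps.
Variable R : realType.
Notation C := (R[i]).
Notation m := 14%N.
Notation V := 'rV[C]_m.
Notation Spn := (spinor R m).
Notation E := [:: Splus].
Notation Sec := {ffun 'I_(size E) -> Spn}.
Implicit Types (p : nat) (ws : seq (nat * Z)) (d : seq Z) (x : C) (r : seq (seq Z)).

Definition evn (a : nat) : V := ev R (om a (isT : 0 < m)%N).
Definition wv ws : V := \sum_(al <- ws) zC C al.2 *: evn al.1.
Definition coef ws (b : nat) : Z := foldr (fun al acc => if al.1 == b then (al.2 + acc)%ZZ else acc) 0%ZZ ws.
Fixpoint zq ws : Z := if ws is al :: ws' then (zq ws' + al.2 * coef ws' (13 - al.1))%ZZ else 0%ZZ.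
(** Indices with sum 13 are opposite; excluding them makes w orthogonal to e_p, so the denominator
    [Eden] is 1 and all matrices are polynomial. *)
Definition step_ok (st : step) : bool :=
 (st.1.1 < m)%N && all (fun al => (al.1 < m)%N && (al.1 + st.1.1 != 13)%N) st.1.2.

Lemma val_om a : (a < m)%N -> val (om a (isT : 0 < m)%N) = a.
by move=> h; rewrite /= modn_small. Qed.

Lemma evnE a (j : 'I_m) : (a < m)%N -> evn a 0 j = (a == j)%:R.
by move=> h; rewrite /evn evE -val_eqE val_om // eq_sym. Qed.

Lemma rev_om a : (a < m)%N -> rev_ord (om a (isT : 0 < m)%N) = om (13 - a) (isT : 0 < m)%N.
by move=> h; apply: val_inj; rewrite /= !modn_small //; lia. Qed.

Lemma rev_om_neq a : (a < m)%N -> (rev_ord (om a (isT : 0 < m)%N) == om a (isT : 0 < m)%N) = false.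
by move=> h; rewrite rev_om // -val_eqE /= !modn_small //; lia. Qed.

Lemma bform_evn a (v : V) : (a < m)%N -> bform (evn a) v = v 0 (om (13 - a) (isT : 0 < m)%N).
by move=> h; rewrite bform_ev rev_om_neq // rev_om // mulr1n. Qed.

Lemma qform_evn a : (a < m)%N -> qform (evn a) = 0.
by move=> h; rewrite qform_ev rev_om_neq. Qed.

Lemma wvE ws (j : 'I_m) : all (fun al => (al.1 < m)%N) ws -> wv ws 0 j = zC C (coef ws j).
rewrite /wv; elim: ws => [|al ws IH] /=; first by rewrite big_nil mxE zC0.
case/andP=> h /IH {}IH; rewrite big_cons mxE IH mxE evnE //.
by case: eqP => _; rewrite ?mulr1 ?zCD // mulr0 add0r.
Qed.

Lemma qform_wv ws : all (fun al => (al.1 < m)%N) ws -> qform (wv ws) = zC C (zq ws).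
elim: ws => [|al ws IH] /=.
 have -> : wv [::] = 0 :> V by rewrite /wv big_nil.
 by have := qformZ 0 (0 : V); rewrite scale0r expr0n mul0r zC0.
case/andP=> h ok; have {}IH := IH ok.
have -> : wv (al :: ws) = zC C al.2 *: evn al.1 + wv ws by rewrite /wv big_cons.
rewrite qformD qformZ qform_evn // mulr0 add0r bformZl bform_evn // wvE // val_om; last by lia.
by rewrite zCD zCM IH.
Qed.

Lemma bform_wv ws (v : V) : all (fun al => (al.1 < m)%N) ws ->
 bform (wv ws) v = \sum_(al <- ws) zC C al.2 * v 0 (om (13 - al.1) (isT : 0 < m)%N).
move=> ok; rewrite /wv bform_suml big_seq [RHS]big_seq; apply: eq_bigr => al /(allP ok) h.
by rewrite bformZl bform_evn.
Qed.

Lemma step_okP st : step_ok st -> [/\ (st.1.1 < m)%N, all (fun al => (al.1 < m)%N) st.1.2 &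
 bform (evn st.1.1) (wv st.1.2) = 0].
case/andP=> h /allP ok; have ok' : all (fun al => (al.1 < m)%N) st.1.2 by apply/allP => al /ok/andP[].
split=> //; rewrite bformC bform_wv // big_seq big1 // => al /ok/andP[al14 ap].
rewrite evnE // val_om; last by lia.
by case: eqP => [e|_]; [exfalso; move: ap; rewrite e; lia|rewrite mulr0].
Qed.

Definition stmx (st : step) x : 'M[C]_m := Emx (evn st.1.1) (wv st.1.2) (peval st.2 x).
Definition smx (S : seq step) x : 'M[C]_m := foldr (fun st M => stmx st x *m M) 1%:M S.

Lemma smx_cat S S' x : smx (S ++ S') x = smx S x *m smx S' x.
by elim: S => [|st S IH] /=; rewrite ?mul1mx // IH mulmxA. Qed.

(** The formula of [mul_Emx] with denominator 1, on a row of coefficient lists. *)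
Definition vst (r : seq (seq Z)) (st : step) : seq (seq Z) :=
 let: (p, ws, d) := st in
 let bp := mulz d (nth [::] r (13 - p)) in
 let bw := foldr (fun al acc => addz (scz al.2 (nth [::] r (13 - al.1))) acc) [::] ws in
 mkseq (fun j => addz (nth [::] r j)
  (addz (if j == p then addz (mulz d bw) (scz (- zq ws)%ZZ (mulz d bp)) else [::])
     (scz (- coef ws j)%ZZ bp))) m.
Definition srow (S : seq step) r : seq (seq Z) := foldl vst r S.

Lemma size_srow S r : size r = m -> size (srow S r) = m.
by elim: S r => [|[[p ws] d] S IH] r //= _; apply: IH; rewrite size_mkseq.
Qed.

Definition rowmod (v : V) r x : Prop := forall j : 'I_m, v 0 j = peval (nth [::] r j) x.

Lemma rowmod_om v r x a : rowmod v r x -> (a < m)%N -> v 0 (om a (isT : 0 < m)%N) = peval (nth [::] r a) x.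
by move=> h am; rewrite h val_om. Qed.

Lemma row_comb (v u w : V) (a b e : C) j :
 (v + a *: u - b *: w - e *: u) 0 j = v 0 j + a * u 0 j - b * w 0 j - e * u 0 j.
by rewrite !mxE. Qed.

Lemma vstP v r x st : step_ok st -> rowmod v r x -> rowmod (v *m stmx st x) (vst r st) x.
move=> ok vr j; have [pm wm b0] := step_okP ok; rewrite /stmx mul_Emx /Eden b0 mulr0 addr0 !divr1.
case: st ok pm wm b0 => [[p ws] d] /= ok pm wm b0.
rewrite nth_mkseq ?ltn_ord // !pevalD -vr row_comb evnE // wvE // qform_wv // bform_evn //.
rewrite (rowmod_om vr); last by lia.
rewrite pevalZ pevalM zCN.
have -> : bform (wv ws) v = peval (foldr (fun al acc => addz (scz al.2 (nth [::] r (13 - al.1))) acc) [::] ws) x.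
 rewrite bform_wv //; elim: (ws) wm => [|al ws' IH] /=; first by rewrite big_nil.
 case/andP=> h h'; rewrite big_cons pevalD pevalZ IH //; congr (_ * _ + _).
 by apply: (rowmod_om vr); lia.
rewrite [p == j]eq_sym; case: eqP => _ /=; last by rewrite !mulr0; ring.
by rewrite pevalD pevalZ !pevalM zCN; ring.
Qed.

Lemma srowP S v r x : all step_ok S -> rowmod v r x -> rowmod (v *m smx S x) (srow S r) x.
elim: S v r => [|st S IH] v r /=; first by rewrite mulmx1.
by case/andP=> ok Sok vr; rewrite mulmxA; apply: IH => //; exact: vstP.
Qed.

Definition unitr (i : nat) : seq (seq Z) := mkseq (fun a => if a == i then [:: 1%ZZ] else [::]) m.
Definition hm (S : seq step) : seq (seq (seq Z)) := mkseq (fun i => srow S (unitr i)) m.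

Lemma smx_entry S x (i j : 'I_m) : all step_ok S ->
 smx S x i j = peval (ent (hm S) i j) x.
move=> ok; rewrite nth_mkseq ?ltn_ord //.
have h : rowmod (delta_mx 0 i) (unitr i) x.
 move=> a; rewrite mxE /= nth_mkseq ?ltn_ord // -val_eqE; case: eqP => _ //=.
 by rewrite mulr0 addr0 zC1.
by rewrite -(srowP ok h j) -rowE mxE.
Qed.

Definition mclp (j : nat) (y : seq bool -> seq Z) (v : seq bool) : seq Z :=
 if (j < 7)%N then if nth false v j then scz (zsg (sgnb j v)) (y (tog j v)) else [::]
 else if nth false v (13 - j) then [::] else scz (zsg (sgnb (13 - j) v)) (y (tog (13 - j) v)).

Lemma cf_cl_poly (a : nat) y (u : Spn) x : (a < m)%N -> (forall I, cf u I = peval (y (bits I)) x) ->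
 forall I, cf (cl (evn a) u) I = peval (mclp a y (bits I)) x.
move=> am ux I; rewrite /evn; set j := om a _; have ja : val j = a by exact: val_om.
rewrite -ja /mclp; have [[i [b ->]]|jm] := idx_cases j; last by rewrite rev_om_neq in jm.
have im : (i < 7)%N := ltn_ord i.
rewrite cl_idx ext_sign_bits; case: b => /=.
 by rewrite im nth_bits; case: (i \in I); rewrite // pevalZ ux bits_toggle.
have h : (13 - (14 - i.+1) = i)%N by move: (nat_of_ord i) im => z; lia.
have h7 : (7 <= 14 - i.+1)%N by move: (nat_of_ord i) im => z; lia.
rewrite ltnNge h7 /= h nth_bits.
by case: (i \in I); rewrite // pevalZ ux bits_toggle.
Qed.

Definition sst (y : seq bool -> seq Z) (st : step) : seq bool -> seq Z := fun v =>
 let: (p, ws, d) := st in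
 addz (y v) (mulz d (foldr (fun al acc => addz (scz al.2 (mclp p (mclp al.1 y) v)) acc) [::] ws)).

Definition smod (y : seq bool -> seq Z) (s : Sec) x : Prop :=
 forall kp, sc (E := E) s kp = peval (y (bits kp.2)) x.

Lemma gact_step st x s y : step_ok st -> smod y s x ->
 exists2 s', gact (E := E) (stmx st x) s s' & smod (sst y st) s' x.
move=> ok sy; have [pm wm b0] := step_okP ok.
have gh : cpair (stmx st x) (linfun (Eop (evn st.1.1) (wv st.1.2) (peval st.2 x))).
 by apply: cpair_E; [exact: qform_evn|rewrite /Eden b0 mulr0 addr0 oner_neq0].
exists (happ (linfun (Eop (evn st.1.1) (wv st.1.2) (peval st.2 x))) s).
 exact: (happ_gact s gh).
move=> kp; rewrite sc_happ lfunE /= /Eop cfD cfZ (sy (kp.1, kp.2) : cf (s kp.1) kp.2 = _) /=.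
case: st ok pm wm b0 {gh} => [[p ws] d] /= ok pm wm b0; rewrite pevalD pevalM; congr (_ + _ * _).
rewrite /wv cl_suml; elim: ws {ok b0} wm => [|al ws IH] /=.
 by rewrite big_nil cliff0r cf0.
case/andP=> h h'; rewrite big_cons cliffDr cfD IH // pevalD; congr (_ + _).
rewrite cliffordZl cliffZr cfZ pevalZ; congr (_ * _).
apply: cf_cl_poly => // J; apply: cf_cl_poly => // J'; exact: (sy (kp.1, J')).
Qed.

Lemma gact_steps S x s y : all step_ok S -> smod y s x ->
 exists2 s', gact (E := E) (smx S x) s s' & smod (foldl sst y S) s' x.
elim: S s y => [|st S IH] s y /=; first by move=> _ sy; exists s; [exact: gact1|exact: sy].
case/andP=> ok Sok sy; have [s1 g1 y1] := gact_step ok sy; have [s2 g2 y2] := IH _ _ Sok y1.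
by exists s2; [exact: (gact_comp g1 g2)|exact: y2].
Qed.

Definition seqv (y y' : seq bool -> seq Z) : bool := all (fun v => peq (y v) (y' v)) (allbits 7).

Lemma smod_eq y y' s s' x : seqv y y' -> smod y s x -> smod y' s' x -> s = s'.
move=> /allP h sy sy'; apply: scP => kp; rewrite sy sy'; apply: peval_peq; apply: h; exact: bits_allbits.
Qed.

Lemma gact_steps_eq S x s y s' y' : all step_ok S -> smod y s x -> smod y' s' x ->
 seqv (foldl sst y S) y' -> gact (E := E) (smx S x) s s'.
move=> ok sy sy' h; have [s2 g2 y2] := gact_steps ok sy.
by rewrite -(smod_eq h y2 sy').
Qed.

(** With d = [tZ] this is the one-parameter family of the generator; with constant d it gives the
    elements used for conjugation. *)
Definition gsteps (g : seq (nat * seq (nat * Z) * Z)) d : seq step := [seq (st.1, scz st.2 d) | st <- g].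

Lemma smx_gsteps g d d' x x' : peval d x = peval d' x' -> smx (gsteps g d) x = smx (gsteps g d') x'.
move=> e; elim: g => [|st g IH]; first by [].
have e1 : peval (scz st.2 d) x = peval (scz st.2 d') x' by rewrite !pevalZ e.
exact (congr2 mulmx (congr1 (Emx (evn st.1.1) (wv st.1.2)) e1) IH).
Qed.
End Steps.

(** * Invariant forms and the functions T1, T2 *)

Section Forms.
Variable R : realType.
Notation C := (R[i]).
Notation m := 14%N.

Definition mg (k : nat) (M : 'M[C]_(k, m)) (i a : nat) : C :=
 if insub i is Some i' then if insub a is Some a' then M i' a' else 0 else 0.
Lemma mgE k (M : 'M[C]_(k, m)) (i : 'I_k) (a : 'I_m) : mg M i a = M i a.
by rewrite /mg !valK. Qed.
Lemma mg_out k (M : 'M[C]_(k, m)) i a : (m <= a)%N -> mg M i a = 0.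
by move=> h; rewrite /mg; case: insub => // i'; rewrite insubF // ltnNge h. Qed.

Definition colsM (H : seq (seq (seq Z))) (b : nat) : seq (nat * seq Z) :=
 [seq ah <- [seq (a, ent H a b) | a <- iota 0 m] | ~~ pzero ah.2].

Lemma rmul_colsM H x (r : nat -> C) b :
 rmul (colsM H) x r b = \sum_(a < m) r a * peval (ent H a b) x.
rewrite /rmul /colsM big_filter big_map big_mkcond -[iota 0 m]/(index_iota 0 m) big_mkord.
apply: eq_bigr => a _; rewrite /=; case: ifP => // /negbFE/(peval_pzero x) ->; by rewrite mulr0.
Qed.

Lemma rmul_smx k (M : 'M[C]_(k, m)) S (x : C) i b : all step_ok S -> (i < k)%N ->
 rmul (colsM (hm S)) x (mg M i) b = mg (M *m smx S x) i b.
move=> ok ik; rewrite rmul_colsM; have [bm|bm] := ltnP b m; last first.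
 rewrite mg_out // big1 // => a _; rewrite [ent (hm S) a b]nth_default ?mulr0 //.
 rewrite nth_mkseq ?ltn_ord //; apply: leq_trans bm.
  by rewrite size_srow // size_mkseq.
rewrite (mgE (M *m smx S x) (Ordinal ik) (Ordinal bm)) mxE; apply: eq_bigr => a _.
by rewrite (mgE M (Ordinal ik) a) smx_entry.
Qed.

Definition form := seq (seq nat * Z).
Definition ftensor (d : nat) (phi : form) : tensor := flatten [seq tscale t.2 (alt d t.1) | t <- phi].
Definition fev (d : nat) (phi : form) (f : nat -> nat -> C) : C :=
 \sum_(t <- phi) zC C t.2 * \det (\matrix_(i < d, j < d) f i (nth 0%N t.1 j)).

Lemma ftensorP d phi f x : all (fun t => size t.1 == d) phi ->
 tev (ftensor d phi) [seq f i | i <- iota 0 d] x = fev d phi f.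
rewrite /fev /ftensor; elim: phi => [|t phi IH] /=; first by rewrite /tev !big_nil.
by case/andP=> /eqP s /IH h; rewrite tev_cat h big_cons tev_scale altP.
Qed.

Definition tcols S := mkseq (colsM (hm S)) m.
Lemma tcolsE S : nth [::] (tcols S) = colsM (hm S).
apply/funext => b; have [bm|bm] := ltnP b m; first by rewrite nth_mkseq.
rewrite nth_default ?size_mkseq // /colsM (eq_in_filter (a2 := pred0)) ?filter_pred0 //.
move=> _ /mapP[a am ->] /=; rewrite [ent _ a b]nth_default //.
move: am; rewrite mem_iota => /andP[_ am]; rewrite nth_mkseq //; apply: leq_trans bm.
by rewrite size_srow // size_mkseq.
Qed.
(** An identity of tensors with coefficients in Z[x], so a single check covers every value of x. *)
Definition finv_ck d phi S : bool :=
 let T := ftensor d phi in let c := tcols S in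
 [&& all (fun t => size t.1 == d) phi, all (fun t => size t.1 == d) T & teq m d (tsub (nth [::] c) T) T].

Lemma finvP d phi S k (M : 'M[C]_(k, m)) (x : C) (i : nat -> nat) : all step_ok S -> finv_ck d phi S ->
 (forall a, (a < d)%N -> (i a < k)%N) ->
 fev d phi (fun a => mg (M *m smx S x) (i a)) = fev d phi (fun a => mg M (i a)).
move=> ok /and3P[s1 s2]; rewrite tcolsE => h ik.
have sz : size [seq mg M (i a) | a <- iota 0 d] = d by rewrite size_map size_iota.
rewrite -!(ftensorP _ x) // -(teqP x sz h) tsubP ?sz // -map_comp; congr (tev _ _ _); apply/eq_in_map => a; rewrite mem_iota add0n => /andP[_ ad] /=.
by apply/funext => b; rewrite rmul_smx // ik.
Qed.

(** The coordinate l of the vector obtained by contracting the (d+1)-vector of the rows with the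
    d-form phi. *)
Definition contr (d : nat) (phi : form) (f : nat -> nat -> C) (l : nat) : C :=
 \sum_(t <- phi) zC C t.2 * \det (\matrix_(i < d.+1, j < d.+1) f i (nth 0%N (rcons t.1 l) j)).

Lemma contrE d phi f l : all (fun t => size t.1 == d) phi ->
 contr d phi f l = \sum_(i < d.+1) (-1) ^+ (i + d) * f i l * fev d phi (fun a => f (bump i a)).
move=> s; rewrite /contr /fev; under [RHS]eq_bigr do rewrite mulr_sumr.
rewrite [RHS]exchange_big /= big_seq [RHS]big_seq; apply: eq_bigr => t /(allP s)/eqP st.
rewrite (expand_det_col _ ord_max) mulr_sumr; apply: eq_bigr => i _.
rewrite mxE nth_rcons st ltnn eqxx /cofactor.
have -> : row' i (col' ord_max (\matrix_(i < d.+1, j < d.+1) f i (nth 0%N (rcons t.1 l) j))) =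
  \matrix_(a < d, b < d) f (bump i a) (nth 0%N t.1 b).
 by apply/matrixP => a b; rewrite !mxE lift_max nth_rcons st ltn_ord.
ring.
Qed.

Lemma contr_inv d phi S (M : 'M[C]_(d.+1, m)) (x : C) l : all step_ok S -> finv_ck d phi S ->
 contr d phi (mg (M *m smx S x)) l = rmul (colsM (hm S)) x (contr d phi (mg M)) l.
move=> ok ck; have /and3P[s _ _] := ck; rewrite contrE // /rmul.
transitivity (\sum_(i < d.+1) (-1) ^+ (i + d) * rmul (colsM (hm S)) x (mg M i) l * fev d phi (fun a => mg M (bump i a))).
 apply: eq_bigr => i _; rewrite (rmul_smx M x l ok (ltn_ord i)); congr (_ * _).
 by apply: (finvP M x ok ck) => a ad; exact: (@leq_ltn_trans a.+1 _ d.+1 (leq_add (leq_b1 (i <= a)%N) (leqnn a)) ad).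
transitivity (\sum_(i < d.+1) \sum_(ah <- colsM (hm S) l)
  (-1) ^+ (i + d) * (mg M i ah.1 * peval ah.2 x) * fev d phi (fun a => mg M (bump i a))).
 by apply: eq_bigr => i _; rewrite /rmul [X in X * _]mulr_sumr mulr_suml.
rewrite exchange_big /=; apply: eq_bigr => ah _; rewrite contrE // mulr_suml; apply: eq_bigr => i _; ring.
Qed.

(** The bilinear form Q on two such contractions: a quadric in the Plucker coordinates, invariant as
    soon as Q, phi and phi' are. *)
Definition qf (d : nat) (Q : tensor) (phi phi' : form) (M : 'M[C]_(d.+1, m)) : C :=
 tev Q [:: contr d phi (mg M); contr d phi' (mg M)] 0.
Definition qinv_check (Q : tensor) S : bool := let c := tcols S in
 [&& all (fun t => size t.1 == 2) Q, all (fun t => size t.2 <= 1)%N Q & teq m 2 (tsub (nth [::] c) Q) Q].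

Lemma tev_const Q (rows : seq (nat -> C)) x y : all (fun t => size t.2 <= 1)%N Q -> tev Q rows x = tev Q rows y.
move=> /allP h; rewrite /tev big_seq [RHS]big_seq; apply: eq_bigr => t /h.
by case: t.2 => [|a [|]] //=; rewrite !mulr0.
Qed.

Lemma qf_inv d Q phi phi' S (M : 'M[C]_(d.+1, m)) (x : C) : all step_ok S ->
 finv_ck d phi S -> finv_ck d phi' S -> qinv_check Q S ->
 qf Q phi phi' (M *m smx S x) = qf Q phi phi' M.
move=> ok c1 c2 /and3P[s1 s2]; rewrite tcolsE => h; rewrite /qf (tev_const _ 0 x s2) [RHS](tev_const _ 0 x s2).
rewrite -[RHS](teqP (rows := [:: _; _]) _ erefl h) tsubP //=; congr (tev _ [:: _; _] _); apply/funext => l; exact: contr_inv.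
Qed.

Section Polynomials.
Variable k : nat.
Notation poly := {mpoly C[plucker_dim k m]}.
Definition pX (q : seq nat) : poly :=
 'X_(enum_rank [ffun j : 'I_k => om (nth 0%N q j) (isT : 0 < m)%N]).
Lemma pX_homog q : pX q \is 1.-homog.
by rewrite dhomogX /= mdeg1. Qed.

Lemma pXE q (M : 'M[C]_(k, m)) : all (fun a => a < m)%N q -> size q = k ->
 (pX q).@[plm M] = \det (\matrix_(i < k, j < k) mg M i (nth 0%N q j)).
move=> qm sq; rewrite mevalXU /plm enum_rankK /minor; congr (\det _); apply/matrixP => i j.
have qj : (nth 0%N q j < m)%N by apply: (allP qm); apply: mem_nth; rewrite sq.
by rewrite !mxE ffunE -mgE val_om.
Qed.
End Polynomials.

Definition formX (k : nat) (phi : form) : {mpoly C[plucker_dim k m]} :=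
 \sum_(t <- phi) zC C t.2 *: pX k t.1.
Definition form_ok k (phi : form) : bool := all (fun t => all (fun a => a < m)%N t.1 && (size t.1 == k)) phi.

Lemma formX_homog k phi : formX k phi \is 1.-homog.
by apply: rpred_sum => t _; apply: rpredZ; exact: pX_homog. Qed.

Lemma formXE k phi (M : 'M[C]_(k, m)) : form_ok k phi -> (formX k phi).@[plm M] = fev k phi (mg M).
move=> /allP ok; rewrite /formX /fev raddf_sum /= big_seq [RHS]big_seq; apply: eq_bigr => t /ok/andP[h /eqP s].
by rewrite mevalZ pXE.
Qed.

Definition ext_form (phi : form) (l : nat) : form := [seq (rcons t.1 l, t.2) | t <- phi].
Lemma contr_fev d phi f l : contr d phi f l = fev d.+1 (ext_form phi l) f.
by rewrite /contr /fev /ext_form big_map. Qed.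

Definition qfX (d : nat) (Q : tensor) (phi phi' : form) : {mpoly C[plucker_dim d.+1 m]} :=
 \sum_(t <- Q) peval t.2 (0 : C) *:
   (formX d.+1 (ext_form phi (nth 0%N t.1 0)) * formX d.+1 (ext_form phi' (nth 0%N t.1 1))).
Lemma qfX_homog d Q phi phi' : qfX d Q phi phi' \is 2.-homog.
by apply: rpred_sum => t _; apply: rpredZ; exact: (dhomogM (formX_homog _ _) (formX_homog _ _)). Qed.

Definition qf_ok d (Q : tensor) phi phi' : bool :=
 [&& form_ok d phi, form_ok d phi' & all (fun t => (size t.1 == 2) && all (fun a => a < m)%N t.1) Q].

Lemma ext_form_ok d phi l : (l < m)%N -> form_ok d phi -> form_ok d.+1 (ext_form phi l).
move=> lm /allP ok; apply/allP => _ /mapP[t /ok/andP[h1 h2] ->] /=.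
by rewrite all_rcons lm h1 size_rcons eqSS.
Qed.

Lemma qfXE d Q phi phi' (M : 'M[C]_(d.+1, m)) : qf_ok d Q phi phi' ->
 (qfX d Q phi phi').@[plm M] = qf Q phi phi' M.
case/and3P=> o1 o2 /allP oQ; rewrite /qfX /qf /tev raddf_sum /= big_seq [RHS]big_seq.
apply: eq_bigr => t tQ; have := oQ t tQ; case: t {tQ} => -[|a [|b [|]]] h //= /andP[am /andP[bm _]].
by rewrite mevalZ mevalM !formXE ?ext_form_ok // -!contr_fev mulr1.
Qed.

Definition fevp (phi : form) (rows : seq (seq (seq Z))) : seq Z :=
 foldr (fun t acc => addz (scz t.2 (detp rows t.1)) acc) [::] phi.
Lemma fevpP k phi rows (M : 'M[C]_(k, m)) x : form_ok k phi -> size rows = k ->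
 all (fun r => size r == m) rows ->
 (forall (i : 'I_k) (a : 'I_m), M i a = peval (ent rows i a) x) ->
 fev k phi (mg M) = peval (fevp phi rows) x.
move=> + sr ar ME; rewrite /fev /fevp; elim: phi => [|t phi IH] /=; first by rewrite big_nil.
case/andP=> /andP[tm /eqP st] /IH h; rewrite big_cons pevalD pevalZ h; congr (_ * _ + _).
apply/esym/detpP => // i a ik; have [am|am] := ltnP a m; first by rewrite -(ME (Ordinal ik) (Ordinal am)) -mgE.
have sz : size (nth [::] rows i) = m by apply/eqP; apply: (allP ar); rewrite mem_nth // sr.
by rewrite mg_out // nth_default // sz.
Qed.

Definition qfp (Q : tensor) (phi phi' : form) rows : seq Z :=
 foldr (fun t acc => addz (mulz t.2 (mulz (fevp (ext_form phi (nth 0%N t.1 0)) rows)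
                  (fevp (ext_form phi' (nth 0%N t.1 1)) rows))) acc) [::] Q.
Lemma qfpP d Q phi phi' rows (M : 'M[C]_(d.+1, m)) x : qf_ok d Q phi phi' ->
 all (fun t => size t.2 <= 1)%N Q -> size rows = d.+1 -> all (fun r => size r == m) rows ->
 (forall (i : 'I_d.+1) (a : 'I_m), M i a = peval (ent rows i a) x) ->
 qf Q phi phi' M = peval (qfp Q phi phi' rows) x.
case/and3P=> o1 o2 oQ cQ sr ar ME; rewrite /qf (tev_const _ 0 x) // /tev /qfp {cQ}.
elim: Q oQ => [|t Q IH] /=; first by rewrite big_nil.
case/andP=> oT /IH h; rewrite big_cons pevalD h !pevalM; congr (_ * _ + _).
case: t oT => -[|a [|b [|]]] h' //= /andP[am /andP[bm _]].
by rewrite mulr1 !contr_fev !(fevpP _ sr ar ME) // ext_form_ok.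
Qed.
End Forms.

Lemma opp_or_eq (a b : nat) (x y : bool) : (a < 7)%N -> (b < 7)%N ->
 ((if x then a else 13 - a) + (if y then b else 13 - b) = 13 \/
  (if x then a else 13 - a) = (if y then b else 13 - b))%N -> a = b.
by case: x; case: y => ha hb [] h; lia. Qed.

(** * A space lying in all charts *)

Section Minors.
Definition indices := iota 0 14.
Arguments indices : simpl never.

(** The columns of the charts of isotropic coordinate spaces: increasing lists without two opposite
    indices. *)
Fixpoint adm (k : nat) : seq (seq nat) :=
 if k is k'.+1 then
  [seq aq.1 :: aq.2 | aq <- [seq (a, q) | a <- indices, q <- adm k'] &
    all (fun b => (aq.1 < b)%N && (aq.1 + b != 13)%N) aq.2]
 else [:: [::]].

Lemma mem_adm q : all (fun a => (a < 14)%N) q -> sorted ltn q -> pairwise (fun a b => (a + b != 13)%N) q ->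
 q \in adm (size q).
elim: q => [//|a q IH] /andP[am qm] aq /andP[aq' pq].
change (a :: q \in [seq aq.1 :: aq.2 | aq <- [seq (a0, q0) | a0 <- indices, q0 <- adm (size q)] &
    all (fun b => (aq.1 < b)%N && (aq.1 + b != 13)%N) aq.2]).
apply/mapP; exists (a, q) => //; rewrite mem_filter; apply/andP; split.
 apply/allP => b bq; rewrite [X in _ && X](allP aq' _ bq) andbT; exact: (allP (order_path_min ltn_trans aq) _ bq).
by apply: allpairs_f; [rewrite /indices mem_iota|apply: IH => //; exact: path_sorted aq].
Qed.

Lemma det_perm_cols (F : fieldType) (f : nat -> nat -> F) (k : nat) (q q' : seq nat) : size q = k -> perm_eq q q' ->
 \det (\matrix_(i < k, j < k) f i (nth 0%N q j)) != 0 -> \det (\matrix_(i < k, j < k) f i (nth 0%N q' j)) != 0.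
move=> sq pq; have sq' : size q' = k by rewrite -(perm_size pq).
have /tuple_permP[p pE] : perm_eq q' (Tuple (introT eqP sq)) by rewrite perm_sym.
have -> : \matrix_(i < k, j < k) f i (nth 0%N q' j) = col_perm p (\matrix_(i < k, j < k) f i (nth 0%N q j)).
 apply/matrixP => i j; rewrite !mxE pE.
 by rewrite -[X in nth _ X j]/(val (mktuple (fun i => tnth (Tuple (introT eqP sq)) (p i)))) -tnth_nth tnth_mktuple (tnth_nth 0%N).
rewrite col_permE det_mulmx det_perm neqM => ->.
by rewrite -signr_odd; case: odd; rewrite ?expr1 ?oppr_eq0 oner_neq0.
Qed.

Variables (R : realType) (k : nat).
Hypothesis k7 : (k <= 14./2)%N.
Notation c := (widen_ord k7).
Notation eps := (fun _ : 'I_k => true).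
Notation U0 := (Ucoord R eps (@wid_inj k 14 k7)).

Definition generic_check (S : seq step) : bool :=
 all step_ok S &&
 (let rows := [seq srow S (unitr i) | i <- iota 0 k] in
  all (fun q => ~~ Z.eqb (nth 0%ZZ (detp rows q) 0) 0) (adm k)).

Lemma val_bidx (c' : 'I_k -> 'I_14./2) (e : 'I_k -> bool) i :
 val (bidx c' e i) = if e i then val (c' i) else (13 - c' i)%N.
by rewrite /bidx /idx; case: (e i). Qed.

Lemma coord_mxE (i : 'I_k) (j : 'I_14) : coord_mx R c eps i j = (val i == val j)%:R.
by rewrite mxE evE -val_eqE /= eq_sym. Qed.

Lemma coord_smx S x (i : 'I_k) (j : 'I_14) : all step_ok S ->
 (coord_mx R c eps *m smx S x) i j = peval (nth [::] (srow S (unitr i)) j) x.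
move=> ok; have ij : (i < 14)%N := leq_trans (ltn_ord i) (leq_trans k7 (isT : (7 <= 14)%N)).
rewrite mxE (bigD1 (Ordinal ij)) //= coord_mxE eqxx mul1r big1 ?addr0 => [|a ai].
 by rewrite smx_entry // nth_mkseq.
by rewrite coord_mxE eq_sym (_ : (val a == val i) = false) ?mul0r //; apply/negP => /eqP e; case/eqP: ai; apply: val_inj.
Qed.

(** The word S moves U0 into all charts at once, which makes it the W0 of [witt]. The word is
    evaluated at x = 0, so only constant coefficients of the minors matter. *)
Theorem witt_model S : generic_check S -> forall W W', OG R k 14 W -> OG R k 14 W' ->
 exists g h, cpair g h /\ gla g W = W'.
case/andP=> ok /allP ck.
have [|_ [h [_ [gh _ _]]] _] := @gact_steps R S 0 0 (fun=> [::]) ok.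
 by move=> kp; rewrite /sc [X in cf X]ffunE cf0.
have [u _ _ _] := gh.
apply: (@witt R 14 k (gla (smx S 0) U0)); first exact: (OG_cpair gh (@OG_Ucoord _ _ _ _ _ _)).
move=> c' e ci; set f := finfun _.
have rB : row_free (coord_mx R c eps *m smx S 0).
 by apply: row_freeM => //; apply: row_free_coord; exact: wid_inj.
have -> : gla (smx S 0) U0 = mx_Gr rB.
 apply: mx_Gr_eq => i; rewrite row_mul mem_glM //; apply/mem_mx_Gr.
 by exists (delta_mx 0 i); rewrite rowE.
have [z zn zE] := plm_mx_Gr rB (pX_homog R k [seq val (f i) | i <- enum 'I_k]).
have fE (i : 'I_k) : nth 0%N [seq val (f i) | i <- enum 'I_k] i = val (f i).
 by rewrite (nth_map i) ?size_enum_ord // nth_ord_enum.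
have fX : [ffun j : 'I_k => om (nth 0%N [seq val (f i) | i <- enum 'I_k] j) (isT : 0 < 14)%N] = f.
 have fl j : (val (f j) < 14)%N := ltn_ord (f j).
 by apply/ffunP => j; rewrite [LHS]ffunE fE; apply: val_inj; exact: val_om (fl j).
have : (pX R k [seq val (f i) | i <- enum 'I_k]).@[plucker (mx_Gr rB)] = minor (bmx (mx_Gr rB)) f.
 by rewrite mevalXU fX pluckerE enum_rankK.
move=> <-; suff : (pX R k [seq val (f i) | i <- enum 'I_k]).@[plm (coord_mx R c eps *m smx S 0)] != 0.
 by rewrite zE neqM => /andP[].
have fm : all (fun a => (a < 14)%N) [seq val (f i) | i <- enum 'I_k].
 by apply/allP => _ /mapP[i _ ->]; exact: ltn_ord.
have sf : size [seq val (f i) | i <- enum 'I_k] = k by rewrite size_map size_enum_ord.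
rewrite pXE //; set q := map _ _ in fm sf *.
have ifc i j : (val (f i) + val (f j) = 13 \/ val (f i) = val (f j))%N -> i = j.
 move=> hij; apply: ci; apply: val_inj; move: hij; rewrite !ffunE !val_bidx.
 exact: (opp_or_eq (ltn_ord (c' i)) (ltn_ord (c' j))).
have uq : uniq q.
 rewrite map_inj_uniq ?enum_uniq // => i j ij; apply: ifc; by right.
apply: (@det_perm_cols _ _ _ (sort leq q) q); first by rewrite size_sort.
 by rewrite perm_sort.
have sq : size (sort leq q) = k by rewrite size_sort.
have rowsE i a : (i < k)%N -> mg (coord_mx R c eps *m smx S 0) i a =
  peval (nth [::] (nth [::] [seq srow S (unitr i) | i <- iota 0 k] i) a) 0.
 move=> ik; rewrite (nth_map 0%N) ?size_iota // nth_iota // add0n.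
 have [am|am] := ltnP a 14; first by rewrite (mgE _ (Ordinal ik) (Ordinal am)) coord_smx.
 rewrite mg_out // nth_default //; apply: leq_trans am.
 by rewrite size_srow // size_mkseq.
rewrite -(detpP (rows := [seq srow S (unitr i) | i <- iota 0 k]) _ sq rowsE); last by rewrite size_map size_iota.
have : sort leq q \in adm k.
 rewrite -[X in adm X]sq; apply: mem_adm.
 - by rewrite all_sort.
 - by rewrite ltn_sorted_uniq_leq sort_uniq uq sort_sorted //; exact: leq_total.
 apply/(pairwiseP 0%N) => a b; rewrite !inE sq => ak bk ab; apply/negP => /eqP s13.
 have [i ia] : exists i, val (f i) = nth 0%N (sort leq q) a.
  have : nth 0%N (sort leq q) a \in q by rewrite -(mem_sort leq) mem_nth ?sq.
  by case/mapP => i _ ->; exists i.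
 have [j jb] : exists j, val (f j) = nth 0%N (sort leq q) b.
  have : nth 0%N (sort leq q) b \in q by rewrite -(mem_sort leq) mem_nth ?sq.
  by case/mapP => j _ ->; exists j.
 have ij : i = j by apply: ifc; left; rewrite ia jb.
 move: ia jb; rewrite ij => -> /eqP; rewrite nth_uniq ?sq ?sort_uniq // => /eqP e'; by rewrite e' ltnn in ab.
move/ck => /Z.eqb_spec h0; case: (detp _ _) h0 => [|a p] /= h0; first by case: h0.
by rewrite mul0r addr0 zC_neq0.
Qed.
End Minors.

Section DualCheck.
Variables (R : realType) (k n : nat).
Notation C := (R[i]).
Notation T := ('I_k * 'I_k + 'I_n)%type.
Variable dz : nat -> nat -> nat -> Z.
Definition pos (x : T) : nat := match x with inl ab => (ab.1 * k + ab.2)%N | inr l => (k * k + l)%N end.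

Lemma pair_lt (a b : 'I_k) : (a * k + b < k * k)%N.
by apply: (@leq_trans (a * k + k)); rewrite ?ltn_add2l // -mulSnr leq_mul2r ltn_ord orbT.
Qed.

Lemma pos_lt x : (pos x < k * k + n)%N.
by case: x => [[a b]|l] /=; rewrite ?ltn_add2l // (leq_trans (pair_lt a b)) ?leq_addr. Qed.

Lemma pos_inj : injective pos.
case=> [[a b]|l] [[a' b']|l'] /= h.
- have k0 : (0 < k)%N by apply: leq_ltn_trans (leq0n _) (ltn_ord a).
 have ha := congr1 (divn^~ k) h; have hb := congr1 (modn^~ k) h.
 rewrite /= !divnMDl // !divn_small ?addn0 // in ha.
 rewrite /= !modnMDl !modn_small // in hb.
 by rewrite (val_inj ha) (val_inj hb).
- by have := pair_lt a b; rewrite /= h ltnNge leq_addr.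
- by have := pair_lt a' b'; rewrite /= -h ltnNge leq_addr.
by move/addnI: h => /val_inj ->.
Qed.

Definition coords : seq (nat * nat) := [seq (i, j) | i <- iota 0 k, j <- iota 0 14].
Definition rowsJ : seq (seq Z) := [seq mkseq (fun t => dz t ij.1 ij.2) (k * k + n) | ij <- coords].

(** The rows of [rowsJ] are the matrix positions and its columns the directions, so the coefficients
    that express a unit vector by the rows form a functional dual to one direction. *)
Lemma dual_check (B : T -> 'M[C]_(k, 14)) : spanck (k * k + n) rowsJ ->
 (forall x (i : 'I_k) (j : 'I_14), B x i j = zC C (dz (pos x) i j)) ->
 exists L : T -> 'M[C]_(k, 14), forall x y, mxdot (L y) (B x) = (x == y)%:R.
move=> ck BE; have cu : uniq coords.
 by apply: allpairs_uniq; rewrite ?iota_uniq // => -[a b] [a' b'] _ _ [-> ->].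
have h y := span_checkP C ck (pos_lt y).
exists (fun y => let a := projT1 (cid (h y)) in \matrix_(i < k, j < 14) a (index (val i, val j) coords)) => x y.
have aE := projT2 (cid (h y)); set a := projT1 _ in aE *.
rewrite [x == y]eq_sym -(inj_eq pos_inj) -aE ?pos_lt // /mxdot.
transitivity (\sum_(ij <- coords) a (index ij coords) * zC C (dz (pos x) ij.1 ij.2)).
 rewrite big_allpairs (_ : iota 0 k = index_iota 0 k) ?big_mkord; last by rewrite /index_iota subn0.
 apply: eq_bigr => i _.
 rewrite -[iota 0 14]/(index_iota 0 14) big_mkord; apply: eq_bigr => j _.
 by rewrite mxE BE.
rewrite (big_nth (0%N, 0%N)) big_mkord size_map; apply: eq_bigr => r _.
rewrite index_uniq //; congr (_ * zC _ _).
by rewrite (nth_map (0%N, 0%N)) // nth_mkseq // pos_lt.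
Qed.
End DualCheck.

Definition genT := seq (nat * seq (nat * Z) * Z).
Definition tZ : seq Z := [:: 0; 1]%ZZ.

(* The generator h.1, conjugated by the generator given by h.2 at parameter 1. *)
Definition hword (gens : seq genT) (h : nat * option nat) : seq step :=
 let g := gsteps (nth [::] gens h.1) tZ in
 if h.2 is Some j then
  gsteps (nth [::] gens j) [:: -1]%ZZ ++ g ++ gsteps (nth [::] gens j) [:: 1]%ZZ else g.

Lemma zC_foldr (F : numFieldType) (s : seq nat) (g : nat -> Z) :
 zC F (foldr (fun a acc => (g a + acc)%ZZ) 0%ZZ s) = \sum_(a <- s) zC F (g a).
by elim: s => [|a s IH] /=; rewrite ?big_nil ?zC0 // big_cons zCD IH. Qed.

(** * The cohomogeneity bound as an integer computation *)

Section Model.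
Variables (R : realType) (k : nat).
Notation C := (R[i]).
Notation m := 14%N.
Notation E := [:: Splus].
Notation N := (size E).
Notation Spn := (spinor R m).
Notation Sec := {ffun 'I_N -> Spn}.
Notation K := ('I_N * {set 'I_m./2})%type.
Notation Y := (OG R k m).
Hypotheses (k0 : (0 < k)%N)
 (k7 : (k <= m./2)%N)
 (k6 : (k.+1 < m./2)%N).
Notation c := (widen_ord k7).
Notation eps := (fun _ : 'I_k => true).
Notation U0 := (Ucoord R eps (@wid_inj k m k7)).
Notation kill := (fun (i : 'I_N) (I : {set 'I_m./2}) => forb c eps I).
Notation AK := (@AK m E kill).
Notation Aall := (@Aall m E).

(** s0 is the section y0. At the parameter x, [path] carries s0 to yb + x y' and the space spanned
    by [rows] to U0. The [gens] fix s0, [hw] lists the words used as parameters on their orbits, and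
    S0 is the word put into general position. *)
Variables (y0 yb y' : seq bool -> Z) (path : seq step) (rows : seq (seq (seq Z))) (gens : seq genT).
Variables (hw : seq (nat * option nat)) (S0 : seq step) (z1 z2 : Z).
Notation n := (size hw).

Definition conz (y : seq bool -> Z) (v : seq bool) : seq Z := [:: y v].
Definition gens_check : bool :=
 all (fun g => all step_ok (gsteps g tZ) && seqv (foldl sst (conz y0) (gsteps g tZ)) (conz y0)) gens.
Definition id0 (H : seq (seq (seq Z))) : bool :=
 all (fun i => all (fun j => Z.eqb (nth 0%ZZ (ent H i j) 0) (if i == j then 1 else 0)%ZZ)
  (iota 0 m)) (iota 0 m).
Definition hw_check : bool :=
 all (fun h => [&& (h.1 < size gens)%N, if h.2 is Some j then (j < size gens)%N else true
  & id0 (hm (hword gens h))]) hw.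
Definition path_check : bool :=
 [&& all step_ok path, seqv (foldl sst (conz y0) path) (fun v => [:: yb v; y' v]), size rows == k
  & all (fun i => let r := srow path (nth [::] rows i) in
    all (fun j => peq (nth [::] r j) (nth [::] (unitr i) j)) (iota 0 m)) (iota 0 k)].
Definition pevZ (z : Z) (p : seq Z) : Z := foldr (fun a acc => (a + z * acc)%ZZ) 0%ZZ p.
Definition dirz (t i j : nat) : Z :=
 if (t < k * k)%N then
  if (t %/ k == i)%N then pevZ z1 (nth [::] (nth [::] rows (t %% k)%N) j) else 0%ZZ
 else let H := hm (hword gens (nth (0%N, None) hw (t - k * k)%N)) in
  foldr (fun a acc => (pevZ z1 (ent rows i a) * nth 0%ZZ (ent H a j) 1%N + acc)%ZZ) 0%ZZ (iota 0 m).
Definition dir_check : bool := spanck (k * k + n) (rowsJ k n dirz).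
Definition spinor_check : bool :=
 let hm0 := isT : (0 < m)%N in let hN := isT : (0 < N)%N in
 let Al := kept m E (fun _ _ => false) in let AlK := kept m E (kl_OG k) in let z _ _ := 0%ZZ in
 [&& suppck m E (kl_OG k) (fun _ => yb), suppck m E (kl_OG k) (fun _ => y'),
   spanck (size Al) (mrows Al (all_elems hm0 hN) (fun _ v => y0 v + 0)%ZZ z)
  & spanck (size AlK) (mrows AlK (stab_elems hm0 hN (iota 0 k)) (fun _ v => yb v + z2 * y' v)%ZZ (fun _ => y'))].

Hypotheses (gensC : gens_check)
 (hwC : hw_check)
 (pathC : path_check)
 (dirC : dir_check)
 (spinC : spinor_check)
 (genC : generic_check k S0)
 (dims : (#|allowed_set c eps| + #|AK| <= n.+1 + #|Aall|)%N).

Variables (D : nat) (T1 T2 : {mpoly C[plucker_dim k m]}) (t1 t2 : 'M[C]_(k, m) -> C).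
Hypotheses (hT1 : T1 \is D.-homog)
 (hT2 : T2 \is D.-homog)
 (t1E : forall M, T1.@[plm M] = t1 M)
 (t2E : forall M, T2.@[plm M] = t2 M).
Hypothesis t_inv : forall g, g \in gens -> forall (x : C) M,
 t1 (M *m smx (gsteps g tZ) x) = t1 M /\ t2 (M *m smx (gsteps g tZ) x) = t2 M.
Hypothesis t_val : forall (M : 'M[C]_(k, m)) (x : C),
 (forall (i : 'I_k) (a : 'I_m), M i a = peval (ent rows i a) x) ->
 t1 M = x * t2 M /\ t2 M != 0.

Let s0 : Sec := sec_model R m E (fun _ => y0).
Let bt (x : C) : Sec := baseM m E (fun _ => yb) (fun _ => y') x.
Notation X := (zero_locus Y s0).
Let lok (i : 'I_N) : label_ok m (@label_at E i). by case: i => [[|]]. Qed.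
Let km : odd m || (k.+1 < m./2)%N. by rewrite k6 orbT. Qed.
Let Ycp := @OG_cp R m k.

Let smod_s0 x : smod (conz y0) s0 x.
by move=> kp; rewrite sc_sec_of /= mulr0 addr0. Qed.

Let smod_bt x : smod (fun v => [:: yb v; y' v]) (bt x) x.
by move=> kp; rewrite scD scZ !sc_sec_of /= mulr0 addr0. Qed.

Let path_gact x : gact (E := E) (smx path x) s0 (bt x).
by case/and4P: pathC => ok h _ _; exact: (gact_steps_eq ok (smod_s0 x) (smod_bt x) h). Qed.

Let W (x : C) : 'M[C]_(k, m) := \matrix_(i, j) peval (ent rows i j) x.
Let WE x (i : 'I_k) (a : 'I_m) : W x i a = peval (ent rows i a) x.
by rewrite mxE. Qed.

Let W_path x : W x *m smx path x = coord_mx R c eps.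
case/and4P: pathC => ok _ _ /allP h; apply/row_matrixP => i; apply/rowP => j.
have wm : rowmod (row i (W x)) (nth [::] rows i) x by move=> a; rewrite !mxE.
rewrite row_mul (srowP ok wm) mxE coord_mxE.
have hi : val i \in iota 0 k by rewrite mem_iota ltn_ord.
have hj : val j \in iota 0 m by rewrite mem_iota ltn_ord.
rewrite (peval_peq x (allP (h _ hi) _ hj)).
rewrite nth_mkseq ?ltn_ord // eq_sym; case: eqP => _ //=.
by rewrite mulr0 addr0 zC1.
Qed.

Let upath (x : C) : smx path x \in unitmx. exact: gact_un (path_gact x). Qed.

Let W_free x : row_free (W x).
have h : row_free (smx path x) by rewrite row_free_unit upath.
by rewrite /row_free -(mxrankMfree _ h) W_path; apply: row_free_coord; exact: wid_inj.
Qed.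

Let fixes (h : 'M[C]_m) : Prop := gact (E := E) h s0 s0 /\
 forall M : 'M[C]_(k, m), t1 (M *m h) = t1 M /\ t2 (M *m h) = t2 M.

Let fixes_mul h h' : fixes h -> fixes h' -> fixes (h *m h').
move=> [g1 f1] [g2 f2]; split; first exact: gact_comp g1 g2.
by move=> M; rewrite mulmxA; have [-> ->] := f2 (M *m h); exact: f1.
Qed.

Let fixes_gen j d (x : C) : (j < size gens)%N -> fixes (smx (gsteps (nth [::] gens j) d) x).
move=> js; have gj : nth [::] gens j \in gens by exact: mem_nth.
have e : smx (gsteps (nth [::] gens j) d) x = smx (gsteps (nth [::] gens j) tZ) (peval d x).
 by apply: smx_gsteps; rewrite /= mulr0 addr0 zC0 zC1 add0r mulr1.
rewrite e; split; last by move=> M; exact: t_inv.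
by have /andP[ok h] := allP gensC _ gj; exact: (gact_steps_eq ok (smod_s0 _) (smod_s0 _) h).
Qed.

Let hs (l : 'I_n) : seq step := hword gens (nth (0%N, None) hw l).

Let fixes_hs l (x : C) : fixes (smx (hs l) x).
have /and3P[h1 h2 _] := allP hwC _ (mem_nth (0%N, None) (ltn_ord l)).
rewrite /hs /hword; case: (nth _ hw l) h1 h2 => a [j|] /= h1 h2; last exact: fixes_gen.
by rewrite !smx_cat; apply: fixes_mul; [exact: fixes_gen|apply: fixes_mul; exact: fixes_gen].
Qed.

Let gens_ok j d : (j < size gens)%N -> all step_ok (gsteps (nth [::] gens j) d).
move=> js; have /andP[+ _] := allP gensC _ (mem_nth [::] js).
by rewrite /gsteps !all_map.
Qed.

Let hs_ok l : all step_ok (hs l).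
have /and3P[h1 h2 _] := allP hwC _ (mem_nth (0%N, None) (ltn_ord l)).
rewrite /hs /hword; case: (nth _ hw l) h1 h2 => a [j|] /= h1 h2; last exact: gens_ok.
by rewrite !all_cat !gens_ok.
Qed.

Let hs_entry l (x : C) (i j : 'I_m) : smx (hs l) x i j = peval (ent (hm (hs l)) i j) x.
exact: smx_entry (hs_ok l). Qed.

Let hs_const l (i j : 'I_m) : zC C (nth 0%ZZ (ent (hm (hs l)) i j) 0) = (i == j)%:R.
have /and3P[_ _ /allP h] := allP hwC _ (mem_nth (0%N, None) (ltn_ord l)).
have hi : val i \in iota 0 m by rewrite mem_iota ltn_ord.
have hj : val j \in iota 0 m by rewrite mem_iota ltn_ord.
have /Z.eqb_spec -> := allP (h _ hi) _ hj.
by rewrite -val_eqE; case: eqP => _; rewrite ?zC1 ?zC0.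
Qed.

Let hs0 l : smx (hs l) (0 : C) = 1%:M.
apply/matrixP => i j; rewrite hs_entry mxE -(hs_const l).
by case: (nth [::] _ _) => [|a p] /=; rewrite ?zC0 // mul0r addr0.
Qed.

Let Hp (s : seq 'I_n) (v : 'I_n -> C) : 'M[C]_m := foldr (fun l M => smx (hs l) (v l) *m M) 1%:M s.
Let fixes_Hp s v : fixes (Hp s v).
elim: s => [|l s IH] /=; last exact: fixes_mul (fixes_hs _ _) IH.
by split; [exact: gact1|move=> M; rewrite mulmx1].
Qed.

(** The family Psi: the first coordinate is tau, the others move the space W tau by words fixing
    s0. *)
Let F (v : 'I_n.+1 -> C) : 'M[C]_(k, m) := W (v ord0) *m Hp (enum 'I_n) (fun l => v (lift ord0 l)).

Let F_mpf i j : mpf (fun v => F v i j).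
have pp (p : seq Z) (a : 'I_n.+1) : mpf (fun v : 'I_n.+1 -> C => peval p (v a)).
 have [r rE] := peval_poly C p; apply: mpfE (fun v => rE (v a)) _; apply: mpf_horner; exact: mpfX.
apply: mpfMx => a b; first by apply: mpfE (fun v => WE (v ord0) a b) _; exact: pp.
rewrite /Hp; elim: (enum _) a b => [|l s IH] a b /=; first exact: mpfC.
apply: mpfMx => a' b'; last exact: IH.
by apply: mpfE (fun v => hs_entry l (v (lift ord0 l)) a' b') _; exact: pp.
Qed.

Let Hp_single (s : seq 'I_n) l x : uniq s -> Hp s (fun b => x * (b == l)%:R) = if l \in s then smx (hs l) x else 1%:M.
elim: s => [//|a s IH] /= /andP[as' us]; rewrite IH // in_cons [l == a]eq_sym.
case: eqP as' => [->|_] as'; first by rewrite (negPf as') mulr1 mulmx1.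
by rewrite mulr0 hs0 mul1mx.
Qed.

Theorem coh_model : general_zero_locus Y E (cohomogeneity_at_most 1).
have [sb sy' sp1 sp2] := and4P spinC.
have bt_supp x : supp AK (bt x).
 have e : AK = [set kp in Aall | ~~ kl_OG k (val kp.1) (bits kp.2)]%SET.
  by apply/setP => kp; rewrite !inE (forb_OG k7 kp.2 kp.1).
 rewrite e; apply: suppD; first exact: (supp_checkP sb (@sec_modelP R m E (fun _ => yb))).
 by apply: suppZ; exact: (supp_checkP sy' (@sec_modelP R m E (fun _ => y'))).
have supK s : supp AK s <-> supp Aall s /\ zero_locus Y s U0 :=
 supp_K (Y := Y) (kill := kill) (@OG_Ucoord R m k c eps (@wid_inj k m k7)) (@van_base R m k E km lok c eps _) s.
have sA0 : supp Aall s0.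
 by apply: (Aall_gact lok (gact_inv (path_gact 0))); case/supK: (bt_supp 0).
have wt := @witt_model R k k7 S0 genC.
have witt0 W1 : Y W1 -> exists g h, cpair g h /\ gla g U0 = W1.
 by move=> YW; apply: wt => //; exact: OG_Ucoord.
set L1 := all_elems (isT : (0 < m)%N) (isT : (0 < N)%N).
have L1ok : all (@sel_ok m E) L1 := all_elems_ok _ _.
set L2 := stab_elems (isT : (0 < m)%N) (isT : (0 < N)%N) (iota 0 k) in sp2.
have /andP[L2ok L2st'] : all (@sel_ok m E) L2 && all (stabm (iota 0 k)) L2 := stab_elems_ok _ _ _.
have L2st : all (stabU c eps) L2.
 apply: sub_all L2st' => e; exact: (stabmP (inb_OG k7)).
have AlAll (kp : K) : kp \in Aall -> (val kp.1, bits kp.2) \in kept m E (fun _ _ => false) by rewrite mem_Aall.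
have AlK (kp : K) : kp \in AK -> (val kp.1, bits kp.2) \in kept m E (kl_OG k).
 by rewrite mem_kept inE inE (forb_OG k7 kp.2 kp.1).
have b0E : baseM m E (fun _ => y0) (fun _ _ => 0%ZZ) (zC C 0%ZZ) = s0 by exact: baseM0.
have sp1' : spanck (size (kept m E (fun _ _ => false))) (mrows (kept m E (fun _ _ => false)) L1
  (fun i v => y0 v + 0 * (fun _ _ => 0) i v)%ZZ (fun _ _ => 0%ZZ)) by exact: sp1.
have jac := @span_model R m E _ Aall L1 (fun _ => y0) (fun _ _ => 0%ZZ) 0%ZZ AlAll sp1'.
have jac0 kp : kp \in Aall -> exists a : 'I_(size L1) -> C, forall kp', kp' \in Aall ->
  \sum_r a r * sc (Nop (tnth (in_tuple L1) r) s0) kp' = (kp == kp')%:R.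
 move=> /jac[a [a0 aE]]; exists a => kp' /aE <-.
 by rewrite bpM_deriv zC0 mulr0 addr0 b0E.
have span := @span_model R m E _ AK L2 (fun _ => yb) (fun _ => y') z2 AlK sp2.
have [P PE] := fmx_family F_mpf.
have PF v : fmx P v = F v by apply/matrixP => i j; rewrite mxE PE.
have uHp v : Hp (enum 'I_n) v \in unitmx by exact: gact_un (fixes_Hp _ _).1.
have Mf v : row_free (fmx P v) by rewrite PF; apply: row_freeM.
pose ext (x : C) : 'I_n.+1 -> C := fun a => if unlift ord0 a is Some b then 0 else x.
have ext0 x : ext x ord0 = x by rewrite /ext unlift_none.
have Fext x : F (ext x) = W x.
 rewrite /F ext0 -[RHS]mulmx1; congr (_ *m _).
 have -> : (fun l => ext x (lift ord0 l)) = fun=> 0 by apply/funext => l; rewrite /ext liftK.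
 by elim: (enum _) => [//|l s IH] /=; rewrite hs0 mul1mx.
have famg v g (ug : g \in unitmx) w : fmx P w = fmx P v *m g -> gla g (fam Mf v) = fam Mf w.
 move=> e; apply: mx_Gr_eq => i; rewrite e row_mul mem_glM //; exact: fam_row.
have famE v : fam Mf v = gla (Hp (enum 'I_n) (fun l => v (lift ord0 l))) (fam Mf (ext (v ord0))).
 by apply/esym; apply: famg => //; rewrite !PF Fext.
have base_link x : gla (smx path x) (fam Mf (ext x)) = U0.
 apply: mx_Gr_eq => i; have -> : coord_mx R c eps = fmx P (ext x) *m smx path x by rewrite PF Fext W_path.
 by rewrite row_mul mem_glM ?upath //; exact: fam_row.
have Xbase x : X (fam Mf (ext x)).
 apply: (proj2 (zero_gact lok (Y := Y) Ycp (fam Mf (ext x)) (path_gact x))).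
 by rewrite base_link; exact: ((supK _).1 (bt_supp x)).2.
have aut_fix h U : fixes h -> aut_orbit X U (gla h U).
 move=> [gh _]; exists (gla h) => //; apply: gl_aut (gact_un gh) _ => U'.
 exact: (zero_gact lok (Y := Y) Ycp U' gh).
have XPsi v : X (fam Mf v).
 by rewrite famE; apply: (proj1 (zero_gact lok (Y := Y) Ycp _ (fixes_Hp _ _).1)); exact: Xbase.
have orb v w : v ord0 = w ord0 -> aut_orbit X (fam Mf v) (fam Mf w).
 move=> vw; rewrite (famE v) (famE w) -vw; set U1 := fam Mf (ext _).
 apply: (@orbit_trans _ _ _ _ _ U1); last exact: aut_fix.
 by apply: aut_orbit_sym; [exact: Xbase|exact: aut_fix].
apply: (@general_orbit R m E k Y (cohomogeneity_at_most 1) L1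
  (baseM m E (fun _ => y0) (fun _ _ => 0%ZZ)) _ (zC C 0%ZZ) 1 lok Ycp _ L1ok (fun mu kp => baseME _ _ mu kp) _ _ _ jac).
- by move=> g X1 X2 ug h; exact: (coh_gl ug h).
- by move=> mu; rewrite baseM0.
- exact: oner_neq0.
move=> mu _; rewrite baseM0 -/s0.
have tF v : t1 (F v) = v ord0 * t2 (F v) /\ t2 (F v) != 0.
 by have [e1 e2] := (fixes_Hp (enum 'I_n) (fun l => v (lift ord0 l))).2 (W (v ord0)); rewrite /F e1 e2; apply: t_val.
have lineP t l i j : exists p : {poly C},
  [/\ forall x, (P i j).@[fun a => if unlift ord0 a is Some b then x * (b == l)%:R else t] = p.[x],
   p.[0] = W t i j & p^`().[0] = (W t *m (\matrix_(a, b) zC C (nth 0%ZZ (ent (hm (hs l)) a b) 1))) i j].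
 have /fin_all_exists[r rE] a := peval_deriv C (ent (hm (hs l)) (val (a : 'I_m)) j).
 exists (\sum_a (W t i a)%:P * r a); split.
 - move=> x; rewrite PE /F unlift_none.
  have -> : (fun l0 => match unlift ord0 (lift ord0 l0) with Some b => x * (b == l)%:R | None => t end) =
    (fun b => x * (b == l)%:R) by apply/funext => b; rewrite liftK.
  rewrite Hp_single ?enum_uniq // mem_enum inE mxE horner_sum; apply: eq_bigr => a _.
  by rewrite hornerM hornerC hs_entry; have [-> _ _] := rE a.
 - rewrite horner_sum (bigD1 j) //= big1 ?addr0 => [|a aj].
   by rewrite hornerM hornerC; have [_ -> _] := rE j; rewrite hs_const eqxx mulr1.
  by rewrite hornerM hornerC; have [_ -> _] := rE a; rewrite hs_const (negPf aj) mulr0.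
 rewrite deriv_bigsum horner_sum mxE; apply: eq_bigr => a _.
 have [_ _ dE] := rE a; rewrite derivM derivC mul0r add0r hornerM hornerC dE; congr (_ * _).
 by rewrite [RHS]mxE.
have pevZE z p : zC C (pevZ z p) = peval p (zC C z).
 by elim: p => [|a p IH] /=; rewrite ?zC0 // zCD zCM IH.
set Am : 'I_n -> 'M[C]_m := fun l => \matrix_(a, b) zC C (nth 0%ZZ (ent (hm (hs l)) a b) 1) in lineP.
have [L0 L0E] : exists L : 'I_k * 'I_k + 'I_n -> 'M[C]_(k, m), forall x y, mxdot (L y) (dirs W Am (zC C z1) x) = (x == y)%:R.
 apply: (dual_check dirC) => -[[a b]|l] i j; rewrite /pos.
  rewrite /dirz /= -[X in if X then _ else _]/(a * k + b < k * k)%N pair_lt.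
  rewrite divnMDl // divn_small ?ltn_ord // addn0 modnMDl modn_small ?ltn_ord //.
  rewrite mxE (bigD1 b) //= big1 ?addr0 => [|b' b'b]; last by rewrite mxE (negPf b'b) andbF mul0r.
  rewrite mxE eqxx andbT -val_eqE eq_sym; case: eqP => _; last by rewrite mul0r zC0.
  by rewrite mul1r WE pevZE.
 have -> : dirz (k * k + l) i j = foldr (fun a acc => (pevZ z1 (ent rows i a) *
   nth 0%ZZ (ent (hm (hs l)) a j) 1%N + acc)%ZZ) 0%ZZ (iota 0 m).
  by rewrite /dirz ltnNge leq_addr addKn.
 rewrite zC_foldr -[iota 0 m]/(index_iota 0 m) big_mkord.
 rewrite [dirs _ _ _ _]/(W (zC C z1) *m Am l) mxE; apply: eq_bigr => a _.
 by rewrite zCM pevZE WE [Am l a j]mxE.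
have Wp i j : exists p : {poly C}, forall t, W t i j = p.[t].
 by have [r rE] := peval_poly C (ent rows i j); exists r => t; rewrite WE rE.
have [bad badP] := slice_chains Mf (W := W) (A := Am) Wp lineP L0E.
apply: (@coh_family R k m n X P Mf _ XPsi orb D T1 T2 hT1 hT2 _ _ _ bad badP).
- exact: (zero_closed k0 km lok sA0).
- by move=> v; rewrite t1E t2E PF; exact: (tF v).1.
- by exists (fun=> 0); rewrite t2E PF; exact: (tF _).2.
- move=> e Ds eD; have h := dimension_bound k0 km lok L1ok sA0 jac0 witt0 eD.
 by rewrite -(leq_add2r #|Aall|); exact: leq_trans h dims.
move=> rho O rho0 Oo On; apply: (@family_dense R m k E km lok c eps _ L1 s0 L1ok sA0 jac0 witt0 L2 L2ok L2st
 bt _ (zC C z2) (fun mu kp => baseME _ _ mu kp) bt_supp span n P Mf _ orb rho O rho0 Oo On).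
by move=> x; exists (smx path x), (ext x); split.
Qed.
End Model.

(** * Data and verification for OG(4,14) and OG(5,14) *)

Definition signs (p n : seq nat) (v : seq bool) : Z := (ones 14 [:: p] 0 v - ones 14 [:: n] 0 v)%ZZ.

Section Dimensions.
Variable k : nat.
Hypothesis k7 : (k <= 14./2)%N.
Notation c := (widen_ord k7).
Notation eps := (fun _ : 'I_k => true).
Notation E := [:: Splus].

Lemma allowed_card : (#|allowed_set (m := 14) c eps| <= \sum_(i < k) \sum_(j < 14) ((k <= j) && (j < 13 - i)))%N.
rewrite -sum1_card pair_bigA big_mkcond; apply: leq_sum => -[i j] _ /=.
rewrite inE /allowed /=; case: ifP => // /andP[/forallP h1 /forallP h2].
have -> : (k <= j)%N.
 rewrite leqNgt; apply/negP => jk; have /negP[] := h1 (Ordinal jk).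
 by apply/eqP/val_inj; rewrite val_bidx.
have -> : (j < 13 - i)%N; last by [].
rewrite ltnNge; apply/negP => ij; have j14 := ltn_ord j.
have hi : (13 - j < k)%N by apply: leq_ltn_trans (ltn_ord i); lia.
have := h2 (Ordinal hi); rewrite (_ : (Ordinal hi <= i)%N) /=; last by lia.
by move/negP; apply; apply/eqP/val_inj; rewrite /= -[X in _ = (14 - X.+1)%N]/(val (bidx c eps (Ordinal hi))) val_bidx /=; lia.
Qed.

(** The dimension count needs only an inequality, so it suffices to list distinct killed
    coordinates. *)
Lemma killed_card (ss : seq (seq bool)) : uniq ss ->
 all (fun s => [&& size s == 7, ~~ odd (count id s) & kl_OG k 0 s]) ss ->
 (#|@AK 14 E (fun _ I => forb c eps I)| + size ss <= #|Aall 14 E|)%N.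
move=> us /allP ss7; pose I (s : seq bool) : {set 'I_14./2} := [set i : 'I_14./2 | nth false s i]%SET.
have bI s : size s = 7%N -> bits (I s) = s.
 move=> s7; apply: (@eq_from_nth _ false); first by rewrite size_bits.
 rewrite size_bits => i im; have e := nth_bits (I s) (Ordinal im).
 by apply: etrans e _; rewrite inE.
pose B := [seq (ord0 : 'I_(size E), I s) | s <- ss].
have uB : uniq B.
 rewrite map_inj_in_uniq // => s t /ss7/and3P[/eqP s7 _ _] /ss7/and3P[/eqP t7 _ _] [e].
 by rewrite -(bI s s7) e bI.
have BA : {subset B <= (Aall 14 E :\: @AK 14 E (fun _ I => forb c eps I))%SET}.
 move=> _ /mapP[s sss ->]; have /and3P[/eqP s7 so sk] := ss7 s sss.
 by rewrite !inE /= (forb_OG k7 (I s) 0) -count_bits bI // so sk.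
have hAK : (@AK 14 E (fun _ I => forb c eps I) \subset Aall 14 E)%SET.
 by apply/fintype.subsetP => kp; rewrite inE => /andP[].
rewrite -(cardsID (@AK 14 E (fun _ I => forb c eps I)) (Aall 14 E)) (finset.setIidPr hAK) leq_add2l.
rewrite -(size_map (fun s => (ord0 : 'I_(size E), I s)) ss) -/B -(card_uniqP uB).
by apply: subset_leq_card; apply/fintype.subsetP.
Qed.
End Dimensions.

Definition rst (a b : nat) (x : Z) : step := (a, [:: (b, 1%ZZ)], [:: x]).
Definition lroot (a b : nat) : genT := [:: (a, [:: (b, 1%ZZ)], 1%ZZ)].
Definition sroot (i j : nat) (e : Z) (p q r : nat) (f : Z) : genT :=
 [:: (p, [:: (i, 1%ZZ); (j, e)], 1%ZZ); (q, [:: (r, 1%ZZ)], f)].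
Definition sparse_row (i : nat) (l : seq (nat * seq Z)) : seq (seq Z) :=
 mkseq (fun j => if j == i then [:: 1%ZZ] else flatten [seq p.2 | p <- l & p.1 == j]) 14.

(* The coefficients are arbitrary: the word only has to be in general position. *)
Definition generic_steps : seq step :=
 [seq (p, [seq (a, Z.of_nat (a * (a + p) %% 5)) | a <- iota 0 14 & a + p != 13], [:: 1%ZZ])
 | p <- [:: 9; 12; 10; 13; 5; 9; 11]]%N.

(* Root elements of the stabilizer G2 x G2 of spin4; the two factors act on
 orthogonal spaces of dimension 7, which share the plane of e_2 and e_11. *)
Definition gens4 : seq genT :=
 [:: lroot 4 8; lroot 4 3; lroot 10 8; lroot 10 9; lroot 5 3; lroot 5 9;
 lroot 1 13; lroot 1 6; lroot 7 13; lroot 7 12; lroot 0 6; lroot 0 12;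
 sroot 2 11 (-1) 4 3 8 1; sroot 2 11 (-1) 9 10 5 (-1); sroot 2 11 (-1) 10 9 8 (-1);
 sroot 2 11 (-1) 3 4 5 1; sroot 2 11 (-1) 5 9 3 1; sroot 2 11 (-1) 8 4 10 (-1);
 sroot 2 11 1 1 6 13 1; sroot 2 11 1 12 7 0 1; sroot 2 11 1 7 12 13 (-1);
 sroot 2 11 1 6 1 0 (-1); sroot 2 11 1 0 12 6 1; sroot 2 11 1 13 1 7 1].

(* Carries the space of rows4 to the standard one and spin4 to spinb4 + x spind4. *)
Definition path4 : seq step :=
 [:: rst 11 12 1; rst 5 11 1; rst 10 12 (-1); rst 13 9 (-1);
 rst 5 11 (-1); rst 12 9 1; rst 4 11 (-1); (10%N, [:: (11%N, 1%ZZ)], [:: 0; 1]%ZZ)].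

Definition rows4 : seq (seq (seq Z)) :=
 [:: sparse_row 0 [:: (9%N, [:: (-1)])]%ZZ;
 sparse_row 1 [:: (9%N, [:: 1]); (10%N, [:: 1]); (11%N, [:: (-1)])]%ZZ;
 sparse_row 2 [:: (4%N, [:: 1]); (10%N, [:: 0; (-1)]); (13%N, [:: 1])]%ZZ;
 sparse_row 3 [:: (11%N, [:: 0; 1]); (12%N, [:: (-1)])]%ZZ].

Definition spin4 := signs [:: 15; 51; 72; 116]%N [::].
Definition spinb4 := signs [:: 5; 9; 15; 27; 51; 72; 116]%N [:: 17; 33; 34]%N.
Definition spind4 := signs [:: 3]%N [::].

(** Root elements alone do not give enough directions; conjugating one by its opposite, as in the
    last two words, yields directions of the maximal torus. Together with tau the 25 words
    parametrize a zero locus of dimension 26. *)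
Definition words4 : seq (nat * option nat) :=
 [seq (l, None) | l <- iota 0 22 ++ [:: 23%N]] ++ [:: (0%N, Some 5%N); (1%N, Some 3%N)].

(** Twice the polar form of the orthogonal projection to the space of the first factor, spanned by
    e_2 - e_11 and the vectors of indices 3, 4, 5, 8, 9, 10; doubling clears the denominator of the
    projection. *)
Definition gram4 : tensor :=
 [:: ([:: 4; 9]%N, [:: 2]); ([:: 10; 3]%N, [:: 2]); ([:: 5; 8]%N, [:: 2]); ([:: 8; 5]%N, [:: 2]);
 ([:: 3; 10]%N, [:: 2]); ([:: 9; 4]%N, [:: 2]); ([:: 2; 11]%N, [:: 1]); ([:: 11; 11]%N, [:: -1]);
 ([:: 11; 2]%N, [:: 1]); ([:: 2; 2]%N, [:: -1])]%ZZ.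

(* The invariant 3-form and 4-form of the first factor G2. *)
Definition phi3 : form :=
 [:: ([:: 2; 3; 10]%N, 1); ([:: 2; 4; 9]%N, -1); ([:: 2; 5; 8]%N, -1); ([:: 3; 8; 9]%N, -2);
 ([:: 3; 10; 11]%N, -1); ([:: 4; 5; 10]%N, 2); ([:: 4; 9; 11]%N, 1); ([:: 5; 8; 11]%N, 1)]%ZZ.

Definition phi4 : form :=
 [:: ([:: 2; 3; 8; 9]%N, 1); ([:: 2; 4; 5; 10]%N, 1); ([:: 3; 4; 9; 10]%N, -1);
 ([:: 3; 5; 8; 10]%N, -1); ([:: 3; 8; 9; 11]%N, 1); ([:: 4; 5; 8; 9]%N, 1); ([:: 4; 5; 10; 11]%N, 1)]%ZZ.

Definition gens5 : seq genT :=
 [:: lroot 12 7; lroot 12 8; lroot 5 7; lroot 5 1; lroot 6 8; lroot 6 1;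
 lroot 9 11; lroot 9 10; lroot 3 11; lroot 3 4; lroot 2 10; lroot 2 4;
 sroot 0 13 (-1) 12 8 7 1; sroot 0 13 (-1) 1 5 6 (-1); sroot 0 13 (-1) 5 1 7 (-1);
 sroot 0 13 (-1) 8 12 6 1; sroot 0 13 (-1) 6 1 8 1; sroot 0 13 (-1) 7 12 5 (-1);
 sroot 0 13 1 9 10 11 1; sroot 0 13 1 4 3 2 1; sroot 0 13 1 3 4 11 (-1);
 sroot 0 13 1 10 9 2 (-1); sroot 0 13 1 2 4 10 1; sroot 0 13 1 11 9 3 1].

Definition path5 : seq step :=
 [:: rst 12 13 (-1); rst 9 8 1; rst 12 11 (-1); rst 5 10 (-1);
 (5%N, [:: (9%N, 1%ZZ)], [:: 0; 1]%ZZ)].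

Definition rows5 : seq (seq (seq Z)) :=
 [:: sparse_row 0 [:: (12%N, [:: 1])]%ZZ; sparse_row 1 [:: (11%N, [:: (-1)]); (13%N, [:: (-1)])]%ZZ;
 sparse_row 2 [:: (12%N, [:: 1])]%ZZ; sparse_row 3 [:: (5%N, [:: 1]); (9%N, [:: (-1)])]%ZZ;
 sparse_row 4 [:: (5%N, [:: 0; (-1)]); (8%N, [:: 1]); (9%N, [:: 0; 1])]%ZZ].

Definition spin5 := signs [:: 18; 108]%N [:: 15; 113]%N.
Definition spinb5 := signs [:: 12; 18; 33; 39; 65; 108]%N [:: 9; 15; 36; 113]%N.
Definition spind5 := signs [:: 34]%N [::].

Definition words5 : seq (nat * option nat) :=
 [seq (l, None) | l <- iota 0 24] ++ [:: (0%N, Some 5%N); (1%N, Some 3%N); (6%N, Some 11%N)].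

(** The same for the factor acting on e_0 - e_13 and the indices 1, 5, 6, 7, 8, 12. The form [psi5]
    belongs to the other factor and [psi5'] to this one. *)
Definition gram5 : tensor :=
 [:: ([:: 12; 1]%N, [:: 2]); ([:: 5; 8]%N, [:: 2]); ([:: 6; 7]%N, [:: 2]); ([:: 7; 6]%N, [:: 2]);
 ([:: 8; 5]%N, [:: 2]); ([:: 1; 12]%N, [:: 2]); ([:: 0; 13]%N, [:: 1]); ([:: 13; 13]%N, [:: -1]);
 ([:: 13; 0]%N, [:: 1]); ([:: 0; 0]%N, [:: -1])]%ZZ.

(* The invariant 4-forms of the two factors G2. *)
Definition psi5 : form :=
 [:: ([:: 0; 2; 3; 9]%N, 1); ([:: 0; 4; 10; 11]%N, -1); ([:: 2; 3; 9; 13]%N, -1);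
 ([:: 2; 3; 10; 11]%N, 1); ([:: 2; 4; 9; 11]%N, -1); ([:: 3; 4; 9; 10]%N, -1);
 ([:: 4; 10; 11; 13]%N, 1)]%ZZ.

Definition psi5' : form :=
 [:: ([:: 0; 1; 7; 8]%N, 1); ([:: 0; 5; 6; 12]%N, 1); ([:: 1; 5; 8; 12]%N, 1);
 ([:: 1; 6; 7; 12]%N, 1); ([:: 1; 7; 8; 13]%N, 1); ([:: 5; 6; 7; 8]%N, -1); ([:: 5; 6; 12; 13]%N, 1)]%ZZ.

Lemma invariance4 : all (fun g => let S := gsteps g tZ in
 [&& all step_ok S, finv_ck 3 phi3 S, finv_ck 4 phi4 S & qinv_check gram4 S]) gens4.
by_vm. Qed.

Lemma invariance5 : all (fun g => let S := gsteps g tZ in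
 [&& all step_ok S, finv_ck 4 psi5 S, finv_ck 4 (psi5 ++ psi5') S & qinv_check gram5 S]) gens5.
by_vm. Qed.

Theorem cohomogeneity_OG4_14 (R : realType) : general_zero_locus (OG R 4 14) [:: Splus] (cohomogeneity_at_most 1).
have k7 : (4 <= 14./2)%N by [].
have ok : qf_ok 3 gram4 phi3 phi3 by vm_compute.
have ok4 : form_ok 4 phi4 by vm_compute.
have gc : all (fun t => size t.2 <= 1)%N gram4 by vm_compute.
(* On the spaces of [rows4] the quadratic invariant is 4 x and phi4 is -1; the factor 4 makes T1 /
   T2 equal to x. *)
apply: (@coh_model R 4 isT k7 isT spin4 spinb4 spind4 path4 rows4 gens4 words4 generic_steps
 1%ZZ 1%ZZ _ _ _ _ _ _ _ 2
 (qfX R 3 gram4 phi3 phi3) (4 *: (formX R 4 phi4 * formX R 4 phi4))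
 (fun M => qf (d := 3) gram4 phi3 phi3 M) (fun M => 4 * fev 4 phi4 (mg M) ^+ 2)).
1-6: by_vm.
(* 30 chart coordinates minus the 4 conditions of vanishing at U0 give 26 = n + 1. *)
- apply: leq_trans (leq_add (allowed_card k7) (leqnn _)) _.
 apply: leq_trans (leq_add (leqnn _) (killed_card k7 (ss := [seq bitsN 7 x | x <- [:: 0; 48; 80; 96]]) isT isT)).
 by rewrite !big_ord_recl !big_ord0 /=; lia.
- exact: qfX_homog.
- by apply: rpredZ; exact: (dhomogM (formX_homog _ _ _) (formX_homog _ _ _)).
- by move=> M; exact: qfXE.
- by move=> M; rewrite mevalZ mevalM formXE // expr2.
- move=> g gg x M; have /and4P[o1 o2 o3 o4] := allP invariance4 _ gg; split; first exact: qf_inv.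
 congr (4 * _ ^+ 2); exact: (finvP (i := id) M x o1 o3).
move=> M x ME; have r7 : all (fun r => size r == 14%N) rows4 by vm_compute.
rewrite (qfpP ok gc (erefl : size rows4 = 4%N) r7 ME) (fevpP ok4 (erefl : size rows4 = 4%N) r7 ME).
have /(peval_peq x) -> : peq (qfp gram4 phi3 phi3 rows4) [:: 0; 4]%ZZ by vm_compute.
have /(peval_peq x) -> : peq (fevp phi4 rows4) [:: -1]%ZZ by vm_compute.
rewrite /=.
have z4 : zC R[i] 4%ZZ = 4 by rewrite /zC.
rewrite z4 zC0 zCm1 mulr0 !addr0 add0r sqrrN expr1n mulr1; split=> //.
by rewrite pnatr_eq0.
Qed.

Theorem cohomogeneity_OG5_14 (R : realType) : general_zero_locus (OG R 5 14) [:: Splus] (cohomogeneity_at_most 1).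
have k7 : (5 <= 14./2)%N by [].
have ok : qf_ok 4 gram5 psi5 (psi5 ++ psi5') by vm_compute.
have ok' : qf_ok 4 gram5 psi5 psi5 by vm_compute.
have gc : all (fun t => size t.2 <= 1)%N gram5 by vm_compute.
(* On the spaces of [rows5] the two quadrics are 2 x and -1, whence the factor -2. *)
apply: (@coh_model R 5 isT k7 isT spin5 spinb5 spind5 path5 rows5 gens5 words5 generic_steps
 1%ZZ 1%ZZ _ _ _ _ _ _ _ 2
 (qfX R 4 gram5 psi5 (psi5 ++ psi5')) (- 2 *: qfX R 4 gram5 psi5 psi5)
 (fun M => qf (d := 4) gram5 psi5 (psi5 ++ psi5') M) (fun M => - 2 * qf (d := 4) gram5 psi5 psi5 M)).
1-6: by_vm.
(* 30 chart coordinates minus 2 conditions give 28 = n + 1. *)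
- apply: leq_trans (leq_add (allowed_card k7) (leqnn _)) _.
 apply: leq_trans (leq_add (leqnn _) (killed_card k7 (ss := [seq bitsN 7 x | x <- [:: 0; 96]]) isT isT)).
 by rewrite !big_ord_recl !big_ord0 /=; lia.
- exact: qfX_homog.
- by apply: rpredZ; exact: qfX_homog.
- by move=> M; exact: qfXE.
- by move=> M; rewrite mevalZ qfXE.
- move=> g gg x M; have /and4P[o1 o2 o3 o4] := allP invariance5 _ gg; split; first exact: qf_inv.
 congr (_ * _); exact: qf_inv.
move=> M x ME; have r7 : all (fun r => size r == 14%N) rows5 by vm_compute.
rewrite (qfpP ok gc (erefl : size rows5 = 5%N) r7 ME) (qfpP ok' gc (erefl : size rows5 = 5%N) r7 ME).
have /(peval_peq x) -> : peq (qfp gram5 psi5 (psi5 ++ psi5') rows5) [:: 0; 2]%ZZ by vm_compute.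
have /(peval_peq x) -> : peq (qfp gram5 psi5 psi5 rows5) [:: -1]%ZZ by vm_compute.
rewrite /=.
have z2 : zC R[i] 2%ZZ = 2 by rewrite /zC.
rewrite z2 zC0 zCm1 mulr0 !addr0 add0r mulrNN mulr1; split=> //.
by rewrite pnatr_eq0.
Qed.

(** * The eighteen varieties *)

Ltac by_model l := split; first by
 match goal with
 | |- general_zero_locus (OG ?R ?k ?m) ?E _ => apply: (@qh_OG R k m E isT isT l)
 | |- general_zero_locus (OGmax ?R ?m _) ?E _ => apply: (@qh_OGplus R m E isT isT l)
 end; vm_compute.

Theorem theoremB (R : realType) :
 general_zero_locus (OG R 3 8) [:: Splus] quasi_homogeneous /\
 general_zero_locus (OG R 3 8) [:: Splus; Sminus] quasi_homogeneous /\
 general_zero_locus (OG R 3 9) [:: Sfull] quasi_homogeneous /\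
 general_zero_locus (OG R 2 10) [:: Splus] quasi_homogeneous /\
 general_zero_locus (OG R 3 10) [:: Splus] quasi_homogeneous /\
 general_zero_locus (OG R 3 10) [:: Splus; Splus] quasi_homogeneous /\
 general_zero_locus (OG R 3 10) [:: Splus; Sminus] quasi_homogeneous /\
 general_zero_locus (OGmax R 10 Splus) [:: Splus] quasi_homogeneous /\
 general_zero_locus (OGmax R 10 Splus) [:: Splus; Splus] quasi_homogeneous /\
 general_zero_locus (OG R 3 11) [:: Sfull] quasi_homogeneous /\
 general_zero_locus (OG R 3 12) [:: Splus] quasi_homogeneous /\
 general_zero_locus (OG R 4 12) [:: Splus] quasi_homogeneous /\
 general_zero_locus (OGmax R 12 Splus) [:: Splus] quasi_homogeneous /\
 general_zero_locus (OG R 3 14) [:: Splus] quasi_homogeneous /\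
 general_zero_locus (OGmax R 14 Splus) [:: Splus] quasi_homogeneous /\
 general_zero_locus (OGmax R 14 Sminus) [:: Splus] quasi_homogeneous /\
 general_zero_locus (OG R 4 14) [:: Splus] (cohomogeneity_at_most 1) /\
 general_zero_locus (OG R 5 14) [:: Splus] (cohomogeneity_at_most 1).
(* Each list encodes in binary the monomials of the components of a section that vanishes at the
   base space; its orbit is open among all sections, and its orbit under words fixing the base space
   is open among the sections vanishing there. *)
by_model ([:: [:: 3; 12]]%N).
by_model ([:: [:: 3; 12]; [:: 2; 13]]%N).
by_model ([:: [:: 1; 3; 12]]%N).
by_model ([:: [:: 6; 17]]%N).
by_model ([:: [:: 9; 20]]%N).
by_model ([:: [:: 5; 9; 15; 20; 27]; [:: 10; 17]]%N).
split; first exact: qh_OG3_10.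
by_model ([:: [:: 9; 20]]%N).
by_model ([:: [:: 5; 10; 29]; [:: 6; 17]]%N).
by_model ([:: [:: 2; 7; 9; 11; 20]]%N).
by_model ([:: [:: 9; 20; 54; 58]]%N).
by_model ([:: [:: 15; 18; 36; 57]]%N).
by_model ([:: [:: 3; 20; 40; 43; 48]]%N).
by_model ([:: [:: 10; 12; 15; 33; 43; 60; 65; 114; 125]]%N).
by_model ([:: [:: 12; 20; 33; 34; 46; 65; 83; 105; 120]]%N).
split; first by apply: (@qh_OGminus R 14 6 (erefl 7%N) isT isT isT [:: [:: 12; 18; 46; 54; 71; 77; 102; 106; 113]]%N); vm_compute.
split; first exact: cohomogeneity_OG4_14.
exact: cohomogeneity_OG5_14.
Qed.
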